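(* Unless $NP \subseteq DTIME(n^{\mathrm{poly}\log n})$, for any constant $\epsilon>0$, the 1-DR-2 problem admits no polynomial-time $2^{\log^{1-\epsilon} n}$-approximation algorithm (where $n$ is the number of vertices of the input graph), even if the input graph is triangle-free, or even if the constraint that the feasible solution must be a dominating set is dropped (i.e., for the problem of finding a minimum-cardinality vertex set covering all target couples).
   Context: For a graph $G=(V,E)$ and $S\subseteq V$, $G[S]$ is the subgraph induced by $S$. For vertices $u,v$, $m_G(u,v)$ is the number of internal vertices on a shortest $u$–$v$ path in $G$ (so $m_G(u,v)=0$ if $u,v$ are adjacent, and $m_G(u,v)=1$ if they are non-adjacent but have a common neighbor); it is $\infty$ if no path exists. For $D\subseteq V$, $m^D_G(u,v)=m_{G[D\cup\{u,v\}]}(u,v)$. Two vertices $u,v$ form a target couple $[u,v]$ if $m_G(u,v)=1$. A set $D$ covers a target couple $[u,v]$ if $m^D_G(u,v)\le 2$. A set $D$ is a dominating set if every vertex of $V\setminus D$ is adjacent to a vertex of $D$. The 1-DR-2 problem: given a connected graph $G$, find a minimum-cardinality dominating set $D$ of $G$ that covers every target couple of $G$. An $r$-approximation algorithm outputs a feasible solution of size at most $r$ times the optimum. *)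

(* Defs.v *)
From mathcomp Require Import all_boot all_order all_algebra.
From mathcomp Require Import reals exp.

Set Implicit Arguments.
Unset Strict Implicit.
Unset Printing Implicit Defensive.

(* Multi-tape Turing machines over the input alphabet {0,1}; a machine has
   tm_tapes.+1 tapes. The tape alphabet is option (bool + tm_aux): None is the
   blank, Some (inl b) an input/output bit, Some (inr a) an auxiliary symbol. *)
Definition symbol (aux : finType) : finType := option (bool + aux)%type.

(* Head moves: None = stay, Some false = left, Some true = right. *)
Definition move : finType := option bool.

(* An action: new state and, for each tape, the written symbol and the move. *)
Definition action (k : nat) (state aux : finType) : finType :=
  (state * k.-tuple (symbol aux * move))%type.

Record tm := TM {
  tm_tapes : nat;
  tm_aux : finType;
  tm_state : finType;
  tm_start : tm_state;
  tm_accept : {set tm_state};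
  tm_trans : tm_state -> tm_tapes.+1.-tuple (symbol tm_aux) ->
             {set action tm_tapes.+1 tm_state tm_aux}
}.

Definition deterministic (M : tm) : Prop :=
  forall q s, #|@tm_trans M q s| <= 1.

(* A two-way infinite tape (l, r): the scanned cell is the first of r, l lists
   the cells to its left, nearest first; every cell not listed is blank. *)
Definition tape (aux : finType) : eqType :=
  (seq (symbol aux) * seq (symbol aux))%type.

Definition tape_read aux (t : tape aux) : symbol aux := head None t.2.

Definition tape_write aux (a : symbol aux) (t : tape aux) : tape aux :=
  (t.1, a :: behead t.2).

Definition tape_move aux (m : move) (t : tape aux) : tape aux :=
  match m with
  | None => t
  | Some false => (behead t.1, head None t.1 :: t.2)
  | Some true => (head None t.2 :: t.1, behead t.2)
  end.

Definition config (M : tm) : eqType :=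
  (tm_state M * (tm_tapes M).+1.-tuple (tape (tm_aux M)))%type.

Definition enabled (M : tm) (c : config M) :
    {set action (tm_tapes M).+1 (tm_state M) (tm_aux M)} :=
  tm_trans c.1 [tuple tape_read (tnth c.2 i) | i < (tm_tapes M).+1].

Definition perform (M : tm)
    (a : action (tm_tapes M).+1 (tm_state M) (tm_aux M)) (c : config M) :
    config M :=
  (a.1, [tuple tape_move (tnth a.2 i).2
                 (tape_write (tnth a.2 i).1 (tnth c.2 i))
        | i < (tm_tapes M).+1]).

Definition step (M : tm) : rel (config M) :=
  fun c c' => [exists a in enabled c, c' == perform a c].

Definition halted (M : tm) (c : config M) : bool := enabled c == set0.

(* The input is on tape 0, with the head on its first bit. *)
Definition initial (M : tm) (x : seq bool) : config M :=
  (tm_start M,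
   [tuple if i == ord0 then ([::], [seq Some (inl b) | b <- x])
          else ([::], [::]) | i < (tm_tapes M).+1]).

Definition final (M : tm) (x : seq bool) (c : config M) : Prop :=
  exists p, [/\ path (@step M) (initial M x) p,
                last (initial M x) p = c & halted c].

Definition accepts (M : tm) (x : seq bool) : Prop :=
  exists c, final x c /\ c.1 \in tm_accept M.

Fixpoint leading_bits (aux : finType) (s : seq (symbol aux)) : seq bool :=
  if s is Some (inl b) :: s' then b :: leading_bits s' else [::].

(* The output is the longest block of bits on tape 0 starting at the head. *)
Definition outputs (M : tm) (x y : seq bool) : Prop :=
  exists c, @final M x c /\ leading_bits (tnth c.2 ord0).2 = y.

Definition halts_within (M : tm) (x : seq bool) (t : nat) : Prop :=
  forall p, path (@step M) (initial M x) p -> size p <= t.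

Definition language : Type := seq bool -> Prop.

Definition decides_in (M : tm) (L : language) (T : nat -> nat) : Prop :=
  (forall x, L x <-> accepts M x) /\
  exists c, forall x, halts_within M x (c * T (size x) + c).

Definition NTIME (T : nat -> nat) (L : language) : Prop :=
  exists M, decides_in M L T.

Definition DTIME (T : nat -> nat) (L : language) : Prop :=
  exists M, deterministic M /\ decides_in M L T.

Definition NP (L : language) : Prop := exists k, NTIME (fun n => n ^ k) L.

(* DTIME(n^(polylog n)), the union over k of DTIME(n^(log^k n)); rounding the
   logarithm down does not change the union. *)
Definition DTIME_npolylog (L : language) : Prop :=
  exists k, DTIME (fun n => n ^ (trunc_log 2 n ^ k)) L.

Section Graphs.
Variables (V : finType) (e : rel V).

Definition simple_graph : Prop := symmetric e /\ irreflexive e.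

Definition connected_graph : Prop :=
  0 < #|V| /\ forall u v, connect e u v.

Definition triangle_free : Prop :=
  forall x y z, ~~ [&& e x y, e y z & e z x].

(* There is a u-v path with exactly k internal vertices. *)
Definition path_internal (u v : V) (k : nat) : bool :=
  [exists p : k.-tuple V, path e u (rcons p v) && uniq (u :: rcons p v)].

(* m_G(u,v) for distinct u, v, with None for infinity: a path has fewer than
   #|V| internal vertices. *)
Definition m_G (u v : V) : option nat :=
  ohead [seq k <- iota 0 #|V| | path_internal u v k].

Definition target_couple (u v : V) : Prop := m_G u v = Some 1.

Definition dominating (D : {set V}) : Prop :=
  forall v, v \notin D -> exists2 u, u \in D & e u v.

End Graphs.

(* G[S], keeping the vertices outside S as isolated ones; this does not affect
   the paths between vertices of S. *)
Definition induced (V : finType) (e : rel V) (S : {set V}) : rel V :=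
  [rel x y in S | e x y].

Definition m_within (V : finType) (e : rel V) (D : {set V}) (u v : V) :
    option nat :=
  m_G (induced e (D :|: [set u; v])) u v.

Definition covers (V : finType) (e : rel V) (D : {set V}) (u v : V) : Prop :=
  exists2 k, m_within e D u v = Some k & k <= 2.

Definition covers_all (V : finType) (e : rel V) (D : {set V}) : Prop :=
  forall u v, target_couple e u v -> covers e D u v.

(* The feasible solutions of 1-DR-2. *)
Definition feasible_1DR2 (V : finType) (e : rel V) (D : {set V}) : Prop :=
  dominating e D /\ covers_all e D.

Definition min_card (V : finType) (F : {set V} -> Prop) (D : {set V}) : Prop :=
  F D /\ forall D', F D' -> #|D| <= #|D'|.

(* Row-major adjacency matrix. *)
Definition encode_graph n (e : rel 'I_n) : seq bool :=
  [seq e u v | u <- enum 'I_n, v <- enum 'I_n].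

Definition encode_set n (D : {set 'I_n}) : seq bool :=
  [seq v \in D | v <- enum 'I_n].

Import GRing.Theory Num.Theory.
Local Open Scope ring_scope.

(* M is a polynomial-time r(n)-approximation algorithm for: given a connected
   graph in the class C, find a minimum vertex set satisfying F. Nothing is
   required of M on other inputs. *)
Definition poly_time_approx (R : realType)
    (C : forall V : finType, rel V -> Prop)
    (F : forall V : finType, rel V -> {set V} -> Prop)
    (r : nat -> R) (M : tm) : Prop :=
  deterministic M /\
  exists c k : nat, forall (n : nat) (e : rel 'I_n),
    simple_graph e -> connected_graph e -> C _ e ->
    halts_within M (encode_graph e) (c * size (encode_graph e) ^ k + c)%N /\
    exists D : {set 'I_n},
      [/\ outputs M (encode_graph e) (encode_set D),
          F _ e D
        & forall Dopt, min_card (F _ e) Dopt ->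
            #|D|%:R <= r n * #|Dopt|%:R].

Definition all_graphs (V : finType) (e : rel V) : Prop := True.

Definition log2 (R : realType) (n : nat) : R := ln n%:R / ln 2%:R.

Definition approx_ratio (R : realType) (eps : R) (n : nat) : R :=
  2%:R `^ (log2 R n `^ (1 - eps)).

(* Main.v *)
(* An approximation algorithm for 1-DR-2 with ratio 2^(log^(1-eps) n) decides
   every NP language in time n^(polylog n).  A computation of a nondeterministic
   machine is a tableau; its local constraints form a CNF on 2^m variables,
   m = O(log n), whose clauses are recognized from their index.  Arithmetizing
   the clauses over F_p, p of polylogarithmic bit size, gives a projection game:
   a vertex is a random point with its claimed values, an axis-parallel segment
   of the sum-check chain, or a line of the low-degree test, and a label is the
   list of coefficients answered there.  Satisfiable formulas have consistent
   labellings, for unsatisfiable ones every labelling loses a fraction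
   1/polylog n.

   The k-fold parallel repetition is analysed as a covering problem: label
   lists such that every pair of vertices has a consistent pair of listed
   labels have total size at least 2^kap times the number X of vertices.  This
   follows from the contraction of a positive semidefinite energy of the list
   indicator under one round, which tensorizes.  The gadget graph has vertex
   classes P, L, R, Q, W, where L and R are the pairs (vertex, label), and hubs
   that cover all target couples except those between P and Q; to cover the
   latter, D must contain a consistent pair of labels, the many copies making
   the alternative too expensive.  Hence the optimum is at most 2X + 7 or at
   least X 2^kap, and kap is a power of log n large enough to beat the ratio. *)

Require Import Defs.
From HB Require Import structures.
From mathcomp Require Import all_boot all_order all_algebra.
From mathcomp Require Import reals exp.
From mathcomp Require Import boolp zify ring lra.
Set Implicit Arguments.
Unset Strict Implicit.
Unset Printing Implicit Defensive.

(** Usual parallel repetition bounds the success of one label per vertex, but a vertex set may list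
    several labels per vertex, so hardness of covering by lists is needed. A positive semidefinite
    form suits this: it weighs all pairs of vertices at once, and its tensor powers are bounded
    round by round without conditioning on earlier rounds. The zero test of the verifier uses no
    random coefficients: the polynomial that must vanish on the cube is made linear in one variable
    after the other, so that in the end it is identically zero exactly if it vanished on the cube.
    The graph has quasi-polynomially many vertices and must be written by an actual Turing machine.
    It is enough that all numbers involved are polynomial in the size of the graph, or cut off
    there: numbers are kept in unary, and functions are computed in time polynomial in their values.
    The parameters are arranged so that, with B polynomial in the logarithm of the input length, the
    gap is about 2^(B^r) while the graph has at most 2^(B^(r+1)) vertices; r is of order 1/eps. *)

Module TuringRuns.
Import Order.TTheory GRing.Theory Num.Theory.

(** * Tapes as functions on the integers, independent of their list representation *)

Section Views.
Variable aux : finType.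
Implicit Types (t : tape aux) (f : int -> symbol aux).

(** Positions are relative to the head, so a move becomes a translation. As [Negz n] stands for
    [-(n + 1)], the left list is read at [n] directly. *)
Definition cells t : int -> symbol aux :=
  fun o => match o with Posz n => nth None t.2 n | Negz n => nth None t.1 n end.

Definition fwrite (a : symbol aux) f : int -> symbol aux :=
  fun o => if o == 0%R then a else f o.

Definition fmove (mv : move) f : int -> symbol aux :=
  match mv with
  | None => f
  | Some false => fun o => f (o - 1)%R
  | Some true => fun o => f (o + 1)%R
  end.

Lemma cells_read t : tape_read t = cells t 0.
Proof. by case: t => l [|a r]. Qed.

Lemma cells_write a t : cells (tape_write a t) = fwrite a (cells t).
Proof.
apply: funext => -[[|n]|n] //=; case: t => l r /=; rewrite /fwrite /=.
by rewrite nth_behead.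
Qed.

Lemma cells_move mv t : cells (tape_move mv t) = fmove mv (cells t).
Proof.
case: mv => [[]|] //; apply: funext => o; case: t => l r; rewrite /fmove.
- case: o => [n|[|n]].
  + have -> : (Posz n + 1 = Posz n.+1)%R by lia.
    by rewrite /= nth_behead.
  + by rewrite /= nth0.
  + have -> : (Negz n.+1 + 1 = Negz n)%R by lia.
    by [].
- case: o => [[|n]|n].
  + by rewrite /= nth0.
  + have -> : (Posz n.+1 - 1 = Posz n)%R by lia.
    by [].
  + have -> : (Negz n - 1 = Negz n.+1)%R by lia.
    by rewrite /= nth_behead.
Qed.

Definition input_cells (x : seq bool) : int -> symbol aux :=
  fun o => match o with
           | Posz n => nth None [seq Some (inl b) | b <- x] n
           | Negz _ => None
           end.

Lemma leading_bitsP (s : seq (symbol aux)) y : leading_bits s = y ->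
  (forall i, i < size y -> nth None s i = Some (inl (nth false y i))) /\
  (forall b, nth None s (size y) <> Some (inl b)).
Proof.
elim: s y => [|[[b|a]|] s IH] y <-; try by split.
have [IH1 IH2] := IH _ erefl; split=> // -[|i] //= lti; exact: IH1.
Qed.

End Views.

(** * Runs of machines in terms of these views *)

Section Runs.
Variable M : tm.
Local Notation K := (tm_tapes M).+1.
Local Notation sym := (symbol (tm_aux M)).

(* Configurations seen through the contents of the cells relative to the
   heads; this forgets the trailing blanks of the list representation. *)
Definition vconfig : Type := (tm_state M * ('I_K -> int -> sym))%type.

Definition view (c : config M) : vconfig :=
  (c.1, fun i => cells (tnth c.2 i)).

Definition venabled (v : vconfig) := tm_trans v.1 [tuple v.2 i 0 | i < K].

Definition vperform (a : action K (tm_state M) (tm_aux M)) (v : vconfig) :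
    vconfig :=
  (a.1, fun i => fmove (tnth a.2 i).2 (fwrite (tnth a.2 i).1 (v.2 i))).

Definition vinitial x : vconfig :=
  (tm_start M, fun i => if i == ord0 then @input_cells _ x else fun=> None).

Lemma view_initial x : view (initial M x) = vinitial x.
Proof.
congr pair; apply: funext => i; rewrite tnth_mktuple.
case: eqP => _; apply: funext => -[n|n] //=; by rewrite nth_nil.
Qed.

Lemma enabled_view c : enabled c = venabled (view c).
Proof.
by congr (tm_trans _ _); apply: eq_from_tnth => i; rewrite !tnth_mktuple cells_read.
Qed.

Lemma perform_view a c : view (perform a c) = vperform a (view c).
Proof.
congr pair; apply: funext => i.
by rewrite /= tnth_mktuple cells_move cells_write.
Qed.

Fixpoint vrun n (v v' : vconfig) : Prop :=
  if n is n'.+1 then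
    exists2 a, a \in venabled v & vrun n' (vperform a v) v'
  else v' = v.

Lemma vrun_cat n1 n2 v1 v2 v3 :
  vrun n1 v1 v2 -> vrun n2 v2 v3 -> vrun (n1 + n2) v1 v3.
Proof.
elim: n1 v1 => [|n1 IH] v1 /=; first by move=> ->.
by move=> [a Ha H1] H2; exists a => //; exact: IH H1 H2.
Qed.

Lemma vrun1 a v : a \in venabled v -> vrun 1 v (vperform a v).
Proof. by move=> Ha; exists a. Qed.

Lemma path_vrun c p : path (@step M) c p ->
  vrun (size p) (view c) (view (last c p)).
Proof.
elim: p c => [|c' p IH] c //= /andP[/existsP[a /andP[Ha /eqP ->]] /IH].
by rewrite perform_view => H; exists a => //; rewrite -enabled_view.
Qed.

Lemma vrun_path n c v : vrun n (view c) v ->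
  exists p, [/\ path (@step M) c p, size p = n & view (last c p) = v].
Proof.
elim: n c => [|n IH] c /=; first by move=> ->; exists [::].
move=> [a Ha]; rewrite -perform_view => /IH[p [pP sp lp]].
exists (perform a c :: p); split=> //=; last by rewrite sp.
rewrite pP andbT; apply/existsP; exists a; rewrite eqxx andbT.
by rewrite enabled_view.
Qed.

Hypothesis detM : deterministic M.

(** A deterministic run that reaches a halting configuration has every other run from the same start
    as a prefix. Exhibiting one run thus yields both a time bound and the outcome. *)
Lemma vrun_det n n' v v1 v2 : vrun n v v1 -> vrun n' v v2 ->
  venabled v1 = set0 -> n' <= n /\ (venabled v2 = set0 -> n' = n /\ v2 = v1).
Proof.
elim: n n' v => [|n IH] [|n'] v /=.
- by move=> -> ->.
- by move=> -> [a Ha _] H0; rewrite H0 inE in Ha.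
- by move=> [a Ha _] -> _; split=> // H0; rewrite H0 inE in Ha.
move=> [a Ha H1] [b Hb H2] H0.
have E : b = a.
  have/card_le1P/(_ a Ha) := detM v.1 [tuple v.2 i 0 | i < K].
  by move=> /(_ b); rewrite inE Hb => /esym/eqP.
move: H2; rewrite E => H2; have [] := IH _ _ H1 H2 H0.
by move=> le_n H; split=> // /H[-> ->].
Qed.

Lemma vrun_halts_within x n v : vrun n (vinitial x) v -> venabled v = set0 ->
  halts_within M x n.
Proof.
move=> H H0 p /path_vrun; rewrite view_initial => Hp.
by have [] := vrun_det H Hp H0.
Qed.

Lemma vrun_accepts x n v : vrun n (vinitial x) v -> venabled v = set0 ->
  accepts M x <-> v.1 \in tm_accept M.
Proof.
move=> H H0; split.
  move=> [c [[p [Hp lp]]]]; rewrite /halted enabled_view => /eqP hc ac.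
  move: (path_vrun Hp); rewrite view_initial lp => Hr.
  have [_ /(_ hc)[_ <-]] := vrun_det H Hr H0; exact: ac.
move=> av; move: H; rewrite -view_initial => /vrun_path[p [pP _ lp]].
exists (last (initial M x) p); split; last by move: av; rewrite -lp.
by exists p; split => //; rewrite /halted enabled_view lp H0.
Qed.

(** The last two conclusions describe the output by cells: the bits of [y], followed by a symbol
    that is not a bit. This is the form in which a program can consume it. *)
Lemma outputs_vrun x y t : outputs M x y -> halts_within M x t ->
  exists n v, [/\ n <= t, vrun n (vinitial x) v, venabled v = set0,
    (forall i, i < size y ->
       v.2 ord0 (Posz i) = Some (inl (nth false y i))) &
    (forall b, v.2 ord0 (Posz (size y)) <> Some (inl b))].
Proof.
move=> [c [[p [Hp lp hc]] Hy]] Ht; exists (size p), (view c).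
have [H1 H2] := leading_bitsP Hy.
split=> //; first exact: Ht.
- by have := path_vrun Hp; rewrite view_initial lp.
- by rewrite -enabled_view; apply/eqP.
Qed.

End Runs.

Definition upd (T : Type) (f : nat -> T) i a := fun j => if j == i then a else f j.

(** * A structured programming language and its compilation to machines *)

Section Programs.
Variable M0 : tm.
Hypothesis detM0 : deterministic M0.
Local Notation sym := (symbol (tm_aux M0)).
Local Notation mt := (tm_tapes M0).+1.

(** [Prim i f] rewrites the scanned symbol of tape [i] and moves its head; [Ite] and [While] branch
    on the scanned symbol of one tape. [Halt] is the accepting control point and has no
    successor. *)
Inductive cmd :=
  | Prim of nat & (sym -> sym * move)
  | Seq of cmd & cmd
  | Ite of nat & (sym -> bool) & cmd & cmd
  | While of nat & (sym -> bool) & cmd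
  | Exec
  | Halt.

(** Commands contain functions, and their equality is taken classically. It is needed to turn a list
    of continuations into a finite type of states. *)
HB.instance Definition _ := gen_eqMixin cmd.
HB.instance Definition _ := gen_choiceMixin cmd.

Definition tapes := nat -> int -> sym.

(* [Exec] runs [M0] on the tapes 1, ..., mt. *)
Inductive exec : cmd -> tapes -> tapes -> nat -> Prop :=
  | ExPrim i f T : exec (Prim i f) T
      (upd T i (fmove (f (T i 0%R)).2 (fwrite (f (T i 0%R)).1 (T i)))) 1
  | ExSeq a b T T1 T2 n1 n2 : exec a T T1 n1 -> exec b T1 T2 n2 ->
      exec (Seq a b) T T2 (n1 + n2).+1
  | ExIte i (t : pred sym) a b T T1 n :
      exec (if t (T i 0%R) then a else b) T T1 n ->
      exec (Ite i t a b) T T1 n.+1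
  | ExWhileF i (t : pred sym) a T : ~~ t (T i 0%R) -> exec (While i t a) T T 1
  | ExWhileT i (t : pred sym) a T T1 T2 n1 n2 : t (T i 0%R) ->
      exec a T T1 n1 -> exec (While i t a) T1 T2 n2 ->
      exec (While i t a) T T2 (n1 + n2).+1
  | ExExec T (v : vconfig M0) n :
      vrun n (tm_start M0, fun i : 'I_mt => T i.+1) v -> venabled v = set0 ->
      exec Exec T
        (fun j => if 0 < j <= mt then v.2 (inord j.-1) else T j) n.+2.

Fixpoint maxtape c : nat :=
  match c with
  | Prim i _ => i
  | Seq a b => maxn (maxtape a) (maxtape b)
  | Ite i _ a b => maxn i (maxn (maxtape a) (maxtape b))
  | While i _ a => maxn i (maxtape a)
  | Exec => mt
  | Halt => 0
  end.

(** A continuation is the stack of commands still to be executed. Only finitely many stacks arise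
    from a program, because the body of a loop returns to the same stack; they become the control
    states. *)
Fixpoint conts c (k : seq cmd) : seq (seq cmd) :=
  (c :: k) ::
  match c with
  | Seq a b => conts a (b :: k) ++ conts b k
  | Ite _ _ a b => conts a k ++ conts b k
  | While _ _ a => conts a (c :: k)
  | _ => [::]
  end.

Lemma conts_self c k : c :: k \in conts c k.
Proof. by case: c => *; rewrite inE eqxx. Qed.

Section Machine.
Variable prog : cmd.
Let K1 := maxn (maxtape prog) mt.
Let S : seq (seq cmd) := [::] :: conts prog [::].
Local Notation state := (seq_sub S * option (tm_state M0))%type.
Local Notation K := K1.+1.

Fact S0 : [::] \in S. Proof. by rewrite inE. Qed.
Fact Sprog : [:: prog] \in S. Proof. by rewrite inE conts_self orbT. Qed.

Definition st (k : seq cmd) : seq_sub S := insubd (SeqSub S0) k.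

Definition mk (k : seq cmd) (q : option (tm_state M0))
    (w : nat -> sym * move) : action K state (tm_aux M0) :=
  ((st k, q), [tuple w i | i < K]).

(** A control state is a continuation together with a state of [M0], which is present only while
    [Exec] is running. Tape [i] of [M0] is tape [i.+1] here, since tape 0 holds the input. *)
Definition prog_trans (s : state) (rd : K.-tuple sym) :
    {set action K state (tm_aux M0)} :=
  let r i := tnth rd (inord i) in
  let stay i := (r i, None : move) in
  match ssval s.1 with
  | [::] => set0
  | Halt :: _ => set0
  | Prim i f :: k =>
      [set mk k None (fun j => if j == i then f (r j) else stay j)]
  | Seq a b :: k => [set mk (a :: b :: k) None stay]
  | Ite i t a b :: k => [set mk ((if t (r i) then a else b) :: k) None stay]
  | (While i t a as c) :: k =>
      [set mk (if t (r i) then a :: c :: k else k) None stay]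
  | Exec :: k =>
      if s.2 is Some q then
        let A := tm_trans q [tuple r i.+1 | i < mt] in
        if A == set0 then [set mk k None stay] else
        [set mk (Exec :: k) (Some a.1)
           (fun j => if 0 < j <= mt then tnth a.2 (inord j.-1) else stay j)
        | a in A]
      else [set mk (Exec :: k) (Some (tm_start M0)) stay]
  end.

Definition machine : tm := @TM K1 (tm_aux M0) state (st [:: prog], None)
  [set s : state | if ssval s.1 is Halt :: _ then true else false] prog_trans.

Lemma machine_det : deterministic machine.
Proof.
move=> [s q] rd /=; rewrite /prog_trans /=.
case: (ssval s) => [|[i f|a b|i t a b|i t a||] k]; rewrite ?cards0 ?cards1 //.
case: q => [q|]; last by rewrite cards1.
case: ifP => _; first by rewrite cards1.
exact: leq_trans (leq_imset_card _ _) (detM0 _ _).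
Qed.

Definition mview (k : seq cmd) q (T : tapes) : vconfig machine :=
  ((st k, q), fun i : 'I_K => T i).

Lemma st_val k : k \in S -> ssval (st k) = k.
Proof. by move=> kS; rewrite /st /insubd insubT. Qed.

Lemma fwrite_id (f : int -> sym) : fwrite (f 0%R) f = f.
Proof. by apply: funext => o; rewrite /fwrite; case: eqP => // ->. Qed.

Lemma vperform_mk k q w T k0 q0 T' :
  (forall i, i <= K1 -> T' i = fmove (w i).2 (fwrite (w i).1 (T i))) ->
  @vperform machine (mk k q w) (mview k0 q0 T) = mview k q T'.
Proof.
move=> H; congr pair; apply: funext => i /=.
by rewrite tnth_mktuple H // -ltnS.
Qed.

Lemma one_step k q w T T' k0 q0 rest :
  mk k q w \in @venabled machine (mview k0 q0 T) ->
  (forall i, i <= K1 -> T' i = fmove (w i).2 (fwrite (w i).1 (T i))) ->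
  forall n v, n = rest.+1 -> vrun rest (mview k q T') v ->
  vrun n (mview k0 q0 T) v.
Proof.
move=> H1 H2 n v -> H; exists (mk k q w) => //.
by rewrite (vperform_mk _ _ _ _ H2).
Qed.

(** The additional step notices that [M0] has halted and removes [Exec] from the stack. *)
Lemma exec_Exec k T v n q : Exec :: k \in S ->
  @vrun M0 n (q, fun i : 'I_mt => T i.+1) v -> venabled v = set0 ->
  vrun n.+1 (mview (Exec :: k) (Some q) T)
    (mview k None (fun j => if 0 < j <= mt then v.2 (inord j.-1) else T j)).
Proof.
move=> kS; elim: n q T => [|n IH] q T.
  move=> -> H0; set T' := (fun j : nat => _).
  have -> : T' = T.
    apply: funext => j; rewrite /T'; case: ifP => // /andP[j0 jm].
    by rewrite /= inordK prednK.
  apply: (@one_step k None (fun i => (T i 0%R, None)) T T _ _ 0) (erefl 1) _ => //.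
  - rewrite /venabled /= /prog_trans /= st_val //=.
    set A := tm_trans _ _; have -> : A = set0.
      move: H0; rewrite /venabled /A => <-; congr (tm_trans _ _).
      apply: eq_from_tnth => i; rewrite !tnth_mktuple /= inordK //.
      by rewrite ltnS leq_max ltn_ord orbT.
    rewrite eqxx inE; apply/eqP; congr pair; apply: eq_from_tnth => i.
    by rewrite !tnth_mktuple /= inord_val.
  - by move=> i _ /=; rewrite fwrite_id.
move=> [a Ha Hr] H0.
set T1 : tapes := fun j => if 0 < j <= mt then
  fmove (tnth a.2 (inord j.-1)).2 (fwrite (tnth a.2 (inord j.-1)).1 (T j))
  else T j.
have HT1 : (fun i : 'I_mt => T1 i.+1) =
    (vperform a (q, fun i : 'I_mt => T i.+1) : vconfig M0).2.
  by apply: funext => i; rewrite /T1 /= ltn_ord inord_val.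
have {}Hr : vrun n ((a.1, fun i : 'I_mt => T1 i.+1) : vconfig M0) v.
  by rewrite HT1.
have := IH _ _ Hr H0.
set T' := (fun j : nat => _); set T'' := (fun j : nat => _) => H.
have -> : T'' = T'.
  by apply: funext => j; rewrite /T' /T'' /T1; case: ifP.
apply: (@one_step (Exec :: k) (Some a.1) (fun j => if 0 < j <= mt then
   tnth a.2 (inord j.-1) else (T j 0%R, None)) T T1 _ _ n.+1) (erefl n.+2) H.
- rewrite /venabled /= /prog_trans /= st_val //=.
  set A := tm_trans _ _; have aA : a \in A.
    move: Ha; rewrite /venabled /A; congr (_ \in tm_trans _ _).
    apply: eq_from_tnth => i; rewrite !tnth_mktuple /= inordK //.
    by rewrite ltnS leq_max ltn_ord orbT.
  case: eqP => [A0|_]; first by rewrite A0 inE in aA.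
  apply/imsetP; exists a => //; congr pair; apply: eq_from_tnth => i.
  by rewrite !tnth_mktuple /= inord_val.
- move=> i le_i; rewrite /T1 /=; case: ifP => //= _; by rewrite fwrite_id.
Qed.

(** The step count of [exec] is exact for the compiled machine. The inclusion guarantees that all
    stacks met on the way are states; [st] would replace any other stack by the empty one. *)
Lemma exec_vrun c T T' n k : exec c T T' n -> maxtape c <= K1 ->
  {subset k :: conts c k <= S} ->
  vrun n (mview (c :: k) None T) (mview k None T').
Proof.
move=> H; elim: H k => {c T T' n}.
- move=> i f T k /= le_i sub.
  apply: (@one_step k None
    (fun j => if j == i then f (T j 0%R) else (T j 0%R, None)) T
    (upd T i (fmove (f (T i 0%R)).2 (fwrite (f (T i 0%R)).1 (T i)))) _ _ 0)
    (erefl 1) _ => //.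
  + rewrite /venabled /= /prog_trans /= st_val; last by rewrite sub ?inE ?eqxx ?orbT.
    rewrite inE; apply/eqP; congr pair; apply: eq_from_tnth => j.
    by rewrite !tnth_mktuple /= inord_val.
  + by move=> j _; rewrite /upd; case: eqP => [->|] //=; rewrite fwrite_id.
- move=> a b T T1 T2 n1 n2 _ IH1 _ IH2 k /=; rewrite geq_max => /andP[la lb] sub.
  apply: (@one_step (a :: b :: k) None (fun j => (T j 0%R, None)) T T _ _ (n1 + n2))
    (erefl _) _.
  + rewrite /venabled /= /prog_trans /= st_val; last by rewrite sub ?inE ?eqxx ?orbT.
    rewrite inE; apply/eqP; congr pair; apply: eq_from_tnth => j.
    by rewrite !tnth_mktuple /= inord_val.
  + by move=> j _; rewrite /= fwrite_id.
  apply: vrun_cat (IH1 _ la _) (IH2 _ lb _) => d.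
    rewrite inE => /predU1P[->|dc]; apply: sub.
      by rewrite !inE mem_cat conts_self !orbT.
    by rewrite !inE mem_cat dc !orbT.
  rewrite inE => /predU1P[->|dc]; apply: sub; first by rewrite inE eqxx.
  by rewrite !inE mem_cat dc !orbT.
- move=> i t a b T T1 n _ IH k /=; rewrite !geq_max => /and3P[li la lb] sub.
  apply: (@one_step ((if t (T i 0%R) then a else b) :: k) None
    (fun j => (T j 0%R, None)) T T _ _ n) (erefl _) _.
  + rewrite /venabled /= /prog_trans /= st_val; last by rewrite sub ?inE ?eqxx ?orbT.
    rewrite tnth_mktuple /= inordK //.
    rewrite inE; apply/eqP; congr pair; apply: eq_from_tnth => j.
    by rewrite !tnth_mktuple /= inord_val.
  + by move=> j _; rewrite /= fwrite_id.
  apply: IH; first by case: ifP.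
  move=> d; rewrite inE => /predU1P[->|dc]; apply: sub; first by rewrite inE eqxx.
  by rewrite !inE mem_cat; case: ifP dc => _ ->; rewrite !orbT.
- move=> i t a T Ht k /=; rewrite geq_max => /andP[li la] sub.
  apply: (@one_step k None (fun j => (T j 0%R, None)) T T _ _ 0) (erefl _) _ => //.
  + rewrite /venabled /= /prog_trans /= st_val; last by rewrite sub ?inE ?eqxx ?orbT.
    rewrite tnth_mktuple /= inordK // (negbTE Ht).
    rewrite inE; apply/eqP; congr pair; apply: eq_from_tnth => j.
    by rewrite !tnth_mktuple /= inord_val.
  + by move=> j _; rewrite /= fwrite_id.
- move=> i t a T T1 T2 n1 n2 Ht _ IH1 _ IH2 k /= le; move: (le).
  rewrite geq_max => /andP[li la] sub.
  apply: (@one_step (a :: While i t a :: k) None (fun j => (T j 0%R, None)) T T _ _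
    (n1 + n2)) (erefl _) _ => //.
  + rewrite /venabled /= /prog_trans /= st_val; last by rewrite sub ?inE ?eqxx ?orbT.
    rewrite tnth_mktuple /= inordK // Ht.
    rewrite inE; apply/eqP; congr pair; apply: eq_from_tnth => j.
    by rewrite !tnth_mktuple /= inord_val.
  + by move=> j _; rewrite /= fwrite_id.
  apply: vrun_cat (IH1 _ la _) (IH2 _ le sub) => d.
  rewrite inE => /predU1P[->|dc]; apply: sub; first by rewrite !inE eqxx orbT.
  by rewrite !inE dc !orbT.
- move=> T v n Hr H0 k /= le sub.
  have ES : Exec :: k \in S by rewrite sub ?inE ?eqxx ?orbT.
  apply: (@one_step (Exec :: k) (Some (tm_start M0)) (fun j => (T j 0%R, None))
     T T _ _ n.+1) (erefl _) _ => //.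
  + rewrite /venabled /= /prog_trans /= st_val //=.
    rewrite inE; apply/eqP; congr pair; apply: eq_from_tnth => j.
    by rewrite !tnth_mktuple /= inord_val.
  + by move=> j _; rewrite /= fwrite_id.
  exact: exec_Exec.
Qed.

End Machine.

Definition input_tapes (x : seq bool) : tapes :=
  fun i => if i == 0 then @input_cells _ x else fun=> None.

Definition Skip : cmd := Prim 0 (fun s => (s, None)).

(** The three additional steps are the outer [Seq], the final test, and the [Skip] that leads a
    rejecting run to the empty stack, which halts without accepting. *)
Lemma exec_decides (c : cmd) i (t : pred sym) (L : language) (T : nat -> nat) :
  (forall x, exists T' n, [/\ exec c (input_tapes x) T' n, n <= T (size x) &
     L x <-> t (T' i 0%R)]) ->
  exists D, [/\ deterministic D, (forall x, L x <-> accepts D x) &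
    forall x, halts_within D x (T (size x) + 3)].
Proof.
move=> H; pose prog := Seq c (Ite i t Halt Skip).
have main x : exists n v, [/\ @vrun (machine prog) n (vinitial _ x) v,
    venabled v = set0, n <= T (size x) + 3 &
    L x <-> v.1 \in tm_accept (machine prog)].
  have [T' [n [Hc nT LT]]] := H x.
  have [cS iS hS sS] : [/\ {subset [:: Ite i t Halt Skip] ::
       conts c [:: Ite i t Halt Skip] <= [::] :: conts prog [::]},
      [:: Ite i t Halt Skip] \in [::] :: conts prog [::],
      [:: Halt] \in [::] :: conts prog [::] &
      [:: Skip] \in [::] :: conts prog [::]].
    split=> [d||| ]; rewrite /prog /= !inE ?mem_cat !inE ?eqxx ?orbT //.
    by case/predU1P=> [->|->]; rewrite ?eqxx ?orbT.
  have mc : maxtape c <= maxn (maxtape prog) mt by rewrite /= leq_max leq_max leqnn.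
  have mi : i <= maxn (maxtape prog) mt by rewrite /= !leq_max leqnn !orbT.
  pose w := fun T : tapes => fun j => (T j 0%R, None : move).
  have Hrun : vrun n.+2 (mview prog [:: prog] None (input_tapes x))
      (mview prog [:: if t (T' i 0%R) then Halt else Skip] None T').
    apply: (@one_step prog [:: c; Ite i t Halt Skip] None (w (input_tapes x))
       _ (input_tapes x) _ _ n.+1) (erefl _) _ => //.
    - rewrite /venabled /= /prog_trans /= st_val; last exact: Sprog.
      rewrite inE; apply/eqP; congr pair; apply: eq_from_tnth => j.
      by rewrite !tnth_mktuple /= inord_val.
    - by move=> j _; rewrite /= fwrite_id.
    rewrite -addn1; apply: vrun_cat (exec_vrun Hc mc cS) _.
    apply: (@one_step prog [:: if t (T' i 0%R) then Halt else Skip] None (w T')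
       _ T' _ _ 0) (erefl _) _ => //.
    - rewrite /venabled /= /prog_trans /= st_val //.
      rewrite tnth_mktuple /= inordK // inE; apply/eqP; congr pair.
      by apply: eq_from_tnth => j; rewrite !tnth_mktuple /= inord_val.
    - by move=> j _; rewrite /= fwrite_id.
  have vi : mview prog [:: prog] None (input_tapes x) = vinitial _ x.
    by congr pair; apply: funext => -[[|j] lj].
  rewrite vi in Hrun; case: ifP Hrun => Ht Hrun.
    exists n.+2, (mview prog [:: Halt] None T'); split=> //.
    - by rewrite /venabled /= /prog_trans /= st_val.
    - by rewrite -addn2 leq_add.
    - by rewrite inE /= st_val // LT Ht.
  exists (n.+2 + 1), (mview prog [::] None T'); split=> //.
  - apply: vrun_cat Hrun _.
    apply: (@one_step prog [::] None (w T') _ T' _ _ 0) (erefl _) _ => //.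
    - rewrite /venabled /= /prog_trans /= st_val //.
      rewrite inE; apply/eqP; congr pair; apply: eq_from_tnth => j.
      by rewrite !tnth_mktuple /= inord_val; case: eqP.
    - by move=> j _; rewrite /= fwrite_id.
  - by rewrite /venabled /= /prog_trans /= st_val ?S0.
  - by rewrite addn1 -addn3 leq_add.
  - by rewrite inE /= st_val ?S0 // LT Ht.
exists (machine prog); split; first exact: machine_det.
- by move=> x; have [n [v [Hr H0 _ ->]]] := main x;
  rewrite (vrun_accepts (machine_det (prog := prog)) Hr H0).
- move=> x p Hp; have [n [v [Hr H0 le_n _]]] := main x.
  apply: leq_trans le_n.
  exact: (vrun_halts_within (machine_det (prog := prog)) Hr H0).
Qed.

End Programs.
End TuringRuns.

(** * Functions computable in time polynomial in their values, and register programs *)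

Module ComputableFunctions.
Import TuringRuns.
Import Order.TTheory GRing.Theory Num.Theory.

(** Only [m > 1] is considered, so that constant factors and summands are absorbed by the
    exponent. *)
Definition polyb (g : nat -> nat) := exists k, forall m, 1 < m -> g m <= m ^ k.

Lemma polyb_le g h : polyb h -> (forall m, 1 < m -> g m <= h m) -> polyb g.
Proof. by move=> [k H] le; exists k => m m1; apply: leq_trans (le _ m1) (H _ m1). Qed.

Lemma polybX k : polyb (fun m => m ^ k). Proof. by exists k. Qed.

Lemma polyb_id : polyb id. Proof. by exists 1 => m _; rewrite expn1. Qed.

Lemma polybC c : polyb (fun=> c).
Proof. by exists c => m m1; apply/ltnW/ltn_expl. Qed.

Lemma polybM g h : polyb g -> polyb h -> polyb (fun m => g m * h m).
Proof.
by move=> [k1 H1] [k2 H2]; exists (k1 + k2) => m m1; rewrite expnD leq_mul ?H1 ?H2.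
Qed.

Lemma polybD g h : polyb g -> polyb h -> polyb (fun m => g m + h m).
Proof.
move=> [k1 H1] [k2 H2]; exists (maxn k1 k2).+1 => m m1.
have le k : k <= maxn k1 k2 -> m ^ k <= m ^ maxn k1 k2.
  by move=> le_k; rewrite leq_exp2l.
have L1 := leq_trans (H1 _ m1) (le _ (leq_maxl _ _)).
have L2 := leq_trans (H2 _ m1) (le _ (leq_maxr _ _)).
rewrite expnS; nia.
Qed.

Lemma polyb_comp g k : polyb g -> polyb (fun m => g (m ^ k)).
Proof.
move=> [k1 H1]; case: k => [|k]; first exact: (polyb_le (polybC (g 1))).
exists (k.+1 * k1) => m m1; rewrite expnM; apply: H1.
by rewrite -{1}(exp1n k.+1) ltn_exp2r.
Qed.

Ltac polyb := repeat first
  [ apply: polybC | apply: polyb_id | apply: polybX | apply: polybD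
  | apply: polybM | by assumption ].

Definition env : Type := (seq bool * (nat -> nat))%type.

Definition scons (a : nat) (s : env) : env :=
  (s.1, fun i => if i is j.+1 then s.2 j else a).

(* The class of functions of the input word and of finitely many numbers that
   are computable in time polynomial in the VALUES of the numbers. *)
Inductive vcomp : (env -> nat) -> Prop :=
  | comp_var i : vcomp (fun s => s.2 i)
  | comp_zero : vcomp (fun=> 0)
  | comp_succ f : vcomp f -> vcomp (fun s => (f s).+1)
  | comp_add f g : vcomp f -> vcomp g -> vcomp (fun s => f s + g s)
  | comp_sub f g : vcomp f -> vcomp g -> vcomp (fun s => f s - g s)
  | comp_mul f g : vcomp f -> vcomp g -> vcomp (fun s => f s * g s)
  | comp_bit f : vcomp f -> vcomp (fun s => nth false s.1 (f s))
  | comp_iter b a F B : vcomp b -> vcomp a -> vcomp F -> vcomp B ->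
      (forall i acc s, F (scons i (scons acc s)) <= B s) ->
      vcomp (fun s => iteri (b s) (fun i acc => F (scons i (scons acc s))) (a s)).

(** Every iteration carries a bound [B] on its body that is independent of the accumulator; this
    prevents iterated multiplication from growing exponentially. *)
Lemma comp_bound f : vcomp f -> exists2 g, polyb g &
  forall s m, 1 < m -> (forall i, s.2 i <= m) -> f s <= g m.
Proof.
elim=> {f}.
- by move=> i; exists id => //; exact: polyb_id.
- by exists id => //; exact: polyb_id.
- move=> f _ [g pg H]; exists (fun m => g m + 1); first by polyb.
  by move=> s m m1 sm; rewrite addn1 ltnS H.
- move=> f1 f2 _ [g1 p1 H1] _ [g2 p2 H2]; exists (fun m => g1 m + g2 m).
    by polyb.
  by move=> s m m1 sm; rewrite leq_add ?H1 ?H2.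
- move=> f1 f2 _ [g1 p1 H1] _ [g2 p2 H2]; exists g1 => //.
  by move=> s m m1 sm; apply: leq_trans (leq_subr _ _) _; rewrite H1.
- move=> f1 f2 _ [g1 p1 H1] _ [g2 p2 H2]; exists (fun m => g1 m * g2 m).
    by polyb.
  by move=> s m m1 sm; rewrite leq_mul ?H1 ?H2.
- move=> f _ _; exists (fun=> 1); first by polyb.
  by move=> s m _ _; case: nth.
- move=> b a F B _ _ _ [ga pa Ha] _ _ _ [gB pB HB] le.
  exists (fun m => ga m + gB m); first by polyb.
  move=> s m m1 sm; case: (b s) => [|n] /=.
    by rewrite (leq_trans (Ha _ _ m1 sm)) ?leq_addr.
  by rewrite (leq_trans (le _ _ _)) // (leq_trans (HB _ _ m1 sm)) ?leq_addl.
Qed.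

Section Registers.
Variable M0 : tm.
Local Notation sym := (symbol (tm_aux M0)).
Local Notation mt := (tm_tapes M0).+1.

Definition mark : sym := Some (inl true).

(** A register holds a number in unary, as [v] marks ending at the head. Testing for zero,
    incrementing and decrementing then happen next to the head. *)
Definition cnt (v : nat) : int -> sym :=
  fun o => if ((o <= 0) && (- Posz v < o))%R then mark else None.

Definition reg r := r + mt.+1.

(** Tape 0 is the input, tapes 1 to [mt] belong to [M0], and all later tapes are registers. *)
Definition memory (inp : int -> sym) (G : tapes M0) (rho : nat -> nat) : tapes M0 :=
  fun i => if i == 0 then inp else if i <= mt then G i else cnt (rho (i - mt.+1)).

Definition hexec c inp G rho inp' G' rho' B := exists2 n,
  n <= B & exec c (memory inp G rho) (memory inp' G' rho') n.

(** The quantification over [G] makes a register program usable before and after [M0] has run; the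
    input head must be back in place at the end. *)
Definition runs inp c (rho rho' : nat -> nat) B :=
  forall G, hexec c inp G rho inp G rho' B.

Definition nz : pred sym := fun s => s != None.

Lemma mem_reg inp G rho r : memory inp G rho (reg r) = cnt (rho r).
Proof. by rewrite /memory /reg addnS /= ltnNge leq_addl /= subSS addnK. Qed.

Lemma mem_upd inp G rho r v :
  upd (memory inp G rho) (reg r) (cnt v) = memory inp G (upd rho r v).
Proof.
apply: funext => i; rewrite /upd /memory; case: eqP => [->|ne].
  by rewrite /reg addnS /= ltnNge leq_addl /= subSS addnK eqxx.
case: eqP => // i0; case: leqP => // lt; case: eqP => // E.
by case: ne; rewrite /reg -E subnK.
Qed.

Lemma nz_reg inp G rho r : nz (memory inp G rho (reg r) 0%R) = (0 < rho r).
Proof.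
rewrite mem_reg /nz /cnt lexx /=.
by case: (rho r) => [|v] //=.
Qed.

Lemma runs_le inp c rho rho' B B' :
  runs inp c rho rho' B -> B <= B' -> runs inp c rho rho' B'.
Proof. by move=> H le G; have [n l e] := H G; exists n => //; exact: leq_trans le. Qed.

Lemma hexec_seq a b i1 i2 i3 G1 G2 G3 r1 r2 r3 B1 B2 :
  hexec a i1 G1 r1 i2 G2 r2 B1 -> hexec b i2 G2 r2 i3 G3 r3 B2 ->
  hexec (Seq a b) i1 G1 r1 i3 G3 r3 (B1 + B2 + 1).
Proof.
move=> [n1 l1 e1] [n2 l2 e2].
exists (n1 + n2).+1; first by rewrite addn1 ltnS leq_add.
exact: ExSeq e1 e2.
Qed.

Lemma runs_seq inp a b rho rho1 rho2 B1 B2 : runs inp a rho rho1 B1 ->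
  runs inp b rho1 rho2 B2 -> runs inp (Seq a b) rho rho2 (B1 + B2 + 1).
Proof. by move=> H1 H2 G; exact: hexec_seq (H1 G) (H2 G). Qed.

Lemma runs_skip inp rho : runs inp (Skip M0) rho rho 1.
Proof.
move=> G; exists 1 => //.
have := @ExPrim M0 0 (fun s => (s, None)) (memory inp G rho); rewrite /= fwrite_id.
congr exec; apply: funext => i; rewrite /upd; by case: eqP => [->|].
Qed.

Definition Inc r : cmd M0 := Seq (Prim (reg r) (fun s => (s, Some true)))
  (Prim (reg r) (fun=> (mark, None))).
Definition Dec r : cmd M0 := Prim (reg r) (fun=> (None, Some false)).

Lemma runs_inc inp r rho : runs inp (Inc r) rho (upd rho r (rho r).+1) 3.
Proof.
move=> G; exists 3 => //; apply: (@ExSeq _ _ _ _ _ _ 1 1); first exact: ExPrim.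
set T1 := upd _ _ _.
have := @ExPrim M0 (reg r) (fun=> (mark, None)) T1; congr exec.
rewrite -mem_upd; apply: funext => i; rewrite /upd /T1 /upd.
case: eqP => // _ /=; rewrite eqxx mem_reg; apply: funext => o /=.
rewrite /fwrite /cnt; case: (eqVneq o 0%R) => [->|ne] //=; do ?[case: ifP => ?] => //; exfalso; lia.
Qed.

Lemma runs_dec inp r rho v : rho r = v.+1 ->
  runs inp (Dec r) rho (upd rho r v) 1.
Proof.
move=> rv G; exists 1 => //.
have := @ExPrim M0 (reg r) (fun=> (None, Some false)) (memory inp G rho).
congr exec; rewrite -mem_upd; apply: funext => i; rewrite /upd.
case: eqP => // _ /=; rewrite mem_reg rv; apply: funext => o /=.
rewrite /fwrite /cnt; do ?[case: ifP => ?] => //; exfalso; lia.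
Qed.

Definition Loop r (c : cmd M0) : cmd M0 := While (reg r) nz (Seq (Dec r) c).

(** Configurations are given as sequences indexed by the number of completed rounds, so an invariant
    is a formula in [j]. Three steps per round pay for the test, the sequencing and the
    decrement. *)
Lemma hexec_loop r c (Fi : nat -> int -> sym) (FG : nat -> tapes M0)
    (F : nat -> nat -> nat) N B :
  (forall j, j <= N -> F j r = N - j) ->
  (forall j, j < N -> hexec c (Fi j) (FG j) (upd (F j) r (N - j.+1))
     (Fi j.+1) (FG j.+1) (F j.+1) B) ->
  hexec (Loop r c) (Fi 0) (FG 0) (F 0) (Fi N) (FG N) (F N) ((B + 3) * N + 1).
Proof.
move=> Fr Hc; have: forall d j, j + d = N ->
  hexec (Loop r c) (Fi j) (FG j) (F j) (Fi N) (FG N) (F N) ((B + 3) * d + 1);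
  last by move/(_ N 0 erefl).
elim=> [|d IH] j jN.
  exists 1; first by rewrite muln0.
  move: jN; rewrite addn0 => ->; apply: ExWhileF.
  by rewrite nz_reg Fr ?subnn.
have jltN : j < N by lia.
have [n1 l1 e1] := Hc j jltN.
have [n2 l2 e2] := IH j.+1 ltac:(lia).
have Hd : F j r = (N - j.+1).+1 by rewrite Fr; lia.
have [n0 l0 e0] := @runs_dec (Fi j) r (F j) _ Hd (FG j).
exists ((n0 + n1).+1 + n2).+1; first by nia.
apply: ExWhileT (ExSeq e0 e1) e2.
by rewrite nz_reg Hd.
Qed.

Lemma runs_loop inp r c (F : nat -> nat -> nat) N B :
  (forall j, j <= N -> F j r = N - j) ->
  (forall j, j < N -> runs inp c (upd (F j) r (N - j.+1)) (F j.+1) B) ->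
  runs inp (Loop r c) (F 0) (F N) ((B + 3) * N + 1).
Proof.
move=> Fr Hc G; apply: (@hexec_loop r c (fun=> inp) (fun=> G)) => // j lt.
exact: Hc.
Qed.

Lemma runs_ite inp r a b rho rho' B :
  runs inp (if 0 < rho r then a else b) rho rho' B ->
  runs inp (Ite (reg r) nz a b) rho rho' (B + 1).
Proof.
move=> H G; have [n l e] := H G; exists n.+1; first by rewrite addn1.
by apply: ExIte; rewrite nz_reg.
Qed.


Ltac regs := apply: funext => ?; rewrite /upd; repeat case: eqP => ?; subst; lia.

Definition Clear r := Loop r (Skip M0).

Lemma runs_clear inp r rho : runs inp (Clear r) rho (upd rho r 0) (4 * rho r + 1).
Proof.
have := @runs_loop inp r (Skip M0) (fun j => upd rho r (rho r - j)) (rho r) 1.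
have -> : upd rho r (rho r - 0) = rho by regs.
have -> : upd rho r (rho r - rho r) = upd rho r 0 by regs.
apply=> [j _|j lt]; first by rewrite /upd eqxx.
have -> : upd (upd rho r (rho r - j)) r (rho r - j.+1) = upd rho r (rho r - j.+1).
  by regs.
exact: runs_skip.
Qed.

Definition Move r r' := Loop r (Inc r').

Lemma runs_move inp r r' rho : r != r' ->
  runs inp (Move r r') rho (upd (upd rho r 0) r' (rho r' + rho r)) (6 * rho r + 1).
Proof.
move=> ne.
have := @runs_loop inp r (Inc r')
  (fun j => upd (upd rho r (rho r - j)) r' (rho r' + j)) (rho r) 3.
have -> : upd (upd rho r (rho r - 0)) r' (rho r' + 0) = rho by regs.
have -> : upd (upd rho r (rho r - rho r)) r' (rho r' + rho r) =
          upd (upd rho r 0) r' (rho r' + rho r) by regs.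
apply=> [j _|j lt]; first by rewrite /upd eqxx (negbTE ne).
have := @runs_inc inp r' (upd (upd (upd rho r (rho r - j)) r' (rho r' + j)) r (rho r - j.+1)).
congr (runs _ _ _ _ _); regs.
Qed.

Definition Move2 r r1 r2 := Loop r (Seq (Inc r1) (Inc r2)).

Lemma runs_move2 inp r r1 r2 rho : r != r1 -> r != r2 -> r1 != r2 ->
  runs inp (Move2 r r1 r2) rho
    (upd (upd (upd rho r 0) r1 (rho r1 + rho r)) r2 (rho r2 + rho r))
    (10 * rho r + 1).
Proof.
move=> n1 n2 n3.
have := @runs_loop inp r (Seq (Inc r1) (Inc r2))
  (fun j => upd (upd (upd rho r (rho r - j)) r1 (rho r1 + j)) r2 (rho r2 + j))
  (rho r) 7.
have -> : upd (upd (upd rho r (rho r - 0)) r1 (rho r1 + 0)) r2 (rho r2 + 0) = rho.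
  by regs.
have -> : upd (upd (upd rho r (rho r - rho r)) r1 (rho r1 + rho r)) r2
    (rho r2 + rho r) =
  upd (upd (upd rho r 0) r1 (rho r1 + rho r)) r2 (rho r2 + rho r) by regs.
apply=> [j _|j lt]; first by rewrite /upd eqxx (negbTE n1) (negbTE n2).
set rho1 := upd _ _ (_ - _.+1).
have := runs_seq (@runs_inc inp r1 rho1) (@runs_inc inp r2 _).
rewrite /rho1; congr (runs _ _ _ _ _); regs.
Qed.

(** Reading a unary register destroys it: the content goes to the target and to a scratch register,
    from which it is restored. *)
Definition Copy r r' t := Seq (Move2 r r' t) (Move t r).

Lemma runs_copy inp r r' t rho : r != r' -> r != t -> r' != t -> rho t = 0 ->
  runs inp (Copy r r' t) rho (upd rho r' (rho r' + rho r)) (16 * rho r + 3).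
Proof.
move=> n1 n2 n3 t0.
have tr : t != r by rewrite eq_sym.
have := runs_seq (@runs_move2 inp r r' t rho n1 n2 n3) (@runs_move inp t r _ tr).
move/runs_le => H.
have {}H := H (16 * rho r + 3) ltac:(by rewrite /upd eqxx t0; lia).
move: H; congr (runs _ _ _ _ _).
by apply: funext => j; rewrite /upd; repeat case: eqP => ?; subst; lia.
Qed.

End Registers.
End ComputableFunctions.

(** * Compilation of computable functions to register programs *)

Module Compilation.
Import TuringRuns ComputableFunctions.
Import Order.TTheory GRing.Theory Num.Theory.

Ltac regs := apply: funext => ?; rewrite /upd; repeat case: eqP => ?; subst; lia.

Section Compile.
Variable M0 : tm.
Local Notation sym := (symbol (tm_aux M0)).
Local Notation mt := (tm_tapes M0).+1.
Local Notation inp x := (@input_cells (tm_aux M0) x).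

Definition lookup (rho : nat -> nat) (vs : seq nat) : nat -> nat :=
  fun i => if i < size vs then rho (nth 0 vs i) else 0.

(** Arguments sit in the registers [vs] below [fr]; all registers from [fr] on are zero at entry and
    serve as scratch space. At exit only [fr] has changed, so programs compose by raising [fr]. *)
Definition compiled (f : env -> nat) := forall vs fr, all (fun r => r < fr) vs ->
  exists (c : cmd M0) g, polyb g /\ forall x rho m, 1 < m ->
    (forall r, fr <= r -> rho r = 0) -> (forall r, r \in vs -> rho r <= m) ->
    runs (inp x) c rho (upd rho fr (f (x, lookup rho vs))) (g m).

Lemma lookup_upd rho vs fr r v : all (fun r => r < fr) vs -> fr <= r ->
  lookup (upd rho r v) vs = lookup rho vs.
Proof.
move=> /allP av le; apply: funext => i; rewrite /lookup /upd.
case: ifP => // lt; case: eqP => // E.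
by have /= := av _ (mem_nth 0 lt); lia.
Qed.

Lemma lookup_le rho vs m : (forall r, r \in vs -> rho r <= m) ->
  forall i, lookup rho vs i <= m.
Proof. by move=> H i; rewrite /lookup; case: ifP => // lt; apply: H; exact: mem_nth. Qed.

Lemma allS fr vs : all (fun r => r < fr) vs -> all (fun r => r < fr.+1) vs.
Proof. by apply: sub_all => r /= /ltnW. Qed.

Lemma runs_eq inp c rho rho' rho2 B B' : @runs M0 inp c rho rho' B ->
  rho' = rho2 -> B <= B' -> runs inp c rho rho2 B'.
Proof. by move=> H <-; exact: runs_le. Qed.

Lemma compiled2 f1 f2 vs fr : vcomp f1 -> vcomp f2 -> compiled f1 -> compiled f2 ->
  all (fun r => r < fr) vs ->
  exists (c : cmd M0) g, polyb g /\ forall x rho m, 1 < m ->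
    (forall r, fr <= r -> rho r = 0) -> (forall r, r \in vs -> rho r <= m) ->
    [/\ runs (inp x) c rho (upd (upd rho fr (f1 (x, lookup rho vs))) fr.+1
       (f2 (x, lookup rho vs))) (g m), f1 (x, lookup rho vs) <= g m &
       f2 (x, lookup rho vs) <= g m].
Proof.
move=> k1 k2 C1 C2 av; have [c1 [g1 [p1 H1]]] := C1 vs fr av.
have [c2 [g2 [p2 H2]]] := C2 vs fr.+1 (allS av).
have [b1 pb1 B1] := comp_bound k1; have [b2 pb2 B2] := comp_bound k2.
exists (Seq c1 c2), (fun m => g1 m + g2 m + 1 + b1 m + b2 m).
split=> [|x rho m m1 r0 rm]; first by polyb.
have L := lookup_le rm.
have E1 := B1 (x, lookup rho vs) m m1 L.
have E2 := B2 (x, lookup rho vs) m m1 L.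
split; try lia.
apply: runs_eq (runs_seq (H1 x rho m m1 r0 rm) (H2 x _ m m1 _ _)) _ _.
- by move=> r le; rewrite /upd; case: eqP => ?; [lia | apply: r0; lia].
- move=> r rv; rewrite /upd; case: eqP => [E|_]; last exact: rm.
  by have /= := allP av _ rv; rewrite E ltnn.
- by rewrite (lookup_upd _ _ av).
- by lia.
Qed.

Lemma compiled_add f1 f2 : vcomp f1 -> vcomp f2 -> compiled f1 -> compiled f2 ->
  compiled (fun s => f1 s + f2 s).
Proof.
move=> k1 k2 C1 C2 vs fr av; have [c [g [pg H]]] := compiled2 k1 k2 C1 C2 av.
exists (Seq c (Move M0 fr.+1 fr)), (fun m => g m + (6 * g m + 1) + 1).
split=> [|x rho m m1 r0 rm]; first by polyb.
have [Hr L1 L2] := H x rho m m1 r0 rm.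
have ne : fr.+1 != fr by lia.
apply: runs_eq (runs_seq Hr (runs_move _ _ ne)) _ _.
- have := r0 fr.+1 (leqnSn _); move: (lookup rho vs) => L E; regs.
- by rewrite /upd eqxx; lia.
Qed.

Lemma compiled_sub f1 f2 : vcomp f1 -> vcomp f2 -> compiled f1 -> compiled f2 ->
  compiled (fun s => f1 s - f2 s).
Proof.
move=> k1 k2 C1 C2 vs fr av; have [c [g [pg H]]] := compiled2 k1 k2 C1 C2 av.
exists (Seq c (Loop fr.+1 (Ite (reg M0 fr) (@nz M0) (Dec M0 fr) (Skip M0)))),
  (fun m => g m + (5 * g m + 1) + 1).
split=> [|x rho m m1 r0 rm]; first by polyb.
have [Hr L1 L2] := H x rho m m1 r0 rm.
move: Hr L1 L2; set a := f1 _; set b := f2 _ => Hr L1 L2.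
pose F j := upd (upd rho fr (a - j)) fr.+1 (b - j).
have HL : runs (inp x) (Loop fr.+1 (Ite (reg M0 fr) (@nz M0) (Dec M0 fr) (Skip M0)))
    (F 0) (F b) ((2 + 3) * b + 1).
  apply: runs_loop => [j _|j lt]; first by rewrite /F /upd eqxx.
  apply: (@runs_ite M0 _ _ _ _ _ _ 1).
  have -> : upd (F j) fr.+1 (b - j.+1) fr = a - j.
    by rewrite /F /upd; repeat case: eqP => ?; lia.
  case: ifP => Ha.
    apply: runs_eq (@runs_dec M0 _ fr _ (a - j.+1) _) _ _ => //.
      by rewrite /F /upd eqxx; repeat case: eqP => ?; lia.
    by rewrite /F; regs.
  by apply: runs_eq (runs_skip _ _) _ _ => //; rewrite /F; regs.
apply: runs_eq (runs_seq Hr _) _ _; last first.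
- instantiate (1 := 5 * b + 1); lia.
- have := r0 fr.+1 (leqnSn _); rewrite /F => E; instantiate (1 := F b); rewrite /F.
  regs.
- move: HL; rewrite {1}/F !subn0; exact.
Qed.

Lemma compiled_mul f1 f2 : vcomp f1 -> vcomp f2 -> compiled f1 -> compiled f2 ->
  compiled (fun s => f1 s * f2 s).
Proof.
move=> k1 k2 C1 C2 vs fr av; have [c [g [pg H]]] := compiled2 k1 k2 C1 C2 av.
exists (Seq (Seq c (Loop fr (Copy M0 fr.+1 fr.+2 fr.+3)))
  (Seq (Clear M0 fr.+1) (Move M0 fr.+2 fr))),
  (fun m => (g m + ((16 * g m + 6) * g m + 1) + 1) +
    (4 * g m + 1 + (6 * (g m * g m) + 1) + 1) + 1).
split=> [|x rho m m1 r0 rm]; first by polyb.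
have [Hr L1 L2] := H x rho m m1 r0 rm.
move: Hr L1 L2; set a := f1 _; set b := f2 _ => Hr L1 L2.
pose F j := upd (upd (upd rho fr (a - j)) fr.+1 b) fr.+2 (j * b).
have R2 := r0 fr.+2 ltac:(lia); have R3 := r0 fr.+3 ltac:(lia).
have R1 := r0 fr.+1 ltac:(lia).
have HL : runs (inp x) (Loop fr (Copy M0 fr.+1 fr.+2 fr.+3))
    (F 0) (F a) ((16 * b + 3 + 3) * a + 1).
  apply: runs_loop => [j _|j lt].
    by rewrite /F /upd; repeat case: eqP => ?; lia.
  apply: runs_eq (@runs_copy M0 _ fr.+1 fr.+2 fr.+3 _ _ _ _ _) _ _; try lia.
  - by rewrite /F /upd; repeat case: eqP => ?; lia.
  - by rewrite /F; regs.
  - by rewrite /F /upd; repeat case: eqP => ?; lia.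
have F0 : F 0 = upd (upd rho fr a) fr.+1 b by rewrite /F; regs.
rewrite F0 in HL.
have ne : fr.+2 != fr by lia.
apply: runs_eq (runs_seq (runs_seq Hr HL) (runs_seq (runs_clear _ fr.+1 _)
  (runs_move _ _ ne))) _ _.
- by rewrite /F; regs.
- rewrite /F /upd; repeat case: eqP => ?; try lia; nia.
Qed.

(** State of a running loop: remaining rounds in [fr], accumulator in [fr.+1], index in [fr.+2]. The
    last two are put in front of [vs] because an iteration binds them as variables 1 and 0. *)
Definition extend (rho : nat -> nat) fr n acc j :=
  upd (upd (upd rho fr (n - j)) fr.+1 acc) fr.+2 j.

Lemma lookup_extend rho vs fr n acc j x : all (fun r => r < fr) vs ->
  (x, lookup (extend rho fr n acc j) (fr.+2 :: fr.+1 :: vs)) =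
  scons j (scons acc (x, lookup rho vs)).
Proof.
move=> /allP av; rewrite /scons /=; congr pair; apply: funext => -[|[|i]] //=.
- by rewrite /lookup /= /extend /upd eqxx.
- by rewrite /lookup /= /extend /upd eqxx; case: eqP => //; lia.
- rewrite /lookup /= !ltnS; case: ifP => // lt.
  have /= := av _ (mem_nth 0 lt); rewrite /extend /upd => lt2.
  by repeat case: eqP => ?; lia.
Qed.

Lemma compiled_iter b a F B : vcomp b -> vcomp a -> vcomp F -> vcomp B ->
  (forall i acc s, F (scons i (scons acc s)) <= B s) ->
  compiled b -> compiled a -> compiled F ->
  compiled (fun s => iteri (b s) (fun i acc => F (scons i (scons acc s))) (a s)).
Proof.
move=> kb ka kF kB leF Cb Ca CF vs fr av.
have [c [g [pg H]]] := compiled2 kb ka Cb Ca av.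
have av' : all (fun r => r < fr.+3) [:: fr.+2, fr.+1 & vs].
  rewrite /= ltnSn leqW ?leqnn //=; do 3!apply: allS; exact: av.
have [cF [gF [pF HF]]] := CF _ _ av'.
have [gB pB HB] := comp_bound kB.
case: (pg) => kg Hg; case: (pB) => kB' HB'.
(* With this exponent [m ^ k] bounds the number of rounds, every accumulator and [m] itself, so all
   rounds share the time bound [gF (m ^ k)]. *)
set k := (kg + kB' + 2).
pose gs := fun m => gF (m ^ k) + (4 * m ^ k + 1 + (6 * m ^ k + 1) + 1) + 1 + 3 + 1.
pose body := Seq (Seq cF (Seq (Clear M0 fr.+1) (Move M0 fr.+3 fr.+1))) (Inc M0 fr.+2).
exists (Seq (Seq c (Loop fr body)) (Seq (Clear M0 fr.+2) (Move M0 fr.+1 fr))).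
exists (fun m => g m + ((gs m + 3) * m ^ k + 1) + 1 +
  (4 * m ^ k + 1 + (6 * m ^ k + 1) + 1) + 1).
split.
  rewrite /gs; polyb; exact: polyb_comp.
move=> x rho m m1 r0 rm; have [Hr L1 L2] := H x rho m m1 r0 rm.
have L := lookup_le rm.
have LB := HB (x, lookup rho vs) m m1 L.
set s := (x, lookup rho vs) in Hr L1 L2 LB *.
pose acc j := iteri j (fun i acc => F (scons i (scons acc s))) (a s).
have kk j : j <= k -> m ^ j <= m ^ k by move=> le; rewrite leq_exp2l.
have Lb : b s <= m ^ k.
  by apply: leq_trans L1 (leq_trans (Hg _ m1) (kk _ _)); rewrite /k; lia.
have Lacc j : acc j <= m ^ k.
  case: j => [|j]; rewrite /acc /=.
    by apply: leq_trans L2 (leq_trans (Hg _ m1) (kk _ _)); rewrite /k; lia.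
  apply: leq_trans (leF _ _ _) (leq_trans LB (leq_trans (HB' _ m1) (kk _ _))).
  by rewrite /k; lia.
have Lm : m <= m ^ k by rewrite -{1}(expn1 m) kk // /k; lia.
pose Fs j := extend rho fr (b s) (acc j) j.
have R1 := r0 fr.+1 ltac:(lia).
have R2 := r0 fr.+2 ltac:(lia); have R3 := r0 fr.+3 ltac:(lia).
have HL : runs (inp x) (Loop fr body) (Fs 0) (Fs (b s)) ((gs m + 3) * b s + 1).
  apply: runs_loop => [j _|j lt].
    by rewrite /Fs /extend /upd; repeat case: eqP => ?; lia.
  have -> : upd (Fs j) fr (b s - j.+1) = extend rho fr (b s - 1) (acc j) j.
    by rewrite /Fs /extend; regs.
  set rho1 := extend _ _ _ _ _.
  have HF1 : runs (inp x) cF rho1 (upd rho1 fr.+3 (acc j.+1)) (gF (m ^ k)).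
    have := HF x rho1 (m ^ k); rewrite lookup_extend //; apply.
    - lia.
    - move=> r le; rewrite /rho1 /extend /upd.
      by repeat case: eqP => ?; [lia | lia | lia | apply: r0; lia].
    - move=> r; rewrite !inE => /or3P[/eqP->|/eqP->|rv].
      + by rewrite /rho1 /extend /upd eqxx; lia.
      + rewrite /rho1 /extend /upd eqxx.
        by case: eqP => ?; [lia | exact: Lacc].
      + have := rm _ rv; have /= := allP av _ rv; rewrite /rho1 /extend /upd.
        by repeat case: eqP => ?; lia.
  have ne : fr.+3 != fr.+1 by lia.
  apply: runs_eq (runs_seq (runs_seq HF1 (runs_seq (runs_clear _ fr.+1 _)
    (runs_move _ _ ne))) (runs_inc _ fr.+2 _)) _ _.
  - by rewrite /Fs /rho1 /extend; regs.
  - have := Lacc j; have := Lacc j.+1.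
    by rewrite /gs /rho1 /extend /upd; repeat case: eqP => ?; lia.
have F0 : Fs 0 = upd (upd rho fr (b s)) fr.+1 (a s).
  by rewrite /Fs /extend /acc /=; regs.
rewrite F0 in HL.
have ne : fr.+1 != fr by lia.
apply: runs_eq (runs_seq (runs_seq Hr HL) (runs_seq (runs_clear _ fr.+2 _)
  (runs_move _ _ ne))) _ _.
- by rewrite /Fs /extend -/(acc (b s)); regs.
- have := Lacc (b s); rewrite /Fs /extend /upd.
  have := leq_mul (leqnn (gs m + 3)) Lb.
  by repeat case: eqP => ?; lia.
Qed.

Definition MoveInput (d : bool) : cmd M0 := Prim 0 (fun s => (s, Some d)).

Lemma exec_move_input d i G rho :
  hexec (MoveInput d) i G rho (fmove (Some d) i) G rho 1.
Proof.
exists 1 => //.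
have := @ExPrim M0 0 (fun s => (s, Some d)) (memory i G rho); congr exec.
by apply: funext => j; rewrite /upd /memory; case: eqP => //= _; rewrite fwrite_id.
Qed.

Definition shift (h : nat) (i : int -> sym) : int -> sym := fun o => i (o + Posz h)%R.

Lemma shift0 i : shift 0 i = i.
Proof. by apply: funext => o; rewrite /shift addr0. Qed.

Lemma shiftS h i : fmove (Some true) (shift h i) = shift h.+1 i.
Proof. by apply: funext => o; rewrite /fmove /shift; congr (i _); lia. Qed.

Lemma shiftP h i : fmove (Some false) (shift h.+1 i) = shift h i.
Proof. by apply: funext => o; rewrite /fmove /shift; congr (i _); lia. Qed.

Definition is_one : pred sym := fun s => s == Some (inl true).

(** The input head walks to the requested cell while [fr.+1] counts the moves; after the bit is
    read, the counter brings the head back. *)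
Lemma compiled_bit f : vcomp f -> compiled f ->
  compiled (fun s => nth false s.1 (f s)).
Proof.
move=> kf Cf vs fr av; have [c [g [pg H]]] := Cf vs fr av.
have [gf pf Hf] := comp_bound kf.
exists (Seq (Seq c (Loop fr (Seq (MoveInput true) (Inc M0 fr.+1))))
  (Seq (Ite 0 is_one (Inc M0 fr) (Skip M0)) (Loop fr.+1 (MoveInput false)))).
exists (fun m => g m + (8 * gf m + 1) + 1 + (4 + (4 * gf m + 1) + 1) + 1).
split=> [|x rho m m1 r0 rm]; first by polyb.
have Hr := H x rho m m1 r0 rm.
have L1 := Hf (x, lookup rho vs) m m1 (lookup_le rm).
set a := f _ in Hr L1 *; move=> G /=.
have R0 := r0 fr ltac:(lia); have R1 := r0 fr.+1 ltac:(lia).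
pose F1 j := upd (upd rho fr (a - j)) fr.+1 j.
have H1 : hexec (Loop fr (Seq (MoveInput true) (Inc M0 fr.+1)))
   (shift 0 (inp x)) G (F1 0) (shift a (inp x)) G (F1 a) ((5 + 3) * a + 1).
  apply: (@hexec_loop M0 fr _ (fun j => shift j (inp x)) (fun=> G)) => j lt.
    by rewrite /F1 /upd; repeat case: eqP => ?; lia.
  have := hexec_seq (exec_move_input true (shift j (inp x)) G
    (upd (F1 j) fr (a - j.+1))) (runs_inc _ fr.+1 _ G).
  rewrite shiftS; congr hexec; rewrite /F1; regs.
set bit : nat := nth false x a.
pose F2 j := upd (upd rho fr bit) fr.+1 (a - j).
have H2 : hexec (Ite 0 is_one (Inc M0 fr) (Skip M0)) (shift a (inp x)) G (F1 a)
   (shift a (inp x)) G (F2 0) 4.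
  have E : is_one (memory (shift a (inp x)) G (F1 a) 0 0%R) = nth false x a.
    rewrite /memory eqxx /shift add0r /input_cells.
    case: (ltnP a (size x)) => lt.
      by rewrite (nth_map false) // /is_one; case: nth.
    by rewrite !nth_default ?size_map.
  have [n ln en] : hexec (if nth false x a then Inc M0 fr else Skip M0)
     (shift a (inp x)) G (F1 a) (shift a (inp x)) G (F2 0) 3.
    rewrite /F2 /bit; case: nth.
      have := runs_inc (shift a (inp x)) fr (F1 a) G; congr hexec; rewrite /F1; regs.
    have [n l e] := runs_skip (shift a (inp x)) (F1 a) G.
    exists n; first by lia.
    by move: e; congr exec; congr memory; rewrite /F1; regs.
  exists n.+1 => //; apply: ExIte; by rewrite E.
have H3 : hexec (Loop fr.+1 (MoveInput false))
   (shift (a - 0) (inp x)) G (F2 0) (shift (a - a) (inp x)) G (F2 a) ((1 + 3) * a + 1).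
  apply: (@hexec_loop M0 fr.+1 _ (fun j => shift (a - j) (inp x)) (fun=> G)) => j lt.
    by rewrite /F2 /upd; repeat case: eqP => ?; lia.
  have := exec_move_input false (shift (a - j) (inp x)) G
    (upd (F2 j) fr.+1 (a - j.+1)).
  have -> : a - j = (a - j.+1).+1 by lia.
  by rewrite shiftP; congr hexec; rewrite /F2; regs.
rewrite subn0 subnn shift0 in H3; rewrite shift0 in H1.
have F10 : F1 0 = upd rho fr a by rewrite /F1; regs.
rewrite F10 in H1.
have [n ln en] := hexec_seq (hexec_seq (Hr G) H1) (hexec_seq H2 H3).
exists n; first by lia.
by move: en; congr exec; congr memory; rewrite /F2; regs.
Qed.

Theorem comp_compiled f : vcomp f -> compiled f.
Proof.
elim=> {f}.
- move=> i vs fr av; case: (ltnP i (size vs)) => lt; last first.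
    exists (Skip M0), id; split=> [|x rho m m1 r0 rm]; first exact: polyb_id.
    apply: runs_eq (runs_skip _ _) _ (ltnW m1); rewrite /lookup /= ltnNge lt /=.
    have := r0 fr (leqnn _) => E; regs.
  exists (Copy M0 (nth 0 vs i) fr fr.+1), (fun m => 16 * m + 3).
  split=> [|x rho m m1 r0 rm]; first by polyb.
  have lti := mem_nth 0 lt; have /= ltf := allP av _ lti.
  apply: runs_eq (@runs_copy M0 _ (nth 0 vs i) fr fr.+1 _ _ _ _ _) _ _; try lia.
  + by apply: r0; lia.
  + rewrite /lookup /= lt; have := r0 fr (leqnn _) => E; regs.
  + by rewrite leq_add2r leq_mul2l /= rm.
- move=> vs fr av; exists (Skip M0), id; split=> [|x rho m m1 r0 rm].
    exact: polyb_id.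
  apply: runs_eq (runs_skip _ _) _ (ltnW m1).
  by have := r0 fr (leqnn _) => E; regs.
- move=> f kf Cf vs fr av; have [c [g [pg H]]] := Cf vs fr av.
  exists (Seq c (Inc M0 fr)), (fun m => g m + 3 + 1).
  split=> [|x rho m m1 r0 rm]; first by polyb.
  apply: runs_eq (runs_seq (H x rho m m1 r0 rm) (runs_inc _ fr _)) _ _ => //.
  by move: (lookup rho vs) => L; regs.
- by move=> f g kf Cf kg Cg; exact: compiled_add.
- by move=> f g kf Cf kg Cg; exact: compiled_sub.
- by move=> f g kf Cf kg Cg; exact: compiled_mul.
- by move=> f kf Cf; exact: compiled_bit.
- move=> b a F B kb Cb ka Ca kF CF kB _ le; exact: (compiled_iter kb ka kF kB).
Qed.

End Compile.
End Compilation.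

(** * Programs that measure the input, write the graph and count the output *)

Module GraphPrograms.
Import TuringRuns ComputableFunctions Compilation.
Import Order.TTheory GRing.Theory Num.Theory.

Section Decider.
Variable M0 : tm.
Hypothesis detM0 : deterministic M0.
Local Notation sym := (symbol (tm_aux M0)).
Local Notation mt := (tm_tapes M0).+1.
Local Notation inp x := (@input_cells (tm_aux M0) x).

Lemma hexec_le c i1 G1 r1 i2 G2 r2 B B' :
  @hexec M0 c i1 G1 r1 i2 G2 r2 B -> B <= B' -> hexec c i1 G1 r1 i2 G2 r2 B'.
Proof. by move=> [n l e] le; exists n => //; exact: leq_trans le. Qed.

Lemma hexec_eq c i1 G1 r1 i2 G2 r2 r3 B B' :
  @hexec M0 c i1 G1 r1 i2 G2 r2 B -> r2 = r3 -> B <= B' ->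
  hexec c i1 G1 r1 i2 G2 r3 B'.
Proof. by move=> H <-; exact: hexec_le. Qed.

Lemma hexec_while t (p : pred sym) c (Fi : nat -> int -> sym) (FG : nat -> tapes M0)
    (F : nat -> nat -> nat) N B :
  (forall j, j < N -> p (memory (Fi j) (FG j) (F j) t 0%R)) ->
  ~~ p (memory (Fi N) (FG N) (F N) t 0%R) ->
  (forall j, j < N ->
    hexec c (Fi j) (FG j) (F j) (Fi j.+1) (FG j.+1) (F j.+1) B) ->
  hexec (While t p c) (Fi 0) (FG 0) (F 0) (Fi N) (FG N) (F N) ((B + 1) * N + 1).
Proof.
move=> Hp Hn Hc; have: forall d j, j + d = N ->
  hexec (While t p c) (Fi j) (FG j) (F j) (Fi N) (FG N) (F N) ((B + 1) * d + 1);
  last by move/(_ N 0 erefl).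
elim=> [|d IH] j jN.
  exists 1; first by rewrite muln0.
  by move: jN; rewrite addn0 => ->; apply: ExWhileF.
have jltN : j < N by lia.
have [n1 l1 e1] := Hc j jltN.
have [n2 l2 e2] := IH j.+1 ltac:(lia).
exists (n1 + n2).+1; first by nia.
by apply: ExWhileT e1 e2; exact: Hp.
Qed.

Definition is_bit : pred sym := fun s => if s is Some (inl _) then true else false.

Definition CountInput : cmd M0 :=
  Seq (While 0 is_bit (Seq (MoveInput M0 true) (Seq (Inc M0 0) (Inc M0 1))))
      (Loop 1 (MoveInput M0 false)).

Lemma input_is_bit x j : is_bit (inp x (Posz j)) = (j < size x).
Proof.
rewrite /=; case: ltnP => lt; first by rewrite (nth_map false).
by rewrite nth_default ?size_map.
Qed.

Lemma exec_count_input x G : hexec CountInput (inp x) G (fun=> 0) (inp x) G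
  (upd (fun=> 0) 0 (size x)) (10 * size x + 1 + (4 * size x + 1) + 1).
Proof.
set n := size x.
pose F1 j := upd (upd (fun=> 0) 0 j) 1 j.
have H1 : hexec (While 0 is_bit (Seq (MoveInput M0 true) (Seq (Inc M0 0) (Inc M0 1))))
   (shift 0 (inp x)) G (F1 0) (shift n (inp x)) G (F1 n) ((9 + 1) * n + 1).
  apply: (@hexec_while 0 is_bit _ (fun j => shift j (inp x)) (fun=> G) F1).
  - by move=> j lt; rewrite /memory eqxx /shift add0r input_is_bit.
  - by rewrite /memory eqxx /shift add0r input_is_bit ltnn.
  move=> j lt; have := hexec_seq (exec_move_input true (shift j (inp x)) G (F1 j))
    (hexec_seq (runs_inc _ 0 _ G) (runs_inc _ 1 _ G)).
  by rewrite shiftS; congr hexec; rewrite /F1; regs.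
pose F2 j := upd (upd (fun=> 0) 0 n) 1 (n - j).
have H3 : hexec (Loop 1 (MoveInput M0 false))
   (shift (n - 0) (inp x)) G (F2 0) (shift (n - n) (inp x)) G (F2 n) ((1 + 3) * n + 1).
  apply: (@hexec_loop M0 1 _ (fun j => shift (n - j) (inp x)) (fun=> G)) => j lt.
    by rewrite /F2 /upd.
  have := exec_move_input false (shift (n - j) (inp x)) G (upd (F2 j) 1 (n - j.+1)).
  have -> : n - j = (n - j.+1).+1 by lia.
  by rewrite shiftP; congr hexec; rewrite /F2; regs.
have E1 : F1 0 = fun=> 0 by rewrite /F1; regs.
have E2 : F2 0 = F1 n by rewrite /F2 /F1; regs.
have E3 : F2 n = upd (fun=> 0) 0 n by rewrite /F2; regs.
rewrite shift0 E1 in H1; rewrite subn0 subnn shift0 E2 E3 in H3.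
exact: hexec_seq H1 H3.
Qed.

(** Register 2, started at 1, is doubled as often as register 1 says. The resulting [2 ^ E] is the
    value in which all later running times are polynomial. *)
Definition Double : cmd M0 :=
  Loop 1 (Seq (Move2 M0 2 3 4) (Seq (Move M0 3 2) (Move M0 4 2))).

Lemma runs_double i n E : runs i (Seq (Inc M0 2) Double)
  (upd (upd (fun=> 0) 0 n) 1 E) (upd (upd (fun=> 0) 0 n) 2 (2 ^ E))
  (3 + ((22 * 2 ^ E + 8) * E + 1) + 1).
Proof.
pose F j := upd (upd (upd (fun=> 0) 0 n) 1 (E - j)) 2 (2 ^ j).
have H : runs i Double (F 0) (F E) ((22 * 2 ^ E + 5 + 3) * E + 1).
  apply: runs_loop => [j _|j lt]; first by rewrite /F /upd.
  apply: runs_eq (runs_seq (@runs_move2 M0 _ 2 3 4 _ _ _ _)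
   (runs_seq (@runs_move M0 _ 3 2 _ _) (@runs_move M0 _ 4 2 _ _))) _ _ => //.
  - by rewrite /F; apply: funext => k; rewrite /upd; repeat case: eqP => ?; subst;
    rewrite ?expnS; lia.
  - rewrite /F /upd /=; have : 2 ^ j <= 2 ^ E by rewrite leq_exp2l // ltnW.
    lia.
set r0 := upd _ 1 E.
have F0 : F 0 = upd r0 2 (r0 2).+1 by rewrite /F /r0; regs.
rewrite F0 in H.
apply: runs_eq (runs_seq (runs_inc _ 2 _) H) _ _; last by lia.
by rewrite /F; regs.
Qed.


(** The head of tape 1 stands just behind the bits, ready for the next one; the other tapes of [M0]
    are still blank. *)
Definition written (bs : seq bool) : tapes M0 :=
  fun i => if i == 1 then shift (size bs) (inp bs) else fun=> None.

Definition WriteBit (b : bool) : cmd M0 := Prim 1 (fun=> (Some (inl b), Some true)).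

Lemma exec_write_bit b i bs rho :
  hexec (WriteBit b) i (written bs) rho i (written (rcons bs b)) rho 1.
Proof.
exists 1 => //.
have := @ExPrim M0 1 (fun=> (Some (inl b), Some true)) (memory i (written bs) rho).
congr exec; apply: funext => j; rewrite /upd /memory.
case: (eqVneq j 1) => [->|j1] /=; last first.
  by case: eqP => // j0; case: leqP => //; rewrite /written (negbTE j1).
apply: funext => o; rewrite /written /= /fwrite /shift size_rcons /fmove.
have -> : (o + Posz (size bs).+1 = o + 1 + Posz (size bs))%R by lia.
case: eqP => [->|ne].
  rewrite add0r /input_cells (nth_map false) ?size_rcons // nth_rcons ltnn.
  by rewrite eqxx.
case E : (o + 1 + Posz (size bs))%R => [k|k] //=.
rewrite map_rcons nth_rcons size_map; case: ltnP => // le.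
by case: eqP => [?|_]; [lia | rewrite nth_default ?size_map].
Qed.

Definition MoveBack : cmd M0 := Prim 1 (fun s => (s, Some false)).
Definition at_pos (bs : seq bool) h : tapes M0 :=
  fun i => if i == 1 then shift h (inp bs) else fun=> None.

Lemma exec_move_back i bs h rho :
  hexec MoveBack i (at_pos bs h.+1) rho i (at_pos bs h) rho 1.
Proof.
exists 1 => //.
have := @ExPrim M0 1 (fun s => (s, Some false)) (memory i (at_pos bs h.+1) rho).
congr exec; apply: funext => j; rewrite /upd /memory.
case: (eqVneq j 1) => [->|j1] /=; last first.
  by case: eqP => // j0; case: leqP => //; rewrite /at_pos (negbTE j1).
by rewrite fwrite_id; exact: shiftP.
Qed.

(* Registers: 0 = n, 2 = Q, 3 = N, 4 = row, 5 = column, 6, 7 = loop counters. *)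
Definition base n Q N u v cu cv : nat -> nat :=
  upd (upd (upd (upd (upd (upd (upd (fun=> 0) 0 n) 2 Q) 3 N) 4 u) 5 v) 6 cu) 7 cv.

Lemma lookup_base n Q N u v cu cv x :
  (x, lookup (base n Q N u v cu cv) [:: 5; 4; 2; 0]) =
  scons v (scons u (scons Q (scons n (x, fun=> 0)))).
Proof. by congr pair; apply: funext => -[|[|[|[|i]]]]. Qed.

Section WriteGraph.
Variables (adjf : env -> nat) (cA : cmd M0) (gA : nat).
Variables (x : seq bool) (n Q N : nat).
Let val u v := adjf (scons v (scons u (scons Q (scons n (x, fun=> 0))))).
Let row u := mkseq (fun v => 0 < val u v) N.
Hypothesis HA : forall u v cu cv, u < N -> v < N -> runs (inp x) cA
  (base n Q N u v cu cv)
  (upd (base n Q N u v cu cv) 8 (val u v)) gA.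
Hypothesis val_le : forall u v, u < N -> v < N -> val u v <= gA.

Definition WriteEntry : cmd M0 := Seq cA
  (Seq (Ite (reg M0 8) (@nz M0) (WriteBit true) (WriteBit false))
  (Seq (Clear M0 8) (Inc M0 5))).

Definition WriteRow : cmd M0 :=
  Seq (Copy M0 3 7 8) (Seq (Loop 7 WriteEntry) (Seq (Clear M0 5) (Inc M0 4))).

Definition WriteGraph : cmd M0 := Seq (Copy M0 3 6 8) (Loop 6 WriteRow).

(** After writing, the head is [N * N] cells too far to the right; the nested loop moves it back, so
    that tape 1 becomes the initial tape of [M0]. *)
Definition Rewind : cmd M0 := Seq (Clear M0 4) (Seq (Copy M0 3 6 8)
  (Loop 6 (Seq (Copy M0 3 7 8) (Loop 7 MoveBack)))).

Definition bits u v := flatten (mkseq row u) ++ mkseq (fun w => 0 < val u w) v.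

Lemma exec_entry u v cu cv : u < N -> v < N ->
  hexec WriteEntry (inp x) (written (bits u v)) (base n Q N u v cu cv)
   (inp x) (written (bits u v.+1)) (base n Q N u v.+1 cu cv)
   (gA + (2 + (4 * gA + 1 + 3 + 1) + 1) + 1).
Proof.
move=> lu lv.
have Hb : bits u v.+1 = rcons (bits u v) (0 < val u v).
  by rewrite /bits mkseqS rcons_cat.
set rho1 := upd (base n Q N u v cu cv) 8 (val u v).
have H2 : hexec (Ite (reg M0 8) (@nz M0) (WriteBit true) (WriteBit false))
   (inp x) (written (bits u v)) rho1 (inp x) (written (bits u v.+1)) rho1 2.
  have [k l e] := exec_write_bit (0 < val u v) (inp x) (bits u v) rho1.
  exists k.+1 => //; apply: ExIte; rewrite nz_reg Hb /rho1 {1}/upd /=.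
  by case: ifP e.
have := hexec_seq (HA cu cv lu lv (written (bits u v))) (hexec_seq H2
  (hexec_seq (runs_clear _ 8 _ _) (runs_inc _ 5 _ _))).
move/hexec_eq; apply.
- by rewrite /rho1 /base; regs.
- have := val_le lu lv; rewrite /rho1 {1}/upd /=; lia.
Qed.

Lemma exec_row u cu : u < N ->
  hexec WriteRow (inp x) (written (bits u 0)) (base n Q N u 0 cu 0)
   (inp x) (written (bits u.+1 0)) (base n Q N u.+1 0 cu 0)
   (16 * N + 3 + ((5 * gA + 12) * N + 1 + (4 * N + 1 + 3 + 1) + 1) + 1).
Proof.
move=> lu.
have HL : hexec (Loop 7 WriteEntry) (inp x) (written (bits u 0))
   (base n Q N u 0 cu (N - 0)) (inp x) (written (bits u N)) (base n Q N u N cu (N - N))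
   ((5 * gA + 9 + 3) * N + 1).
  apply: (@hexec_loop M0 7 _ (fun=> inp x) (fun v => written (bits u v))
    (fun v => base n Q N u v cu (N - v))) => v lv.
    by rewrite /base /upd.
  have -> : upd (base n Q N u v cu (N - v)) 7 (N - v.+1) =
            base n Q N u v cu (N - v.+1) by rewrite /base; regs.
  apply: hexec_le (exec_entry _ _ lu lv) _; lia.
have Hb : bits u N = bits u.+1 0.
  by rewrite /bits mkseqS flatten_rcons cats0.
rewrite subn0 subnn Hb in HL.
have E1 : upd (base n Q N u 0 cu 0) 7 (base n Q N u 0 cu 0 7 + base n Q N u 0 cu 0 3)
  = base n Q N u 0 cu N by rewrite /base; regs.
have HC := @runs_copy M0 (inp x) 3 7 8 (base n Q N u 0 cu 0) erefl erefl erefl erefl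
  (written (bits u 0)).
rewrite E1 in HC.
have := hexec_seq HC (hexec_seq HL (hexec_seq (runs_clear _ 5 _ _) (runs_inc _ 4 _ _))).
move/hexec_eq; apply; first by rewrite /base; regs.
by rewrite /base /upd /=; lia.
Qed.

Lemma exec_write_graph : hexec WriteGraph (inp x) (fun _ _ => None)
  (base n Q N 0 0 0 0) (inp x) (written (flatten (mkseq row N))) (base n Q N N 0 0 0)
  (16 * N + 3 + ((16 * N + 3 + ((5 * gA + 12) * N + 1 + (4 * N + 1 + 3 + 1) + 1) + 4)
     * N + 1) + 1).
Proof.
have HL : hexec (Loop 6 WriteRow) (inp x) (written (bits 0 0))
   (base n Q N 0 0 (N - 0) 0) (inp x) (written (bits N 0)) (base n Q N N 0 (N - N) 0)
   ((16 * N + 3 + ((5 * gA + 12) * N + 1 + (4 * N + 1 + 3 + 1) + 1) + 1 + 3) * N + 1).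
  apply: (@hexec_loop M0 6 _ (fun=> inp x) (fun u => written (bits u 0))
    (fun u => base n Q N u 0 (N - u) 0)) => u lu.
    by rewrite /base /upd.
  have -> : upd (base n Q N u 0 (N - u) 0) 6 (N - u.+1) =
            base n Q N u 0 (N - u.+1) 0 by rewrite /base; regs.
  exact: exec_row.
have b0 : bits 0 0 = [::] by [].
have bN : bits N 0 = flatten (mkseq row N) by rewrite /bits cats0.
have w0 : written [::] = fun _ _ => None.
  apply: funext => i; rewrite /written; case: eqP => // _.
  by apply: funext => o; rewrite /shift /input_cells; case: (_ + _)%R => // k; rewrite nth_nil.
rewrite subn0 subnn b0 bN w0 in HL.
have E1 : upd (base n Q N 0 0 0 0) 6 (base n Q N 0 0 0 0 6 + base n Q N 0 0 0 0 3)
  = base n Q N 0 0 N 0 by rewrite /base; regs.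
have HC := @runs_copy M0 (inp x) 3 6 8 (base n Q N 0 0 0 0) erefl erefl erefl erefl
  (fun _ _ => None).
rewrite E1 in HC.
have := hexec_seq HC HL; move/hexec_le; apply.
by rewrite /base /upd /=; lia.
Qed.

Lemma exec_rewind bs : size bs = N * N -> hexec Rewind (inp x) (written bs)
  (base n Q N N 0 0 0) (inp x) (at_pos bs 0) (base n Q N 0 0 0 0)
  (4 * N + 1 + (16 * N + 3 + ((16 * N + 3 + (4 * N + 1) + 4) * N + 1) + 1) + 1).
Proof.
move=> sb.
have HL1 u : u < N -> hexec (Seq (Copy M0 3 7 8) (Loop 7 MoveBack)) (inp x)
    (at_pos bs ((N - u) * N)) (base n Q N 0 0 (N - u.+1) 0)
    (inp x) (at_pos bs ((N - u.+1) * N)) (base n Q N 0 0 (N - u.+1) 0)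
    (16 * N + 3 + ((1 + 3) * N + 1) + 1).
  move=> lu; have E1 : upd (base n Q N 0 0 (N - u.+1) 0) 7
      (base n Q N 0 0 (N - u.+1) 0 7 + base n Q N 0 0 (N - u.+1) 0 3)
    = base n Q N 0 0 (N - u.+1) N by rewrite /base; regs.
  have HC := @runs_copy M0 (inp x) 3 7 8 (base n Q N 0 0 (N - u.+1) 0) erefl erefl erefl erefl
    (at_pos bs ((N - u) * N)).
  rewrite E1 in HC.
  have HL : hexec (Loop 7 MoveBack) (inp x) (at_pos bs ((N - u) * N - 0))
     (base n Q N 0 0 (N - u.+1) (N - 0)) (inp x) (at_pos bs ((N - u) * N - N))
     (base n Q N 0 0 (N - u.+1) (N - N)) ((1 + 3) * N + 1).
    apply: (@hexec_loop M0 7 _ (fun=> inp x) (fun v => at_pos bs ((N - u) * N - v))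
      (fun v => base n Q N 0 0 (N - u.+1) (N - v))) => v lv.
      by rewrite /base /upd.
    have -> : upd (base n Q N 0 0 (N - u.+1) (N - v)) 7 (N - v.+1) =
              base n Q N 0 0 (N - u.+1) (N - v.+1) by rewrite /base; regs.
    have -> : (N - u) * N - v = ((N - u) * N - v.+1).+1.
      have L : N <= (N - u) * N by rewrite leq_pmull // subn_gt0.
      by move: lv L; move: ((N - u) * N) => k; lia.
    exact: exec_move_back.
  rewrite !subn0 subnn in HL.
  have E2 : (N - u) * N - N = (N - u.+1) * N.
    have -> : N - u = (N - u.+1).+1 by lia.
    by rewrite mulSn addKn.
  rewrite E2 in HL.
  exact: hexec_seq HC HL.
have HL : hexec (Loop 6 (Seq (Copy M0 3 7 8) (Loop 7 MoveBack))) (inp x)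
   (at_pos bs ((N - 0) * N)) (base n Q N 0 0 (N - 0) 0)
   (inp x) (at_pos bs ((N - N) * N)) (base n Q N 0 0 (N - N) 0)
   ((16 * N + 3 + ((1 + 3) * N + 1) + 1 + 3) * N + 1).
  apply: (@hexec_loop M0 6 _ (fun=> inp x) (fun u => at_pos bs ((N - u) * N))
    (fun u => base n Q N 0 0 (N - u) 0)) => u lu.
    by rewrite /base /upd.
  have -> : upd (base n Q N 0 0 (N - u) 0) 6 (N - u.+1) =
            base n Q N 0 0 (N - u.+1) 0 by rewrite /base; regs.
  exact: HL1.
rewrite subn0 subnn mul0n in HL.
have E0 : upd (base n Q N N 0 0 0) 4 0 = base n Q N 0 0 0 0 by rewrite /base; regs.
have H0 := runs_clear (inp x) 4 (base n Q N N 0 0 0) (written bs).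
rewrite E0 in H0.
have E1 : upd (base n Q N 0 0 0 0) 6 (base n Q N 0 0 0 0 6 + base n Q N 0 0 0 0 3)
  = base n Q N 0 0 N 0 by rewrite /base; regs.
have HC := @runs_copy M0 (inp x) 3 6 8 (base n Q N 0 0 0 0) erefl erefl erefl erefl
  (written bs).
rewrite E1 in HC.
have Hw : at_pos bs (N * N) = written bs.
  by apply: funext => i; rewrite /at_pos /written sb.
rewrite Hw in HL.
have := hexec_seq H0 (hexec_seq HC HL); move/hexec_le; apply.
by rewrite /base /upd /=; lia.
Qed.

Lemma size_bits_graph : size (flatten (mkseq row N)) = N * N.
Proof.
rewrite size_flatten /shape /mkseq -map_comp.
rewrite (eq_map (g := fun=> N)); last by move=> u /=; rewrite size_mkseq.
suff H k j : sumn [seq N | _ <- iota j k] = k * N by exact: H.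
by elim: k j => //= k IH j; rewrite IH mulSn.
Qed.

End WriteGraph.

(** [encode_set] has one bit per vertex, so the number of ones in the output is the cardinality of
    the set; it ends up in register 4. *)
Definition CountOutput : cmd M0 := While 1 is_bit
  (Seq (Ite 1 (@is_one M0) (Inc M0 4) (Skip M0)) (Prim 1 (fun s => (s, Some true)))).

Lemma exec_count_output i (G : tapes M0) (y : seq bool) n Q N :
  (forall j, j < size y -> G 1 (Posz j) = Some (inl (nth false y j))) ->
  (forall b, G 1 (Posz (size y)) <> Some (inl b)) ->
  exists G', hexec CountOutput i G (base n Q N 0 0 0 0)
    i G' (base n Q N (count id y) 0 0 0) (7 * size y + 1).
Proof.
move=> H1 H2.
pose FG h : tapes M0 := fun j => if j == 1 then shift h (G 1) else G j.
exists (FG (size y)).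
have {1}-> : G = FG 0.
  by apply: funext => j; rewrite /FG; case: eqP => [->|] //; rewrite shift0.
have := @hexec_while 1 is_bit
  (Seq (Ite 1 (@is_one M0) (Inc M0 4) (Skip M0)) (Prim 1 (fun s => (s, Some true))))
  (fun=> i) FG (fun j => base n Q N (count id (take j y)) 0 0 0) (size y) 6.
rewrite take0 take_size; apply.
- move=> j lt; rewrite /memory /= /FG /= /shift add0r H1 //.
- rewrite /memory /= /FG /= /shift add0r.
  by case E : (G 1 _) => [[b|a]|] //; case: (H2 b).
move=> j lt; set r0 := base n Q N (count id (take j y)) 0 0 0.
set r1 := base _ _ _ _ _ _ _.
have Hr : memory i (FG j) r0 1 0%R = Some (inl (nth false y j)).
  by rewrite /memory /= /FG /= /shift add0r H1.
have HI : hexec (Ite 1 (@is_one M0) (Inc M0 4) (Skip M0)) i (FG j) r0 i (FG j) r1 4.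
  have E : r1 = upd r0 4 (r0 4 + nth false y j).
    rewrite /r1 (take_nth false) // -cats1 count_cat /= addn0 /r0 /base; regs.
  have [k l e] : hexec (if nth false y j then Inc M0 4 else Skip M0) i (FG j) r0 i (FG j) r1 3.
    rewrite E; case: nth; first by rewrite addn1; exact: runs_inc.
    apply: hexec_eq (runs_skip _ _ _) _ _ => //; regs.
  exists k.+1 => //; apply: ExIte; rewrite Hr /is_one.
  by case: nth e.
have HM : hexec (Prim 1 (fun s : sym => (s, Some true))) i (FG j) r1 i (FG j.+1) r1 1.
  exists 1 => //.
  have := @ExPrim M0 1 (fun s => (s, Some true)) (memory i (FG j) r1).
  congr exec; apply: funext => t; rewrite /upd /memory.
  case: (eqVneq t 1) => [->|t1] /=; last first.
    by case: eqP => // t0; case: leqP => //; rewrite /FG (negbTE t1).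
  by rewrite fwrite_id; exact: shiftS.
exact: hexec_seq HI HM.
Qed.

End Decider.
End GraphPrograms.

(** * From an approximation algorithm to a decision procedure *)

Module GraphDecider.
Import TuringRuns ComputableFunctions Compilation GraphPrograms.
Import Order.TTheory GRing.Theory Num.Theory.

Definition env0 (x : seq bool) : env := (x, fun=> 0).

Lemma encode_graph_rows N (f : nat -> nat -> bool) :
  encode_graph (fun u v : 'I_N => f u v) =
  flatten (mkseq (fun u => mkseq (f u) N) N).
Proof.
rewrite /encode_graph /mkseq -val_enum_ord -map_comp; congr flatten.
by apply: eq_map => u /=; rewrite -map_comp; apply: eq_map.
Qed.

Lemma count_encode_set N (D : {set 'I_N}) : count id (encode_set D) = #|D|.
Proof.
rewrite /encode_set count_map -sum1_count -sum1_card big_mkcond [RHS]big_mkcond.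
by rewrite big_enum.
Qed.

(** The machine computes [2 ^ E] and the number of vertices, writes the adjacency matrix on the
    first tape of [M0], runs [M0], and evaluates [Tf] on the size of the returned set. Environments
    have the newest number in front: [2 ^ E] precedes the input length, and the two vertices or the
    size of the set precede both. *)
Theorem decider (M0 : tm) (Ef Nf adjf Tf : env -> nat) (E : nat -> nat)
    (L : language) cM kM :
  deterministic M0 -> vcomp Ef -> vcomp Nf -> vcomp adjf -> vcomp Tf ->
  (forall x, Ef (scons (size x) (env0 x)) = E (size x)) ->
  (forall x, let s := scons (2 ^ E (size x)) (scons (size x) (env0 x)) in
     let e := fun u v : 'I_(Nf s) => 0 < adjf (scons v (scons u s)) in
     exists D : {set 'I_(Nf s)},
      [/\ outputs M0 (encode_graph e) (encode_set D),
          halts_within M0 (encode_graph e) (cM * size (encode_graph e) ^ kM + cM) &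
          L x <-> 0 < Tf (scons #|D| s)]) ->
  exists D g, [/\ polyb g, deterministic D, forall x, L x <-> accepts D x &
    forall x, halts_within D x (g (size x + 2 ^ E (size x) + 2))].
Proof.
move=> detM0 kE kN kA kT EE H.
have [cE [gE [pE HE]]] := comp_compiled M0 kE (vs := [:: 0]) (fr := 1) erefl.
have [cN [gN [pN HN]]] := comp_compiled M0 kN (vs := [:: 2; 0]) (fr := 3) erefl.
have [cA [gA [pA HA]]] := comp_compiled M0 kA (vs := [:: 5; 4; 2; 0]) (fr := 8) erefl.
have [cT [gT [pT HT]]] := comp_compiled M0 kT (vs := [:: 4; 2; 0]) (fr := 5) erefl.
have [bN [kb pbN] HbN] := comp_bound kN.
have [bA pbA HbA] := comp_bound kA.
(* The successor makes [m ^ k] bound [m] as well as the number of vertices. *)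
pose k := kb.+1.
pose ga m := gA (m ^ k) + bA (m ^ k).
have pga : polyb ga by apply: polybD; exact: polyb_comp.
pose t1 m := 10 * m + 1 + (4 * m + 1) + 1.
pose t2 m := gE m + (3 + ((22 * m + 8) * m + 1) + 1) + 1.
pose t3 m := 16 * m ^ k + 3 + ((16 * m ^ k + 3 + ((5 * ga m + 12) * m ^ k + 1 +
  (4 * m ^ k + 1 + 3 + 1) + 1) + 4) * m ^ k + 1) + 1.
pose t4 m := 4 * m ^ k + 1 + (16 * m ^ k + 3 + ((16 * m ^ k + 3 + (4 * m ^ k + 1) + 4)
  * m ^ k + 1) + 1) + 1.
pose t5 m := cM * (m ^ k * m ^ k) ^ kM + cM + 2.
pose t6 m := 7 * m ^ k + 1.
pose t7 m := gT (m ^ k).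
pose g m := t1 m + (t2 m + (gN m + (t3 m + (t4 m + (t5 m + (t6 m + t7 m + 1)
  + 1) + 1) + 1) + 1) + 1) + 1.
have pg : polyb g.
  have p5 : polyb (fun m => (m ^ k * m ^ k) ^ kM).
    exists ((k + k) * kM) => m _; by rewrite -expnD -expnM.
  have p7 : polyb t7 by exact: polyb_comp.
  rewrite /g /t1 /t2 /t3 /t4 /t5 /t6; polyb; exact: polyb_comp.
pose prog := Seq (CountInput M0) (Seq (Seq cE (Seq (Inc M0 2) (Double M0))) (Seq cN
  (Seq (WriteGraph cA) (Seq (Rewind M0) (Seq (Exec M0) (Seq (CountOutput M0) cT)))))).
have main x : exists T' n, [/\ @exec M0 prog (@input_tapes M0 x) T' n,
    n <= g (size x + 2 ^ E (size x) + 2) & L x <-> @nz M0 (T' (reg M0 5) 0%R)].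
  set n := size x; set Q := 2 ^ E n; set m := n + Q + 2.
  have m1 : 1 < m by rewrite /m; lia.
  have [D [HO Hh HL]] := H x.
  set s := scons Q (scons n (env0 x)) in D HO Hh HL.
  set N := Nf s in D HO Hh HL; set e := (fun u v => _) in HO Hh.
  set inp := @input_cells (tm_aux M0) x.
  have i0 : @input_tapes M0 x = memory inp (fun _ _ => None) (fun=> 0).
    apply: funext => i; rewrite /input_tapes /memory; case: eqP => // _.
    case: leqP => // _; apply: funext => o; rewrite /cnt; case: ifP => //; lia.
  pose r1 := upd (fun=> 0) 0 n.
  have H1 := @exec_count_input M0 x (fun _ _ => None); rewrite -/n -/inp -/r1 in H1.
  have lE : (x, lookup r1 [:: 0]) = scons n (env0 x).
    by congr pair; apply: funext => -[|i].
  have H2 : hexec (Seq cE (Seq (Inc M0 2) (Double M0))) inp (fun _ _ => None) r1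
      inp (fun _ _ => None) (upd r1 2 Q) (t2 m).
    have C1 : runs inp cE r1 (upd r1 1 (E n)) (gE m).
      have := HE x r1 m m1; rewrite lE EE; apply.
      - by move=> r; rewrite /r1 /upd; case: eqP => //; lia.
      - by move=> r; rewrite inE => /eqP->; rewrite /r1 /upd /m /=; lia.
    have C2 := runs_seq C1 (runs_double inp n (E n)).
    apply: hexec_le (C2 _) _; rewrite /t2.
    have L1 : 2 ^ E n <= m by rewrite /m /Q; lia.
    have L2 : E n <= m.
      by apply: leq_trans _ L1; apply/ltnW/ltn_expl.
    have := leq_mul (leq_add (leq_mul (leqnn 22) L1) (leqnn 8)) L2; lia.
  have bm : m <= m ^ k.
    by rewrite -{1}(expn1 m) leq_exp2l.
  have sm i : s.2 i <= m.
    case: i => [|[|i]] //=; rewrite /m; lia.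
  have Nm : N <= m ^ k.
    apply: leq_trans (HbN _ _ m1 sm) (leq_trans (pbN _ m1) _).
    by rewrite leq_exp2l // /k.
  have H3 : hexec cN inp (fun _ _ => None) (upd r1 2 Q) inp (fun _ _ => None)
      (base n Q N 0 0 0 0) (gN m).
    have lN : (x, lookup (upd r1 2 Q) [:: 2; 0]) = s.
      by congr pair; apply: funext => -[|[|i]].
    have := HN x (upd r1 2 Q) m m1; rewrite lN -/N => HN'.
    apply: hexec_eq (HN' _ _ _) _ (leqnn _).
    - by move=> r; rewrite /r1 /upd; repeat case: eqP => ?; lia.
    - by move=> r; rewrite !inE => /orP[] /eqP->; rewrite /r1 /upd /m /=; lia.
    - by rewrite /r1 /base; regs.
  have mk1 : 1 < m ^ k by lia.
  pose val u v := adjf (scons v (scons u s)).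
  have Hval u v : u < N -> v < N -> val u v <= ga m.
    move=> lu lv; apply: leq_trans (HbA _ (m ^ k) mk1 _) (leq_addl _ _).
    by move=> [|[|i]] /=; [lia | lia | apply: leq_trans (sm i) bm].
  have HA' u v cu cv : u < N -> v < N -> runs inp cA (base n Q N u v cu cv)
      (upd (base n Q N u v cu cv) 8 (val u v)) (ga m).
    move=> lu lv; have := HA x (base n Q N u v cu cv) (m ^ k) mk1.
    rewrite lookup_base => HA''; apply: runs_eq (HA'' _ _) _ (leq_addr _ _) => //.
    - by move=> r; rewrite /base /upd; repeat case: eqP => ?; lia.
    - move=> r; rewrite !inE => /or4P[] /eqP->; rewrite /base /upd /=.
      + lia.
      + lia.
      + by apply: leq_trans bm; rewrite /m; lia.
      + by apply: leq_trans bm; rewrite /m; lia.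
  set enc := encode_graph e in HO Hh.
  have encE : flatten (mkseq (fun u => mkseq (fun v => 0 < val u v) N) N) = enc.
    by rewrite /enc /e -encode_graph_rows.
  have senc : size enc = N * N by rewrite -encE (size_bits_graph adjf x n Q N).
  have H4 := exec_write_graph HA' Hval.
  rewrite encE in H4.
  have H5 := exec_rewind M0 x n Q senc.
  have [nM [v [lM rM hM oM1 oM2]]] := outputs_vrun HO Hh.
  pose G' : tapes M0 := fun j => v.2 (inord j.-1).
  have H6 : hexec (Exec M0) inp (at_pos M0 enc 0) (base n Q N 0 0 0 0)
      inp G' (base n Q N 0 0 0 0) (t5 m).
    exists nM.+2.
      rewrite /t5 addn2 !ltnS; apply: leq_trans lM _; rewrite senc.
      have leX j : (N * N) ^ j <= (m ^ k * m ^ k) ^ j.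
        by case: j => // j; rewrite leq_exp2r // leq_mul.
      by rewrite leq_add2r leq_mul2l leX orbT.
    have := @ExExec M0 (memory inp (at_pos M0 enc 0) (base n Q N 0 0 0 0)) v nM.
    have -> : (fun i : 'I_(tm_tapes M0).+1 =>
       memory inp (at_pos M0 enc 0) (base n Q N 0 0 0 0) i.+1) = (vinitial M0 enc).2.
      apply: funext => i; rewrite /memory /= ltn_ord /at_pos eqSS /=.
      by rewrite -(inj_eq val_inj) /=; case: eqP => // _; rewrite shift0.
    move=> /(_ rM hM); congr exec.
    apply: funext => j; rewrite /memory /G'; case: j => //= j.
    by case: (j < _).
  have sD : size (encode_set D) = N by rewrite /encode_set size_map size_enum_ord.
  have G1 : G' 1 = v.2 ord0 by rewrite /G' /=; congr (v.2 _); apply: val_inj; rewrite /= inordK.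
  have [|| G'' H7] := @exec_count_output M0 inp G' (encode_set D) n Q N.
  - by rewrite G1.
  - by rewrite G1.
  rewrite count_encode_set sD in H7.
  set dD := #|D| in H7 HL.
  have dN : dD <= N by rewrite /dD -[X in _ <= X](card_ord N) max_card.
  have H8 : hexec cT inp G'' (base n Q N dD 0 0 0) inp G''
      (upd (base n Q N dD 0 0 0) 5 (Tf (scons dD s))) (t7 m).
    have lT : (x, lookup (base n Q N dD 0 0 0) [:: 4; 2; 0]) = scons dD s.
      by congr pair; apply: funext => -[|[|[|i]]].
    have := HT x (base n Q N dD 0 0 0) (m ^ k) mk1; rewrite lT; apply.
    - by move=> r; rewrite /base /upd; repeat case: eqP => ?; lia.
    - move=> r; rewrite !inE => /or3P[] /eqP->; rewrite /base /upd /=.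
      + lia.
      + by apply: leq_trans bm; rewrite /m; lia.
      + by apply: leq_trans bm; rewrite /m; lia.
  have [nn le_n ex] := hexec_seq H1 (hexec_seq H2 (hexec_seq H3 (hexec_seq H4
    (hexec_seq H5 (hexec_seq H6 (hexec_seq H7 H8)))))).
  exists (memory inp G'' (upd (base n Q N dD 0 0 0) 5 (Tf (scons dD s)))), nn.
  split; first by rewrite i0.
  - apply: leq_trans le_n _; rewrite /g -/m.
    have L1 : n <= m by rewrite /m; lia.
    have P1 : 10 * n + 1 + (4 * n + 1) + 1 <= t1 m by rewrite /t1; lia.
    by do ![apply: leq_add => // | apply: leq_mul => //].
  - by rewrite nz_reg /upd eqxx.
have [Dm [d1 d2 d3]] := exec_decides detM0 (T := fun n => g (n + 2 ^ E n + 2)) main.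
exists Dm, (fun m => g m + 3); split=> //.
by apply: polybD => //; exact: polybC.
Qed.
End GraphDecider.

(** * The energy of one round of a projection game *)

Module EnergyBound.
Import Order.TTheory GRing.Theory Num.Theory.

(** Numbers serve as tuples whose entries are the base-[b] digits, lowest first. *)
Definition digit b j x := iter j (fun y => y %/ b) x %% b.

Lemma digit0 b x : digit b 0 x = x %% b. Proof. by []. Qed.

Lemma digitS b j x : digit b j.+1 x = digit b j (x %/ b).
Proof. by rewrite /digit iterSr. Qed.

Local Open Scope ring_scope.

Lemma sum_ord_mul (R : nmodType) n m (F : nat -> R) :
  \sum_(x < n * m) F x = \sum_(b < m) \sum_(a < n) F (b * n + a)%N.
Proof.
elim: m => [|m IH]; first by rewrite muln0 !big_ord0.
rewrite big_ord_recr /= -IH mulnS addnC big_split_ord /=; congr (_ + _).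
by apply: eq_bigr => a _; rewrite mulnC.
Qed.

Section CauchySchwarz.
Variable R : realFieldType.

Lemma sqr_sum_le (I : finType) (P : pred I) (F : I -> R) :
  (\sum_(i | P i) F i) ^+ 2 <= #|P|%:R * \sum_(i | P i) F i ^+ 2.
Proof.
rewrite expr2 mulr_suml.
apply: (@le_trans _ _ (\sum_(i | P i) \sum_(j | P j) (F i ^+ 2 + F j ^+ 2) / 2)).
  apply: ler_sum => i _; rewrite mulr_sumr; apply: ler_sum => j _.
  by have := sqr_ge0 (F i - F j); lra.
rewrite le_eqVlt; apply/orP; left; apply/eqP.
transitivity (\sum_(i | P i) (#|P|%:R * F i ^+ 2 + \sum_(j | P j) F j ^+ 2) / 2).
  apply: eq_bigr => i _; rewrite -mulr_suml big_split /= sumr_const.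
  by rewrite mulr_natl.
rewrite -mulr_suml big_split /= sumr_const -mulr_sumr -mulr_natl.
by set a := #|P|%:R; set b := \sum_(i | _) _; field.
Qed.

Lemma sum_sqr_le (I : finType) (F : I -> R) : (forall i, 0 <= F i) ->
  \sum_i F i ^+ 2 <= (\sum_i F i) ^+ 2.
Proof.
move=> F0; rewrite expr2 mulr_suml; apply: ler_sum => i _.
rewrite expr2; apply: ler_wpM2l => //; rewrite (bigD1 i) //= lerDl.
by apply: sumr_ge0.
Qed.

End CauchySchwarz.

Section Game.
Variables (R : realFieldType) (V S E U A : finType).
Variables (pos : V -> E -> U) (ans : V -> S -> E -> A).
Variable eps : R.
Hypothesis V0 : (0 < #|V|)%N.
Hypothesis E0 : (0 < #|E|)%N.
Hypothesis S0 : S.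
Hypothesis A0 : A.
Hypothesis eps01 : 0 < eps <= 1.
Hypothesis sound : forall (Pi : U -> A) (bf : V -> S),
  (#|[set ve : V * E | ans ve.1 (bf ve.1) ve.2 == Pi (pos ve.1 ve.2)]|)%:R
   <= (1 - eps) * (#|V|%:R * #|E|%:R) :> R.

Let nv : R := #|V|%:R.
Let ne : R := #|E|%:R.
Let nv0 : 0 < nv. Proof. by rewrite ltr0n. Qed.
Let ne0 : 0 < ne. Proof. by rewrite ltr0n. Qed.

Definition deg u : R := \sum_v \sum_e (pos v e == u)%:R.

Definition hit u a v b : R := \sum_e ((pos v e == u) && (ans v b e == a))%:R.

Definition tot (h : V -> S -> R) u a : R := \sum_v \sum_b hit u a v b * h v b.

(** Let [u] be the position of a uniformly random pair [(v, e)]. The energy is the mean over [u] of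
    the squared norm of the answer weights seen at [u]. For normalized [h] it is the probability
    that two independent pairs meeting at the same [u] receive equal answers. *)
Definition energy (h : V -> S -> R) : R :=
  \sum_u \sum_a deg u / (nv * ne) * (tot h u a / deg u) ^+ 2.

Lemma deg_ge0 u : 0 <= deg u.
Proof. by apply: sumr_ge0 => v _; apply: sumr_ge0. Qed.

Lemma hit_ge0 u a v b : 0 <= hit u a v b.
Proof. by apply: sumr_ge0. Qed.

Lemma sum_hit u v b : \sum_a hit u a v b = \sum_e (pos v e == u)%:R.
Proof.
rewrite exchange_big; apply: eq_bigr => e _ /=.
rewrite (bigD1 (ans v b e)) //= eqxx andbT big1 ?addr0 // => a ne_a.
by rewrite [_ == a]eq_sym (negbTE ne_a) andbF.
Qed.

Lemma sum_tot (h : V -> S -> R) u :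
  \sum_a tot h u a = \sum_v \sum_e (pos v e == u)%:R * \sum_b h v b.
Proof.
rewrite exchange_big; apply: eq_bigr => v _ /=.
rewrite exchange_big -mulr_suml mulr_sumr; apply: eq_bigr => b _ /=.
by rewrite -mulr_suml sum_hit.
Qed.

Lemma tot_le (h h' : V -> S -> R) u a : (forall v b, `|h v b| <= h' v b) ->
  `|tot h u a| <= tot h' u a.
Proof.
move=> H; apply: le_trans (ler_norm_sum _ _ _) _; apply: ler_sum => v _.
apply: le_trans (ler_norm_sum _ _ _) _; apply: ler_sum => b _.
by rewrite normrM ger0_norm ?hit_ge0 // ler_wpM2l ?hit_ge0.
Qed.

Lemma sum_pos (F : V -> R) : \sum_u \sum_v \sum_e (pos v e == u)%:R * F v =
  ne * \sum_v F v.
Proof.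
rewrite exchange_big mulr_sumr; apply: eq_bigr => v _ /=.
rewrite exchange_big /=.
have -> : ne * F v = \sum_(e : E) F v by rewrite sumr_const mulr_natl.
apply: eq_bigr => e _; rewrite (bigD1 (pos v e)) //= eqxx mul1r big1 ?addr0 //.
by move=> u ne_u; rewrite [_ == u]eq_sym (negbTE ne_u) mul0r.
Qed.

Lemma degE u : deg u = #|[pred ve : V * E | pos ve.1 ve.2 == u]|%:R.
Proof.
rewrite /deg pair_bigA /= -sum1_card natr_sum [RHS]big_mkcond /=.
by apply: eq_bigr => ve _; rewrite inE; case: (_ == _).
Qed.

Lemma sqr_tot_le (h : V -> S -> R) u : (forall v b, 0 <= h v b) ->
  deg u * \sum_a (tot h u a / deg u) ^+ 2 <=
  \sum_v \sum_e (pos v e == u)%:R * (\sum_b h v b) ^+ 2.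
Proof.
move=> h0; have T0 a : 0 <= tot h u a.
  apply: sumr_ge0 => v _; apply: sumr_ge0 => b _; by rewrite mulr_ge0 ?hit_ge0.
case: (eqVneq (deg u) 0) => [->|d0].
  rewrite mul0r; apply: sumr_ge0 => v _; apply: sumr_ge0 => e _.
  by rewrite mulr_ge0 ?sqr_ge0.
have dp : 0 < deg u by rewrite lt_def d0 deg_ge0.
under eq_bigr do rewrite exprMn; rewrite -mulr_suml.
have L1 : \sum_a tot h u a ^+ 2 <= (\sum_a tot h u a) ^+ 2 by exact: sum_sqr_le.
have L2 : (\sum_a tot h u a) ^+ 2 <=
   deg u * \sum_v \sum_e (pos v e == u)%:R * (\sum_b h v b) ^+ 2.
  rewrite sum_tot degE !pair_bigA /=.
  have cv (F : V -> R) : \sum_(p : V * E) (pos p.1 p.2 == u)%:R * F p.1 =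
      \sum_(p | [pred ve : V * E | pos ve.1 ve.2 == u] p) F p.1.
    rewrite [RHS]big_mkcond /=; apply: eq_bigr => p _.
    by case: (_ == _); rewrite ?mul1r ?mul0r.
  rewrite (cv (fun v => \sum_b h v b)) (cv (fun v => (\sum_b h v b) ^+ 2)).
  exact: sqr_sum_le.
move: L1 L2; set s := \sum_a tot h u a ^+ 2 => L1 L2.
have -> : deg u * (s * (deg u)^-1 ^+ 2) = s / deg u by field.
by rewrite ler_pdivrMr // mulrC (le_trans L1).
Qed.

(** At each position the sum of squares over answers is at most the square of the total mass, and
    Cauchy-Schwarz over the incident pairs passes from the squared mean to the mean square. *)
Lemma energy_le (h : V -> S -> R) :
  energy h <= nv^-1 * \sum_v (\sum_b `|h v b|) ^+ 2.
Proof.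
apply: (@le_trans _ _ (energy (fun v b => `|h v b|))).
  apply: ler_sum => u _; apply: ler_sum => a _; apply: ler_wpM2l.
    by rewrite divr_ge0 ?deg_ge0 // mulr_ge0 ?ltW.
  rewrite -[(_ / _) ^+ 2]real_normK ?num_real // -[X in _ <= X]real_normK ?num_real //.
  apply: lerXn2r; rewrite ?nnegrE ?normr_ge0 // !normrM ler_wpM2r ?normr_ge0 //.
  by apply: le_trans (tot_le _ _ _) (ler_norm _).
apply: (@le_trans _ _ (\sum_u (nv * ne)^-1 *
   \sum_v \sum_e (pos v e == u)%:R * (\sum_b `|h v b|) ^+ 2)).
  apply: ler_sum => u _; rewrite -mulr_sumr [deg u / _]mulrC -mulrA.
  apply: ler_wpM2l; first by rewrite invr_ge0 mulr_ge0 ?ltW.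
  by apply: sqr_tot_le.
rewrite -mulr_sumr sum_pos mulrA.
have -> : (nv * ne)^-1 * ne = nv^-1 by field; rewrite ?gt_eqF.
by [].
Qed.

(** The squared norm of a distribution is at most its largest entry. The most likely answer [Pi u]
    at each position and the best label [bf v] against these answers form a deterministic strategy,
    to which soundness applies. *)
Lemma energy_normalized (h : V -> S -> R) : (forall v b, 0 <= h v b) ->
  (forall v, \sum_b h v b = 1) -> energy h <= 1 - eps.
Proof.
move=> h0 h1; have T0 u a : 0 <= tot h u a.
  apply: sumr_ge0 => v _; apply: sumr_ge0 => b _; by rewrite mulr_ge0 ?hit_ge0.
pose Pi u := [arg max_(a > A0) tot h u a]%O.
have PiP u a : tot h u a <= tot h u (Pi u).
  by rewrite /Pi; case: Order.TotalTheory.arg_maxP => // c _; exact.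
have sT u : \sum_a tot h u a = deg u.
  rewrite sum_tot; apply: eq_bigr => v _; apply: eq_bigr => e _.
  by rewrite h1 mulr1.
pose bf v := [arg max_(b > S0) \sum_e (ans v b e == Pi (pos v e))%:R : R]%O.
have bfP v b : \sum_e (ans v b e == Pi (pos v e))%:R <=
    \sum_e (ans v (bf v) e == Pi (pos v e))%:R :> R.
  by rewrite /bf; case: Order.TotalTheory.arg_maxP => // c _; exact.
have nn0 : 0 <= (nv * ne)^-1 by rewrite invr_ge0 mulr_ge0 ?ltW.
apply: (@le_trans _ _ (\sum_u (nv * ne)^-1 * tot h u (Pi u))).
  apply: ler_sum => u _.
  case: (eqVneq (deg u) 0) => [d0|d0].
    rewrite big1; first by rewrite mulr_ge0.
    by move=> a _; rewrite d0 !mul0r.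
  have dp : 0 < deg u by rewrite lt_def d0 deg_ge0.
  apply: (@le_trans _ _ (\sum_a (nv * ne)^-1 * (tot h u (Pi u) / deg u) * tot h u a)).
    apply: ler_sum => a _.
    have -> : deg u / (nv * ne) * (tot h u a / deg u) ^+ 2 =
      (nv * ne)^-1 * (tot h u a / deg u) * tot h u a.
      by field; rewrite d0 !gt_eqF.
    apply: ler_wpM2r => //; apply: ler_wpM2l => //.
    by rewrite ler_wpM2r ?invr_ge0 ?deg_ge0.
  by rewrite -mulr_sumr sT -mulrA divfK.
rewrite -mulr_sumr mulrC ler_pdivrMr ?mulr_gt0 //.
apply: le_trans (sound Pi bf).
have -> : \sum_u tot h u (Pi u) =
    \sum_v \sum_b h v b * \sum_e (ans v b e == Pi (pos v e))%:R.
  rewrite exchange_big; apply: eq_bigr => v _ /=.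
  rewrite exchange_big; apply: eq_bigr => b _ /=.
  rewrite -mulr_suml mulrC; congr (_ * _).
  rewrite exchange_big; apply: eq_bigr => e _ /=.
  rewrite (bigD1 (pos v e)) //= eqxx /= big1 ?addr0 // => u ne_u.
  by rewrite [_ == u]eq_sym (negbTE ne_u).
apply: (@le_trans _ _ (\sum_v \sum_e (ans v (bf v) e == Pi (pos v e))%:R)).
  apply: ler_sum => v _; set y := (X in _ <= X).
  have -> : y = \sum_b h v b * y by rewrite -mulr_suml h1 mul1r.
  by apply: ler_sum => b _; apply: ler_wpM2l => //; exact: bfP.
rewrite pair_bigA /= -sum1_card natr_sum [X in _ <= X]big_mkcond /=.
by apply: ler_sum => p _; rewrite inE; case: (_ == _).
Qed.

(** Young's inequality for a quadratic form: term by term the two sides differ by a nonnegative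
    multiple of [(t * x - y) ^+ 2 / t]. *)
Lemma energyD (h1 h2 : V -> S -> R) t : 0 < t ->
  energy (fun v b => h1 v b + h2 v b) <=
  (1 + t) * energy h1 + (1 + t^-1) * energy h2.
Proof.
move=> t0; rewrite /energy !mulr_sumr -big_split; apply: ler_sum => u _ /=.
rewrite !mulr_sumr -big_split; apply: ler_sum => a _ /=.
have -> : tot (fun v b => h1 v b + h2 v b) u a = tot h1 u a + tot h2 u a.
  rewrite /tot -big_split; apply: eq_bigr => v _ /=.
  by rewrite -big_split; apply: eq_bigr => b _ /=; rewrite mulrDr.
set c := deg u / (nv * ne); rewrite mulrDl.
have c0 : 0 <= c by rewrite divr_ge0 ?deg_ge0 // mulr_ge0 ?ltW.
set x := tot h1 u a / _; set y := tot h2 u a / _.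
have -> : (1 + t) * (c * x ^+ 2) + (1 + t^-1) * (c * y ^+ 2) =
  c * ((1 + t) * x ^+ 2 + (1 + t^-1) * y ^+ 2) by ring.
apply: ler_wpM2l => //; rewrite -subr_ge0.
have -> : (1 + t) * x ^+ 2 + (1 + t^-1) * y ^+ 2 - (x + y) ^+ 2 =
   (t * x - y) ^+ 2 / t by field; rewrite gt_eqF.
by rewrite divr_ge0 ?sqr_ge0 ?ltW.
Qed.

Lemma energyZ (h : V -> S -> R) c :
  energy (fun v b => c * h v b) = c ^+ 2 * energy h.
Proof.
rewrite /energy mulr_sumr; apply: eq_bigr => u _; rewrite mulr_sumr.
apply: eq_bigr => a _.
have -> : tot (fun v b => c * h v b) u a = c * tot h u a.
  rewrite /tot mulr_sumr; apply: eq_bigr => v _; rewrite mulr_sumr.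
  by apply: eq_bigr => b _; ring.
ring.
Qed.

(* Adding the anchor term makes the quadratic form contract by a factor
   1 - eps^2/16 although [h] is not normalized: a weight [w] that is far from
   constant is penalized by the anchor, a nearly constant one by soundness. *)
Lemma anchored_energy (h : V -> S -> R) : (forall v b, 0 <= h v b) ->
  energy h / 2 + (nv^-1 * \sum_v \sum_b h v b) ^+ 2 / 2 <=
  (1 - eps ^+ 2 / 16) * (nv^-1 * \sum_v (\sum_b h v b) ^+ 2).
Proof.
move=> h0; case/andP: eps01 => e0 e1.
pose w v := \sum_b h v b.
(* The conditional distribution on labels; where the weight is zero it is set to the point mass at
   [S0]. *)
pose hh v b : R := if w v == 0 then (b == S0)%:R else h v b / w v.
have w0 v : 0 <= w v by apply: sumr_ge0.
have hh0 v b : 0 <= hh v b.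
  by rewrite /hh; case: ifP => // _; rewrite divr_ge0.
have hh1 v : \sum_b hh v b = 1.
  rewrite /hh; case: (eqVneq (w v) 0) => w1; last by rewrite -mulr_suml mulfV.
  by rewrite (bigD1 S0) //= eqxx big1 ?addr0 // => b /negbTE ->.
have hE v b : h v b = w v * hh v b.
  rewrite /hh; case: ifP => [/eqP w1|/negbT w1]; last by rewrite mulrC divfK.
  by rewrite w1 mul0r; apply: (psumr_eq0P _ w1).
set a := nv^-1 * \sum_v w v; set Sq := nv^-1 * \sum_v w v ^+ 2.
have Q1 : energy h <= Sq.
  apply: le_trans (energy_le h) _; rewrite le_eqVlt; apply/orP; left; apply/eqP.
  congr (_ * _); apply: eq_bigr => v _; congr (_ ^+ 2); apply: eq_bigr => b _.
  by rewrite ger0_norm.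
pose t := eps / 2; have t0 : 0 < t by rewrite divr_gt0.
(* The weight is split into its mean [a] and the deviation from it. The mean part is a multiple of a
   normalized function, so soundness applies; the other part is bounded by the variance
   [Sq - a ^+ 2]. *)
have Q2 : energy h <= (1 + t) * (a ^+ 2 * (1 - eps)) + (1 + t^-1) * (Sq - a ^+ 2).
  have -> : energy h = energy (fun v b => a * hh v b + (w v - a) * hh v b).
    congr energy; apply: funext => v; apply: funext => b.
    by rewrite hE -mulrDl addrC subrK.
  apply: le_trans (energyD _ _ t0) _; apply: lerD; apply: ler_wpM2l.
  - by rewrite addr_ge0 // ltW.
  - by rewrite energyZ ler_wpM2l ?sqr_ge0 // energy_normalized.
  - by rewrite addr_ge0 // invr_ge0 ltW.
  apply: le_trans (energy_le _) _.
  have -> : Sq - a ^+ 2 = nv^-1 * \sum_v (w v - a) ^+ 2.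
    have -> : \sum_v (w v - a) ^+ 2 = \sum_v w v ^+ 2 - 2 * a * \sum_v w v + nv * a ^+ 2.
      have -> : nv * a ^+ 2 = \sum_(v : V) a ^+ 2 by rewrite sumr_const mulr_natl.
      rewrite mulr_sumr -sumrB -big_split.
      by apply: eq_bigr => v _ /=; ring.
    have sw : \sum_v w v = nv * a by rewrite /a mulrA mulfV ?mul1r ?gt_eqF.
    by rewrite sw /Sq; field; rewrite gt_eqF.
  rewrite le_eqVlt; apply/orP; left; apply/eqP.
  congr (_ * _); apply: eq_bigr => v _.
  under eq_bigr do rewrite normrM (ger0_norm (hh0 _ _)).
  by rewrite -mulr_sumr hh1 mulr1 real_normK ?num_real.
have a2 : a ^+ 2 <= Sq.
  rewrite /a /Sq exprMn.
  have := sqr_sum_le (fun=> true) w.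
  have -> : #|(fun=> true) : pred V|%:R = nv by rewrite /nv; congr (_%:R); exact: eq_card.
  move=> L; apply: (@le_trans _ _ (nv^-1 ^+ 2 * (nv * \sum_v w v ^+ 2))).
    by apply: ler_wpM2l; rewrite ?sqr_ge0.
  by rewrite le_eqVlt; apply/orP; left; apply/eqP; field; rewrite gt_eqF.
have Q2' : eps * energy h <=
   eps * ((1 + t) * (1 - eps)) * a ^+ 2 + (eps + 2) * (Sq - a ^+ 2).
  apply: le_trans (ler_wpM2l (ltW e0) Q2) _.
  rewrite le_eqVlt; apply/orP; left; apply/eqP.
  by rewrite /t; field; rewrite gt_eqF.
set x := a ^+ 2 in a2 Q2' *; set q := energy h in Q1 Q2' *.
have x0 : 0 <= x by rewrite sqr_ge0.
(* Of [4 * q], the share [(4 - eps) * q] is bounded by [Q1] and [eps * q] by [Q2']. The slack, a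
   multiple of the variance plus [eps ^+ 2 * x / 2], covers the required loss. *)
have M1 : (4 - eps) * q <= (4 - eps) * Sq by apply: ler_wpM2l => //; lra.
have M2 : 0 <= eps ^+ 3 * x by rewrite mulr_ge0 // exprn_ge0 // ltW.
have M3 : eps ^+ 2 * (Sq - x) <= Sq - x.
  by rewrite ler_piMl ?subr_ge0 // expr_le1 // ltW.
have M4 : eps * ((1 + t) * (1 - eps)) * x = eps * x - eps ^+ 2 * x / 2 - eps ^+ 3 * x / 2.
  by rewrite /t; field.
rewrite M4 in Q2'.
have -> : q / 2 + x / 2 = (4 * q + 4 * x) / 8 by field.
have -> : (1 - eps ^+ 2 / 16) * Sq = Sq - (eps ^+ 2 * (Sq - x) + eps ^+ 2 * x) / 16.
  by field.
have E1 : (4 - eps) * q + eps * q = 4 * q by ring.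
have E2 : (4 - eps) * Sq = 4 * Sq - eps * Sq by ring.
have E3 : (eps + 2) * (Sq - x) = eps * Sq - eps * x + 2 * Sq - 2 * x by ring.
rewrite E3 in Q2'; rewrite E2 in M1.
move: (eps * Sq) (eps * x) (eps * q) ((4 - eps) * q) (eps ^+ 2 * x) (eps ^+ 3 * x)
 (eps ^+ 2 * (Sq - x)) Q2' M1 M2 M3 E1 => *; lra.
Qed.

End Game.
End EnergyBound.

(** * Tensor powers of the quadratic form and the bound for coverings by label lists *)

Module ParallelGame.
Import EnergyBound.
Import Order.TTheory GRing.Theory Num.Theory.
Local Open Scope ring_scope.

(** The arithmetic-geometric mean inequality for three numbers with product 1. It serves to bound a
    reciprocal from below by a linear expression. *)
Lemma agm3 (R : realFieldType) (p q : R) : 0 < p -> 0 < q ->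
  3 <= (p * q)^-1 + p + q.
Proof.
move=> p0 q0; set t := p * q; have t0 : 0 < t by rewrite mulr_gt0.
rewrite leNgt; apply/negP => H.
have s4 : 4 * t <= (p + q) ^+ 2 by have := sqr_ge0 (p - q); rewrite /t; lra.
have tv : t * t^-1 = 1 by rewrite mulfV ?gt_eqF.
have L : (p + q) * t < 3 * t - 1.
  by rewrite -tv; have := ltr_pM2r t0 ((p + q)) (3 - t^-1); nra.
have pq0 : 0 < (p + q) * t by rewrite mulr_gt0 // addr_gt0.
have L2 : ((p + q) * t) ^+ 2 < (3 * t - 1) ^+ 2 by rewrite ltrXn2r // ?nnegrE; lra.
have L3 : 4 * t * t ^+ 2 <= ((p + q) * t) ^+ 2.
  by rewrite [((p + q) * t) ^+ 2]exprMn; apply: ler_wpM2r; rewrite ?sqr_ge0.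
have L4 : 0 <= (t - 1) ^+ 2 * (4 * t - 1).
  by rewrite mulr_ge0 ?sqr_ge0 //; lra.
have E : (t - 1) ^+ 2 * (4 * t - 1) = 4 * t * t ^+ 2 - (3 * t - 1) ^+ 2 by ring.
lra.
Qed.

Section Tensor.
Variables (R : realFieldType) (I : finType) (nv ns : nat).
Variables (c : I -> R) (g : I -> nat -> nat -> R) (lam : R).
Variables (kap : nat -> nat -> R) (R1 : nat -> nat -> nat -> nat -> bool).
Hypothesis nv0 : (0 < nv)%N.
Hypothesis ns0 : (0 < ns)%N.
Hypothesis lam0 : 0 <= lam.
Hypothesis c0 : forall i, 0 <= c i.
Hypothesis g0 : forall i v b, 0 <= g i v b.
Hypothesis base : forall h : nat -> nat -> R, (forall v b, 0 <= h v b) ->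
  \sum_i c i * (\sum_(v < nv) \sum_(b < ns) g i v b * h v b) ^+ 2 <=
  lam * (nv%:R^-1 * \sum_(v < nv) (\sum_(b < ns) h v b) ^+ 2).

(** The Gram matrix of the form of one round. The weight [kap] on pairs of vertices, symmetric and
    with uniform marginals, is a lower bound for it on consistent labels. *)
Definition ker v b v' b' : R := \sum_i c i * g i v b * g i v' b'.

Hypothesis kap0 : forall v v', 0 <= kap v v'.
Hypothesis kapC : forall v v', kap v v' = kap v' v.
Hypothesis kap1 : forall v, (v < nv)%N -> \sum_(v' < nv) kap v v' = nv%:R^-1.
Hypothesis kap_ker : forall v b v' b', (v < nv)%N -> (v' < nv)%N ->
  (b < ns)%N -> (b' < ns)%N -> R1 v b v' b' -> kap v v' <= ker v b v' b'.

(** The [k]-fold tensor power, acting on the digits of the numbers that encode [k]-tuples. *)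
Fixpoint kerk k x y x' y' : R :=
  if k is k'.+1 then ker (x %% nv) (y %% ns) (x' %% nv) (y' %% ns) *
    kerk k' (x %/ nv)%N (y %/ ns)%N (x' %/ nv)%N (y' %/ ns)%N
  else 1.

Fixpoint kapk k x x' : R :=
  if k is k'.+1 then kap (x %% nv) (x' %% nv) * kapk k' (x %/ nv)%N (x' %/ nv)%N
  else 1.

Fixpoint Rk k x y x' y' : bool :=
  if k is k'.+1 then R1 (x %% nv) (y %% ns) (x' %% nv) (y' %% ns) &&
    Rk k' (x %/ nv)%N (y %/ ns)%N (x' %/ nv)%N (y' %/ ns)%N
  else true.

Lemma ker_ge0 v b v' b' : 0 <= ker v b v' b'.
Proof. by apply: sumr_ge0 => i _; rewrite !mulr_ge0. Qed.

Lemma kerk_ge0 k x y x' y' : 0 <= kerk k x y x' y'.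
Proof. by elim: k x y x' y' => //= k IH *; rewrite mulr_ge0 ?ker_ge0. Qed.

Lemma kapk_ge0 k x x' : 0 <= kapk k x x'.
Proof. by elim: k x x' => //= k IH *; rewrite mulr_ge0. Qed.

Lemma kapkC k x x' : kapk k x x' = kapk k x' x.
Proof. by elim: k x x' => //= k IH x x'; rewrite kapC IH. Qed.

Lemma kapk_kerk k x y x' y' : Rk k x y x' y' -> kapk k x x' <= kerk k x y x' y'.
Proof.
elim: k x y x' y' => //= k IH x y x' y' /andP[H1 H2].
by apply: ler_pM; rewrite ?kap0 ?kapk_ge0 ?kap_ker ?ltn_pmod ?IH.
Qed.

Lemma divmod_dec n b a : (a < n)%N -> ((b * n + a) %/ n = b)%N * ((b * n + a) %% n = a)%N.
Proof.
move=> lt; rewrite divnMDl ?divn_small ?addn0 ?modnMDl ?modn_small //.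
exact: leq_ltn_trans lt.
Qed.

Lemma kapk1 k x : (x < nv ^ k)%N -> \sum_(x' < nv ^ k) kapk k x x' = (nv ^ k)%:R^-1.
Proof.
elim: k x => [|k IH] x; first by rewrite expn0 big_ord_recl big_ord0 /= addr0 invr1.
rewrite expnS => lt; rewrite (sum_ord_mul _ _ (kapk k.+1 x)) /=.
transitivity (\sum_(b < nv ^ k) nv%:R^-1 * kapk k (x %/ nv)%N b).
  apply: eq_bigr => b _; rewrite -(kap1 (ltn_pmod x nv0)) mulr_suml.
  by apply: eq_bigr => a _; rewrite !divmod_dec.
rewrite -mulr_sumr IH; first by rewrite natrM invfM.
by rewrite ltn_divLR // mulnC.
Qed.

Lemma dsum X Y (F : nat -> nat -> R) :
  \sum_(x < nv * X) \sum_(y < ns * Y) F x y =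
  \sum_(z : 'I_X * 'I_Y) \sum_(p : 'I_nv * 'I_ns)
    F (z.1 * nv + p.1)%N (z.2 * ns + p.2)%N.
Proof.
rewrite (sum_ord_mul _ _ (fun x => \sum_(y < _) F x y)) /=.
transitivity (\sum_(x < X) \sum_(a < nv) \sum_(y < Y) \sum_(b < ns)
   F (x * nv + a)%N (y * ns + b)%N).
  by apply: eq_bigr => x _; apply: eq_bigr => a _; rewrite (sum_ord_mul _ _ (F (x * nv + a)%N)).
transitivity (\sum_(x < X) \sum_(y < Y) \sum_(a < nv) \sum_(b < ns)
   F (x * nv + a)%N (y * ns + b)%N).
  by apply: eq_bigr => x _; exact: exchange_big.
rewrite pair_bigA /=; apply: eq_bigr => z _.
by rewrite pair_bigA.
Qed.

(** The lowest digit is contracted: for fixed [i] the bound for [k] rounds applies to the partial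
    inner product [H i] of [h] with [g i], and [base] bounds the remaining squares. [H i] is
    nonnegative but not normalized, hence the generality of [base]. *)
Lemma kerk_upper k (h : nat -> nat -> R) : (forall x y, 0 <= h x y) ->
  \sum_(x < nv ^ k) \sum_(y < ns ^ k) \sum_(x' < nv ^ k) \sum_(y' < ns ^ k)
    kerk k x y x' y' * (h x y * h x' y') <=
  lam ^+ k * ((nv ^ k)%:R^-1 * \sum_(x < nv ^ k) (\sum_(y < ns ^ k) h x y) ^+ 2).
Proof.
elim: k h => [|k IH] h h0.
  by rewrite !expn0 !big_ord_recl !big_ord0 /= !addr0 expr0 invr1 !mul1r.
set X := (nv ^ k)%N in IH *; set Y := (ns ^ k)%N in IH *.
rewrite [(nv ^ _)%N]expnS [(ns ^ _)%N]expnS -/X -/Y.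
pose H i x y := \sum_(p : 'I_nv * 'I_ns) g i p.1 p.2 *
  h (x * nv + p.1)%N (y * ns + p.2)%N.
have H0 i x y : 0 <= H i x y by apply: sumr_ge0 => p _; rewrite mulr_ge0.
have -> : \sum_(x < nv * X) \sum_(y < ns * Y) \sum_(x' < nv * X) \sum_(y' < ns * Y)
    kerk k.+1 x y x' y' * (h x y * h x' y') =
    \sum_i c i * \sum_(x < X) \sum_(y < Y) \sum_(x' < X) \sum_(y' < Y)
      kerk k x y x' y' * (H i x y * H i x' y').
  rewrite (dsum X Y (fun x y => \sum_(x' < nv * X) \sum_(y' < ns * Y)
    kerk k.+1 x y x' y' * (h x y * h x' y'))).
  transitivity (\sum_(z : 'I_X * 'I_Y) \sum_(z' : 'I_X * 'I_Y)
     kerk k z.1 z.2 z'.1 z'.2 * \sum_i c i * (H i z.1 z.2 * H i z'.1 z'.2)).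
    apply: eq_bigr => z _.
    transitivity (\sum_(p : 'I_nv * 'I_ns) \sum_(z' : 'I_X * 'I_Y)
      \sum_(p' : 'I_nv * 'I_ns) kerk k z.1 z.2 z'.1 z'.2 *
       (ker p.1 p.2 p'.1 p'.2 * (h (z.1 * nv + p.1)%N (z.2 * ns + p.2)%N *
         h (z'.1 * nv + p'.1)%N (z'.2 * ns + p'.2)%N))).
      apply: eq_bigr => p _.
      rewrite (dsum X Y (fun x' y' => kerk k.+1 (z.1 * nv + p.1)%N (z.2 * ns + p.2)%N
        x' y' * (h (z.1 * nv + p.1)%N (z.2 * ns + p.2)%N * h x' y'))).
      apply: eq_bigr => z' _.
      apply: eq_bigr => p' _; rewrite /= !divmod_dec //.
      by rewrite mulrA [ker _ _ _ _ * _]mulrC -!mulrA.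
    rewrite exchange_big; apply: eq_bigr => z' _ /=.
    rewrite mulr_sumr; transitivity (kerk k z.1 z.2 z'.1 z'.2 *
       \sum_(p : 'I_nv * 'I_ns) \sum_(p' : 'I_nv * 'I_ns) \sum_i
        c i * ((g i p.1 p.2 * h (z.1 * nv + p.1)%N (z.2 * ns + p.2)%N) *
         (g i p'.1 p'.2 * h (z'.1 * nv + p'.1)%N (z'.2 * ns + p'.2)%N))).
      rewrite mulr_sumr; apply: eq_bigr => p _; rewrite mulr_sumr.
      apply: eq_bigr => p' _; congr (_ * _); rewrite /ker mulr_suml.
      by apply: eq_bigr => i _; ring.
    rewrite -mulr_sumr; congr (_ * _).
    transitivity (\sum_(p : 'I_nv * 'I_ns) \sum_i \sum_(p' : 'I_nv * 'I_ns)
        c i * ((g i p.1 p.2 * h (z.1 * nv + p.1)%N (z.2 * ns + p.2)%N) *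
         (g i p'.1 p'.2 * h (z'.1 * nv + p'.1)%N (z'.2 * ns + p'.2)%N))).
      by apply: eq_bigr => p _; exact: exchange_big.
    rewrite exchange_big; apply: eq_bigr => i _ /=.
    rewrite /H mulr_suml mulr_sumr; apply: eq_bigr => p _.
    by rewrite mulr_sumr mulr_sumr.
  transitivity (\sum_(z : 'I_X * 'I_Y) \sum_i \sum_(z' : 'I_X * 'I_Y)
    c i * (kerk k z.1 z.2 z'.1 z'.2 * (H i z.1 z.2 * H i z'.1 z'.2))).
    apply: eq_bigr => z _; rewrite [RHS]exchange_big; apply: eq_bigr => z' _ /=.
    by rewrite mulr_sumr; apply: eq_bigr => i _; ring.
  rewrite exchange_big; apply: eq_bigr => i _ /=.
  rewrite [in RHS]pair_bigA /= mulr_sumr; apply: eq_bigr => z _.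
  by rewrite [in RHS]pair_bigA /= mulr_sumr.
apply: (@le_trans _ _ (\sum_i c i * (lam ^+ k * (X%:R^-1 *
   \sum_(x < X) (\sum_(y < Y) H i x y) ^+ 2)))).
  by apply: ler_sum => i _; apply: ler_wpM2l => //; exact: IH.
have X0 : 0 <= X%:R^-1 :> R by rewrite invr_ge0.
have -> : \sum_i c i * (lam ^+ k * (X%:R^-1 * \sum_(x < X) (\sum_(y < Y) H i x y) ^+ 2))
  = lam ^+ k * (X%:R^-1 * \sum_(x < X) \sum_i c i * (\sum_(y < Y) H i x y) ^+ 2).
  rewrite exchange_big /= !mulr_sumr; apply: eq_bigr => i _.
  by rewrite -mulr_sumr; ring.
have -> : lam ^+ k.+1 * ((nv * X)%:R^-1 * \sum_(x < nv * X) (\sum_(y < ns * Y) h x y) ^+ 2)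
  = lam ^+ k * (X%:R^-1 * (\sum_(x < X) lam * (nv%:R^-1 * \sum_(v < nv)
     (\sum_(b < ns) \sum_(y < Y) h (x * nv + v)%N (y * ns + b)%N) ^+ 2))).
  rewrite (sum_ord_mul _ _ (fun x => (\sum_(y < ns * Y) h x y) ^+ 2)).
  rewrite natrM invfM exprSr.
  rewrite -mulr_sumr -mulr_sumr.
  set s1 := \sum_(b < X) _; set s2 := \sum_(x < X) _.
  have -> : s1 = s2.
    apply: eq_bigr => x _; apply: eq_bigr => v _; congr (_ ^+ 2).
    rewrite (sum_ord_mul _ _ (h (x * nv + v)%N)); exact: exchange_big.
  ring.
apply: ler_wpM2l; first by rewrite exprn_ge0.
apply: ler_wpM2l => //; apply: ler_sum => x _.
apply: le_trans (base (h := fun v b => \sum_(y < Y) h (x * nv + v)%N (y * ns + b)%N) _).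
  rewrite le_eqVlt; apply/orP; left; apply/eqP; apply: eq_bigr => i _.
  congr (_ * _ ^+ 2); rewrite /H [LHS]exchange_big [RHS]pair_bigA /=.
  by apply: eq_bigr => p _; rewrite mulr_sumr.
by move=> v b; apply: sumr_ge0.
Qed.

(** Unit weight is spread evenly over the list of each vertex, of size [l x]. A consistent pair of
    listed labels contributes at least [kapk k x x' / (l x * l x')] to the tensor form, whose value
    is at most [lam ^+ k]. Since the average list size is at most [s], the weighted mean of
    [1 / (l x * l x')] is at least [1 / s ^+ 2]. *)
Theorem cover_bound k (L : nat -> nat -> bool) (s : R) : 0 < s ->
  (forall x x', (x < nv ^ k)%N -> (x' < nv ^ k)%N -> exists y y',
     [/\ (y < ns ^ k)%N, (y' < ns ^ k)%N, L x y, L x' y' & Rk k x y x' y']) ->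
  \sum_(x < nv ^ k) \sum_(y < ns ^ k) (L x y)%:R <= s * (nv ^ k)%:R ->
  1 <= s ^+ 2 * lam ^+ k.
Proof.
move=> s0 cov le_s; set X := (nv ^ k)%N in cov le_s *; set Y := (ns ^ k)%N in cov le_s *.
pose l x : R := \sum_(y < Y) (L x y)%:R.
have lp x : (x < X)%N -> 0 < l x.
  move=> lx; have [y [_ [ly _ Ly _ _]]] := cov x x lx lx.
  rewrite /l (bigD1 (Ordinal ly)) //= Ly ltr_wpDr //; exact: sumr_ge0.
pose h x y : R := (L x y)%:R / l x.
have l0 x : 0 <= l x by apply: sumr_ge0.
have h0 x y : 0 <= h x y by rewrite divr_ge0.
have X0 : (0 < X)%N by rewrite expn_gt0 nv0.
have Xr : X%:R != 0 :> R by rewrite pnatr_eq0 -lt0n.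
have up := kerk_upper k h0; rewrite -/X -/Y in up.
have h1 (x : 'I_X) : \sum_(y < Y) h x y = 1.
  by rewrite -mulr_suml mulfV // gt_eqF // lp.
have {up} : \sum_(x < X) \sum_(x' < X) kapk k x x' / (l x * l x') <= lam ^+ k.
  have -> : lam ^+ k = lam ^+ k * (X%:R^-1 * \sum_(x < X) (\sum_(y < Y) h x y) ^+ 2).
    under eq_bigr do rewrite h1 expr1n.
    by rewrite sumr_const card_ord mulVf ?mulr1.
  apply: le_trans up; apply: ler_sum => x _; rewrite exchange_big /=.
  apply: ler_sum => x' _.
  have [y [y' [ly ly' Ly Ly' Hr]]] := cov x x' (ltn_ord x) (ltn_ord x').
  have nn (a b : nat) : 0 <= kerk k x a x' b * (h x a * h x' b).
    by rewrite mulr_ge0 ?kerk_ge0 // mulr_ge0 ?h0.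
  rewrite (bigD1 (Ordinal ly)) //= (bigD1 (Ordinal ly')) //=.
  apply: (@le_trans _ _ (kerk k x y x' y' * (h x y * h x' y'))).
    rewrite /h Ly Ly' !mul1r -invfM ler_wpM2r ?kapk_kerk //.
    by rewrite invr_ge0 mulr_ge0.
  by rewrite -addrA lerDl addr_ge0 //; do ![apply: sumr_ge0 => ? _] => //.
move=> H.
have kk1 : \sum_(x < X) \sum_(x' < X) kapk k x x' = 1.
  under eq_bigr => x _ do rewrite (kapk1 (ltn_ord x)).
  by rewrite sumr_const card_ord -[LHS]mulr_natl; exact: mulfV.
have kl : \sum_(x < X) \sum_(x' < X) kapk k x x' * (l x / s) <= 1.
  under eq_bigr => x _ do rewrite -mulr_suml (kapk1 (ltn_ord x)).
  rewrite -mulr_sumr -mulr_suml mulrA ler_pdivrMr // mul1r.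
  rewrite mulrC ler_pdivrMr ?ltr0n //.
have kl' : \sum_(x < X) \sum_(x' < X) kapk k x x' * (l x' / s) <= 1.
  rewrite exchange_big /=; apply: le_trans kl; rewrite le_eqVlt; apply/orP; left.
  by apply/eqP; apply: eq_bigr => x _; apply: eq_bigr => x' _; rewrite kapkC.
apply: (@le_trans _ _ (s ^+ 2 * \sum_(x < X) \sum_(x' < X) kapk k x x' / (l x * l x')));
  last by rewrite ler_wpM2l ?sqr_ge0.
rewrite mulr_sumr.
(* The inequality of means makes the lower bound linear in the list sizes, so the averages [kl] and
   [kl'] suffice. *)
apply: (@le_trans _ _ (\sum_(x < X) \sum_(x' < X)
   (3 * kapk k x x' - kapk k x x' * (l x / s) - kapk k x x' * (l x' / s)))).
  under eq_bigr do rewrite 2!sumrB -mulr_sumr.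
  rewrite 2!sumrB -mulr_sumr kk1; lra.
apply: ler_sum => x _; rewrite mulr_sumr; apply: ler_sum => x' _.
have p0 := lp x (ltn_ord x); have q0 := lp x' (ltn_ord x').
have := agm3 (divr_gt0 p0 s0) (divr_gt0 q0 s0).
have -> : (l x / s * (l x' / s))^-1 = s ^+ 2 / (l x * l x').
  by field; rewrite !gt_eqF.
set a := s ^+ 2 / _ => A.
have -> : s ^+ 2 * (kapk k x x' / (l x * l x')) = kapk k x x' * a by rewrite /a; ring.
have -> : 3 * kapk k x x' - kapk k x x' * (l x / s) - kapk k x x' * (l x' / s) =
  kapk k x x' * (3 - l x / s - l x' / s) by ring.
apply: ler_wpM2l; first exact: kapk_ge0.
by move: A; move: (l x / s) (l x' / s) => u v; lra.
Qed.

End Tensor.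
End ParallelGame.

(** * The covering bound for a projection game *)

Module ProjectionGame.
Import EnergyBound ParallelGame.
Import Order.TTheory GRing.Theory Num.Theory.
Local Open Scope ring_scope.

Section GameCover.
Variables (R : realFieldType) (nv ns : nat) (E U A : finType).
Variables (pos : nat -> E -> U) (ans : nat -> nat -> E -> A).
Variable eps : R.
Hypothesis nv0 : (0 < nv)%N.
Hypothesis ns0 : (0 < ns)%N.
Hypothesis E0 : (0 < #|E|)%N.
Hypothesis A0 : A.
Hypothesis eps01 : 0 < eps <= 1.
Hypothesis sound : forall (Pi : U -> A) (bf : 'I_nv -> 'I_ns),
  (#|[set ve : 'I_nv * E |
      ans ve.1 (bf ve.1) ve.2 == Pi (pos ve.1 ve.2)]|)%:R
   <= (1 - eps) * (#|'I_nv|%:R * #|E|%:R) :> R.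

Definition consistent v b v' b' : bool :=
  [forall e, forall e', (pos v e == pos v' e') ==> (ans v b e == ans v' b' e')].

Let posV (v : 'I_nv) e := pos v e.
Let ansV (v : 'I_nv) (b : 'I_ns) e := ans v b e.
Let dg u : R := deg R posV u.
Let ne : R := #|E|%:R.
Let nvr : R := nv%:R.
Let nvr0 : 0 < nvr. Proof. by rewrite ltr0n. Qed.
Let ne0 : 0 < ne. Proof. by rewrite ltr0n. Qed.

Let hitn u a v b : R := \sum_e ((pos v e == u) && (ans v b e == a))%:R.
Let inc v u : R := \sum_e (pos v e == u)%:R.

(** The form of one round as a sum of squares: half the energy, indexed by positions and answers,
    and the anchor at index [None]. *)
Let c (i : option (U * A)) : R :=
  if i is Some (u, a) then dg u / (nvr * ne) / 2 else 2^-1.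
Let g (i : option (U * A)) v b : R :=
  if i is Some (u, a) then hitn u a v b / dg u else nvr^-1.
(** The value of the kernel at consistent labels, which depends on the vertices only. The constant
    term comes from the anchor and gives weight also to pairs of vertices without a common
    position. *)
Let kap v v' : R := \sum_u dg u / (nvr * ne) / 2 * (inc v u / dg u) * (inc v' u / dg u)
  + nvr^-1 * nvr^-1 / 2.

Let dg0 u : 0 <= dg u. Proof. exact: deg_ge0. Qed.

Let big_option (F : option (U * A) -> R) :
  \sum_i F i = F None + \sum_u \sum_a F (Some (u, a)).
Proof.
rewrite (bigD1 None) //=; congr (_ + _); rewrite pair_bigA /=.
rewrite (reindex_omap (Some : U * A -> option (U * A)) id) /=.
  by apply: eq_big => [[u a]|[u a] _] //=; rewrite eqxx.
by case.
Qed.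

Lemma game_base (h : nat -> nat -> R) : (forall v b, 0 <= h v b) ->
  \sum_i c i * (\sum_(v < nv) \sum_(b < ns) g i v b * h v b) ^+ 2 <=
  (1 - eps ^+ 2 / 16) * (nv%:R^-1 * \sum_(v < nv) (\sum_(b < ns) h v b) ^+ 2).
Proof.
move=> h0; rewrite big_option /=.
have card : (0 < #|'I_nv|)%N by rewrite card_ord.
have := @anchored_energy R 'I_nv 'I_ns E U A posV ansV eps card E0 (Ordinal ns0) A0 eps01 sound
  (fun v b => h v b) (fun v b => h0 _ _).
rewrite card_ord; apply: le_trans; rewrite addrC; apply: lerD.
  rewrite /energy mulr_suml; apply: ler_sum => u _; rewrite mulr_suml.
  apply: ler_sum => a _; rewrite card_ord -/ne -/nvr.
  rewrite le_eqVlt; apply/orP; left; apply/eqP.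
  rewrite [RHS]mulrAC; congr (_ * _ ^+ 2); rewrite /tot mulr_suml.
  apply: eq_bigr => v _; rewrite mulr_suml; apply: eq_bigr => b _.
  by rewrite /hitn /hit; ring.
rewrite [X in _ <= X]mulrC ler_wpM2l ?invr_ge0 //.
rewrite le_eqVlt; apply/orP; left; apply/eqP; congr (_ ^+ 2).
by rewrite mulr_sumr; apply: eq_bigr => v _; rewrite mulr_sumr.
Qed.

(** Consistent labels give equal answers whenever they meet at [u], so summing over answers leaves
    the number of pairs of incidences. *)
Lemma sum_hit_consistent u v b v' b' : consistent v b v' b' ->
  \sum_a hitn u a v b * hitn u a v' b' = inc v u * inc v' u.
Proof.
move=> /forallP C.
have CC e e' : pos v e = u -> pos v' e' = u -> ans v b e = ans v' b' e'.
  move=> p1 p2; have := C e => /forallP/(_ e'); rewrite p1 p2 eqxx /=.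
  by move/eqP.
transitivity (\sum_e \sum_e' (pos v e == u)%:R * (pos v' e' == u)%:R : R); last first.
  by rewrite /inc big_distrlr.
transitivity (\sum_a \sum_e \sum_e' ((pos v e == u) && (ans v b e == a))%:R *
   ((pos v' e' == u) && (ans v' b' e' == a))%:R : R).
  by apply: eq_bigr => a _; rewrite /hitn big_distrlr.
rewrite exchange_big; apply: eq_bigr => e _ /=.
rewrite exchange_big; apply: eq_bigr => e' _ /=.
case: (eqVneq (pos v e) u) => p1 /=; last by rewrite mul0r big1 // => a _; rewrite mul0r.
case: (eqVneq (pos v' e') u) => p2 /=; last by rewrite mulr0 big1 // => a _; rewrite mulr0.
rewrite (CC _ _ p1 p2) (bigD1 (ans v' b' e')) //= eqxx big1 ?addr0 // => a na.
by rewrite eq_sym (negbTE na) mul0r.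
Qed.

Lemma dgE u : dg u = \sum_(v < nv) inc v u.
Proof. by []. Qed.

Lemma inc_ge0 v u : 0 <= inc v u.
Proof. by apply: sumr_ge0. Qed.

Lemma inc_sum v : \sum_u inc v u = ne.
Proof.
rewrite exchange_big /= /ne -sum1_card natr_sum; apply: eq_bigr => e _.
rewrite (bigD1 (pos v e)) //= eqxx big1 ?addr0 // => u nu.
by rewrite eq_sym (negbTE nu).
Qed.

(** The energy half and the anchor half each contribute [1 / (2 nv)] to a row. *)
Lemma kap_sum v : (v < nv)%N -> \sum_(v' < nv) kap v v' = nv%:R^-1.
Proof.
move=> lv; rewrite big_split /= sumr_const card_ord exchange_big /=.
have -> : \sum_u \sum_(v' < nv) dg u / (nvr * ne) / 2 * (inc v u / dg u) * (inc v' u / dg u)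
  = \sum_u inc v u / (nvr * ne) / 2.
  apply: eq_bigr => u _; rewrite -mulr_sumr -mulr_suml -dgE.
  case: (eqVneq (dg u) 0) => [d0|d0]; last by field; rewrite d0 !gt_eqF.
  have := d0; rewrite dgE => /psumr_eq0P H.
  have -> : inc v u = 0 by apply: (H _ (Ordinal lv)) => // i _; exact: inc_ge0.
  by rewrite !(mul0r, mulr0).
rewrite -!mulr_suml inc_sum -mulr_natl -/nvr.
by field; rewrite !gt_eqF.
Qed.

Lemma kap_ge0 v v' : 0 <= kap v v'.
Proof.
have I0 : 0 <= nvr^-1 by rewrite invr_ge0 ltW.
apply: addr_ge0; last by rewrite !mulr_ge0 // invr_ge0.
have J0 : 0 <= (nvr * ne)^-1 by rewrite invr_ge0 mulr_ge0 ?ltW.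
apply: sumr_ge0 => u _.
by rewrite !mulr_ge0 ?inc_ge0 ?J0 ?invr_ge0 ?dg0.
Qed.

Lemma kap_le_ker v b v' b' : consistent v b v' b' -> kap v v' <= ker c g v b v' b'.
Proof.
move=> C; rewrite /ker big_option /= addrC; apply: lerD.
  apply: ler_sum => u _; rewrite le_eqVlt; apply/orP; left; apply/eqP.
  transitivity (dg u / (nvr * ne) / 2 * ((\sum_a hitn u a v b * hitn u a v' b') /
    dg u / dg u)); first by rewrite sum_hit_consistent //; ring.
  rewrite 2!mulr_suml mulr_sumr; apply: eq_bigr => a _; ring.
rewrite le_eqVlt; apply/orP; left; apply/eqP; ring.
Qed.

Theorem game_cover k (L : nat -> nat -> bool) (s : R) : 0 < s ->
  (forall x x', (x < nv ^ k)%N -> (x' < nv ^ k)%N -> exists y y',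
     [/\ (y < ns ^ k)%N, (y' < ns ^ k)%N, L x y, L x' y' &
         Rk nv ns consistent k x y x' y']) ->
  \sum_(x < nv ^ k) \sum_(y < ns ^ k) (L x y)%:R <= s * (nv ^ k)%:R ->
  1 <= s ^+ 2 * (1 - eps ^+ 2 / 16) ^+ k.
Proof.
move=> s0 cov le_s.
apply: (@cover_bound R _ nv ns c g _ kap consistent nv0 ns0) cov le_s => //.
- case/andP: eps01 => e0 e1; have : eps ^+ 2 <= 1 by rewrite expr_le1 // ltW.
  lra.
- move=> [[u a]|] /=; last by rewrite invr_ge0.
  by rewrite !divr_ge0 ?dg0 // mulr_ge0 ?ltW.
- move=> [[u a]|] v b /=; last by rewrite invr_ge0 ltW.
  by rewrite divr_ge0 ?dg0 //; apply: sumr_ge0.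
- exact: game_base.
- exact: kap_ge0.
- move=> v v'; rewrite /kap; congr (_ + _); apply: eq_bigr => u _; ring.
- exact: kap_sum.
- by move=> v b v' b' _ _ _ _; exact: kap_le_ker.
Qed.

End GameCover.
End ProjectionGame.

(** * The low-degree test by finite differences, with self-correction *)

Module LowDegreeTest.
Import Order.TTheory GRing.Theory Num.Theory.
Local Open Scope ring_scope.

Section FiniteDifference.
Variable F : fieldType.

Definition fdcoef n i : F := (-1) ^+ i * 'C(n, i)%:R.

Lemma fdS n (phi : nat -> F) :
  \sum_(i < n.+2) fdcoef n.+1 i * phi i =
  \sum_(i < n.+1) fdcoef n i * phi i - \sum_(i < n.+1) fdcoef n i * phi i.+1.
Proof.
rewrite big_ord_recl /=.
have -> : \sum_(i < n.+1) fdcoef n.+1 (bump 0 i) * phi (bump 0 i) =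
   \sum_(i < n.+1) fdcoef n i.+1 * phi i.+1 - \sum_(i < n.+1) fdcoef n i * phi i.+1.
  rewrite -sumrB; apply: eq_bigr => i _; rewrite /bump /= add1n /fdcoef binS natrD exprS.
  ring.
rewrite addrA; congr (_ - _); rewrite [RHS]big_ord_recl /=.
have -> : fdcoef n.+1 0 = fdcoef n 0 by rewrite /fdcoef !bin0.
congr (_ + _); rewrite big_ord_recr /= {2}/fdcoef bin_small // mulr0 mul0r addr0.
by apply: eq_bigr => i _; rewrite /bump /= add1n.
Qed.

(** The difference [P - P(X + 1)] cancels the leading coefficient, so every difference lowers the
    degree. *)
Lemma fd_poly n (P : {poly F}) a : (size P <= n)%N ->
  \sum_(i < n.+1) fdcoef n i * P.[a + i%:R] = 0.
Proof.
elim: n P a => [|n IH] P a sP.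
  move: sP; rewrite leqn0 size_poly_eq0 => /eqP ->.
  by rewrite big1 // => i _; rewrite horner0 mulr0.
rewrite (fdS n (fun i => P.[a + i%:R])) -sumrB.
pose Q := P - (P \Po ('X + 1%:P)).
have sQ : (size Q <= n)%N.
  rewrite /Q; have [->|P0] := eqVneq P 0; first by rewrite comp_poly0 subr0 size_poly0.
  have sc : size (P \Po ('X + 1%:P)) = size P.
    by rewrite size_comp_poly2 // size_XaddC.
  have lc : lead_coef (P \Po ('X + 1%:P)) = lead_coef P.
    by rewrite lead_coef_comp ?size_XaddC // lead_coefXaddC expr1n mulr1.
  apply: leq_trans (_ : (size P).-1 <= _)%N; last by rewrite -subn1 leq_subLR.
  apply/leq_sizeP => j le_j; rewrite coefB.
  case: (ltnP j (size P)) => lt; last by rewrite !nth_default ?sc ?subr0.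
  have -> : j = (size P).-1 by lia.
  by rewrite -[in X in _ - X]sc -!lead_coefE lc subrr.
rewrite -[RHS](IH Q a sQ); apply: eq_bigr => i _.
rewrite -mulrBr; congr (_ * _); rewrite /Q hornerD hornerN horner_comp !hornerE.
by rewrite -addrA -natr1.
Qed.

Lemma interpolate n (phi : nat -> F) :
  (forall i j : nat, (i < n)%N -> (j < n)%N -> i%:R = j%:R :> F -> i = j) ->
  exists2 P : {poly F}, (size P <= n)%N & forall i, (i < n)%N -> P.[i%:R] = phi i.
Proof.
elim: n => [|n IH] inj; first by exists 0; rewrite ?size_poly0.
have [P sP HP] := IH (fun i j li lj => inj i j (ltnW li) (ltnW lj)).
pose W := \prod_(x <- [seq i%:R : F | i <- iota 0 n]) ('X - x%:P).
have W0 i : (i < n)%N -> W.[i%:R] = 0.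
  by move=> li; apply/eqP; rewrite -rootE root_prod_XsubC map_f // mem_iota.
have Wn : W.[n%:R] != 0.
  rewrite -rootE root_prod_XsubC; apply/mapP => -[i]; rewrite mem_iota add0n /= => li.
  by move/(inj _ _ (ltnSn _) (ltnW li)) => E; rewrite E ltnn in li.
exists (P + ((phi n - P.[n%:R]) / W.[n%:R]) *: W).
  apply: leq_trans (size_polyD _ _) _; rewrite geq_max (leq_trans sP) //=.
  apply: leq_trans (size_scale_leq _ _) _.
  by rewrite /W size_prod_XsubC size_map size_iota.
move=> i; rewrite ltnS leq_eqVlt => /predU1P[->|li].
  by rewrite hornerD hornerZ divfK // addrC subrK.
by rewrite hornerD hornerZ (W0 _ li) mulr0 addr0 HP.
Qed.

End FiniteDifference.

Lemma sum_or (I : finType) (b : bool) (c : I -> bool) :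
  (b -> exists i, c i) -> (b <= \sum_i (c i : nat))%N.
Proof.
case: b => // /(_ isT) [i ci]; rewrite (bigD1 i) //= ci.
exact: leq_addr.
Qed.

Section LowDegreeTest.
Variables (F : finFieldType) (V : finLmodType F) (d : nat) (f : V -> F).
Hypothesis nz : forall i : nat, (0 < i <= d.+1)%N -> i%:R != 0 :> F.
Let al (i : nat) : F := fdcoef F d.+1 i.

Definition line_test x h : bool := \sum_(i < d.+2) al i * f (x + i%:R *: h) == 0.

Definition nbad : nat := \sum_(x : V) \sum_(h : V) ~~ line_test x h.

(** The value at [x] that would make the test along [h] succeed; the coefficient of [f x] in the
    test is 1. *)
Definition vote x h : F := - \sum_(i < d.+1) al i.+1 * f (x + i.+1%:R *: h).

Lemma al0 : al 0 = 1. Proof. by rewrite /al /fdcoef bin0 mulr1. Qed.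

Lemma line_testE x h : line_test x h = (f x == vote x h).
Proof.
rewrite /line_test big_ord_recl /= al0 mul1r scale0r addr0 /vote -[RHS]subr_eq0 opprK.
by congr (_ + _ == _); apply: eq_bigr => i _; rewrite /bump /= add1n.
Qed.

Lemma affine_inj i x : (0 < i <= d.+1)%N -> injective (fun h : V => x + i%:R *: h).
Proof. by move=> /nz i0 h h' /addrI /(scalerI i0). Qed.

(** If the tests at [x + i h1] in direction [h2] and at [x + j h2] in direction [h1] all pass, both
    votes equal the same double sum over the grid [x + i h1 + j h2]. Each of these [2 (d + 1)] tests
    is made at a uniformly random point and direction, so a union bound applies. *)
Lemma vote_collision x :
  (\sum_(h1 : V) \sum_(h2 : V) (vote x h1 != vote x h2) <= 2 * d.+1 * nbad)%N.
Proof.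
have le (i : 'I_d.+1) : (0 < i.+1 <= d.+1)%N by rewrite /= ltn_ord.
have B1 (i : 'I_d.+1) :
    (\sum_(h1 : V) \sum_(h2 : V) ~~ line_test (x + i.+1%:R *: h1) h2 = nbad)%N.
  rewrite /nbad; symmetry; rewrite (reindex_inj (affine_inj (x := x) (le i))) //=.
have B2 (i : 'I_d.+1) :
    (\sum_(h1 : V) \sum_(h2 : V) ~~ line_test (x + i.+1%:R *: h2) h1 = nbad)%N.
  by rewrite exchange_big; exact: B1.
apply: (@leq_trans (\sum_(h1 : V) \sum_(h2 : V)
   (\sum_(i < d.+1) ~~ line_test (x + i.+1%:R *: h1) h2 +
    \sum_(i < d.+1) ~~ line_test (x + i.+1%:R *: h2) h1))%N).
  apply: leq_sum => h1 _; apply: leq_sum => h2 _.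
  case: (boolP [exists i : 'I_d.+1, ~~ line_test (x + i.+1%:R *: h1) h2]).
    by move/existsP => H; apply: leq_trans (leq_addr _ _); apply: sum_or.
  rewrite negb_exists => /forallP N1.
  case: (boolP [exists i : 'I_d.+1, ~~ line_test (x + i.+1%:R *: h2) h1]).
    by move/existsP => H; apply: leq_trans (leq_addl _ _); apply: sum_or.
  rewrite negb_exists => /forallP N2.
  suff -> : vote x h1 = vote x h2 by rewrite eqxx.
  have E1 (i : 'I_d.+1) : f (x + i.+1%:R *: h1) = vote (x + i.+1%:R *: h1) h2.
    by apply/eqP; rewrite -line_testE; have := N1 i; rewrite negbK.
  have E2 (i : 'I_d.+1) : f (x + i.+1%:R *: h2) = vote (x + i.+1%:R *: h2) h1.
    by apply/eqP; rewrite -line_testE; have := N2 i; rewrite negbK.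
  rewrite {1}/vote [in RHS]/vote; congr (- _).
  under eq_bigr do rewrite E1 /vote mulrN mulr_sumr.
  under [RHS]eq_bigr do rewrite E2 /vote mulrN mulr_sumr.
  rewrite !sumrN exchange_big; congr (- _); apply: eq_bigr => i _ /=.
  by apply: eq_bigr => j _; rewrite mulrCA addrAC.
under eq_bigr => h1 _ do rewrite big_split /=; rewrite big_split /=.
have S1 : (\sum_(h1 : V) \sum_(h2 : V) \sum_(i < d.+1)
    ~~ line_test (x + i.+1%:R *: h1) h2 = d.+1 * nbad)%N.
  under eq_bigr => h1 _ do rewrite exchange_big /=.
  rewrite exchange_big /=; under eq_bigr => i _ do rewrite B1.
  by rewrite sum_nat_const card_ord.
have S2 : (\sum_(h1 : V) \sum_(h2 : V) \sum_(i < d.+1)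
    ~~ line_test (x + i.+1%:R *: h2) h1 = d.+1 * nbad)%N.
  under eq_bigr => h1 _ do rewrite exchange_big /=.
  rewrite exchange_big /=; under eq_bigr => i _ do rewrite B2.
  by rewrite sum_nat_const card_ord.
by rewrite S1 S2; lia.
Qed.

Definition agree x (c : F) : nat := \sum_(h : V) (vote x h == c).

Definition corrected x : F := [arg max_(c > 0) agree x c].

Lemma correctedP x c : (agree x c <= agree x (corrected x))%N.
Proof. by rewrite /corrected; case: arg_maxnP => // c' _; exact. Qed.

Let nV := #|V|.

Lemma sum_neg (T : finType) (P : pred T) : (\sum_x P x + \sum_x ~~ P x = #|T|)%N.
Proof.
by rewrite -big_split -sum1_card; apply: eq_bigr => x _ /=; case: (P x).
Qed.

(** The probability that two independent votes coincide is at most the frequency of the most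
    frequent value. *)
Lemma corrected_vote x :
  ((\sum_(h : V) (vote x h != corrected x)) * nV <= 2 * d.+1 * nbad)%N.
Proof.
apply: leq_trans (vote_collision x).
have H : (\sum_(h1 : V) \sum_(h2 : V) (vote x h1 == vote x h2) <=
   nV * agree x (corrected x))%N.
  rewrite -sum_nat_const; apply: leq_sum => h1 _.
  apply: leq_trans (correctedP x (vote x h1)); apply: leq_sum => h2 _.
  by rewrite eq_sym.
have E1 : (\sum_(h1 : V) \sum_(h2 : V) (vote x h1 == vote x h2) +
   \sum_(h1 : V) \sum_(h2 : V) (vote x h1 != vote x h2) = nV * nV)%N.
  rewrite -big_split /= -sum_nat_const; apply: eq_bigr => h1 _.
  exact: sum_neg.
have E2 : (agree x (corrected x) + \sum_(h : V) (vote x h != corrected x) = nV)%N.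
  exact: sum_neg.
nia.
Qed.

(** Where [f] differs from the plurality value, at most half of the votes equal [f x], so at least
    half of the tests at [x] fail. *)
Lemma corrected_close : ((\sum_(x : V) (f x != corrected x)) * nV <= 2 * nbad)%N.
Proof.
rewrite /nbad big_distrl big_distrr /=; apply: leq_sum => x _.
case: eqP => [|ne]; rewrite ?mul0n // mul1n.
have E1 : (agree x (f x) + \sum_(h : V) ~~ line_test x h = nV)%N.
  rewrite /nV -(sum_neg (fun h => vote x h == f x)); congr addn.
  by apply: eq_bigr => h _; rewrite line_testE eq_sym.
have E2 : (agree x (f x) + agree x (corrected x) <= nV)%N.
  rewrite -big_split /= /nV -sum1_card; apply: leq_sum => h _.
  by case: eqP => [->|_]; case: eqP => // E; case: ne.
have C := correctedP x (f x).
set S := (\sum_(h : V) _)%N.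
have {}E1 : (agree x (f x) + S = nV)%N by exact: E1.
by move: E1 E2 C; move: S => S; lia.
Qed.

Hypothesis small : ((2 * d.+2 * d.+1 + d.+1) * nbad < nV * nV)%N.

(** By a union bound, counted in [small], some [h1] and [h2] make every vote at [x + i h] in
    direction [h1 + i h2] equal to the plurality and every test at [x + j h1] in direction
    [h + j h2] succeed. Summing over the common points in the other order gives zero for each
    [j]. *)
Lemma corrected_line x h : \sum_(i < d.+2) al i * corrected (x + i%:R *: h) = 0.
Proof.
pose A (i : 'I_d.+2) h1 h2 := vote (x + i%:R *: h) (h1 + i%:R *: h2) !=
   corrected (x + i%:R *: h).
pose B (j : 'I_d.+1) h1 h2 := ~~ line_test (x + j.+1%:R *: h1) (h + j.+1%:R *: h2).
have cA i : (\sum_(h1 : V) \sum_(h2 : V) A i h1 h2 <= 2 * d.+1 * nbad)%N.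
  rewrite exchange_big /=; apply: leq_trans (corrected_vote (x + i%:R *: h)).
  rewrite mulnC -sum_nat_const; apply: leq_sum => h2 _; apply: eq_leq.
  rewrite [RHS](reindex_inj (addIr (i%:R *: h2))) //=.
have le (i : 'I_d.+1) : (0 < i.+1 <= d.+1)%N by rewrite /= ltn_ord.
have cB j : (\sum_(h1 : V) \sum_(h2 : V) B j h1 h2 = nbad)%N.
  rewrite /nbad [RHS](reindex_inj (affine_inj (x := x) (le j))) /=.
  apply: eq_bigr => h1 _.
  by rewrite [RHS](reindex_inj (affine_inj (x := h) (le j))).
have [h1 [h2 [HA HB]]] : exists h1 h2, (forall i, ~~ A i h1 h2) /\
    (forall j, ~~ B j h1 h2).
  apply: contrapT => N.
  suff : (nV * nV <= (2 * d.+2 * d.+1 + d.+1) * nbad)%N by lia.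
  apply: (@leq_trans (\sum_(h1 : V) \sum_(h2 : V)
     (\sum_(i < d.+2) A i h1 h2 + \sum_(j < d.+1) B j h1 h2))%N).
    rewrite -sum_nat_const; apply: leq_sum => h1 _.
    rewrite /nV -sum1_card; apply: leq_sum => h2 _.
    case: (boolP [exists i, A i h1 h2]) => [/existsP H|N1].
      by apply: leq_trans (leq_addr _ _); apply: (@sum_or _ true).
    case: (boolP [exists j, B j h1 h2]) => [/existsP H|N2].
      by apply: leq_trans (leq_addl _ _); apply: (@sum_or _ true).
    case: N; exists h1, h2; split.
      by move=> i; move: N1; rewrite negb_exists => /forallP.
    by move=> i; move: N2; rewrite negb_exists => /forallP.
  under eq_bigr => h1 _ do rewrite big_split /=; rewrite big_split /=.
  have S1 : (\sum_(h1 : V) \sum_(h2 : V) \sum_(i < d.+2) A i h1 h2 <=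
     d.+2 * (2 * d.+1 * nbad))%N.
    under eq_bigr => h1 _ do rewrite exchange_big /=.
    rewrite exchange_big /= -[X in (X * _)%N](card_ord d.+2) -sum_nat_const.
    by apply: leq_sum => i _; exact: cA.
  have S2 : (\sum_(h1 : V) \sum_(h2 : V) \sum_(j < d.+1) B j h1 h2 = d.+1 * nbad)%N.
    under eq_bigr => h1 _ do rewrite exchange_big /=.
    rewrite exchange_big /=; under eq_bigr => i _ do rewrite cB.
    by rewrite sum_nat_const card_ord.
  by rewrite S2; apply: leq_trans (leq_add S1 (leqnn _)) _; apply: eq_leq; ring.
have EA (i : 'I_d.+2) : corrected (x + i%:R *: h) =
    vote (x + i%:R *: h) (h1 + i%:R *: h2).
  by apply/esym/eqP; have := HA i; rewrite negbK.
under eq_bigr do rewrite EA /vote mulrN mulr_sumr.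
rewrite sumrN exchange_big /= big1 ?oppr0 // => j _.
have := HB j; rewrite negbK /line_test => /eqP E.
transitivity (al j.+1 * \sum_(i < d.+2)
  al i * f (x + j.+1%:R *: h1 + i%:R *: (h + j.+1%:R *: h2))); last by rewrite E mulr0.
rewrite mulr_sumr; apply: eq_bigr => i _; rewrite mulrCA; congr (_ * (_ * f _)).
rewrite !scalerDr !scalerA [_ * j.+1%:R]mulrC -!addrA; congr (_ + _).
by rewrite addrCA.
Qed.

End LowDegreeTest.

(** Interpolation at [0, ..., d] yields the candidate. The top coefficient of the difference is a
    sign, so each further value is determined by the [d + 1] preceding ones, and in a prime field
    every element is reached this way. *)
Lemma fd_is_poly (p d : nat) (phi : 'F_p -> 'F_p) : prime p -> (d.+1 < p)%N ->
  (forall a : nat, \sum_(i < d.+2) fdcoef 'F_p d.+1 i * phi (a%:R + i%:R) = 0) ->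
  exists2 P : {poly 'F_p}, (size P <= d.+1)%N & forall t, phi t = P.[t].
Proof.
move=> pp dp H.
have inj i j : (i < d.+1)%N -> (j < d.+1)%N -> i%:R = j%:R :> 'F_p -> i = j.
  move=> li lj /(congr1 val) /=; rewrite !val_Fp_nat // !modn_small //; lia.
have [P sP HP] := interpolate (fun i => phi i%:R) inj.
exists P => // t.
suff HN n : phi n%:R = P.[n%:R].
  by rewrite -(natr_Zp t); exact: HN.
elim/ltn_ind: n => n IH; case: (ltnP n d.+1) => ln; first by rewrite HP.
have := H (n - d.+1)%N; have := fd_poly (n - d.+1)%:R sP.
rewrite big_ord_recr [in X in _ -> X]big_ord_recr /= => E1 E2.
have En : (n - d.+1)%:R + d.+1%:R = n%:R :> 'F_p by rewrite -natrD subnK.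
rewrite !En in E1 E2.
have Es : \sum_(i < d.+1) fdcoef 'F_p d.+1 i * phi ((n - d.+1)%:R + i%:R) =
  \sum_(i < d.+1) fdcoef 'F_p d.+1 i * P.[(n - d.+1)%:R + i%:R].
  apply: eq_bigr => i _; rewrite -natrD IH //.
  by have := ltn_ord i; lia.
rewrite Es in E2.
have := congr2 (fun x y => x - y) E2 E1; rewrite /= subrr opprD addrACA subrr add0r -mulrBr.
move/eqP; rewrite mulf_eq0 subr_eq0 => /orP[|/eqP->//].
by rewrite /fdcoef binn mulr1 signr_eq0.
Qed.
End LowDegreeTest.

(** * Individual degrees, Schwartz-Zippel and the linearization chain *)

Module SumCheck.
Import LowDegreeTest.
Import Order.TTheory GRing.Theory Num.Theory.
Local Open Scope ring_scope.

Section LineDegree.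
Variable F : fieldType.

Definition ldeg n (phi : F -> F) :=
  exists2 P : {poly F}, (size P <= n.+1)%N & forall t, phi t = P.[t].

Lemma ldeg_eq n phi psi : ldeg n phi -> (forall t, psi t = phi t) -> ldeg n psi.
Proof. by move=> [P sP HP] E; exists P => // t; rewrite E. Qed.

Lemma ldeg_le n n' phi : (n <= n')%N -> ldeg n phi -> ldeg n' phi.
Proof. by move=> le [P sP HP]; exists P => //; exact: leq_trans sP _. Qed.

Lemma ldegC n c : ldeg n (fun=> c).
Proof.
by exists c%:P => [|t]; rewrite ?hornerC // (leq_trans (size_polyC_leq1 _)).
Qed.

Lemma ldegX n : ldeg n.+1 id.
Proof. by exists 'X => [|t]; rewrite ?hornerX // size_polyX. Qed.

Lemma ldegD n phi psi : ldeg n phi -> ldeg n psi -> ldeg n (fun t => phi t + psi t).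
Proof.
move=> [P sP HP] [Q sQ HQ]; exists (P + Q) => [|t]; last by rewrite hornerD HP HQ.
by rewrite (leq_trans (size_polyD _ _)) // geq_max sP.
Qed.

Lemma ldegM n1 n2 phi psi : ldeg n1 phi -> ldeg n2 psi ->
  ldeg (n1 + n2) (fun t => phi t * psi t).
Proof.
move=> [P sP HP] [Q sQ HQ]; exists (P * Q) => [|t]; last by rewrite hornerM HP HQ.
by rewrite (leq_trans (size_polyMleq _ _)) //; lia.
Qed.

Lemma ldegN n phi : ldeg n phi -> ldeg n (fun t => - phi t).
Proof. by move=> [P sP HP]; exists (- P) => [|t]; rewrite ?size_polyN // hornerN HP. Qed.

Lemma ldeg_sum n (I : finType) (phi : I -> F -> F) : (forall i, ldeg n (phi i)) ->
  ldeg n (fun t => \sum_i phi i t).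
Proof.
move=> H; have H' (s : seq I) : ldeg n (fun t => \sum_(i <- s) phi i t).
  elim: s => [|i s IH]; first by apply: ldeg_eq (ldegC n 0) _ => t; rewrite big_nil.
  by apply: ldeg_eq (ldegD (H i) IH) _ => t; rewrite big_cons.
exact: H'.
Qed.

Lemma ldeg_prod k n (phi : 'I_k -> F -> F) : (forall i, ldeg n (phi i)) ->
  ldeg (k * n) (fun t => \prod_i phi i t).
Proof.
elim: k phi => [|k IH] phi H.
  by apply: ldeg_eq (ldegC _ 1) _ => t; rewrite big_ord0.
apply: ldeg_eq (ldegM (H ord0) (IH (fun i => phi (lift ord0 i)) _)) _ => //.
by move=> t; rewrite big_ord_recl.
Qed.

Lemma ldeg_prod1 k n (phi : 'I_k -> F -> F) (i0 : nat) :
  (forall i : 'I_k, i != i0 :> nat -> exists c, forall t, phi i t = c) ->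
  (forall i : 'I_k, i = i0 :> nat -> ldeg n (phi i)) -> ldeg n (fun t => \prod_i phi i t).
Proof.
elim: k phi i0 => [|k IH] phi i0 Hc H.
  by apply: ldeg_eq (ldegC _ 1) _ => t; rewrite big_ord0.
have [i00|i0n] := eqVneq i0 0.
  have Hr : ldeg 0 (fun t => \prod_(i < k) phi (lift ord0 i) t).
    rewrite -(muln0 k); apply: ldeg_prod => i.
    have [|c Hcc] := Hc (lift ord0 i); first by rewrite i00.
    by apply: ldeg_eq (ldegC 0 c) _.
  rewrite -(addn0 n); apply: ldeg_eq (ldegM (H ord0 _) Hr) _; first by rewrite i00.
  by move=> t; rewrite big_ord_recl.
have [|c Hcc] := Hc ord0; first by rewrite eq_sym.
have Hr : ldeg n (fun t => \prod_(i < k) phi (lift ord0 i) t).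
  apply: (IH _ i0.-1) => i E.
    by apply: Hc; rewrite /= /bump /=; lia.
  by apply: H; rewrite /= /bump /=; lia.
apply: ldeg_eq (ldegM (ldegC 0 c) Hr) _ => t.
by rewrite big_ord_recl Hcc.
Qed.

End LineDegree.

Lemma root_count (F : finFieldType) D (P Q : {poly F}) :
  (size P <= D.+1)%N -> (size Q <= D.+1)%N -> (exists t, P.[t] != Q.[t]) ->
  (\sum_(t : F) (P.[t] == Q.[t]) <= D)%N.
Proof.
move=> sP sQ [t0 ne].
have nz : P - Q != 0.
  by apply: contraNneq ne => E; rewrite -subr_eq0 -hornerN -hornerD E horner0.
have -> : (\sum_(t : F) (P.[t] == Q.[t]) = size [seq t <- enum F | root (P - Q) t])%N.
  rewrite size_filter -sum1_count big_enum_cond /= [RHS]big_mkcond /=.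
  by apply: eq_bigr => t _; rewrite rootE hornerD hornerN subr_eq0; case: eqP.
have sPQ : (size (P - Q)%R <= D.+1)%N.
  by rewrite (leq_trans (size_polyD _ _)) // size_polyN geq_max sP.
rewrite -ltnS; apply: leq_trans sPQ; apply: max_poly_roots => //.
  by apply/allP => t; rewrite mem_filter => /andP[].
by rewrite filter_uniq // enum_uniq.
Qed.

Section Axis.
Variables (F : finFieldType) (M : nat).
Local Notation X := {ffun 'I_M -> F}.
Let p := #|F|.

Definition upx (x : X) (i : 'I_M) t : X := [ffun j => if j == i then t else x j].

Definition axis D (phi : X -> F) :=
  forall x i, ldeg D (fun t => phi (upx x i t)).

Lemma upx_same x i : upx x i (x i) = x.
Proof. by apply/ffunP => j; rewrite ffunE; case: eqP => // ->. Qed.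

Lemma upxx x i s t : upx (upx x i s) i t = upx x i t.
Proof. by apply/ffunP => j; rewrite !ffunE; case: eqP. Qed.

Lemma upxC x i j s t : i != j -> upx (upx x i s) j t = upx (upx x j t) i s.
Proof.
move=> ne; apply/ffunP => k; rewrite !ffunE; case: eqP => // ->.
by rewrite eq_sym (negbTE ne).
Qed.

(** Exchanging the coordinate [x i] with the fresh value [t] is an involution: a uniform point with
    a resampled coordinate is uniform. *)
Lemma resample i (phi : X -> nat) :
  (\sum_(x : X) \sum_t phi (upx x i t) = p * \sum_(x : X) phi x)%N.
Proof.
pose G (q : X * F) : X * F := (upx q.1 i q.2, q.1 i).
have GK : involutive G.
  by move=> [x t]; rewrite /G /= upxx upx_same ffunE eqxx.
rewrite pair_bigA /= (reindex_inj (inv_inj GK)) /=.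
transitivity (\sum_(q : X * F) phi q.1)%N.
  by apply: eq_bigr => q _; rewrite upxx upx_same.
rewrite -(pair_bigA _ (fun x t => phi x)) /= big_distrr /=.
by apply: eq_bigr => x _; rewrite sum_nat_const.
Qed.

(** Starting from [x0], the coordinates are replaced by random ones one at a time; each replacement
    turns a nonzero value into zero with probability at most [D / p]. *)
Lemma schwartz_zippel D (phi : X -> F) x0 : axis D phi -> phi x0 != 0 ->
  ((\sum_(x : X) (phi x == 0)%R) * p <= M * D * #|X|)%N.
Proof.
move=> ax nz; pose hyb n (x : X) : X := [ffun j : 'I_M => if (j < n)%N then x j else x0 j].
have H n : (n <= M)%N -> ((\sum_(x : X) (phi (hyb n x) == 0)%R) * p <= n * D * #|X|)%N.
  elim: n => [|n IH] ln.
    rewrite big1 // => x _; have -> : hyb 0 x = x0 by apply/ffunP => j; rewrite ffunE.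
    by rewrite (negbTE nz).
  pose i := Ordinal ln.
  rewrite mulnC -(resample i (fun x => phi (hyb n.+1 x) == 0)).
  have E x t : hyb n.+1 (upx x i t) = upx (hyb n x) i t.
    apply/ffunP => j; rewrite !ffunE ltnS leq_eqVlt.
    have -> : (j == i) = (j == n :> nat) by [].
    by case: eqP => //= ->; rewrite eqxx.
  apply: (@leq_trans (\sum_(x : X) (D + p * (phi (hyb n x) == 0)%R))%N).
    apply: leq_sum => x _.
    case: (eqVneq (phi (hyb n x)) 0) => [_|ne].
      rewrite muln1 (leq_trans _ (leq_addl _ _)) // /p -sum1_card.
      by apply: leq_sum => t _; case: (_ == _).
    rewrite muln0 addn0.
    have [P sP HP] := ax (hyb n x) i.
    have := @root_count F D P 0 sP; rewrite size_poly0 => /(_ isT) H.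
    apply: leq_trans (H _).
      by apply: leq_sum => t _; rewrite E HP horner0.
    exists (hyb n x i); rewrite horner0 -HP upx_same //.
  rewrite big_split /= sum_nat_const -big_distrr /=.
  have := IH (ltnW ln); rewrite mulnC mulSn mulnDl => H1.
  by rewrite [(#|X| * D)%N]mulnC leq_add2l.
apply: leq_trans (H M (leqnn _)); rewrite leq_mul2r; apply/orP; right.
apply: leq_sum => x _.
by have -> : hyb M x = x by apply/ffunP => j; rewrite ffunE ltn_ord.
Qed.

Definition lin i (phi : X -> F) (x : X) : F :=
  (1 - x i) * phi (upx x i 0) + x i * phi (upx x i 1).

Lemma axis_lin D i phi : (0 < D)%N -> axis D phi -> axis D (lin i phi).
Proof.
move=> D0 ax x j; have [->|ne] := eqVneq j i.
  have H1 : ldeg 1 (fun t : F => 1 - t).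
    by apply: ldegD (ldegC _ _) (ldegN (ldegX _ _)).
  apply: ldeg_le D0 _.
  apply: ldeg_eq (ldegD (ldegM H1 (ldegC 0 (phi (upx x i 0))))
     (ldegM (ldegX F 0) (ldegC 0 (phi (upx x i 1))))) _.
  by move=> t; rewrite /lin !upxx ffunE eqxx.
apply: ldeg_eq (ldegD (ldegM (ldegC 0 (1 - x i)) (ax (upx x i 0) j))
     (ldegM (ldegC 0 (x i)) (ax (upx x i 1) j))) _.
by move=> t; rewrite /lin ffunE eq_sym (negbTE ne) !(upxC _ _ _ ne).
Qed.

(** [g] made linear in its first [n] variables, keeping the values at 0 and 1. At [n = M] this is
    the multilinear extension of the restriction of [g] to the cube. *)
Fixpoint gg (g : X -> F) n : X -> F :=
  if n is n'.+1 then
    if insub n' is Some i then lin i (gg g n') else gg g n'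
  else g.

Lemma ggS g (i : 'I_M) : gg g i.+1 = lin i (gg g i).
Proof. by rewrite /= valK. Qed.

Lemma axis_gg D g n : (0 < D)%N -> axis D g -> axis D (gg g n).
Proof.
move=> D0 ax; elim: n => //= n IH; case: insub => // i; exact: axis_lin.
Qed.

Definition cube (x : X) := forall i, x i = 0 \/ x i = 1.

Lemma gg_cube g n x : cube x -> gg g n x = g x.
Proof.
move=> cx; elim: n => //= n IH; case: insub => // i; rewrite /lin.
have E t : x i = t -> upx x i t = x by move=> <-; exact: upx_same.
by case: (cx i) => xi; rewrite xi (E _ xi) IH ?subr0 ?subrr ?mul1r ?mul0r ?addr0 ?add0r.
Qed.

(** Each step reads only the values 0 and 1 of its variable. The induction therefore treats points
    whose coordinates from [n] on are already 0 or 1. *)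
Lemma gg_vanish g : (forall x, cube x -> g x = 0) -> forall x, gg g M x = 0.
Proof.
move=> H; suff S n : (n <= M)%N -> forall x : X, (forall i : 'I_M, (n <= i)%N ->
    x i = 0 \/ x i = 1) -> gg g n x = 0.
  by move=> x; apply: S => // i; rewrite leqNgt ltn_ord.
elim: n => [|n IH] ln x Hx /=; first by apply: H => i; exact: Hx.
rewrite insubT /lin !IH ?mulr0 ?addr0 //; try exact: ltnW.
- move=> i li; rewrite ffunE -val_eqE /=; case: eqP => [_|ne]; first by right.
  by apply: Hx; lia.
- move=> i li; rewrite ffunE -val_eqE /=; case: eqP => [_|ne]; first by left.
  by apply: Hx; lia.
Qed.

Lemma neq_trans3 (T : eqType) (a b c : T) : ((a != c) <= (a != b) + (b != c))%N.
Proof. by case: (eqVneq a b) => [->|]; case: (_ == c). Qed.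

(** On a segment along axis [i] the claimed polynomial may equal [gam]; then a wrong value of [psi]
    violates the interpolation check. Otherwise it agrees with [gam] in at most [D] points, and at
    every other point it contradicts [phi] or [phi] contradicts [gam]. *)
Lemma chain_step D i (phi psi gam : X -> F) (P : X -> {poly F}) :
  axis D gam -> (forall x, (size (P x) <= D.+1)%N) ->
  (p * \sum_(x : X) (psi x != lin i gam x) <=
   \sum_(x : X) \sum_t ((1 - t) * (P x).[0] + t * (P x).[1] != psi (upx x i t))%R +
   \sum_(x : X) \sum_t ((P x).[t] != phi (upx x i t)) +
   p * \sum_(x : X) (phi x != gam x) + D * #|X|)%N.
Proof.
move=> ax sP.
rewrite -(resample i (fun x => psi x != lin i gam x)).
rewrite -(resample i (fun x => phi x != gam x)).
have -> : (D * #|X| = \sum_(x : X) D)%N by rewrite sum_nat_const mulnC.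
rewrite -!big_split /=; apply: leq_sum => x _.
have [Q sQ HQ] := ax x i.
have linE t : lin i gam (upx x i t) = (1 - t) * Q.[0] + t * Q.[1].
  by rewrite /lin !upxx ffunE eqxx -!HQ.
have S1 : (\sum_t ((P x).[t] != Q.[t]) <=
   \sum_t ((P x).[t] != phi (upx x i t)) + \sum_t (phi (upx x i t) != gam (upx x i t)))%N.
  rewrite -big_split; apply: leq_sum => t _ /=; rewrite HQ; exact: neq_trans3.
have [/existsP[t0 ne]|/existsPn all_eq] := boolP [exists t, (P x).[t] != Q.[t]].
  have S2 : (\sum_t ((P x).[t] == Q.[t]) <= D)%N by apply: root_count => //; exists t0.
  have S3 : (\sum_t ((P x).[t] == Q.[t]) + \sum_t ((P x).[t] != Q.[t]) = p)%N.
    by rewrite /p -big_split -sum1_card; apply: eq_bigr => t _ /=; case: eqP.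
  have S4 : (\sum_t (psi (upx x i t) != lin i gam (upx x i t)) <= p)%N.
    by rewrite /p -sum1_card; apply: leq_sum => t _; case: eqP.
  apply: leq_trans S4 _; rewrite -S3; apply: leq_trans (leq_add S2 S1) _.
  by rewrite addnC leq_add2r -[X in (_ <= X)%N]addnA leq_addl.
rewrite -!addnA; apply: leq_trans (leq_addr _ _); apply: leq_sum => t _.
rewrite linE.
have E s : (P x).[s] = Q.[s] by apply/eqP; have := all_eq s; rewrite negbK.
by rewrite !E eq_sym.
Qed.

End Axis.
End SumCheck.

(** * The verifier and the arithmetized formula *)

Module PcpVerifier.
Import EnergyBound LowDegreeTest SumCheck.
Import Order.TTheory GRing.Theory Num.Theory.

Lemma digit_lt b j x : 0 < b -> digit b j x < b.
Proof. by move=> b0; rewrite /digit ltn_pmod. Qed.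

Lemma digit_sum b N (a : nat -> nat) j : (forall i, a i < b) -> j < N ->
  digit b j (\sum_(i < N) a i * b ^ i) = a j.
Proof.
move=> ab; have b0 : 0 < b := leq_ltn_trans (leq0n _) (ab 0).
elim: N j a ab => // N IH [|j] a ab lj; rewrite big_ord_recl expn0 muln1.
  have -> : \sum_(i < N) a (bump 0 i) * b ^ bump 0 i = b * \sum_(i < N) a i.+1 * b ^ i.
    by rewrite big_distrr; apply: eq_bigr => i _; rewrite /= /bump /= add1n expnS mulnCA.
  by rewrite digit0 mulnC addnC modnMDl modn_small.
rewrite digitS.
have -> : (a (@ord0 N) + \sum_(i < N) a (lift ord0 i) * b ^ lift ord0 i) %/ b =
   \sum_(i < N) a i.+1 * b ^ i.
  have -> : \sum_(i < N) a (lift ord0 i) * b ^ lift ord0 i = (\sum_(i < N) a i.+1 * b ^ i) * b.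
    by rewrite big_distrl; apply: eq_bigr => i _; rewrite /= /bump /= add1n expnSr mulnA.
  by rewrite addnC divnMDl // divn_small ?addn0.
exact: (IH j (fun i => a i.+1)).
Qed.

Lemma sum_digits_lt b N (a : nat -> nat) : (forall i, a i < b) ->
  \sum_(i < N) a i * b ^ i < b ^ N.
Proof.
move=> ab; elim: N => [|N IH]; first by rewrite big_ord0.
rewrite big_ord_recr /= expnS; have := ab N; move: IH.
by move: (\sum_(i < N) _) (b ^ N) (a N) => s B c; nia.
Qed.

Lemma digits_sum b N x : 0 < b -> x < b ^ N -> \sum_(i < N) digit b i x * b ^ i = x.
Proof.
move=> b0; elim: N x => [|N IH] x; first by rewrite expn0 big_ord0; lia.
rewrite expnS => lx; rewrite big_ord_recl digit0 expn0 muln1.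
have -> : \sum_(i < N) digit b (lift ord0 i) x * b ^ lift ord0 i =
  (\sum_(i < N) digit b i (x %/ b) * b ^ i) * b.
  rewrite big_distrl; apply: eq_bigr => i _.
  by rewrite /= /bump /= add1n digitS expnSr mulnA.
rewrite IH; first by rewrite addnC -divn_eq.
by rewrite ltn_divLR // mulnC.
Qed.

Lemma iter_div b j x : 0 < b -> iter j (fun y => y %/ b) x = x %/ b ^ j.
Proof.
move=> b0; elim: j x => [|j IH] x; first by rewrite expn0 divn1.
by rewrite iterS IH -divnMA expnSr.
Qed.

Lemma digitE b j x : 0 < b -> digit b j x = (x %/ b ^ j) %% b.
Proof. by move=> b0; rewrite /digit iter_div. Qed.

Lemma digit_digit b m j i x : 0 < b -> i < m ->
  digit b i (digit (b ^ m) j x) = digit b (j * m + i) x.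
Proof.
move=> b0 lim; have B0 : 0 < b ^ m by rewrite expn_gt0 b0.
rewrite !digitE // expnD -expnM [m * j]mulnC divnMA.
move: (x %/ b ^ (j * m)) => y.
have -> : m = i + (m - i.+1).+1 by lia.
by rewrite expnD mulnC -modn_divl expnS modn_dvdm // dvdn_mulr.
Qed.

Section PCP.
Variables (p m w : nat) (cl : nat -> bool).
Hypothesis pp : prime p.
Hypothesis m0 : 0 < m.
Hypothesis w2 : 1 < w.

(** The number of bits of a clause index: [w] variables of [m] bits each and [w] signs. *)
Definition pcpM := w * m + w.
Local Notation M := pcpM.
(** A factor of the polynomial that is 1 at the cube point [b] and 0 at all others. Computations use
    natural numbers modulo [p], whence [p.-1] for [-1]. *)
Definition nlit b i z := if digit 2 i b == 1 then digit p i z else 1 + p.-1 * digit p i z.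
Definition nCl z := \sum_(b < 2 ^ M) cl b * \prod_(i < M) nlit b i z.
Definition blk j z := digit (p ^ m) j z.
(** The polynomial that has to vanish on the cube, with the values of the assignment at the blocks
    of [z] taken from the label [b]. At the index of a clause it vanishes if some literal has the
    value of its sign. *)
Definition nG z b :=
  nCl z * \prod_(j < w) (digit p j b + p.-1 * digit p (w * m + j) z).
Definition nev n b t := \sum_(j < n) digit p j b * t ^ j.
Definition nup z i t := \sum_(j < M) (if j == i :> nat then t else digit p j z) * p ^ j.
Definition nlin x h e := \sum_(i < m) ((digit p i x + e * digit p i h) %% p) * p ^ i.

(** A vertex is a kind [tau] with a point [z]: kind 0 is a point, kinds 1 to [M] are segments along
    axis [tau - 1], kind [M + 1] is a line. The first component of a position names a table: 0 is
    the assignment, [i + 1] the polynomial after [i] linearizations. A segment thus links two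
    successive tables. Surplus values of [e] repeat the last question. *)
Definition pcp_pos v e t : nat * nat :=
  let tau := v %/ p ^ M in let z := v %% p ^ M in
  if tau == 0 then
    if e < w then (0, blk e z) else if e == w then (1, z) else (M.+1, z)
  else if tau <= M then
    (if e == 0 then tau else tau.+1, nup z tau.-1 t)
  else (0, nlin (blk 0 z) (blk 1 z) (minn e m.+1)).

(** The digits of a label are values of the assignment for a point, and coefficients for a segment
    or line. The second answer of a segment interpolates linearly between the values at 0 and 1,
    digit 0 being the value at 0. The constant answer 0 demands that the last table vanish. *)
Definition pcp_ans v b e t : nat :=
  let tau := v %/ p ^ M in let z := v %% p ^ M in
  if tau == 0 then
    if e < w then digit p e b else if e == w then nG z b else 0
  else if tau <= M then
    if e == 0 then nev m.+2 b t
    else (1 + p.-1 * t) * digit p 0 b + t * nev m.+2 b 1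
  else nev m.+1 b (minn e m.+1).

Definition pcpq := w + m + 2.
Definition pcpnv := M.+2 * p ^ M.
Definition pcpns := p ^ pcpq.

Local Notation F := 'F_p.
Local Notation X := {ffun 'I_M -> F}.
Local Notation Xm := {ffun 'I_m -> F}.

Definition dec N z : {ffun 'I_N -> F} := [ffun i : 'I_N => (digit p i z)%:R%R].
Definition enc N (x : {ffun 'I_N -> F}) : nat :=
  \sum_(i < N) (if insub (i : nat) is Some j then x j : nat else 0) * p ^ i.

Let p0 : 0 < p. Proof. exact: prime_gt0. Qed.
Let p1 : 1 < p. Proof. exact: prime_gt1. Qed.

Lemma val_lt (x : F) : (x : nat) < p.
Proof. by have := ltn_ord x; rewrite [X in _ < X -> _]Fp_cast. Qed.

Lemma natF (x : F) : (x : nat)%:R%R = x.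
Proof. exact: natr_Zp. Qed.

Lemma natF_eq (a b : nat) : (a%:R == b%:R :> F)%R = (a == b %[mod p]).
Proof. by rewrite -val_eqE /= !val_Fp_nat. Qed.

Lemma natF_pred : (p.-1%:R = -1 :> F)%R.
Proof.
apply/eqP; rewrite -subr_eq0 opprK natr1 prednK //.
by apply/eqP; rewrite pchar_Fp_0.
Qed.

Let encf N (x : {ffun 'I_N -> F}) (i : nat) : nat :=
  if insub i is Some j then x j : nat else 0.

Let encf_lt N (x : {ffun 'I_N -> F}) i : encf x i < p.
Proof. by rewrite /encf; case: insub => // j; exact: val_lt. Qed.

Lemma enc_lt N (x : {ffun 'I_N -> F}) : enc x < p ^ N.
Proof. exact: (@sum_digits_lt p N (encf x) (encf_lt x)). Qed.

Lemma digit_enc N (x : {ffun 'I_N -> F}) (i : 'I_N) : digit p i (enc x) = x i :> nat.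
Proof.
have := @digit_sum p N (encf x) i (encf_lt x) (ltn_ord i).
by rewrite /encf valK.
Qed.

Lemma encK N (x : {ffun 'I_N -> F}) : dec N (enc x) = x.
Proof. by apply/ffunP => i; rewrite ffunE digit_enc natF. Qed.

Lemma dec_nat N z (i : 'I_N) : (dec N z i : nat) = digit p i z.
Proof. by rewrite ffunE val_Fp_nat // modn_small // digit_lt. Qed.

Lemma decK N z : z < p ^ N -> enc (dec N z) = z.
Proof.
move=> lz; rewrite -[RHS](digits_sum p0 lz); apply: eq_bigr => i _.
by rewrite valK dec_nat.
Qed.

Lemma sum_enc N (phi : nat -> nat) :
  \sum_(z < p ^ N) phi z = \sum_(x : {ffun 'I_N -> F}) phi (enc x).
Proof.
rewrite (reindex (fun x : {ffun 'I_N -> F} => Ordinal (enc_lt x))) //=.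
exists (fun z : 'I_(p ^ N) => dec N z) => [x _|z _]; first exact: encK.
by apply: val_inj; rewrite /= decK.
Qed.

Lemma card_ffunF N : #|{: {ffun 'I_N -> F}}| = p ^ N.
Proof. by rewrite card_ffun card_Fp // card_ord. Qed.

Definition blkf j (x : X) : Xm := dec m (blk j (enc x)).

Lemma blkfE j x (i : 'I_m) (k : 'I_M) : j < w -> k = j * m + i :> nat ->
  blkf j x i = x k.
Proof.
move=> lj E; rewrite /blkf ffunE digit_digit // -E digit_enc; exact: natF.
Qed.

Lemma blkf_ord (j : nat) (i : 'I_m) : j < w -> j * m + i < M.
Proof. by move=> lj; rewrite /pcpM; have := ltn_ord i; nia. Qed.

Lemma lit_ord (j : 'I_w) : w * m + j < M.
Proof. by rewrite /pcpM ltn_add2l. Qed.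

Local Open Scope ring_scope.

Definition fCl (x : X) : F :=
  \sum_(b < 2 ^ M) (cl b)%:R * \prod_(i < M) (if digit 2 i b == 1%N then x i else 1 - x i).

Definition fg (At : Xm -> F) (x : X) : F :=
  fCl x * \prod_(j < w) (At (blkf j x) - x (Ordinal (lit_ord j))).

Definition ladd (x : Xm) t (h : Xm) : Xm := [ffun i => x i + t * h i].

Definition lines (At : Xm -> F) := forall x h : Xm,
  ldeg m (fun t => At (ladd x t h)).

Lemma axis_fCl : axis 1 fCl.
Proof.
move=> x i; apply: ldeg_sum => b; apply: (@ldegM _ 0 1); first exact: ldegC.
apply: (@ldeg_prod1 _ _ _ _ i) => k E.
  exists (if digit 2 k b == 1%N then x k else 1 - x k) => t; rewrite ffunE.
  by rewrite -val_eqE (negbTE E).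
have H1 : ldeg 1 (fun t : F => 1 - t) by apply: ldegD (ldegC _ _) (ldegN (ldegX _ _)).
have ki : k = i by apply: val_inj.
case: (digit 2 k b == 1%N).
  by apply: ldeg_eq (ldegX F 0) _ => t; rewrite ffunE ki eqxx.
by apply: ldeg_eq H1 _ => t; rewrite ffunE ki eqxx.
Qed.

(** Besides [fCl], of degree 1 in each variable, a coordinate occurs in a single factor: in a block,
    where [At] has degree at most [m] along lines, or as a sign. *)
Lemma axis_fg At : lines At -> axis m.+1 (fg At).
Proof.
move=> LA x i; apply: (@ldegM _ 1 m); first exact: axis_fCl.
pose j0 := (if i < w * m then i %/ m else i - w * m)%N.
have lin_i j : (j < w)%N -> j != j0 :> nat -> forall t, blkf j (upx x i t) = blkf j x.
  move=> lj nj t; apply/ffunP => k.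
  pose K := Ordinal (blkf_ord k lj).
  rewrite (@blkfE _ _ _ K) // [RHS](@blkfE _ _ _ K) // ffunE.
  case: eqP => // KE; case/eqP: nj; rewrite /j0 -KE /=.
  have -> : (j * m + k < w * m)%N by have := ltn_ord k; nia.
  by rewrite divnMDl // divn_small ?addn0.
apply: (@ldeg_prod1 _ _ _ _ j0) => j E.
  exists (At (blkf j x) - x (Ordinal (lit_ord j))) => t.
  rewrite lin_i // ffunE -val_eqE /=; case: eqP => // KE; case/eqP: E.
  rewrite /j0 -KE ltnNge leq_addr /= addKn //.
case: (ltnP i (w * m)) => li; last first.
  have cb t : blkf j (upx x i t) = blkf j x.
    apply/ffunP => k; pose K := Ordinal (blkf_ord k (ltn_ord j)).
    rewrite (@blkfE _ _ _ K) // [RHS](@blkfE _ _ _ K) // ffunE.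
    case: eqP => // KE; have := congr1 val KE => /=; have := ltn_ord k.
    have := ltn_ord j; nia.
  have H1 : ldeg 1 (fun t : F => At (blkf j x) - t).
    by apply: ldegD (ldegC _ _) (ldegN (ldegX _ _)).
  apply: ldeg_le m0 _; apply: ldeg_eq H1 _ => t; rewrite cb ffunE.
  case: eqP => // ne; case: ne; apply: val_inj => /=.
  by rewrite E /j0 ltnNge li /= subnKC.
have lim : (i %% m < m)%N by rewrite ltn_mod.
pose u := blkf j (upx x i 0).
pose h : Xm := [ffun k : 'I_m => (k == (i %% m)%N :> nat)%:R].
have cb t : blkf j (upx x i t) = ladd u t h.
  apply/ffunP => k; pose K := Ordinal (blkf_ord k (ltn_ord j)).
  rewrite (@blkfE _ _ _ K) // [ladd u t h k]ffunE [u k](@blkfE _ _ _ K) // !ffunE.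
  have jE : j = (i %/ m)%N :> nat by rewrite E /j0 li.
  have KE : (K == i) = (k == (i %% m)%N :> nat).
    rewrite -val_eqE /= jE {2}(divn_eq i m) eqn_add2l //.
  rewrite KE; case: eqP => _; last by rewrite mulr0 addr0.
  by rewrite add0r mulr1.
apply: ldegD.
  by apply: ldeg_eq (LA u h) _ => t; rewrite cb.
apply: ldegN; apply: ldeg_eq (ldegC _ (x (Ordinal (lit_ord j)))) _ => t.
rewrite ffunE; case: eqP => // KE; have := congr1 val KE => /= KE'.
by move: li; rewrite -KE' ltnNge leq_addr.
Qed.

Definition cubept N b : {ffun 'I_N -> F} := [ffun i : 'I_N => (digit 2 i b)%:R].

Lemma digit2 i b : (digit 2 i b = 0 \/ digit 2 i b = 1)%N.
Proof. by have := @digit_lt 2 i b isT; case: digit => [|[|k]] //; auto. Qed.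

Lemma cube_cubept b : cube (cubept M b).
Proof. by move=> i; rewrite ffunE; case: (digit2 i b) => ->; auto. Qed.

Lemma cubeE (x : X) : cube x -> exists2 b, (b < 2 ^ M)%N & x = cubept M b.
Proof.
move=> cx.
pose a (i : nat) : nat := if insub i is Some j then nat_of_bool (x j == 1) else 0%N.
have a2 i : (a i < 2)%N by rewrite /a; case: insub => // j; case: eqP.
exists (\sum_(i < M) a i * 2 ^ i)%N; first exact: sum_digits_lt.
apply/ffunP => i; rewrite ffunE digit_sum // /a valK.
by case: (cx i) => ->; rewrite ?eqxx // eq_sym oner_eq0.
Qed.

Lemma fCl_cube b : (b < 2 ^ M)%N -> fCl (cubept M b) = (cl b)%:R.
Proof.
move=> lb; rewrite /fCl (bigD1 (Ordinal lb)) //= [X in _ + X]big1 => [|b' ne].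
  rewrite big1 ?mulr1 ?addr0 // => i _; rewrite ffunE.
  by case: (digit2 i b) => -> //=; rewrite subr0.
have [i Hi] : exists i : 'I_M, digit 2 i b != digit 2 i b'.
  apply/existsP; apply: contraNT ne; rewrite negb_exists => /forallP H.
  apply/eqP/val_inj; rewrite /= -(digits_sum (isT : 0 < 2)%N (ltn_ord b')).
  rewrite -[RHS](digits_sum (isT : 0 < 2)%N lb); apply: eq_bigr => i _.
  by have := H i; rewrite negbK => /eqP ->.
rewrite (bigD1 i) //= ffunE.
case: (digit2 i b) (digit2 i b') Hi => -> [] -> //= _; rewrite ?subrr ?mul0r ?mulr0 //.
Qed.

Lemma blkf_cube j b : (j < w)%N -> blkf j (cubept M b) = cubept m (digit (2 ^ m) j b).
Proof.
move=> lj; apply/ffunP => i; rewrite (@blkfE _ _ _ (Ordinal (blkf_ord i lj))) //.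
by rewrite !ffunE digit_digit.
Qed.

(** A clause index holds the variables of its literals in the low [w * m] bits and their signs in
    the next [w]; a sign is the value that makes its literal true. *)
Definition satisfies (a : nat -> bool) := forall b, (b < 2 ^ M)%N -> cl b ->
  exists2 j, (j < w)%N & a (digit (2 ^ m) j b) = (digit 2 (w * m + j) b == 1%N).

(** [At] need not be Boolean on the cube: at the index of a clause a factor vanishes, which forces
    the value there to be the sign, so it is 0 or 1. Reading every value other than 1 as false is
    therefore harmless. *)
Lemma fg_sound At : (forall x, cube x -> fg At x = 0) ->
  satisfies (fun i => At (cubept m i) == 1).
Proof.
move=> H b lb cb; have := H _ (cube_cubept b); rewrite /fg fCl_cube // cb mul1r.
move/eqP/prodf_eq0 => [j _]; rewrite blkf_cube // ffunE /= subr_eq0 => /eqP E.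
exists j => //; rewrite E; case: (digit2 (w * m + j) b) => -> //=.
Qed.

Definition mle (a : nat -> bool) (u : Xm) : F :=
  \sum_(i < 2 ^ m) (a i)%:R * \prod_(k < m) (if digit 2 k i == 1%N then u k else 1 - u k).

Lemma mle_lines a : lines (mle a).
Proof.
move=> x h; apply: ldeg_sum => i; apply: (@ldegM _ 0 m); first exact: ldegC.
apply: (@ldeg_le _ (m * 1)); first by rewrite muln1.
apply: ldeg_prod => k.
have L : ldeg 1 (fun t : F => ladd x t h k).
  apply: ldeg_eq (ldegD (ldegC 1 (x k)) (ldegM (ldegX F 0) (ldegC 0 (h k)))) _ => t.
  by rewrite !ffunE.
case: (_ == _); first exact: L.
by apply: ldegD (ldegC _ _) (ldegN L).
Qed.

Lemma mle_cube a i : (i < 2 ^ m)%N -> mle a (cubept m i) = (a i)%:R.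
Proof.
move=> li; rewrite /mle (bigD1 (Ordinal li)) //= [X in _ + X]big1 => [|i' ne].
  rewrite big1 ?mulr1 ?addr0 // => k _; rewrite ffunE.
  by case: (digit2 k i) => -> //=; rewrite subr0.
have [k Hk] : exists k : 'I_m, digit 2 k i != digit 2 k i'.
  apply/existsP; apply: contraNT ne; rewrite negb_exists => /forallP H.
  apply/eqP/val_inj; rewrite /= -(digits_sum (isT : 0 < 2)%N (ltn_ord i')).
  rewrite -[RHS](digits_sum (isT : 0 < 2)%N li); apply: eq_bigr => k _.
  by have := H k; rewrite negbK => /eqP ->.
rewrite (bigD1 k) //= ffunE.
case: (digit2 k i) (digit2 k i') Hk => -> [] -> //= _; rewrite ?subrr ?mul0r ?mulr0 //.
Qed.

Lemma fg_complete a : satisfies a -> forall x, cube x -> fg (mle a) x = 0.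
Proof.
move=> sat x /cubeE[b lb ->]; rewrite /fg fCl_cube //.
case cb : (cl b); last by rewrite mul0r.
have [j lj E] := sat b lb cb.
rewrite mul1r (bigD1 (Ordinal lj)) //= blkf_cube // mle_cube; last first.
  by rewrite digit_lt // expn_gt0.
rewrite E ffunE /=.
by case: (digit2 (w * m + j) b) => ->; rewrite subrr mul0r.
Qed.

End PCP.
End PcpVerifier.

(** * Soundness and completeness of the verifier *)

Module PcpCorrectness.
Import EnergyBound LowDegreeTest SumCheck PcpVerifier.
Import Order.TTheory GRing.Theory Num.Theory.

Lemma chain_arith a b c d T U r : a < T -> b < T -> c <= d + r ->
  a + b + c + U <= d + (2 * T + U + r).
Proof. lia. Qed.

(** The closing count of soundness. Every point has a nonzero entry in the last table, a discrepancy
    between this table and the last polynomial, or a zero of that polynomial; for large [p] and [b0]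
    these sets are too small to exhaust all points. *)
Lemma pcp_arith N p b0 M m w z0 cM eM e0 : 0 < N -> 0 < p -> 4 * M * m.+1 <= p ->
  2 * (2 + w + 2 * w * m.+2 + 2 * M) <= b0 ->
  cM * b0 < N -> e0 * b0 <= (1 + w + w * (2 * m.+2)) * N ->
  eM * (p * b0) <= e0 * (p * b0) + M * (2 * (N * p) + m.+1 * N * b0) ->
  z0 * p <= M * m.+1 * N -> N <= cM + eM + z0 -> False.
Proof.
move=> N0 p0 p_big b0_main CM E0 EM SZ tot.
have T1 : cM * b0 * p < N * p by rewrite ltn_pmul2r.
have T2 := leq_mul E0 (leqnn p); have T3 := leq_mul SZ (leqnn b0).
have T4 := leq_mul tot (leqnn (p * b0)).
have T5 := leq_mul b0_main (leqnn p).
have T6 := leq_mul p_big (leqnn b0).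
set c := 2 + w + 2 * w * m.+2 + 2 * M in T5.
have T7 : N * (p * c + 2 * M * m.+1 * b0) <= N * (p * b0).
  rewrite leq_mul2l; apply/orP; right; clear -T5 T6.
  have E1 : 2 * c * p = 2 * (p * c) by ring.
  have E2 : 4 * M * m.+1 * b0 = 2 * (2 * M * m.+1 * b0) by ring.
  rewrite E1 [b0 * p]mulnC in T5; rewrite E2 in T6.
  by move: (p * c) (p * b0) (2 * M * m.+1 * b0) T5 T6 => x y z; lia.
suff : N * (p * b0) < N * (p * c + 2 * M * m.+1 * b0) by rewrite ltnNge T7.
apply: leq_ltn_trans T4 _.
have -> : (cM + eM + z0) * (p * b0) = cM * b0 * p + eM * (p * b0) + z0 * p * b0 by ring.
have R3 : e0 * (p * b0) = e0 * b0 * p by ring.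
have R4 : N * (p * c + 2 * M * m.+1 * b0) =
    N * p + (1 + w + w * (2 * m.+2)) * N * p + M * (2 * (N * p) + m.+1 * N * b0)
     + M * m.+1 * N * b0 by rewrite /c; ring.
rewrite R4; rewrite R3 in EM; clear -T1 T2 T3 EM.
move: (cM * b0 * p) (eM * (p * b0)) (z0 * p * b0) (e0 * b0 * p) T1 T2 T3 EM.
move: (N * p) ((1 + w + w * (2 * m.+2)) * N * p) (M * (2 * (N * p) + m.+1 * N * b0)).
by move: (M * m.+1 * N * b0); lia.
Qed.

Section PCP.
Variables (p m w : nat) (cl : nat -> bool).
Hypothesis pp : prime p.
Hypothesis m0 : 0 < m.
Hypothesis w2 : 1 < w.
Local Notation M := (pcpM m w).
Local Notation F := 'F_p.
Local Notation X := {ffun 'I_M -> F}.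
Local Notation Xm := {ffun 'I_m -> F}.
Local Notation q := (pcpq m w).
Local Notation nv := (pcpnv p m w).
Local Notation fg := (@fg p m w cl).
Local Notation blkf := (@blkf p m w).
Let p0 : 0 < p. Proof. exact: prime_gt0. Qed.
Let N0 n : 0 < p ^ n. Proof. by rewrite expn_gt0 p0. Qed.

Lemma sumF (phi : nat -> nat) : \sum_(t < p) phi t = \sum_(t : F) phi t.
Proof.
transitivity (\sum_(0 <= t < (Zp_trunc (pdiv p)).+2) phi t); last by rewrite big_mkord.
by rewrite Fp_cast // big_mkord.
Qed.

Lemma blk_enc j (x : X) : blk p m j (enc x) = enc (blkf j x).
Proof. by rewrite /blkf decK // /blk digit_lt. Qed.

Lemma digit_encn n (x : {ffun 'I_n -> F}) (j : nat) (lj : j < n) :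
  digit p j (enc x) = x (Ordinal lj) :> nat.
Proof. exact: (digit_enc pp x (Ordinal lj)). Qed.

Lemma nup_enc (x : X) (i : 'I_M) (t : F) : nup p m w (enc x) i t = enc (upx x i t).
Proof.
apply: eq_bigr => j _; rewrite valK ffunE digit_enc // -val_eqE.
by case: eqP.
Qed.

Lemma nlin_enc (u h : Xm) e : nlin p m (enc u) (enc h) e = enc (ladd u e%:R%R h).
Proof.
apply: eq_bigr => i _; rewrite valK ffunE !digit_enc //; congr (_ * _).
rewrite -[in RHS](natF (u i)) -[in RHS](natF (h i)) -natrM -natrD.
by rewrite val_Fp_nat.
Qed.

Local Open Scope ring_scope.

Definition dpoly n b : {poly F} := \poly_(j < n) (digit p j b)%:R.

Lemma nev_dpoly n b t : (nev p n b t)%:R = (dpoly n b).[t%:R].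
Proof.
rewrite /nev horner_poly natr_sum; apply: eq_bigr => j _.
by rewrite natrM natrX.
Qed.

Lemma nG_enc (x : X) b : (nG p m w cl (enc x) b)%:R =
  fCl cl x * \prod_(j < w) ((digit p j b)%:R - x (Ordinal (lit_ord m j))) :> F.
Proof.
rewrite /nG natrM natr_prod; congr (_ * _).
  rewrite /nCl natr_sum; apply: eq_bigr => c _; rewrite natrM; congr (_ * _).
  rewrite natr_prod; apply: eq_bigr => i _; rewrite /nlit digit_enc //.
  case: eqP => _; first exact: natF.
  by rewrite natrD natrM natF_pred // mulN1r natF.
apply: eq_bigr => j _; rewrite (digit_encn x (lit_ord m j)) natrD natrM.
by rewrite natF_pred // mulN1r natF.
Qed.

Local Close Scope ring_scope.

Lemma tau_divmod t z : z < p ^ M -> ((t * p ^ M + z) %/ p ^ M = t) * ((t * p ^ M + z) %% p ^ M = z).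
Proof.
by move=> lz; rewrite divnMDl // divn_small // addn0 modnMDl modn_small.
Qed.

Lemma pMm j : j < w -> p ^ M = (p ^ m) ^ j * (p ^ m * p ^ (M - (j * m + m))).
Proof.
move=> lj; rewrite -expnM -!expnD; congr (_ ^ _).
by rewrite /pcpM; nia.
Qed.

(** Counting form of the fact that a block of a uniform point is uniform. *)
Lemma sum_blk j (phi : nat -> nat) : j < w ->
  (\sum_(z < p ^ M) phi (blk p m j z)) * p ^ m = p ^ M * \sum_(u < p ^ m) phi u.
Proof.
move=> lj; rewrite (pMm lj) (sum_ord_mul _ _ (fun z => phi (blk p m j z))).
have B0 : 0 < (p ^ m) ^ j by rewrite expn_gt0 N0.
transitivity ((\sum_(y < p ^ m * p ^ (M - (j * m + m))) \sum_(a < (p ^ m) ^ j)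
    phi (y %% p ^ m)) * p ^ m).
  congr (_ * _); apply: eq_bigr => y _; apply: eq_bigr => a _; congr phi.
  by rewrite /blk digitE // divnMDl // divn_small // addn0.
rewrite (sum_ord_mul _ _ (fun y => \sum_(a < (p ^ m) ^ j) phi (y %% p ^ m))).
transitivity ((\sum_(r < p ^ (M - (j * m + m))) \sum_(c < p ^ m)
   (p ^ m) ^ j * phi c) * p ^ m).
  congr (_ * _); apply: eq_bigr => r _; apply: eq_bigr => c _.
  by rewrite modnMDl modn_small // sum_nat_const card_ord.
by rewrite sum_nat_const card_ord -big_distrr /=; ring.
Qed.

Lemma sum_blk2 (phi : nat -> nat -> nat) :
  (\sum_(z < p ^ M) phi (blk p m 0 z) (blk p m 1 z)) * (p ^ m * p ^ m) =
  p ^ M * \sum_(u < p ^ m) \sum_(h < p ^ m) phi u h.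
Proof.
have E : p ^ M = p ^ m * (p ^ m * p ^ (M - (1 * m + m))).
  by rewrite (pMm w2) expn1.
rewrite E (sum_ord_mul _ _ (fun z => phi (blk p m 0 z) (blk p m 1 z))).
transitivity ((\sum_(y < p ^ m * p ^ (M - (1 * m + m))) \sum_(a < p ^ m)
    phi a (y %% p ^ m)) * (p ^ m * p ^ m)).
  congr (_ * _); apply: eq_bigr => y _; apply: eq_bigr => a _.
  rewrite /blk digitS !digit0 modnMDl modn_small // divnMDl //.
  by rewrite divn_small // addn0.
rewrite (sum_ord_mul _ _ (fun y => \sum_(a < p ^ m) phi a (y %% p ^ m))).
transitivity ((\sum_(r < p ^ (M - (1 * m + m))) \sum_(h < p ^ m) \sum_(u < p ^ m)
   phi u h) * (p ^ m * p ^ m)).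
  congr (_ * _); apply: eq_bigr => r _; apply: eq_bigr => h _.
  by apply: eq_bigr => u _; rewrite modnMDl modn_small.
by rewrite sum_nat_const card_ord exchange_big /=; ring.
Qed.

Section Sound.
Variable b0 : nat.
Hypothesis p_big : 4 * M * m.+1 <= p.
Hypothesis p_m : m.+2 < p.
Hypothesis b0_ldt : m.+2 * (2 * m.+2 * m.+1 + m.+1) <= b0.
Hypothesis b0_main : 2 * (2 + w + 2 * w * m.+2 + 2 * M) <= b0.
Variables (Pi : nat * nat -> F) (bf : nat -> nat).
Let bad v e t : bool := ((pcp_ans p m w cl v (bf v) e t)%:R != Pi (pcp_pos p m w v e t))%R.
Hypothesis few : (\sum_(v < nv) \sum_(e < q) \sum_(t < p) bad v e t) * (M.+2 * q * b0) <
  nv * q * p.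

Let N := p ^ M.
Let cN : #|{: X}| = N. Proof. exact: card_ffunF. Qed.

(** The factor [M.+2 * q] in [few] pays for all kinds and questions, so each single one is violated
    with probability below [1 / b0]. *)
Lemma few_kind tau e : tau < M.+2 -> e < q ->
  (\sum_(x : X) \sum_(t : F) bad (tau * p ^ M + enc x) e t) * b0 < N * p.
Proof.
move=> lt le.
have L : \sum_(x : X) \sum_(t : F) bad (tau * p ^ M + enc x) e t <=
   \sum_(v < nv) \sum_(e < q) \sum_(t < p) bad v e t.
  rewrite /pcpnv [M.+2 * p ^ M]mulnC (sum_ord_mul _ _ (fun v => \sum_(e < q) \sum_(t < p) bad v e t)).
  rewrite (bigD1 (Ordinal lt)) //= (leq_trans _ (leq_addr _ _)) //.
  rewrite (sum_enc pp M (fun z => \sum_(e < q) \sum_(t < p) bad (tau * p ^ M + z) e t)).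
  apply: leq_sum => x _; rewrite (bigD1 (Ordinal le)) //= (leq_trans _ (leq_addr _ _)) //.
  by rewrite (sumF (fun t => bad (tau * p ^ M + enc x) e t)).
have := few; rewrite /pcpnv -/N => H.
move: (leq_mul L (leqnn (M.+2 * q * b0))) => L2.
have {L2 H} := leq_ltn_trans L2 H; set s := (\sum_(x : X) _).
have -> : s * (M.+2 * q * b0) = M.+2 * q * (s * b0) by ring.
have -> : M.+2 * N * q * p = M.+2 * q * (N * p) by ring.
by rewrite ltn_mul2l => /andP[].
Qed.

Let fA (u : Xm) := Pi (0, enc u).
Let fi i (x : X) := Pi (i.+1, enc x).
Let dg j x : F := (digit p j (bf (enc (x : X))))%:R%R.

Let few0 e (P : X -> bool) : e < q ->
  (forall x t, bad (0 * p ^ M + enc x) e t = P x) -> (\sum_(x : X) P x) * b0 < N.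
Proof.
move=> le H; have := @few_kind 0 e isT le.
have -> : \sum_(x : X) \sum_(t : F) bad (0 * p ^ M + enc x) e t = (\sum_(x : X) P x) * p.
  rewrite big_distrl; apply: eq_bigr => x _ /=.
  under eq_bigr do rewrite H; by rewrite sum_nat_const card_Fp // mulnC.
by rewrite mulnAC ltn_pmul2r.
Qed.

Let few_A j : j < w -> (\sum_(x : X) (dg j x != fA (blkf j x))) * b0 < N.
Proof.
move=> lj; apply: (few0 (e := j)); first by rewrite /pcpq; lia.
move=> x t; rewrite /bad /pcp_ans /pcp_pos !tau_divmod ?enc_lt // eqxx lj.
by rewrite blk_enc.
Qed.

Let few_G : (\sum_(x : X)
  ((fCl cl x * \prod_(j < w) (dg j x - x (Ordinal (lit_ord m j))) != fi 0 x)%R)) * b0 < N.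
Proof.
apply: (few0 (e := w)); first by rewrite /pcpq; lia.
move=> x t; rewrite /bad /pcp_ans /pcp_pos !tau_divmod ?enc_lt // eqxx ltnn eqxx.
by rewrite nG_enc.
Qed.

Let few_M : (\sum_(x : X) ((0 != fi M x)%R)) * b0 < N.
Proof.
apply: (few0 (e := w.+1)); first by rewrite /pcpq; lia.
move=> x t; rewrite /bad /pcp_ans /pcp_pos !tau_divmod ?enc_lt // eqxx.
by rewrite ltnNge leqnSn /= gtn_eqF.
Qed.

Let P (i : 'I_M) (x : X) := dpoly m.+2 (bf (i.+1 * p ^ M + enc x)).

Let few_line (i : 'I_M) :
  (\sum_(x : X) \sum_(t : F) ((P i x).[t] != fi i (upx x i t))%R) * b0 < N * p.
Proof.
have := @few_kind i.+1 0 _ _; rewrite /pcpq => /(_ ltac:(have := ltn_ord i; lia) ltac:(lia)).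
apply: leq_ltn_trans; apply: eq_leq; congr (_ * _).
apply: eq_bigr => x _; apply: eq_bigr => t _; congr nat_of_bool.
rewrite /bad /pcp_ans /pcp_pos !tau_divmod ?enc_lt // /= ltn_ord nup_enc nev_dpoly natF //.
Qed.

Let few_lin (i : 'I_M) : (\sum_(x : X) \sum_(t : F)
   ((1 - t) * (P i x).[0] + t * (P i x).[1] != fi i.+1 (upx x i t))%R) * b0 < N * p.
Proof.
have := @few_kind i.+1 1 _ _; rewrite /pcpq => /(_ ltac:(have := ltn_ord i; lia) ltac:(lia)).
apply: leq_ltn_trans; apply: eq_leq; congr (_ * _).
apply: eq_bigr => x _; apply: eq_bigr => t _; congr nat_of_bool.
rewrite /bad /pcp_ans /pcp_pos !tau_divmod ?enc_lt // /= ltn_ord nup_enc.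
rewrite natrD !natrM natrD natrM natF_pred // nev_dpoly natF // mulN1r.
congr (_ + _ != _)%R; congr (_ * _)%R.
by rewrite horner_coef0 coef_poly.
Qed.

Let toX (v : 'rV[F]_m) : Xm := [ffun i => v ord0 i].
Let ofX (u : Xm) : 'rV[F]_m := \row_i u i.
Let toXK : cancel ofX toX. Proof. by move=> u; apply/ffunP => i; rewrite ffunE mxE. Qed.
Let ofXK : cancel toX ofX. Proof. by move=> v; apply/rowP => i; rewrite mxE ffunE. Qed.

Let f (v : 'rV[F]_m) : F := fA (toX v).

Let toX_line u t h : toX (u + t *: h)%R = ladd (toX u) t (toX h).
Proof. by apply/ffunP => i; rewrite !ffunE !mxE. Qed.

Let sum_rV (phi : Xm -> nat) : \sum_(v : 'rV[F]_m) phi (toX v) = \sum_(u < p ^ m) phi (dec p m u).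
Proof.
rewrite (sum_enc pp m (fun z => phi (dec p m z))).
rewrite (reindex ofX) /=; last by exists toX => ? _; [exact: toXK | exact: ofXK].
by apply: eq_bigr => u _; rewrite toXK encK.
Qed.

(** The label of a line claims a polynomial of degree at most [m] at [m + 2] points. If all claims
    hold, the finite difference of the table is zero there, so a failed test exhibits a violated
    question. *)
Let few_ldt : nbad (V := 'rV[F]_m) m f * b0 < m.+2 * (p ^ m * p ^ m).
Proof.
pose lt (u h : nat) : bool := ~~ line_test (V := 'rV[F]_m) m f (ofX (dec p m u)) (ofX (dec p m h)).
have E1 : nbad (V := 'rV[F]_m) m f = \sum_(u < p ^ m) \sum_(h < p ^ m) lt u h.
  rewrite /nbad.
  rewrite -(sum_rV (fun u => \sum_(h < p ^ m) (~~ line_test (V := 'rV[F]_m) m f (ofX u) (ofX (dec p m h))))).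
  apply: eq_bigr => v _; rewrite ofXK.
  rewrite -(sum_rV (fun h => ~~ line_test (V := 'rV[F]_m) m f v (ofX h))).
  by apply: eq_bigr => h _; rewrite ofXK.
have E2 := sum_blk2 lt; rewrite -E1 -/N in E2.
set sz := (\sum_(z < N) _) in E2.
suff L : sz * b0 < m.+2 * N.
  rewrite -(ltn_pmul2l (N0 M)) -/N mulnA -E2.
  have -> : sz * (p ^ m * p ^ m) * b0 = sz * b0 * (p ^ m * p ^ m) by ring.
  have -> : N * (m.+2 * (p ^ m * p ^ m)) = m.+2 * N * (p ^ m * p ^ m) by ring.
  by rewrite ltn_pmul2r // muln_gt0 !N0.
pose be (e : nat) (x : X) : bool :=
  ((dpoly m.+1 (bf (M.+1 * p ^ M + enc x))).[e%:R] != fA (ladd (blkf 0 x) e%:R (blkf 1 x)))%R.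
have few_e e : e < m.+2 -> (\sum_(x : X) be e x) * b0 < N.
  move=> le; have := @few_kind M.+1 e (leqnn _) ltac:(rewrite /pcpq; lia).
  have -> : \sum_(x : X) \sum_(t : F) bad (M.+1 * p ^ M + enc x) e t =
      (\sum_(x : X) be e x) * p.
    rewrite big_distrl; apply: eq_bigr => x _ /=.
    rewrite (eq_bigr (fun=> (be e x : nat))); first by rewrite sum_nat_const card_Fp // mulnC.
    move=> t _; congr nat_of_bool.
    rewrite /bad /pcp_ans /pcp_pos !tau_divmod ?enc_lt // /= ltnn nev_dpoly !blk_enc.
    by rewrite (minn_idPl _) // nlin_enc.
  by rewrite mulnAC ltn_pmul2r.
have L1 : sz <= \sum_(e < m.+2) \sum_(x : X) be e x.
  rewrite /sz /N (sum_enc pp M (fun z => lt (blk p m 0 z) (blk p m 1 z))).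
  rewrite exchange_big; apply: leq_sum => x _ /=; apply: sum_or => H.
  apply/existsP; apply: contraTT H; rewrite negb_exists /lt negbK => /forallP H.
  rewrite /line_test; apply/eqP.
  rewrite -[RHS](fd_poly (P := dpoly m.+1 (bf (M.+1 * p ^ M + enc x))) 0%R (size_poly _ _)).
  apply: eq_bigr => e _; congr (_ * _)%R; rewrite add0r.
  have := H e; rewrite /be negbK => /eqP ->; rewrite /f toX_line !toXK.
  by rewrite !blk_enc !encK.
apply: leq_ltn_trans (leq_mul L1 (leqnn b0)) _.
rewrite big_distrl /= -[X in _ < X * _](card_ord m.+2) -sum_nat_const.
rewrite [X in X < _]big_ord_recl [X in _ < X]big_ord_recl /=.
rewrite -addSn; apply: leq_add; first exact: few_e.
by apply: leq_sum => e _; apply/ltnW/few_e; rewrite /= /bump /= add1n ltnS.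
Qed.

(** The corrected assignment has degree at most [m] on lines, and the polynomial [g] built from it
    has small degree in each variable. Along the chain the tables stay close to the linearizations
    of [g], and the last table is mostly zero. If [g] were nonzero on the cube, Schwartz-Zippel
    would make the last linearization mostly nonzero. *)
Lemma pcp_sound : exists a, satisfies m w cl a.
Proof.
have nz (i : nat) : (0 < i <= m.+1) -> (i%:R != 0 :> F)%R.
  by move=> /andP[i0 im]; rewrite (natF_eq pp i 0) mod0n modn_small; lia.
have small : (2 * m.+2 * m.+1 + m.+1) * nbad (V := 'rV[F]_m) m f < #|{: 'rV[F]_m}| * #|{: 'rV[F]_m}|.
  rewrite card_mx mul1n card_Fp //; have := few_ldt; move: b0_ldt.
  move: (nbad _ _) (2 * m.+2 * m.+1 + m.+1) (p ^ m * p ^ m) => n c B H1 H2.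
  have H3 : m.+2 * (c * n) < m.+2 * B.
    by apply: leq_ltn_trans H2; rewrite mulnA mulnC leq_mul2l H1 orbT.
  by move: H3; rewrite ltn_pmul2l.
pose At (u : Xm) : F := corrected (V := 'rV[F]_m) m f (ofX u).
have LA : lines At.
  move=> x h.
  have [|a|Q sQ HQ] := @fd_is_poly p m (fun t => At (ladd x t h)) pp _ _.
  - by lia.
  - have := @corrected_line F _ m f nz small (ofX (ladd x a%:R h)) (ofX h).
    move=> E; rewrite -[RHS]E; apply: eq_bigr => i _; congr (_ * corrected _ _ _)%R.
    by apply/rowP => k; rewrite !mxE !ffunE mulrDl addrA.
  - by exists Q.
have closeA : (\sum_(u < p ^ m) (fA (dec p m u) != At (dec p m u))) * b0 <= 2 * m.+2 * p ^ m.
  have C := @corrected_close F _ m f.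
  have E : \sum_(x : 'rV[F]_m) (f x != corrected (V := 'rV[F]_m) m f x) =
     \sum_(u < p ^ m) (fA (dec p m u) != At (dec p m u)).
    rewrite -(sum_rV (fun u => fA u != At u)); apply: eq_bigr => v _.
    by rewrite /At ofXK.
  rewrite E card_mx mul1n card_Fp // in C.
  have key s n B : s * B <= 2 * n -> n * b0 < m.+2 * (B * B) -> 0 < B ->
      s * b0 <= 2 * m.+2 * B.
    move=> C1 L1 B0; rewrite -(leq_pmul2r B0).
    have C' := leq_mul C1 (leqnn b0).
    have -> : s * b0 * B = s * B * b0 by ring.
    apply: leq_trans C' _; rewrite -mulnA.
    have -> : 2 * m.+2 * B * B = 2 * (m.+2 * (B * B)) by ring.
    by rewrite leq_mul2l ltnW.
  exact: key C few_ldt (N0 m).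
have closeB j : j < w -> (\sum_(x : X) (fA (blkf j x) != At (blkf j x))) * b0 <= 2 * m.+2 * N.
  move=> lj; have E := sum_blk (fun u => fA (dec p m u) != At (dec p m u)) lj.
  rewrite (sum_enc pp M (fun z => fA (dec p m (blk p m j z)) != At (dec p m (blk p m j z)))) in E.
  rewrite -/N in E.
  rewrite -(leq_pmul2r (N0 m)) mulnAC.
  have -> : (\sum_(x : X) (fA (blkf j x) != At (blkf j x))) * p ^ m =
    N * \sum_(u < p ^ m) (fA (dec p m u) != At (dec p m u)) by rewrite -E.
  rewrite -mulnA; apply: leq_trans (leq_mul (leqnn N) closeA) _.
  by apply: eq_leq; ring.
pose g := fg At.
have ax : axis m.+1 g by exact: axis_fg.
have axg n : axis m.+1 (gg g n) by apply: axis_gg.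
pose e n := \sum_(x : X) (fi n x != gg g n x).
(* A wrong entry of the first table has one of three causes: the question about it is violated, the
   label disagrees with the assignment at a block, or the assignment was corrected there. *)
have e0 : e 0 * b0 <= (1 + w + w * (2 * m.+2)) * N.
  have L x : (fi 0 x != g x) <=
     ((fCl cl x * \prod_(j < w) (dg j x - x (Ordinal (lit_ord m j))) != fi 0 x)%R) +
     \sum_(j < w) (dg j x != fA (blkf j x)) + \sum_(j < w) (fA (blkf j x) != At (blkf j x)).
    case: (eqVneq (fi 0 x) (g x)) => [//|ng].
    have [/existsP[j H]|/existsPn H] := boolP [exists j : 'I_w, dg j x != fA (blkf j x)].
      apply: leq_trans (leq_b1 _) (leq_trans _ (leq_addr _ _)).
      apply: leq_trans (leq_addl _ _).
      exact: (@sum_or _ true (fun j : 'I_w => dg j x != fA (blkf j x)) (fun _ => ex_intro _ j H)).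
    have [/existsP[j H']|/existsPn H'] := boolP [exists j : 'I_w, fA (blkf j x) != At (blkf j x)].
      apply: leq_trans (leq_b1 _) (leq_trans _ (leq_addl _ _)).
      exact: (@sum_or _ true (fun j : 'I_w => fA (blkf j x) != At (blkf j x))
        (fun _ => ex_intro _ j H')).
    have -> : (fCl cl x * \prod_(j < w) (dg j x - x (Ordinal (lit_ord m j))))%R = g x.
      rewrite /g /PcpVerifier.fg; congr (_ * _)%R; apply: eq_bigr => j _; congr (_ - _)%R.
      by have := H j; have := H' j; rewrite !negbK => /eqP <- /eqP ->.
    apply: leq_trans (leq_b1 _) _; rewrite -addnA; apply: leq_trans (leq_addr _ _).
    by rewrite eq_sym ng.
  apply: leq_trans (_ : (\sum_(x : X) _) * b0 <= _); first rewrite leq_mul2r.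
    by apply/orP; right; apply: leq_sum => x _; exact: L.
  rewrite !big_split /= !mulnDl mul1n; apply: leq_add; [apply: leq_add|].
  - exact: ltnW few_G.
  - rewrite exchange_big big_distrl /= -[X in _ <= X * _](card_ord w) -sum_nat_const.
    by apply: leq_sum => j _; apply/ltnW/few_A.
  - rewrite exchange_big big_distrl /= -mulnA -[X in _ <= X * _](card_ord w) -sum_nat_const.
    by apply: leq_sum => j _; exact: closeB.
(* Each link costs the violations of its two questions and at most [m + 1] accidental agreements per
   segment. *)
have chain n : n <= M -> e n * (p * b0) <= e 0 * (p * b0) + n * (2 * (N * p) + m.+1 * N * b0).
  elim: n => [|n IH] ln; first by rewrite mul0n addn0.
  pose i := Ordinal ln.
  have S := @chain_step F M m.+1 i (fi n) (fi n.+1) (gg g n) (P i) (axg n)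
     (fun x => size_poly _ _).
  rewrite card_Fp // cN in S.
  have := few_line i; have := few_lin i; have := IH (ltnW ln).
  have E : e n.+1 = \sum_(x : X) (fi n.+1 x != lin i (gg g n) x).
    by apply: eq_bigr => x _; rewrite -(ggS g i).
  rewrite -E -/(e n) in S.
  move: S; set A3 := (X in X + _ + _ + _); set A1 := (X in _ + X + _ + _).
  move=> S I1 I3 I2.
  have I3' : A3 * b0 < N * p by exact: I3.
  have I2' : A1 * b0 < N * p by exact: I2.
  move: S I1 I3' I2'; move: (e n.+1) (e n) (e 0) A1 A3 => en1 en e00 A1 A3 S I1 I3' I2'.
  move: (m.+1 * N) S I1 => U S I1.
  apply: leq_trans (_ : (p * en1) * b0 <= _); first by apply: eq_leq; ring.
  apply: leq_trans (leq_mul S (leqnn b0)) _; rewrite !mulnDl (mulSn n).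
  have -> : p * en * b0 = en * (p * b0) by ring.
  exact: chain_arith.
case: (pselect (forall x, cube x -> g x = 0%R)) => [H|H].
  by exists (fun i => At (cubept p m i) == 1%R); apply: fg_sound H.
move/existsNP: H => [x0 /not_implyP[cx gx]].
have gM0 : gg g M x0 != 0%R by rewrite gg_cube //; apply/eqP.
have SZ := schwartz_zippel (axg M) gM0; rewrite card_Fp // cN in SZ.
have tot : N <= \sum_(x : X) ((0 != fi M x)%R) + e M + \sum_(x : X) (gg g M x == 0)%R.
  rewrite -cN -sum1_card -!big_split /=; apply: leq_sum => x _.
  by case: eqP => //= <-; case: eqP => //= <-; rewrite eqxx.
exfalso; apply: (pcp_arith (N0 M) p0 p_big b0_main few_M e0 (chain M (leqnn _)) SZ).
apply: leq_trans tot _; apply: leq_add; first apply: leq_add => //.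
  by apply: leq_sum => x _.
Qed.

End Sound.

Lemma number_with_digits (c : nat -> F) n :
  exists2 b, b < p ^ n & forall j, j < n -> ((digit p j b)%:R = c j)%R.
Proof.
have clt j : (c j : nat) < p by exact: val_lt.
exists (\sum_(j < n) (c j : nat) * p ^ j); first exact: (@sum_digits_lt p n (fun j => c j)).
by move=> j lj; rewrite (@digit_sum p n (fun j => c j)) // natF.
Qed.

Lemma dpoly_coef n b (P : {poly F}) : size P <= n ->
  (forall j, j < n -> ((digit p j b)%:R = P`_j)%R) -> dpoly n b = P.
Proof.
move=> sP H; apply/polyP => j; rewrite coef_poly; case: ltnP => lj; first exact: H.
by rewrite nth_default // (leq_trans sP).
Qed.

(** The honest tables are the multilinear extension of the satisfying assignment and the successive
    linearizations of the resulting polynomial; the labels list the corresponding values or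
    coefficients. *)
Lemma pcp_complete a : satisfies m w cl a ->
  exists (Pi : nat * nat -> F) (bf : nat -> nat),
   (forall v, bf v < pcpns p m w) /\
   forall v e t, v < nv -> e < q -> t < p ->
     ((pcp_ans p m w cl v (bf v) e t)%:R = Pi (pcp_pos p m w v e t))%R.
Proof.
move=> sat; pose At := @mle p m a; have LA : lines At by exact: mle_lines.
pose g := fg At.
have axg n : axis m.+1 (gg g n) by apply: axis_gg => //; exact: axis_fg.
have gM := gg_vanish (fg_complete pp m0 w2 sat : forall x, cube x -> g x = 0%R).
pose Pi (u : nat * nat) : F :=
  if u.1 == 0 then At (dec p m u.2) else gg g u.1.-1 (dec p M u.2).
suff H v : exists2 b, b < pcpns p m w & v < nv -> forall e t, e < q -> t < p ->
     ((pcp_ans p m w cl v b e t)%:R = Pi (pcp_pos p m w v e t))%R.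
  exists Pi, (fun v => s2val (cid2 (H v))); split=> [v|v e t lv le lt].
    by case: (cid2 (H v)).
  by case: (cid2 (H v)) => b /= _ /(_ lv); apply.
set z := v %% p ^ M; have lz : z < p ^ M by rewrite ltn_pmod.
pose x := dec p M z; have xz : enc x = z by rewrite decK.
have [t0|t0] := eqVneq (v %/ p ^ M) 0.
  have [b lb Hb] := number_with_digits (fun j => At (blkf j x)) q.
  exists b => // lv e t le lt; rewrite /pcp_ans /pcp_pos t0 eqxx -/z -xz.
  case: ltnP => lw.
    by rewrite Hb // /Pi /= blk_enc encK.
  case: (eqVneq e w) => [ew|nw]; rewrite /Pi /= encK //; try by rewrite gM.
  rewrite nG_enc /g /PcpVerifier.fg; congr (_ * _)%R; apply: eq_bigr => j _; congr (_ - _)%R.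
  by rewrite Hb //; have := ltn_ord j; rewrite /pcpq; lia.
case: (ltnP (v %/ p ^ M) M.+1) => lt; last first.
  have [P sP HP] := LA (blkf 0 x) (blkf 1 x).
  have [b lb Hb] := number_with_digits (fun j => P`_j)%R q.
  exists b => // lv e t le lt'; rewrite /pcp_ans /pcp_pos (negbTE t0) (leqNgt _ M) lt /=.
  rewrite -/z -xz nev_dpoly !blk_enc nlin_enc /Pi /= encK // HP.
  by rewrite (dpoly_coef sP) // => j lj; apply: Hb; rewrite /pcpq; lia.
have li : (v %/ p ^ M).-1 < M by move: t0 lt; case: (v %/ p ^ M).
pose i := Ordinal li.
have iS : i.+1 = v %/ p ^ M by rewrite /= prednK // lt0n.
have [P sP HP] := axg i x i.
have [b lb Hb] := number_with_digits (fun j => P`_j)%R q.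
have dP : dpoly m.+2 b = P.
  by apply: dpoly_coef => // j lj; apply: Hb; rewrite /pcpq; lia.
exists b => // lv e t le lt'; rewrite /pcp_ans /pcp_pos (negbTE t0) -ltnS lt -/z -xz.
have tF : (t : nat) = (t%:R : F)%R :> nat by rewrite val_Fp_nat // modn_small.
have -> : nup p m w (enc x) (v %/ p ^ M).-1 t = enc (upx x i t%:R%R).
  by rewrite -nup_enc -tF.
case: eqP => [e0|ne]; rewrite /Pi /=.
  by rewrite (negbTE t0) encK // nev_dpoly dP -HP.
rewrite encK // -iS (ggS g i) /lin !upxx ffunE eqxx !HP.
rewrite natrD !natrM natrD natrM natF_pred // mulN1r nev_dpoly dP.
congr (_ * _ + _)%R.
by rewrite horner_coef0 -dP coef_poly.
Qed.

End PCP.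
End PcpCorrectness.

(** * Closure properties of the computable functions *)

Module ComputableClosure.
Import TuringRuns ComputableFunctions EnergyBound PcpVerifier.
Lemma vcomp_ext f g : vcomp f -> (forall s, g s = f s) -> vcomp g.
Proof. by move=> H E; have -> : g = f by apply: funext. Qed.

Definition upren (r : nat -> nat) i := if i is j.+1 then (r j).+1 else 0.

(** The renaming passes under the two variables bound by an iteration, hence the double [upren].
    Weakening is the special case of [succn]. *)
Lemma vren f : vcomp f -> forall r : nat -> nat, vcomp (fun s => f (s.1, s.2 \o r)).
Proof.
elim=> {f}.
- by move=> i r; exact: comp_var.
- by move=> r; exact: comp_zero.
- by move=> f _ H r; apply: comp_succ (H r).
- by move=> f g _ H _ H' r; apply: comp_add (H r) (H' r).
- by move=> f g _ H _ H' r; apply: comp_sub (H r) (H' r).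
- by move=> f g _ H _ H' r; apply: comp_mul (H r) (H' r).
- by move=> f _ H r; apply: (comp_bit (H r)).
- move=> b a F B _ Hb _ Ha _ HF _ HB le r.
  have E i acc s : (scons i (scons acc s)).1 = s.1 by [].
  pose F' := fun s => F (s.1, s.2 \o upren (upren r)).
  have EF i acc s : F' (scons i (scons acc s)) = F (scons i (scons acc (s.1, s.2 \o r))).
    by rewrite /F'; congr F; congr pair; apply: funext => -[|[|j]].
  apply: (@vcomp_ext (fun s => iteri (b (s.1, s.2 \o r))
      (fun i acc => F' (scons i (scons acc s))) (a (s.1, s.2 \o r)))).
    apply: (comp_iter (Hb r) (Ha r) (HF _) (HB r)) => i acc s.
    by rewrite -/(F' _) EF le.
  by move=> s; apply: eq_iteri => i acc; rewrite EF.
Qed.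

Definition tl (s : env) : env := (s.1, fun i => s.2 i.+1).

Lemma vtl f : vcomp f -> vcomp (fun s => f (tl s)).
Proof. by move=> H; exact: (vren H succn). Qed.

Lemma vconst c : vcomp (fun=> c).
Proof. by elim: c => [|c IH]; [exact: comp_zero | exact: comp_succ]. Qed.

Lemma viter b a F B : vcomp b -> vcomp a ->
  vcomp (fun s => F (s.2 0) (s.2 1) (tl (tl s))) -> vcomp B ->
  (forall i acc s, F i acc s <= B s) ->
  vcomp (fun s => iteri (b s) (fun i acc => F i acc s) (a s)).
Proof.
move=> Hb Ha HF HB le.
have E s : tl (tl (scons 0 (scons 0 s))) = s by case: s.
apply: vcomp_ext (comp_iter Hb Ha HF HB _) _.
- by move=> i acc [x s] /=; exact: le.
- by move=> [x s]; apply: eq_iteri.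
Qed.

Lemma vmin f g : vcomp f -> vcomp g -> vcomp (fun s => minn (f s) (g s)).
Proof.
move=> Hf Hg; apply: vcomp_ext (comp_sub Hf (comp_sub Hf Hg)) _ => s; lia.
Qed.

Lemma vle f g : vcomp f -> vcomp g -> vcomp (fun s => f s <= g s).
Proof.
move=> Hf Hg; apply: vcomp_ext (comp_sub (vconst 1) (comp_sub Hf Hg)) _ => s.
by case: leqP => ?; lia.
Qed.

Lemma vlt f g : vcomp f -> vcomp g -> vcomp (fun s => f s < g s).
Proof. by move=> Hf Hg; apply: vle Hg; exact: comp_succ. Qed.

Lemma vand (a b : env -> bool) : vcomp (fun s => a s) -> vcomp (fun s => b s) ->
  vcomp (fun s => a s && b s).
Proof. by move=> Ha Hb; apply: vcomp_ext (comp_mul Ha Hb) _ => s; case: (a s); case: (b s). Qed.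

Lemma vneg (a : env -> bool) : vcomp (fun s => a s) -> vcomp (fun s => ~~ a s).
Proof. by move=> Ha; apply: vcomp_ext (comp_sub (vconst 1) Ha) _ => s; case: (a s). Qed.

Lemma vor (a b : env -> bool) : vcomp (fun s => a s) -> vcomp (fun s => b s) ->
  vcomp (fun s => a s || b s).
Proof.
move=> Ha Hb; apply: vcomp_ext (vneg (vand (vneg Ha) (vneg Hb))) _ => s.
by case: (a s); case: (b s).
Qed.

Lemma veq f g : vcomp f -> vcomp g -> vcomp (fun s => f s == g s).
Proof.
move=> Hf Hg; apply: vcomp_ext (vand (vle Hf Hg) (vle Hg Hf)) _ => s.
by rewrite -eqn_leq.
Qed.

Lemma vif (a : env -> bool) f g : vcomp (fun s => a s) -> vcomp f -> vcomp g ->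
  vcomp (fun s => if a s then f s else g s).
Proof.
move=> Ha Hf Hg.
apply: vcomp_ext (comp_add (comp_mul Ha Hf) (comp_mul (vneg Ha) Hg)) _ => s.
by case: (a s); rewrite /= ?mul1n ?mul0n ?addn0.
Qed.

Lemma vifb (a b c : env -> bool) : vcomp (fun s => a s) -> vcomp (fun s => b s) ->
  vcomp (fun s => c s) -> vcomp (fun s => if a s then b s else c s).
Proof.
by move=> Ha Hb Hc; apply: vcomp_ext (vif Ha Hb Hc) _ => s; case: (a s).
Qed.

Lemma vpred f : vcomp f -> vcomp (fun s => (f s).-1).
Proof. by move=> Hf; apply: vcomp_ext (comp_sub Hf (vconst 1)) _ => s; rewrite subn1. Qed.

Lemma vall b (P : nat -> env -> bool) : vcomp b ->
  vcomp (fun s => P (s.2 0) (tl s)) -> vcomp (fun s => all (fun i => P i s) (iota 0 (b s))).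
Proof.
move=> Hb HP.
have := @viter b (fun=> 1) (fun i acc s => minn 1 acc * P i s) (fun=> 1) Hb (vconst 1).
move=> H; apply: vcomp_ext (H _ (vconst 1) _) _.
- apply: comp_mul; first by apply: vmin (vconst 1) (comp_var 1).
  apply: vcomp_ext (vren HP (fun i => if i is j.+1 then j.+2 else 0)) _ => s.
  by congr (P _ _ : nat).
- by move=> i acc s; case: (P i s); lia.
- move=> s; elim: (b s) => // n IH.
  by rewrite -addn1 iotaD all_cat /= add0n andbT addn1 /= -IH; case: all; case: (P n s).
Qed.

(** An iteration needs a computable bound, which the cap provides. Truncating after each summand is
    harmless because later truncations absorb earlier ones. *)
Lemma vsumcap b F c : vcomp b -> vcomp (fun s => F (s.2 0) (tl s)) -> vcomp c ->
  vcomp (fun s => minn (\sum_(i < b s) F i s) (c s)).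
Proof.
move=> Hb HF Hc.
have H := @viter b (fun=> 0) (fun i acc s => minn (acc + F i s) (c s)) c Hb (vconst 0).
apply: vcomp_ext (H _ Hc _) _.
- apply: vmin; last exact: vtl (vtl Hc).
  apply: comp_add (comp_var 1) _.
  by apply: vcomp_ext (vren HF (fun i => if i is j.+1 then j.+2 else 0)) _.
- by move=> i acc s; rewrite geq_minr.
- move=> s; elim: (b s) => [|n IH]; first by rewrite big_ord0 min0n.
  have E a b' d : minn (a + b') d = minn (minn a d + b') d by lia.
  by rewrite big_ord_recr /= -IH -E.
Qed.

Lemma vcount b (P : nat -> env -> bool) : vcomp b -> vcomp (fun s => P (s.2 0) (tl s)) ->
  vcomp (fun s => \sum_(i < b s) P i s).
Proof.
move=> Hb HP; apply: vcomp_ext (@vsumcap b (fun i s => P i s) b Hb HP Hb) _ => s.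
rewrite (minn_idPl _) // -[X in _ <= X](card_ord (b s)) -sum1_card.
by apply: leq_sum => i _; case: (P i s).
Qed.

Lemma sum_ltn a n : \sum_(i < n) (i < a) = minn a n.
Proof.
elim: n => [|n IH]; first by rewrite big_ord0 minn0.
by rewrite big_ord_recr /= IH; case: (ltnP n a); lia.
Qed.

(** The quotient counts the positive multiples of [g s] up to [f s]; the test [0 < g s] reproduces
    the value 0 of a division by zero. *)
Lemma vdiv f g : vcomp f -> vcomp g -> vcomp (fun s => f s %/ g s).
Proof.
move=> Hf Hg.
have H := @vcount f (fun i s => i.+1 * g s <= f s) Hf.
apply: vcomp_ext (comp_mul (vlt (vconst 0) Hg) (H _)) _.
  by apply: vle (vtl Hf); apply: comp_mul (vtl Hg); apply: comp_succ (comp_var 0).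
move=> s; case: (posnP (g s)) => [->|g0]; first by rewrite divn0.
rewrite mul1n.
have E : \sum_(i < f s) (i.+1 * g s <= f s) = \sum_(i < f s) (i < f s %/ g s).
  by apply: eq_bigr => i _; rewrite leq_divRL.
by rewrite E sum_ltn (minn_idPl _) ?leq_div.
Qed.

Lemma vmod f g : vcomp f -> vcomp g -> vcomp (fun s => f s %% g s).
Proof.
move=> Hf Hg; apply: vcomp_ext (comp_sub Hf (comp_mul (vdiv Hf Hg) Hg)) _ => s.
by rewrite {2}(divn_eq (f s) (g s)) addKn.
Qed.

(** Powers leave the class, capped powers do not; the cap is inactive wherever the power is known to
    be small. *)
Lemma vexpcap f g c : vcomp f -> vcomp g -> vcomp c ->
  vcomp (fun s => minn (f s ^ g s) (c s)).
Proof.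
move=> Hf Hg Hc.
have H := @viter g (fun s => minn 1 (c s)) (fun i acc s => minn (acc * f s) (c s)) c Hg
  (vmin (vconst 1) Hc).
apply: vcomp_ext (H _ Hc _) _.
- by apply: vmin (vtl (vtl Hc)); apply: comp_mul (comp_var 1) (vtl (vtl Hf)).
- by move=> i acc s; rewrite geq_minr.
- move=> s; elim: (g s) => [|n IH]; first by rewrite expn0.
  rewrite /= -IH expnS; case: (posnP (f s)) => [->|f0]; first by rewrite mul0n muln0.
  by case: (leqP (f s ^ n) (c s)) => le; [rewrite mulnC | nia].
Qed.

Lemma digit_capE b j x : digit b j x = (x %/ minn (b ^ j) x.+1) %% b.
Proof.
case: (posnP b) => [->|b0].
  case: j => [|j]; first by rewrite digit0 expn0 (minn_idPl _) ?divn1.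
  by rewrite exp0n // min0n divn0 /digit /= divn0.
rewrite digitE //; congr (_ %% _); case: (leqP (b ^ j) x.+1) => le //.
by rewrite !divn_small // ltnW.
Qed.

Lemma vdigit b j x : vcomp b -> vcomp j -> vcomp x ->
  vcomp (fun s => digit (b s) (j s) (x s)).
Proof.
move=> Hb Hj Hx; apply: vcomp_ext
  (vmod (vdiv Hx (vexpcap Hb Hj (comp_succ Hx))) Hb) _ => s.
exact: digit_capE.
Qed.

(** Since [n %% 0] is [n], the plain residue is not bounded by [p]; this variant is, for all
    arguments. *)
Definition mo n p := if p == 0 then 0 else n %% p.

Lemma mo_le n p : mo n p <= p.
Proof. by rewrite /mo; case: eqP => // /eqP p0; rewrite ltnW // ltn_mod lt0n. Qed.

Lemma mo_mo a p : mo (mo a p) p = mo a p.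
Proof. by rewrite /mo; case: (p == 0) => //; rewrite modn_mod. Qed.

Lemma mo_add a b p : mo (a + b) p = mo (mo a p + mo b p) p.
Proof. by rewrite /mo; case: eqP => // _; rewrite modnDm. Qed.

Lemma mo_mul a b p : mo (a * b) p = mo (mo a p * mo b p) p.
Proof. by rewrite /mo; case: eqP => // _; rewrite modnMm. Qed.

(** Functions of possibly huge value of which only the residue is computed. Sums, products and
    powers can be formed without intermediate growth. *)
Definition vcm p (f : env -> nat) := vcomp (fun s => mo (f s) (p s)).

Lemma vmo f p : vcomp f -> vcomp p -> vcm p f.
Proof.
move=> Hf Hp; apply: vif; [exact: veq Hp (vconst 0) | exact: vconst | exact: vmod].
Qed.

Lemma vcm_add p f g : vcomp p -> vcm p f -> vcm p g -> vcm p (fun s => f s + g s).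
Proof.
move=> Hp Hf Hg; apply: vcomp_ext (vmo (comp_add Hf Hg) Hp) _ => s; exact: mo_add.
Qed.

Lemma vcm_mul p f g : vcomp p -> vcm p f -> vcm p g -> vcm p (fun s => f s * g s).
Proof.
move=> Hp Hf Hg; apply: vcomp_ext (vmo (comp_mul Hf Hg) Hp) _ => s; exact: mo_mul.
Qed.

Lemma vcm_if p (a : env -> bool) f g : vcomp (fun s => a s) -> vcm p f -> vcm p g ->
  vcm p (fun s => if a s then f s else g s).
Proof.
by move=> Ha Hf Hg; apply: vcomp_ext (vif Ha Hf Hg) _ => s; case: (a s).
Qed.

Lemma vcm_sum p b F : vcomp p -> vcomp b ->
  vcm (fun s => p (tl s)) (fun s => F (s.2 0) (tl s)) ->
  vcm p (fun s => \sum_(i < b s) F i s).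
Proof.
move=> Hp Hb HF.
have H := @viter b (fun=> 0) (fun i acc s => mo (acc + mo (F i s) (p s)) (p s)) p Hb (vconst 0).
apply: vcomp_ext (H _ Hp _) _.
- apply: vmo (vtl (vtl Hp)); apply: comp_add (comp_var 1) _.
  by apply: vcomp_ext (vren HF (fun i => if i is j.+1 then j.+2 else 0)) _.
- by move=> i acc s; exact: mo_le.
- move=> s; elim: (b s) => [|n IH]; first by rewrite big_ord0 /mo mod0n; case: ifP.
  rewrite big_ord_recr /= -IH mo_add [RHS]mo_add; congr mo.
  by rewrite !mo_mo.
Qed.

Lemma vcm_prod p b F : vcomp p -> vcomp b ->
  vcm (fun s => p (tl s)) (fun s => F (s.2 0) (tl s)) ->
  vcm p (fun s => \prod_(i < b s) F i s).
Proof.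
move=> Hp Hb HF.
have H := @viter b (fun s => mo 1 (p s))
  (fun i acc s => mo (acc * mo (F i s) (p s)) (p s)) p Hb (vmo (vconst 1) Hp).
apply: vcomp_ext (H _ Hp _) _.
- apply: vmo (vtl (vtl Hp)); apply: comp_mul (comp_var 1) _.
  by apply: vcomp_ext (vren HF (fun i => if i is j.+1 then j.+2 else 0)) _.
- by move=> i acc s; exact: mo_le.
- move=> s; elim: (b s) => [|n IH]; first by rewrite big_ord0.
  rewrite big_ord_recr /= -IH mo_mul [RHS]mo_mul; congr mo.
  by rewrite !mo_mo.
Qed.

Lemma vcm_exp p f n : vcomp p -> vcm p f -> vcomp n -> vcm p (fun s => f s ^ n s).
Proof.
move=> Hp Hf Hn; apply: vcomp_ext (@vcm_prod p n (fun i s => f s) Hp Hn (vtl Hf)) _ => s.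
by rewrite prod_nat_const card_ord.
Qed.

Lemma vpoly_expn f c : vcomp f -> vcomp (fun s => f s ^ c).
Proof.
move=> Hf; elim: c => [|c IH]; first exact: (vconst 1).
by apply: vcomp_ext (comp_mul Hf IH) _ => s; rewrite expnS.
Qed.

Lemma vlog f : vcomp f -> vcomp (fun s => trunc_log 2 (f s)).
Proof.
move=> Hf.
have H := @vcount f (fun i s => minn (2 ^ i.+1) (f s).+1 <= f s) Hf.
apply: vcomp_ext (H _) _.
  apply: vle (vtl Hf); apply: vexpcap (vconst 2) _ (comp_succ (vtl Hf)).
  exact: comp_succ (comp_var 0).
move=> s; set n := f s.
have E : \sum_(i < n) (minn (2 ^ i.+1) n.+1 <= n) = \sum_(i < n) (i < trunc_log 2 n).
  apply: eq_bigr => i _; case: (posnP n) => n0; first by case: i => i; rewrite n0.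
  rewrite geq_min ltnn orbF; congr nat_of_bool; apply/idP/idP => lt.
    exact: trunc_log_max.
  by apply: leq_trans (trunc_logP (isT : 1 < 2) n0); rewrite leq_exp2l.
rewrite E; clear E H.
have le : trunc_log 2 n <= n.
  case: (posnP n) => [->|n0]; first by rewrite trunc_log0.
  by apply: leq_trans (trunc_logP (isT : 1 < 2) n0); apply/ltnW/ltn_expl.
by rewrite sum_ltn (minn_idPl _).
Qed.

Lemma vfactcap f c : vcomp f -> vcomp c -> vcomp (fun s => minn (f s)`! (c s)).
Proof.
move=> Hf Hc.
have H := @viter f (fun s => minn 1 (c s)) (fun i acc s => minn (acc * i.+1) (c s)) c Hf
  (vmin (vconst 1) Hc).
apply: vcomp_ext (H _ Hc _) _.
- apply: vmin (vtl (vtl Hc)); apply: comp_mul (comp_var 1) (comp_succ (comp_var 0)).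
- by move=> i acc s; rewrite geq_minr.
- move=> s; elim: (f s) => [|n IH]; first by rewrite fact0.
  rewrite /= -IH factS; case: (leqP n`! (c s)) => le; first by rewrite mulnC.
  nia.
Qed.

(** The smallest divisor above 1 is 2 plus the number of segments [2, ..., i + 2] that contain no
    divisor. *)
Lemma vpdiv f : vcomp f -> vcomp (fun s => pdiv (f s).+2).
Proof.
move=> Hf; pose P i s := all (fun j => ~~ (j.+2 %| (f s).+2)) (iota 0 i.+1).
have H := @vcount (fun s => (f s).+1) P (comp_succ Hf).
apply: vcomp_ext (comp_succ (comp_succ (H _))) _.
  apply: vall; first exact: comp_succ (comp_var 0).
  apply: vneg; apply: veq (vconst 0).
  apply: vmod; first by apply: comp_succ; apply: comp_succ; apply: vtl (vtl Hf).
  by apply: comp_succ; apply: comp_succ; exact: comp_var.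
move=> s; set n := (f s).+2; have pp : prime (pdiv n) by rewrite pdiv_prime.
have p2 := prime_gt1 pp; have pd := pdiv_dvd n.
have pn : pdiv n <= n by rewrite dvdn_leq.
have E i : P i s = (i.+2 < pdiv n).
  apply/allP/idP => [Hi|lt j].
    rewrite ltnNge; apply/negP => le.
    have := Hi (pdiv n).-2; rewrite mem_iota; have -> : (pdiv n).-2.+2 = pdiv n by lia.
    by rewrite pd => /(_ ltac:(lia)).
  rewrite mem_iota => lj; apply/negP => dj.
  have := pdiv_min_dvd (isT : 1 < j.+2) dj; rewrite leqNgt => /negP; apply.
  by apply: leq_ltn_trans lt; move: lj; rewrite add0n !ltnS.
have E' i : P i s = (i < (pdiv n).-2) by rewrite E; apply/idP/idP; lia.
under eq_bigr do rewrite E'.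
by rewrite sum_ltn; rewrite /n in pn p2 *; lia.
Qed.

(** A dependence on finitely many values can be hard-wired; in this way the tables of a fixed
    machine enter. *)
Lemma vcase c f (h : nat -> env -> nat) : vcomp f -> (forall s, f s < c) ->
  (forall i, vcomp (h i)) -> vcomp (fun s => h (f s) s).
Proof.
move=> Hf lt Hh.
have H : vcomp (fun s => if f s < c then h (f s) s else 0).
  elim: c {lt} => [|c IH]; first exact: vconst.
  apply: vcomp_ext (vif (veq Hf (vconst c)) (Hh c) IH) _ => s.
  by rewrite ltnS leq_eqVlt; case: eqP => [->|].
by apply: vcomp_ext H _ => s; rewrite lt.
Qed.
End ComputableClosure.

(** * The Cook-Levin tableau, with clauses recognized from their index *)

Module CookLevinTableau.
Import TuringRuns ComputableFunctions EnergyBound PcpVerifier ComputableClosure.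
Import Order.TTheory GRing.Theory Num.Theory.

Lemma clause_number m w (l : nat -> nat) (sg : nat -> bool) :
  (forall j, j < w -> l j < 2 ^ m) -> exists2 b, b < 2 ^ pcpM m w &
    forall j, j < w -> digit (2 ^ m) j b = l j /\ digit 2 (w * m + j) b = sg j.
Proof.
move=> lm; have B0 : 0 < 2 ^ m by rewrite expn_gt0.
pose l' j := if j < w then l j else 0.
have ll j : l' j < 2 ^ m by rewrite /l'; case: ifP => // /lm.
pose b1 := \sum_(j < w) l' j * (2 ^ m) ^ j.
have b1lt : b1 < 2 ^ (w * m) by rewrite mulnC expnM; exact: sum_digits_lt.
pose b2 := \sum_(j < w) sg j * 2 ^ j.
have sg2 j : sg j < 2 by case: (sg j).
have b2lt : b2 < 2 ^ w by exact: (@sum_digits_lt 2 w (fun j => sg j)).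
exists (b2 * 2 ^ (w * m) + b1).
  rewrite /pcpM expnD; move: b1lt b2lt.
  by move: b1 b2 (2 ^ (w * m)) (2 ^ w) => x y z t; nia.
have digit2E j : j < w -> digit (2 ^ m) j (b2 * 2 ^ (w * m) + b1) = digit (2 ^ m) j b1.
  move=> jw; rewrite !digitE // -expnM.
  have -> : b2 * 2 ^ (w * m) = (b2 * (2 ^ m * 2 ^ (m * (w - j.+1)))) * 2 ^ (m * j).
    by rewrite -!mulnA -!expnD; congr (_ * 2 ^ _); nia.
  rewrite divnMDl ?expn_gt0 // mulnCA -modnDml modnMr add0n //.
move=> j jw; split.
  by rewrite digit2E // /b1 digit_sum // /l' jw.
rewrite digitE // expnD divnMA addnC divnDMl ?expn_gt0 // (divn_small b1lt) add0n.
by rewrite -digitE // /b2 (@digit_sum 2 w (fun j => sg j)).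
Qed.

Section CookLevin.
Variable N : tm.
Local Notation K0 := (tm_tapes N).+1.
Local Notation sym := (symbol (tm_aux N)).
Local Notation act := (action K0 (tm_state N) (tm_aux N)).
Local Notation cell := (tm_state N * option act * K0.-tuple sym)%type.

(** A cell stores the symbols of all tapes at one offset from the heads, together with the state and
    the guessed action of the whole row. Contents are shifted instead of heads, so all heads stay at
    position [T]. *)
Definition cell0 : cell := (tm_start N, None, [tuple None | _ < K0]).
Definition ncell := #|{: cell}|.
Local Notation K := ncell.
Definition cell_of g : cell := nth cell0 (enum {: cell}) g.
Definition cell_rank (c : cell) : nat := enum_rank c.

Lemma cell_rankK c : cell_of (cell_rank c) = c.
Proof. by rewrite /cell_of /cell_rank nth_enum_rank. Qed.

Lemma cell_rank_lt c : cell_rank c < K.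
Proof. by rewrite /cell_rank ltn_ord. Qed.

Lemma ncell_gt0 : 0 < K. Proof. exact: leq_ltn_trans (cell_rank_lt cell0). Qed.

(** Enough for one literal per content of a cell and for the four literals of a window; clauses with
    fewer literals repeat one. *)
Definition litw := K + 4.

(* The position flag is 1, 2, 3 for the cell under the head, just left of it
   and just right of it. *)
Definition window_ok (fl : nat) (a b c d : cell) : bool :=
  [&& a.1.2 == b.1.2, b.1.2 == c.1.2 &
    if b.1.2 is Some al then
      [&& (fl == 1) ==> (al \in tm_trans b.1.1 b.2), d.1.1 == al.1 &
        [forall i, tnth d.2 i == match (tnth al.2 i).2 with
          | Some true => if fl == 2 then (tnth al.2 i).1 else tnth c.2 i
          | Some false => if fl == 3 then (tnth al.2 i).1 else tnth a.2 i
          | None => if fl == 1 then (tnth al.2 i).1 else tnth b.2 i end]]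
    else (fl == 1) ==> (tm_trans b.1.1 b.2 == set0) && (b.1.1 \in tm_accept N)].

Definition initial_ok (ic : nat) (a : cell) : bool :=
  (a.1.1 == tm_start N) && [forall i, tnth a.2 i ==
     if i == ord0 then (if ic == 0 then None else Some (inl (ic == 2))) else None].

Definition flag T sg := if sg == T then 1 else if sg.+1 == T then 2
  else if sg == T.+1 then 3 else 0.

Lemma flagE T sg : ((flag T sg == 1) = (sg == T)) * ((flag T sg == 2) = (sg.+1 == T)) *
  ((flag T sg == 3) = (sg == T.+1)).
Proof.
by rewrite /flag; split; [split|]; case: (sg =P T) => e1; case: (sg.+1 =P T) => e2;
  case: (sg =P T.+1) => e3 //; lia.
Qed.

(** 0 is a blank, otherwise the code is the bit plus 1; the input starts under the head at position
    [T]. *)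
Definition input_code (x : seq bool) n T sg :=
  if (T <= sg) && (sg - T < n) then (nth false x (sg - T)).+1 else 0.

Section Clauses.
Variables (x : seq bool) (n T m : nat).
Local Notation W := (2 * T).+1.

Definition ltime i := i %/ (K * W).
Definition lpos i := (i %/ K) %% W.
Definition lcell i := i %% K.
Definition var t sg g := (t * W + sg) * K + g.

Definition lit b j := digit (2 ^ m) j b.
Definition sgn b j := digit 2 (litw * m + j) b.

(** Some content of the cell is true. The clause is recognized by the shape of the literals and
    signs read off [b]. Several true contents are possible: the other clauses constrain each of
    them. *)
Definition cell_clause b :=
  all (fun j => (sgn b j == 1) && (lit b j == lit b 0 %/ K * K + minn j K.-1)) (iota 0 litw)
  && (ltime (lit b 0) <= T).

Definition initial_clause b :=
  [&& all (fun j => (sgn b j == 0) && (lit b j == lit b 0)) (iota 0 litw),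
      ltime (lit b 0) == 0 &
      ~~ initial_ok (input_code x n T (lpos (lit b 0))) (cell_of (lcell (lit b 0)))].

(** Forbids one bad combination of contents of three neighbouring cells and of the middle cell in
    the next row. *)
Definition window_clause b :=
  [&& all (fun j => (sgn b j == 0) && ((j < 3) || (lit b j == lit b 3))) (iota 0 litw),
      ltime (lit b 0) == ltime (lit b 1), ltime (lit b 2) == ltime (lit b 1),
      ltime (lit b 3) == (ltime (lit b 1)).+1, ltime (lit b 1) < T,
      lpos (lit b 1) == (lpos (lit b 0)).+1, lpos (lit b 2) == (lpos (lit b 1)).+1,
      lpos (lit b 3) == lpos (lit b 1) &
      ~~ window_ok (flag T (lpos (lit b 1))) (cell_of (lcell (lit b 0)))
           (cell_of (lcell (lit b 1))) (cell_of (lcell (lit b 2))) (cell_of (lcell (lit b 3)))].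

Definition clauses b := [|| cell_clause b, initial_clause b | window_clause b].

Lemma varE t sg g : sg < W -> g < K ->
  [/\ ltime (var t sg g) = t, lpos (var t sg g) = sg & lcell (var t sg g) = g].
Proof.
move=> ls lg; have K0 := ncell_gt0; have d : var t sg g %/ K = t * W + sg.
  by rewrite /var divnMDl // divn_small ?addn0.
split.
- by rewrite /ltime divnMA d divnMDl // divn_small ?addn0.
- by rewrite /lpos d modnMDl modn_small.
- by rewrite /lcell /var modnMDl modn_small.
Qed.

Lemma var_lt t sg g : T.+1 * W * K <= 2 ^ m -> t <= T -> sg < W -> g < K ->
  var t sg g < 2 ^ m.
Proof.
move=> le lt ls lg; apply: leq_trans le; rewrite /var.
apply: leq_trans (_ : (t * W + sg).+1 * K <= _); first by rewrite mulSn addnC ltn_add2r.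
rewrite leq_mul2r; apply/orP; right.
apply: leq_trans (_ : t.+1 * W <= _); first by rewrite mulSn; lia.
exact: leq_mul.
Qed.

End Clauses.

Section Correct.
Variables (x : seq bool) (T m : nat).
Hypothesis T0 : 0 < T.
Hypothesis haltN : halts_within N x T.-1.
Hypothesis Tm : T.+1 * (2 * T).+1 * K <= 2 ^ m.
Local Notation W := (2 * T).+1.
Local Notation cl := (clauses x (size x) T m).

Definition offset sg : int := (sg%:Z - T%:Z)%R.

Lemma input_codeE (sg : nat) (i : 'I_K0) :
  (if i == ord0 then (if input_code x (size x) T sg == 0 then None
     else Some (inl (input_code x (size x) T sg == 2))) else None : sym) =
  (vinitial N x).2 i (offset sg).
Proof.
rewrite /vinitial /=; case: eqP => // _; rewrite /input_code /offset.
case: (leqP T sg) => [le|lt] /=.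
  have -> : (sg%:Z - T%:Z = (sg - T)%N%:Z)%R by lia.
  rewrite /input_cells; case: ltnP => ls.
    by rewrite (nth_map false) //; case: nth.
  by rewrite nth_default // size_map.
by case E: (sg%:Z - T%:Z)%R => [k|k] //; lia.
Qed.

Section Sound.
Variable c : nat -> nat -> cell.
Hypothesis cinit : forall sg, sg < W ->
  initial_ok (input_code x (size x) T sg) (c 0 sg).
Hypothesis cwin : forall t sg, t < T -> 0 < sg -> sg.+1 < W ->
  window_ok (flag T sg) (c t sg.-1) (c t sg) (c t sg.+1) (c t.+1 sg).

(** Windows need both neighbours, so row [t] is trusted only on positions [t] to [2 T - t], which
    include the head while [t <= T]. A run of [T] steps would contradict [haltN]; hence some row has
    no action, and there the machine halts and accepts. *)
Lemma tableau_accepts : accepts N x.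
Proof.
pose acc := exists n v, [/\ vrun n (vinitial N x) v, venabled v = set0 & v.1 \in tm_accept N].
suff [n [v [Hr h0 av]]] : acc.
  move: Hr; rewrite -view_initial => /vrun_path[p [pP _ lp]].
  exists (last (initial N x) p); split; last by move: av; rewrite -lp.
  by exists p; split => //; rewrite /halted enabled_view lp h0.
have inv t : t <= T -> acc \/ exists v, vrun t (vinitial N x) v /\
    forall sg, t <= sg -> sg + t <= 2 * T ->
      (c t sg).1.1 = v.1 /\ forall i, tnth (c t sg).2 i = v.2 i (offset sg).
  elim: t => [|t IH] lt.
    right; exists (vinitial N x); split=> // sg _; rewrite addn0 => ls.
    have /andP[/eqP -> /forallP H] := cinit (ltac:(lia) : sg < W).
    by split=> // i; rewrite (eqP (H i)) input_codeE.
  have [|[v [Hr Hc]]] := IH (ltnW lt); [by left|].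
  have acts sg : t < sg -> sg + t < 2 * T -> (c t sg.-1).1.2 = (c t sg).1.2 /\
      (c t sg.+1).1.2 = (c t sg).1.2.
    move=> h1 h2; have /and3P[/eqP -> /eqP -> _] := @cwin t sg lt (ltac:(lia)) (ltac:(lia)).
    by [].
  (* Windows carry the action guessed at the head to the whole trusted part of the row, here to the
     right and then to the left. *)
  have actR d : d <= T - t -> (c t (T + d)).1.2 = (c t T).1.2.
    elim: d => [|d IHd] ld; first by rewrite addn0.
    rewrite addnS; have [_ ->] := acts (T + d) ltac:(lia) ltac:(lia); apply: IHd; lia.
  have actL d : d <= T - t -> (c t (T - d)).1.2 = (c t T).1.2.
    elim: d => [|d IHd] ld; first by rewrite subn0.
    have [E _] := acts (T - d) ltac:(lia) ltac:(lia).
    have -> : T - d.+1 = (T - d).-1 by lia.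
    rewrite E; apply: IHd; lia.
  have actE sg : t <= sg -> sg + t <= 2 * T -> (c t sg).1.2 = (c t T).1.2.
    move=> h1 h2; case: (leqP T sg) => l.
      by rewrite -(subnKC l); apply: actR; lia.
    have -> : sg = T - (T - sg) by lia.
    by apply: actL; lia.
  have [cq cs] := Hc T (ltnW lt) ltac:(lia).
  have offT : offset T = 0%R by rewrite /offset; lia.
  have readE : (c t T).2 = [tuple v.2 i 0%R | i < K0].
    by apply: eq_from_tnth => i; rewrite cs tnth_mktuple offT.
  have := @cwin t T lt T0 ltac:(lia).
  rewrite /window_ok /flag eqxx /= => /and3P[_ _].
  case Ea : (c t T).1.2 => [al|]; last first.
    move=> /andP[/eqP h ha]; left; exists t, v; split=> //; last by rewrite -cq.
    by rewrite /venabled -readE -cq.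
  move=> /and3P[ha _ _]; right; exists (vperform al v); split.
    have/(vrun_cat Hr) : vrun 1 v (vperform al v).
      by apply: vrun1; rewrite /venabled -readE -cq.
    by rewrite addn1.
  move=> sg h1 h2.
  have := @cwin t sg lt ltac:(lia) ltac:(lia).
  rewrite /window_ok (actE sg) ?Ea; [|lia|lia].
  move=> /and3P[_ _ /and3P[_ /eqP -> /forallP H]]; split=> // i.
  rewrite (eqP (H i)) /= !flagE.
  have [_ sa] := Hc sg.-1 ltac:(lia) ltac:(lia).
  have [_ sb] := Hc sg ltac:(lia) ltac:(lia).
  have [_ sc] := Hc sg.+1 ltac:(lia) ltac:(lia).
  rewrite sa sb sc /fmove /fwrite; case: (tnth al.2 i).2 => [[]|].
  - have -> : offset sg.+1 = (offset sg + 1)%R by rewrite /offset; lia.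
    have -> : ((offset sg + 1)%R == 0%R) = (sg.+1 == T) by rewrite /offset; apply/eqP/eqP; lia.
    by [].
  - have -> : offset sg.-1 = (offset sg - 1)%R by rewrite /offset; lia.
    have -> : ((offset sg - 1)%R == 0%R) = (sg == T.+1) by rewrite /offset; apply/eqP/eqP; lia.
    by [].
  - have -> : (offset sg == 0%R) = (sg == T) by rewrite /offset; apply/eqP/eqP; lia.
    by [].
have [//|[v [Hr _]]] := inv T (leqnn T).
move: Hr; rewrite -view_initial => /vrun_path[p [pP sp _]].
by have := haltN pP; rewrite sp; lia.
Qed.

End Sound.

Lemma vrun_trace n (v v' : vconfig N) : vrun n v v' ->
  exists (vs : nat -> vconfig N) (al : nat -> option act), vs 0 = v /\
    forall t, if t < n then exists a, [/\ al t = Some a, a \in venabled (vs t) &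
                                  vs t.+1 = vperform a (vs t)]
              else al t = None /\ vs t = v'.
Proof.
elim: n v => [|n IH] v /=; first by move=> ->; exists (fun=> v), (fun=> None).
move=> [a Ha /IH[vs [al [v0 H]]]].
exists (fun t => if t is t'.+1 then vs t' else v), (fun t => if t is t'.+1 then al t' else Some a).
split=> // -[|t]; first by exists a; rewrite v0.
by rewrite ltnS; exact: H.
Qed.

(** After the run has halted, its last configuration is repeated with no action; without an action a
    window puts no condition on the next row. *)
Lemma accepts_tableau : accepts N x -> exists c : nat -> nat -> cell,
  (forall sg, sg < W -> initial_ok (input_code x (size x) T sg) (c 0 sg)) /\
  (forall t sg, t < T -> 0 < sg -> sg.+1 < W ->
     window_ok (flag T sg) (c t sg.-1) (c t sg) (c t sg.+1) (c t.+1 sg)).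
Proof.
move=> [cf [[p [Hp lp hc]] ac]].
have := path_vrun Hp; rewrite view_initial lp => /vrun_trace[vs [al [v0 H]]].
exists (fun t sg => (((vs t).1, al t), [tuple (vs t).2 i (offset sg) | i < K0])); split.
  move=> sg ls; rewrite /initial_ok /= v0 eqxx; apply/forallP => i.
  by rewrite tnth_mktuple -input_codeE.
move=> t sg lt s0 s1; rewrite /window_ok /= !eqxx /=.
have rd : sg = T -> [tuple (vs t).2 i (offset sg) | i < K0] = [tuple (vs t).2 i 0%R | i < K0].
  by move=> ->; congr mktuple; apply: funext => i; congr (_ i _); rewrite /offset; lia.
have fl1 : flag T sg == 1 -> sg = T by rewrite flagE => /eqP.
have := H t; case: ifP => [_ [a [-> ea ->]]|_ [-> ->]] /=.
  apply/and3P; split=> //; first by apply/implyP => /fl1/rd ->.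
  apply/forallP => i; rewrite !tnth_mktuple /fmove /fwrite !flagE.
  case: (tnth a.2 i).2 => [[]|]; apply/eqP.
  - have -> : offset sg.+1 = (offset sg + 1)%R by rewrite /offset; lia.
    have -> : ((offset sg + 1)%R == 0%R) = (sg.+1 == T) by rewrite /offset; apply/eqP/eqP; lia.
    by [].
  - have -> : offset sg.-1 = (offset sg - 1)%R by rewrite /offset; lia.
    have -> : ((offset sg - 1)%R == 0%R) = (sg == T.+1) by rewrite /offset; apply/eqP/eqP; lia.
    by [].
  - have -> : (offset sg == 0%R) = (sg == T) by rewrite /offset; apply/eqP/eqP; lia.
    by [].
apply/implyP => /fl1 sT.
rewrite ac andbT; move: hc; rewrite /halted enabled_view /venabled /= => hc.
have -> : [tuple cells (tnth cf.2 i) (offset sg) | i < K0] =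
          [tuple cells (tnth cf.2 i) 0%R | i < K0].
  by congr mktuple; apply: funext => i; rewrite sT /offset; congr (cells _ _); lia.
exact: hc.
Qed.

Theorem cook_levin : (exists a, satisfies m litw cl a) <-> accepts N x.
Proof.
have K0 := ncell_gt0; have w4 : 3 < litw by rewrite /litw; lia.
split=> [[a sat]|/accepts_tableau[c [ci cw]]].
  have ex t sg : t <= T -> sg < W -> exists g : 'I_K, a (var T t sg g).
    move=> lt ls.
    have [j lj|b bM Hb] := @clause_number m litw (fun j => var T t sg (minn j K.-1)) (fun=> true).
      by apply: var_lt => //; lia.
    have lb j : j < litw -> lit m b j = var T t sg (minn j K.-1) by move=> /Hb[].
    have [|j jw] := sat b bM.
      rewrite /clauses; apply/orP; left; rewrite /cell_clause; apply/andP; split.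
        apply/allP => j; rewrite mem_iota add0n => /= lj.
        rewrite /sgn (Hb j lj).2 /= (lb j lj) (lb 0 ltac:(lia)).
        rewrite /var divnMDl // (divn_small (_ : minn 0 _ < K)) ?addn0 //; lia.
      by rewrite (lb 0 ltac:(lia)); have [-> _ _] := @varE T t sg (minn 0 K.-1) ls ltac:(lia).
    rewrite -/(lit m b j) lb // (Hb j jw).2 eqxx => aj.
    have lj : minn j K.-1 < K by lia.
    by exists (Ordinal lj).
  (* One true content is selected for every cell, with a default where there is none. *)
  pose c t sg : cell := cell_of (odflt (Ordinal K0) [pick g : 'I_K | a (var T t sg g)]).
  pose r t sg : nat := odflt (Ordinal K0) [pick g : 'I_K | a (var T t sg g)].
  have rK t sg : r t sg < K by rewrite /r.
  have ar t sg : t <= T -> sg < W -> a (var T t sg (r t sg)).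
    move=> lt ls; rewrite /r; case: pickP => [g //|no].
    by have [g] := ex t sg lt ls; rewrite no.
  apply: (@tableau_accepts c).
    move=> sg ls; apply/negP => bad.
    have [j lj|b bM Hb] := @clause_number m litw (fun j => var T 0 sg (r 0 sg)) (fun=> false).
      exact: var_lt.
    have lb j : j < litw -> lit m b j = var T 0 sg (r 0 sg) by move=> /Hb[].
    have [E1 E2 E3] := @varE T 0 sg (r 0 sg) ls (rK _ _).
    have [|j jw] := sat b bM.
      rewrite /clauses; apply/orP; right; apply/orP; left; apply/and3P; split.
      - apply/allP => j; rewrite mem_iota add0n => /= lj.
        by rewrite /sgn (Hb j lj).2 !lb ?eqxx //; lia.
      - by rewrite lb ?E1 //; lia.
      - by rewrite (lb 0 ltac:(lia)) E2 E3; apply/negP.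
    by rewrite -/(lit m b j) lb // (Hb j jw).2 ar.
  move=> t sg lt s0 s1; apply/negP => bad.
  pose l j := match j with
    | 0 => var T t sg.-1 (r t sg.-1) | 1 => var T t sg (r t sg)
    | 2 => var T t sg.+1 (r t sg.+1) | _ => var T t.+1 sg (r t.+1 sg) end.
  have [j lj|b bM Hb] := @clause_number m litw l (fun=> false).
    by case: j lj => [|[|[|j]]] lj; apply: var_lt => //; lia.
  have lb j : j < litw -> lit m b j = l j by move=> /Hb[].
  have [A1 A2 A3] := @varE T t sg.-1 (r t sg.-1) ltac:(lia) (rK _ _).
  have [B1 B2 B3] := @varE T t sg (r t sg) ltac:(lia) (rK _ _).
  have [C1 C2 C3] := @varE T t sg.+1 (r t sg.+1) ltac:(lia) (rK _ _).
  have [D1 D2 D3] := @varE T t.+1 sg (r t.+1 sg) ltac:(lia) (rK _ _).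
  have [|j jw] := sat b bM.
    rewrite /clauses; apply/orP; right; apply/orP; right.
    rewrite /window_clause !lb; try lia.
    rewrite /l A1 A2 A3 B1 B2 B3 C1 C2 C3 D1 D2 D3 !eqxx lt prednK // eqxx /=.
    apply/andP; split; last by apply/negP; exact: bad.
    apply/allP => j; rewrite mem_iota add0n => /= lj.
    rewrite /sgn (Hb j lj).2 /= lb //; by case: j lj => [|[|[|j]]] // _; rewrite eqxx orbT.
  rewrite -/(lit m b j) lb // (Hb j jw).2.
  by case: j jw => [|[|[|j]]] jw /=; rewrite ar //; lia.
exists (fun i => lcell i == cell_rank (c (ltime T i) (lpos T i))).
move=> b bM /or3P[/andP[/allP H lt]|/and3P[/allP H /eqP t0 bad]|/and5P[/allP H /eqP t0 /eqP t2 /eqP t3]].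
- set i0 := lit m b 0 in H lt.
  set g := cell_rank (c (ltime T i0) (lpos T i0)).
  have gK : g < K := cell_rank_lt _.
  have gw : g < litw by rewrite /litw; lia.
  have := H g; rewrite mem_iota add0n => /(_ gw) /andP[/eqP s1 /eqP l1].
  exists g => //; rewrite -/(sgn m b g) s1 eqxx -/(lit m b g) l1 (minn_idPl _); last by lia.
  have d : (i0 %/ K * K + g) %/ K = i0 %/ K by rewrite divnMDl // (divn_small gK) addn0.
  have -> : ltime T (i0 %/ K * K + g) = ltime T i0 by rewrite /ltime !divnMA d.
  have -> : lpos T (i0 %/ K * K + g) = lpos T i0 by rewrite /lpos d.
  by rewrite /lcell modnMDl modn_small // eqxx.
- have := H 0; rewrite mem_iota /= => /(_ ltac:(lia)) /andP[/eqP s0 _].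
  exists 0; first by lia.
  rewrite -/(sgn m b 0) s0 -/(lit m b 0) t0; apply/negbTE/negP => /eqP E.
  case/negP: bad; rewrite E cell_rankK; apply: ci; rewrite /lpos ltn_mod //.
move=> /and5P[tT /eqP p1 /eqP p2 /eqP p3 bad].
have sg0 j : j < litw -> sgn m b j = 0.
  by move=> lj; have := H j; rewrite mem_iota add0n => /(_ lj) /andP[/eqP].
case: (boolP (all (fun j => lcell (lit m b j) ==
   cell_rank (c (ltime T (lit m b j)) (lpos T (lit m b j)))) (iota 0 4))); last first.
  move=> /allPn[j]; rewrite mem_iota add0n => /= lj nj.
  have lj' : j < litw by lia.
  exists j => //; rewrite -/(sgn m b j) sg0 // -/(lit m b j); exact: negbTE.
move=> /= /and5P[/eqP e0 /eqP e1 /eqP e2 /eqP e3 _]; case/negP: bad.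
rewrite e0 e1 e2 e3 !cell_rankK t0 t2 t3 p3 p2.
have -> : lpos T (lit m b 0) = (lpos T (lit m b 1)).-1 by rewrite p1.
apply: cw => //; first by rewrite p1.
have h : lpos T (lit m b 2) < W by rewrite /lpos ltn_mod.
by rewrite p2 in h.
Qed.

End Correct.

Section Computable.
Variables (nf Tf mf bf : env -> nat).
Hypothesis Hn : vcomp nf.
Hypothesis HT : vcomp Tf.
Hypothesis Hm : vcomp mf.
Hypothesis Hb : vcomp bf.

Lemma vtime i : vcomp i -> forall T, vcomp T -> vcomp (fun s => ltime (T s) (i s)).
Proof.
move=> Hi T HT'; apply: vdiv Hi _; apply: comp_mul (vconst _) _.
by apply: comp_succ; apply: comp_mul (vconst 2) HT'.
Qed.

Lemma vpos i : vcomp i -> forall T, vcomp T -> vcomp (fun s => lpos (T s) (i s)).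
Proof.
move=> Hi T HT'; apply: vmod (vdiv Hi (vconst _)) _.
by apply: comp_succ; apply: comp_mul (vconst 2) HT'.
Qed.

(** [2 ^ m] itself may be too large. Powers are capped at [b + 1], beyond which quotients vanish,
    and the residue is expressed through quotients. *)
Lemma vlit m b j : vcomp m -> vcomp b -> vcomp j -> vcomp (fun s => lit (m s) (b s) (j s)).
Proof.
move=> Hm' Hb' Hj.
apply: (@vcomp_ext (fun s => (b s %/ minn (2 ^ (m s * j s)) (b s).+1) -
  (b s %/ minn (2 ^ (m s * j s)) (b s).+1) %/ minn (2 ^ m s) (b s).+1 *
    minn (2 ^ m s) (b s).+1)); last first.
  move=> s; rewrite /lit digitE ?expn_gt0 // -expnM.
  have E c a : a <= b s -> a %/ minn c (b s).+1 = a %/ c.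
    by move=> la; case: (leqP c (b s).+1) => l //; rewrite !divn_small //; lia.
  rewrite !E ?leq_div //.
  set a := b s %/ _; have la : a <= b s by exact: leq_div.
  case: (leqP (2 ^ m s) (b s).+1) => l; first by rewrite {2}(divn_eq a (2 ^ m s)) addKn.
  by rewrite divn_small ?mul0n ?subn0 ?modn_small //; lia.
have H2 e : vcomp e -> vcomp (fun s => minn (2 ^ e s) (b s).+1).
  by move=> He; apply: vexpcap (vconst 2) He (comp_succ Hb').
have H1 := vdiv Hb' (H2 _ (comp_mul Hm' Hj)).
exact: comp_sub H1 (comp_mul (vdiv H1 (H2 _ Hm')) (H2 _ Hm')).
Qed.

Lemma vsgn m b j : vcomp m -> vcomp b -> vcomp j -> vcomp (fun s => sgn (m s) (b s) (j s)).
Proof.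
move=> Hm' Hb' Hj; apply: vdigit (vconst 2) _ Hb'.
by apply: comp_add Hj; apply: comp_mul (vconst _) Hm'.
Qed.

(** [N] enters only through tables over finitely many cell contents, flags and input codes, which
    [vcase] hard-wires. *)
Lemma vclauses : vcomp (fun s => clauses s.1 (nf s) (Tf s) (mf s) (bf s)).
Proof.
have K0 := ncell_gt0.
have L j : vcomp (fun s => lit (mf s) (bf s) j) := vlit Hm Hb (vconst j).
have L' : vcomp (fun s : env => lit (mf (tl s)) (bf (tl s)) (s.2 0)).
  by apply: vlit (comp_var 0); exact: vtl.
have L'' j : vcomp (fun s : env => lit (mf (tl s)) (bf (tl s)) j).
  exact: (vtl (L j)).
have S' : vcomp (fun s : env => sgn (mf (tl s)) (bf (tl s)) (s.2 0)).
  by apply: vsgn (comp_var 0); exact: vtl.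
have lcK i : lcell i < K by rewrite ltn_mod.
apply: vor; last apply: vor.
- apply: vand; last by apply: vle HT; exact: vtime.
  apply: (@vall (fun=> litw) (fun j s => (sgn (mf s) (bf s) j == 1) &&
    (lit (mf s) (bf s) j == lit (mf s) (bf s) 0 %/ K * K + minn j K.-1))).
    exact: vconst.
  apply: vand; first exact: veq S' (vconst 1).
  apply: veq L' _; apply: comp_add; last exact: vmin (comp_var 0) (vconst _).
  by apply: comp_mul (vconst _); apply: vdiv (L'' 0) (vconst _).
- apply: vand; last apply: vand.
  + apply: (@vall (fun=> litw) (fun j s => (sgn (mf s) (bf s) j == 0) &&
      (lit (mf s) (bf s) j == lit (mf s) (bf s) 0))); first exact: vconst.
    by apply: vand; [exact: veq S' (vconst 0) | exact: veq L' (L'' 0)].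
  + by apply: veq (vconst 0); exact: vtime.
  apply: vneg.
  have Hs : vcomp (fun s => lpos (Tf s) (lit (mf s) (bf s) 0)) by exact: vpos.
  apply: (@vcase 3 _ (fun ic s => initial_ok ic (cell_of (lcell (lit (mf s) (bf s) 0))))).
  + apply: vif; last exact: vconst.
      apply: vand; first exact: vle HT Hs.
      by apply: vlt Hn; exact: comp_sub.
    by apply: comp_succ; apply: (@comp_bit (fun s => _ - _)); exact: comp_sub.
  + by move=> s; rewrite /input_code; case: ifP => // _; case: nth.
  move=> ic; apply: (@vcase K _ (fun g s => initial_ok ic (cell_of g))) => [|s|g].
  + exact: vmod (L 0) (vconst _).
  + exact: lcK.
  + exact: vconst.
have Ht j : vcomp (fun s => ltime (Tf s) (lit (mf s) (bf s) j)) by exact: vtime.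
have Hp j : vcomp (fun s => lpos (Tf s) (lit (mf s) (bf s) j)) by exact: vpos.
have Hg j : vcomp (fun s => lcell (lit (mf s) (bf s) j)) := vmod (L j) (vconst _).
apply: vand.
  apply: (@vall (fun=> litw) (fun j s => (sgn (mf s) (bf s) j == 0) &&
      ((j < 3) || (lit (mf s) (bf s) j == lit (mf s) (bf s) 3)))); first exact: vconst.
  apply: vand; first exact: veq S' (vconst 0).
  by apply: vor; [exact: vlt (comp_var 0) (vconst _) | exact: veq L' (L'' 3)].
apply: vand; first exact: veq.
apply: vand; first exact: veq.
apply: vand; first by apply: veq => //; exact: comp_succ.
apply: vand; first exact: vlt.
apply: vand; first by apply: veq => //; exact: comp_succ.
apply: vand; first by apply: veq => //; exact: comp_succ.
apply: vand; first exact: veq.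
apply: vneg.
apply: (@vcase 4 _ (fun fl s => window_ok fl (cell_of (lcell (lit (mf s) (bf s) 0)))
  (cell_of (lcell (lit (mf s) (bf s) 1))) (cell_of (lcell (lit (mf s) (bf s) 2)))
  (cell_of (lcell (lit (mf s) (bf s) 3))))) => [|s|fl].
- apply: vif; [exact: veq | exact: vconst |].
  apply: vif; [by apply: veq => //; exact: comp_succ | exact: vconst |].
  by apply: vif; [by apply: veq => //; exact: comp_succ | exact: vconst | exact: vconst].
- by rewrite /flag; do ![case: ifP => // _].
apply: (@vcase K _ (fun g0 s => window_ok fl (cell_of g0)
  (cell_of (lcell (lit (mf s) (bf s) 1))) (cell_of (lcell (lit (mf s) (bf s) 2)))
  (cell_of (lcell (lit (mf s) (bf s) 3))))) => [|s|g0]; [exact: Hg | exact: lcK |].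
apply: (@vcase K _ (fun g1 s => window_ok fl (cell_of g0)
  (cell_of g1) (cell_of (lcell (lit (mf s) (bf s) 2)))
  (cell_of (lcell (lit (mf s) (bf s) 3))))) => [|s|g1]; [exact: Hg | exact: lcK |].
apply: (@vcase K _ (fun g2 s => window_ok fl (cell_of g0)
  (cell_of g1) (cell_of g2)
  (cell_of (lcell (lit (mf s) (bf s) 3))))) => [|s|g2]; [exact: Hg | exact: lcK |].
apply: (@vcase K _ (fun g3 s => window_ok fl (cell_of g0)
  (cell_of g1) (cell_of g2) (cell_of g3))) => [|s|g3]; [exact: Hg | exact: lcK |].
exact: vconst.
Qed.

End Computable.
End CookLevin.
End CookLevinTableau.

(** * The gadget graph *)

Module HubGadget.
Section Covering.
Variables (V : finType) (e : rel V).
Hypothesis eS : symmetric e.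
Hypothesis eI : irreflexive e.

Lemma m_G_le u v k : path_internal e u v k -> k < #|V| ->
  exists2 k', m_G e u v = Some k' & k' <= k.
Proof.
move=> pk lk; rewrite /m_G.
have: k \in [seq k <- iota 0 #|V| | path_internal e u v k].
  by rewrite mem_filter pk mem_iota.
have: sorted ltn [seq k <- iota 0 #|V| | path_internal e u v k].
  by apply: sorted_filter; [exact: ltn_trans | exact: iota_ltn_sorted].
case: [seq k <- iota 0 #|V| | path_internal e u v k] => // a s /= Hs.
rewrite inE => /predU1P[->|ks]; first by exists a.
exists a => //; apply/ltnW.
by have /allP := order_path_min ltn_trans Hs; apply.
Qed.

Lemma m_G_Some u v k : m_G e u v = Some k ->
  path_internal e u v k /\ forall j, j < k -> ~~ path_internal e u v j.
Proof.
rewrite /m_G => H.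
have: sorted ltn [seq k <- iota 0 #|V| | path_internal e u v k].
  by apply: sorted_filter; [exact: ltn_trans | exact: iota_ltn_sorted].
case E : [seq k <- iota 0 #|V| | path_internal e u v k] H => [|a s] //= [ak] Hs; subst a.
have: k \in [seq k <- iota 0 #|V| | path_internal e u v k] by rewrite E inE eqxx.
rewrite mem_filter mem_iota => /and3P[pk _ lk]; split=> // j lj; apply/negP => pj.
have: j \in [seq k <- iota 0 #|V| | path_internal e u v k].
  by rewrite mem_filter pj mem_iota /= (leq_trans lj) // ltnW.
rewrite E inE => /predU1P[jk|js]; first by rewrite jk ltnn in lj.
by have /allP /(_ j js) := order_path_min ltn_trans Hs; lia.
Qed.

Lemma path0E u v : path_internal e u v 0 = e u v && (u != v).
Proof.
apply/existsP/andP => [[t]|[H1 H2]].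
  by rewrite (tuple0 t) /= inE !andbT => /andP[].
by exists [tuple]; rewrite /= inE !andbT H1.
Qed.

Lemma path1P u v : reflect (exists2 d, e u d && e d v & [&& u != d, u != v & d != v])
  (path_internal e u v 1).
Proof.
apply: (iffP existsP) => [[t]|[d /andP[H1 H2] /and3P[H3 H4 H5]]].
  case/tupleP: t => d t; rewrite (tuple0 t) /= !inE !andbT negb_or => /andP[H1].
  by move=> /andP[/andP[n1 n2] n3]; exists d; rewrite ?n1 ?n2 ?n3.
by exists [tuple d]; rewrite /= !inE !andbT negb_or H1 H2 H3 H4 H5.
Qed.

Lemma path2P u v : reflect (exists d1 d2, [&& e u d1, e d1 d2 & e d2 v] /\
    uniq [:: u; d1; d2; v]) (path_internal e u v 2).
Proof.
apply: (iffP existsP) => [[t]|[d1 [d2 [H1 H2]]]].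
  case/tupleP: t => d1 t; case/tupleP: t => d2 t; rewrite (tuple0 t) /= andbT.
  by move=> /andP[H1 H2]; exists d1, d2.
by exists [tuple d1; d2]; rewrite /= andbT; apply/andP.
Qed.

End Covering.

Section Covers.
Variables (V : finType) (e : rel V) (D : {set V}).
Hypothesis eS : symmetric e.
Hypothesis eI : irreflexive e.

Lemma uniq_card (s : seq V) : uniq s -> size s <= #|V|.
Proof. by move=> us; rewrite -(card_uniqP us) max_card. Qed.

Let neqe u v : e u v -> u != v.
Proof. by apply: contraTneq => ->; rewrite eI. Qed.

Let ind u v x y : x \in D :|: [set u; v] -> y \in D :|: [set u; v] -> e x y ->
  induced e (D :|: [set u; v]) x y.
Proof. by move=> hx hy exy; rewrite /induced /= hx hy. Qed.

Lemma cover0 u v : e u v -> covers e D u v.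
Proof.
move=> euv; have ne := neqe euv.
have [||k' H1 H2] := @m_G_le V (induced e (D :|: [set u; v])) u v 0.
- by rewrite path0E ne andbT ind // !inE eqxx ?orbT.
- by apply/card_gt0P; exists u.
by exists k' => //; lia.
Qed.

Lemma cover1 u v d : u != v -> d \in D -> e u d -> e d v -> covers e D u v.
Proof.
move=> ne dD e1 e2.
have [||k' H1 H2] := @m_G_le V (induced e (D :|: [set u; v])) u v 1.
- apply/path1P; exists d; last by rewrite ne (neqe e1) (neqe e2).
  by rewrite !ind // !inE ?eqxx ?dD ?orbT.
- by apply: (@uniq_card [:: u; v]); rewrite /= inE ne.
by exists k' => //; lia.
Qed.

Lemma cover2 u v d1 d2 : u != v -> d1 \in D -> d2 \in D ->
  e u d1 -> e d1 d2 -> e d2 v -> covers e D u v.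
Proof.
move=> ne D1 D2 e1 e2 e3.
have [E|n1] := eqVneq d1 v; first by apply: cover0; rewrite -E.
have [E|n2] := eqVneq d2 u; first by apply: cover0; rewrite -E.
have U : uniq [:: u; d1; d2; v].
  rewrite /= !inE !negb_or (neqe e1) (neqe e2) (neqe e3) ne n1 /= !andbT.
  by rewrite eq_sym.
have [||k' H1 H2] := @m_G_le V (induced e (D :|: [set u; v])) u v 2.
- apply/path2P; exists d1, d2; split=> //.
  by rewrite !ind // !inE ?eqxx ?D1 ?D2 ?orbT.
- exact: ltnW (uniq_card U).
by exists k'.
Qed.

Lemma coversE u v : covers e D u v -> e u v \/
  (exists2 d, d \in D & e u d && e d v) \/
  (exists d1 d2, [/\ d1 \in D, d2 \in D, e u d1, e d1 d2 & e d2 v]).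
Proof.
have inD x : x \in D :|: [set u; v] -> x != u -> x != v -> x \in D.
  by rewrite !inE => /orP[//|/orP[]/eqP->]; rewrite eqxx.
move=> [[|[|[|k]]] // H _]; have [H1 _] := m_G_Some H.
- by left; move: H1; rewrite path0E /induced /= => /andP[/andP[_ ->]].
- right; left; case/path1P: H1 => d /andP[].
  rewrite /induced /= => /andP[/andP[_ dD] e1] /andP[_ e2] /and3P[n1 _ n2].
  by exists d; [apply: inD => //; rewrite eq_sym | rewrite e1 e2].
- right; right; case/path2P: H1 => d1 [d2 [/and3P[]]].
  rewrite /induced /= => /andP[/andP[_ D1] e1] /andP[/andP[_ D2] e2] /andP[_ e3].
  rewrite !inE !negb_or => /and4P[/and3P[n1 n2 _] /andP[_ n3] n4 _].
  exists d1, d2; split=> //; apply: inD => //; by rewrite eq_sym.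
Qed.

Lemma target_coupleE u v : target_couple e u v ->
  [/\ u != v, ~~ e u v & exists2 z, e u z & e z v].
Proof.
move=> /m_G_Some[/path1P[z /andP[e1 e2] /and3P[n1 n2 n3]] /(_ 0 isT)].
by rewrite path0E n2 andbT => ne; split=> //; exists z.
Qed.

Lemma target_coupleI u v z : u != v -> ~~ e u v -> e u z -> e z v -> target_couple e u v.
Proof.
move=> ne nuv e1 e2.
have [||k' H1 H2] := @m_G_le V e u v 1.
- by apply/path1P; exists z; rewrite ?e1 ?e2 // ne (neqe e1) (neqe e2).
- by apply: (@uniq_card [:: u; v]); rewrite /= inE ne.
rewrite /target_couple H1; have [H3 _] := m_G_Some H1.
case: k' H1 H2 H3 => [|[|k']] //; by rewrite path0E (negbTE nuv).
Qed.

End Covers.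

Section Gadget.
Variables (X Y Z K : nat) (cons : nat -> nat -> nat -> nat -> bool).
Hypothesis X0 : 0 < X.
Hypothesis Y0 : 0 < Y.
Hypothesis ZXY : X * Y <= Z.
Hypothesis ZXK : X * X * K <= Z.

(* Types 0, ..., 6 are the hubs; 7, ..., 11 the classes P, L, R, Q, W. *)
Definition ty u := if u < 7 then u else 7 + (u - 7) %/ Z.
Definition ix u := (u - 7) %% Z.

(** The classes form the cycle P, L, R, Q, W, and hub [k <= 4] is joined to all of class [7 + k].
    The path 0, 2, 4, 1, 3 joins the hubs of classes at distance two, except those of P and Q, which
    are kept apart on purpose. Hubs 5 and 6 supply connections of length two between the hubs of P
    and L and of R and Q. *)
Definition hub_arcs : seq (nat * nat) :=
  [:: (0, 2); (2, 4); (4, 1); (1, 3); (5, 0); (5, 1); (6, 2); (6, 3);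
      (0, 7); (1, 8); (2, 9); (3, 10); (4, 11)].

(** An index in P, Q or W encodes a pair of game vertices in its two lowest base-[X] digits, the
    rest numbering copies; an index in L or R encodes a game vertex and a label. P uses the first
    vertex of the pair, Q the second, and W joins equal indices. *)
Definition garc u v : bool :=
  if (ty u == 7) && (ty v == 8) then ix u %% X == ix v %% X
  else if (ty u == 10) && (ty v == 9) then (ix u %/ X) %% X == ix v %% X
  else if ((ty u == 7) || (ty u == 10)) && (ty v == 11) then ix u == ix v
  else if (ty u == 8) && (ty v == 9) then
    cons (ix u %% X) ((ix u %/ X) %% Y) (ix v %% X) ((ix v %/ X) %% Y)
  else (ty u, ty v) \in hub_arcs.

Definition adjn u v := garc u v || garc v u.

Definition gsize := 7 + 5 * Z.
Local Notation N := gsize.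
Definition gadj : rel 'I_N := fun u v => adjn u v.

Definition type_arcs := hub_arcs ++
  [:: (7, 8); (10, 9); (7, 11); (10, 11); (8, 9)].
Definition tedge a b := ((a, b) \in type_arcs) || ((b, a) \in type_arcs).

Let Z0 : 0 < Z. Proof. by apply: leq_trans ZXY; rewrite muln_gt0 X0. Qed.

Lemma arc_type u v : garc u v -> (ty u, ty v) \in type_arcs.
Proof.
rewrite /garc mem_cat; case: ifP => [/andP[/eqP-> /eqP->]//|_].
case: ifP => [/andP[/eqP-> /eqP->]//|_].
case: ifP => [/andP[/orP[]/eqP-> /eqP->]//|_].
by case: ifP => [/andP[/eqP-> /eqP->]//|_ ->].
Qed.

Lemma adj_type u v : adjn u v -> tedge (ty u) (ty v).
Proof. by rewrite /tedge => /orP[] /arc_type ->; rewrite ?orbT. Qed.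

Lemma ty_lt u : u < N -> ty u < 12.
Proof.
rewrite /ty /gsize; case: (ltnP u 7) => lu lN; first by lia.
have : (u - 7) %/ Z < 5 by rewrite ltn_divLR //; lia.
lia.
Qed.

(** Types define a homomorphism to a graph with 12 vertices, so the absence of triangles is a finite
    computation. *)
Lemma no_triangle_types : all (fun a => all (fun b => all (fun c =>
  ~~ [&& tedge a b, tedge b c & tedge c a]) (iota 0 12)) (iota 0 12)) (iota 0 12).
Proof. by vm_compute. Qed.

Lemma gadj_simple : simple_graph gadj.
Proof.
split=> [u v|u]; first by rewrite /gadj /adjn orbC.
apply/negP => /adj_type H.
have /allP/(_ (ty u)) : all (fun a => ~~ tedge a a) (iota 0 12) by vm_compute.
by rewrite mem_iota ty_lt // H => /(_ isT).
Qed.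

Lemma gadj_triangle_free : triangle_free gadj.
Proof.
move=> x y z; apply/negP => /and3P[/adj_type H1 /adj_type H2 /adj_type H3].
have m u : ty (u : 'I_N) \in iota 0 12 by rewrite mem_iota ty_lt.
have /allP/(_ _ (m x))/allP/(_ _ (m y))/allP/(_ _ (m z)) := no_triangle_types.
by rewrite H1 H2 H3.
Qed.

Fact hub_lt k : k < 7 -> k < N. Proof. by rewrite /gsize; lia. Qed.
Definition hub k (lk : k < 7) : 'I_N := Ordinal (hub_lt lk).

Fact vtx_lt c i : c < 5 -> i < Z -> 7 + c * Z + i < N.
Proof. by rewrite /gsize; nia. Qed.
Definition vtx c i (lc : c < 5) (li : i < Z) : 'I_N := Ordinal (vtx_lt lc li).

Lemma ty_hub k (lk : k < 7) : ty (hub lk) = k. Proof. by rewrite /ty /= lk. Qed.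

Lemma ty_vtx c i (lc : c < 5) (li : i < Z) :
  (ty (vtx lc li) = 7 + c) * (ix (vtx lc li) = i).
Proof.
have E : (vtx lc li : nat) = 7 + c * Z + i by [].
rewrite /ty /ix E; have -> : (7 + c * Z + i < 7) = false by lia.
have -> : 7 + c * Z + i - 7 = c * Z + i by lia.
by rewrite divnMDl // divn_small // addn0 modnMDl modn_small.
Qed.

Lemma hub_or_class (u : 'I_N) : (exists lk : u < 7, u = hub lk) \/
  (exists c i (lc : c < 5) (li : i < Z), u = vtx lc li).
Proof.
have [lu|lu] : u < 7 \/ 7 <= u by case: (ltnP u 7); auto.
  by left; exists lu; apply: val_inj.
right.
have lN := ltn_ord u; rewrite /gsize in lN.
have lc : (u - 7) %/ Z < 5 by rewrite ltn_divLR // ltn_subLR.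
have li : (u - 7) %% Z < Z by rewrite ltn_mod.
exists _, _, lc, li; apply: val_inj => /=.
by have := divn_eq (u - 7) Z; lia.
Qed.

Lemma adj_hub a b : (ty a < 7) || (ty b < 7) ->
  adjn a b = ((ty a, ty b) \in hub_arcs) || ((ty b, ty a) \in hub_arcs).
Proof.
have small x y : (ty x < 7) || (ty y < 7) -> garc x y = ((ty x, ty y) \in hub_arcs).
  rewrite /garc => H; do 4?[case: ifP => [|_]] => //.
  - by move=> /andP[/eqP E1 /eqP E2]; rewrite E1 E2 in H.
  - by move=> /andP[/eqP E1 /eqP E2]; rewrite E1 E2 in H.
  - by move=> /andP[/orP[]/eqP E1 /eqP E2]; rewrite E1 E2 in H.
  - by move=> /andP[/eqP E1 /eqP E2]; rewrite E1 E2 in H.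
by move=> H; rewrite /adjn !small // orbC.
Qed.

Lemma own_hub c i (lc : c < 5) (li : i < Z) (lk : c < 7) :
  adjn (vtx lc li) (hub lk).
Proof.
rewrite adj_hub; last by rewrite ty_hub lk orbT.
rewrite ty_hub !ty_vtx; clear li; move: lc lk.
by do 5!(case: c => [|c] //).
Qed.

Definition hubadj a b := ((a, b) \in hub_arcs) || ((b, a) \in hub_arcs).

Lemma gadj_hubs k k' (lk : k < 7) (lk' : k' < 7) : hubadj k k' -> gadj (hub lk) (hub lk').
Proof. by move=> H; rewrite /gadj adj_hub ?ty_hub ?lk. Qed.

Lemma gadj_connected : connected_graph gadj.
Proof.
have [eS _] := gadj_simple.
split; first by apply/card_gt0P; exists (hub (isT : 0 < 7)).
have cS : connect_sym gadj by apply: sym_connect_sym.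
pose h0 := hub (isT : 0 < 7).
have st k k' (lk : k < 7) (lk' : k' < 7) : hubadj k k' ->
    connect gadj (hub lk) h0 -> connect gadj (hub lk') h0.
  move=> H; apply: connect_trans; rewrite cS; apply: connect1; exact: gadj_hubs.
have c2 : connect gadj (hub (isT : 2 < 7)) h0 by apply: (st 0 2 isT isT isT).
have c4 : connect gadj (hub (isT : 4 < 7)) h0 by apply: (st 2 4 isT isT isT).
have c1 : connect gadj (hub (isT : 1 < 7)) h0 by apply: (st 4 1 isT isT isT).
have c3 : connect gadj (hub (isT : 3 < 7)) h0 by apply: (st 1 3 isT isT isT).
have c5 : connect gadj (hub (isT : 5 < 7)) h0 by apply: (st 0 5 isT isT isT).
have c6 : connect gadj (hub (isT : 6 < 7)) h0 by apply: (st 2 6 isT isT isT).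
have ch k (lk : k < 7) : connect gadj (hub lk) h0.
  have E (l1 l2 : k < 7) : hub l1 = hub l2 by apply: val_inj.
  case: k lk E => [|[|[|[|[|[|[|k]]]]]]] lk E //.
  - by rewrite (E lk isT).
  - by rewrite (E lk isT).
  - by rewrite (E lk isT).
  - by rewrite (E lk isT).
  - by rewrite (E lk isT).
  - by rewrite (E lk isT).
  - by rewrite (E lk isT).
have c0 u : connect gadj u h0.
  case: (hub_or_class u) => [[lk ->]|[c [i [lc [li ->]]]]]; first exact: ch.
  have lk : c < 7 by lia.
  by apply: connect_trans (ch _ lk); apply: connect1; exact: own_hub.
by move=> u v; apply: connect_trans (c0 u) _; rewrite cS.
Qed.

Section Yes.
Variable ys : nat -> nat.
Hypothesis ysY : forall x, x < X -> ys x < Y.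
Hypothesis ysC : forall x x', x < X -> x' < X -> cons x (ys x) x' (ys x').

Definition lab x := ys x * X + x.
Lemma lab_lt x : x < X -> lab x < Z.
Proof. by move=> lx; apply: leq_trans ZXY; have := ysY lx; rewrite /lab; nia. Qed.

Lemma lab_mod x : x < X -> (lab x %% X = x) * ((lab x %/ X) %% Y = ys x).
Proof.
move=> lx; rewrite /lab modnMDl modn_small // divnMDl // divn_small // addn0.
by rewrite modn_small // ysY.
Qed.

Definition solution : {set 'I_N} :=
  [set u : 'I_N | (u < 7) || [exists x : 'I_X, (u == 7 + 1 * Z + lab x :> nat) ||
                                        (u == 7 + 2 * Z + lab x :> nat)]].

Lemma hub_sol k (lk : k < 7) : hub lk \in solution.
Proof. by rewrite inE /= lk. Qed.

Lemma card_solution : #|solution| <= 2 * X + 7.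
Proof.
pose f (s : 'I_7 + ('I_X + 'I_X)) : nat := match s with
  | inl k => k | inr (inl x) => 7 + 1 * Z + lab x | inr (inr x) => 7 + 2 * Z + lab x end.
pose F (s : 'I_7 + ('I_X + 'I_X)) : 'I_N := insubd (hub (isT : 0 < 7)) (f s).
apply: leq_trans (_ : #|F @: setT| <= _); last first.
  apply: leq_trans (leq_imset_card _ _) _.
  by rewrite cardsT !card_sum !card_ord; lia.
apply/subset_leq_card/subsetP => u; rewrite inE => /orP[lu|/existsP[x H]].
  apply/imsetP; exists (inl (Ordinal lu)) => //; apply: val_inj.
  by rewrite val_insubd /= hub_lt.
case/orP: H => /eqP H; apply/imsetP.
  exists (inr (inl x)) => //; apply: val_inj; rewrite val_insubd /f -H.
  by rewrite ltn_ord.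
exists (inr (inr x)) => //; apply: val_inj; rewrite val_insubd /f -H.
by rewrite ltn_ord.
Qed.

Lemma solution_dominating : dominating gadj solution.
Proof.
have [eS _] := gadj_simple.
move=> v vD; case: (hub_or_class v) => [[lk E]|[c [i [lc [li E]]]]].
  by rewrite E hub_sol in vD.
have lk : c < 7 by lia.
exists (hub lk); first exact: hub_sol.
by rewrite eS E; exact: own_hub.
Qed.

Definition class_nbr a b := tedge (7 + a) (7 + b).

(** For a couple of a hub and a vertex of a class adjacent to its own: the detour goes through a
    further hub and the hub of that class. *)
Lemma hub_far : all (fun a => all (fun b => class_nbr a b ==>
  has (fun k => hubadj a k && hubadj k b) (iota 0 7)) (iota 0 5)) (iota 0 5).
Proof. by vm_compute. Qed.

(** For a couple of vertices in two classes: the hubs of the classes are adjacent, unless the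
    classes are P and Q with common neighbour in W. *)
Lemma hub_near : all (fun a => all (fun b => all (fun c =>
  [&& class_nbr a c, class_nbr c b & a != b] ==>
  (hubadj a b || ((a == 0) && (b == 3) && (c == 4)) ||
    ((a == 3) && (b == 0) && (c == 4)))) (iota 0 5)) (iota 0 5)) (iota 0 5).
Proof. by vm_compute. Qed.

Lemma hub_class_adj k c i (lk : k < 7) (lc : c < 5) (li : i < Z) :
  gadj (hub lk) (vtx lc li) -> k = c.
Proof.
rewrite /gadj adj_hub; last by rewrite ty_hub lk.
rewrite ty_hub ty_vtx; clear li; move: lk lc.
by do 7!(case: k => [|k]; first by do 5!(case: c => [|c] //)).
Qed.

Lemma gadj_w c i j (lc : c < 5) (li : i < Z) (lj : j < Z) (l4 : 4 < 5) :
  (c == 0) || (c == 3) -> gadj (vtx lc li) (vtx l4 lj) = (i == j).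
Proof.
move=> H; rewrite /gadj /adjn /garc !ty_vtx.
by case/orP: H => /eqP E; subst c; rewrite /= ?orbF.
Qed.

Lemma gadj_pl i j (li : i < Z) (lj : j < Z) (l0 : 0 < 5) (l1 : 1 < 5) :
  gadj (vtx l0 li) (vtx l1 lj) = (i %% X == j %% X).
Proof. by rewrite /gadj /adjn /garc !ty_vtx /= orbF. Qed.

Lemma gadj_qr i j (li : i < Z) (lj : j < Z) (l3 : 3 < 5) (l2 : 2 < 5) :
  gadj (vtx l3 li) (vtx l2 lj) = ((i %/ X) %% X == j %% X).
Proof. by rewrite /gadj /adjn /garc !ty_vtx /= orbF. Qed.

Lemma gadj_lr i j (li : i < Z) (lj : j < Z) (l1 : 1 < 5) (l2 : 2 < 5) :
  gadj (vtx l1 li) (vtx l2 lj) =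
  cons (i %% X) ((i %/ X) %% Y) (j %% X) ((j %/ X) %% Y).
Proof. by rewrite /gadj /adjn /garc !ty_vtx /= orbF. Qed.

Lemma pq_covered i (li : i < Z) (l0 : 0 < 5) (l3 : 3 < 5) :
  covers gadj solution (vtx l0 li) (vtx l3 li).
Proof.
have [eS eI] := gadj_simple.
have lx : i %% X < X by rewrite ltn_mod.
have ly : (i %/ X) %% X < X by rewrite ltn_mod.
apply: (@cover2 _ _ _ eI _ _ (vtx (isT : 1 < 5) (lab_lt lx)) (vtx (isT : 2 < 5) (lab_lt ly))).
- by rewrite -val_eqE /=; nia.
- by rewrite /solution inE; apply/orP; right; apply/existsP; exists (Ordinal lx); rewrite eqxx.
- by rewrite /solution inE; apply/orP; right; apply/existsP; exists (Ordinal ly); rewrite eqxx orbT.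
- by rewrite gadj_pl lab_mod.
- by rewrite gadj_lr !lab_mod // ysC.
- by rewrite eS gadj_qr lab_mod.
Qed.

Lemma coversC u v : covers gadj solution u v -> u != v -> covers gadj solution v u.
Proof.
have [eS eI] := gadj_simple.
move=> H ne; case: (coversE H) => [H1|[[d dD /andP[H1 H2]]|[d1 [d2 [D1 D2 H1 H2 H3]]]]].
- by apply: cover0 => //; rewrite eS.
- by apply: (@cover1 _ _ _ eI _ _ d) => //; rewrite 1?eq_sym // eS.
- by apply: (@cover2 _ _ _ eI _ _ d2 d1) => //; rewrite 1?eq_sym // eS.
Qed.

(** A common neighbour that is a hub lies in the solution itself. Otherwise the types determine a
    detour over hubs, and only a couple of P and Q with equal indices has to use the labels. *)
Lemma solution_covers : covers_all gadj solution.
Proof.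
have [eS eI] := gadj_simple.
move=> u v /target_coupleE[ne nuv [z e1 e2]].
case: (hub_or_class z) => [[lk Ez]|[c [i [lc [li Ez]]]]].
  by apply: (@cover1 _ _ _ eI _ _ z) => //; rewrite Ez hub_sol.
subst z; have lc7 : c < 7 by lia.
case: (hub_or_class u) => [[lu Eu]|[cu [iu [lcu [liu Eu]]]]];
case: (hub_or_class v) => [[lv Ev]|[cv [iv [lcv [liv Ev]]]]].
- have Hu := e1; have Hv := e2; rewrite Eu in Hu; rewrite eS Ev in Hv.
  have E1 := hub_class_adj Hu; have E2 := hub_class_adj Hv.
  by case/eqP: ne; rewrite Eu Ev; apply: val_inj; rewrite /= E1 E2.
- have Hu := e1; rewrite Eu in Hu; have E1 := hub_class_adj Hu.
  have lh : cv < 7 by lia.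
  have T : class_nbr c cv by have := adj_type e2; rewrite Ev !ty_vtx.
  have mc : c \in iota 0 5 by rewrite mem_iota.
  have mv : cv \in iota 0 5 by rewrite mem_iota.
  have /allP/(_ c mc)/allP/(_ cv mv)/implyP/(_ T)/hasP[k] := hub_far.
  rewrite mem_iota => lk /andP[A1 A2].
  apply: (@cover2 _ _ _ eI _ _ (hub (lk : k < 7)) (hub lh)) => //; rewrite ?hub_sol //.
  + rewrite Eu; apply: gadj_hubs; by rewrite /= E1.
  + exact: gadj_hubs.
  + by rewrite eS Ev; exact: own_hub.
- have Hv := e2; rewrite eS Ev in Hv; have E1 := hub_class_adj Hv.
  have lh : cu < 7 by lia.
  have T : class_nbr cu c by have := adj_type e1; rewrite Eu !ty_vtx.
  have mc : c \in iota 0 5 by rewrite mem_iota.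
  have mu : cu \in iota 0 5 by rewrite mem_iota.
  have /allP/(_ cu mu)/allP/(_ c mc)/implyP/(_ T)/hasP[k] := hub_far.
  rewrite mem_iota => lk /andP[A1 A2].
  apply: (@cover2 _ _ _ eI _ _ (hub lh) (hub (lk : k < 7))) => //; rewrite ?hub_sol //.
  + by rewrite Eu; exact: own_hub.
  + exact: gadj_hubs.
  + rewrite Ev; apply: gadj_hubs; by rewrite /= E1.
have lhu : cu < 7 by lia.
have lhv : cv < 7 by lia.
have [E|nc] := eqVneq cu cv.
  apply: (@cover1 _ _ _ eI _ _ (hub lhu)) => //; rewrite ?hub_sol //.
    by rewrite Eu; exact: own_hub.
  rewrite eS Ev; subst cu.
  by have := own_hub lcv liv lhu.
have T1 : class_nbr cu c by have := adj_type e1; rewrite Eu !ty_vtx.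
have T2 : class_nbr c cv by have := adj_type e2; rewrite Ev !ty_vtx.
have mc : c \in iota 0 5 by rewrite mem_iota.
have mu : cu \in iota 0 5 by rewrite mem_iota.
have mv : cv \in iota 0 5 by rewrite mem_iota.
have /allP/(_ cu mu)/allP/(_ cv mv)/allP/(_ c mc)/implyP := hub_near.
rewrite T1 T2 nc => /(_ isT) /orP[/orP[H|]|].
- apply: (@cover2 _ _ _ eI _ _ (hub lhu) (hub lhv)) => //; rewrite ?hub_sol //.
  + by rewrite Eu; exact: own_hub.
  + exact: gadj_hubs.
  + by rewrite eS Ev; exact: own_hub.
- move=> /andP[/andP[/eqP E0 /eqP E3] /eqP E4]; subst cu cv c.
  have A1 : iu = i by move: e1; rewrite Eu gadj_w // => /eqP.
  have A2 : iv = i by move: e2; rewrite eS Ev gadj_w // => /eqP.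
  subst iu iv; rewrite Eu Ev (_ : liv = liu); last exact: eq_irrelevance.
  exact: pq_covered.
- move=> /andP[/andP[/eqP E0 /eqP E3] /eqP E4]; subst cu cv c.
  have A1 : iu = i by move: e1; rewrite Eu gadj_w // => /eqP.
  have A2 : iv = i by move: e2; rewrite eS Ev gadj_w // => /eqP.
  subst iu iv; rewrite Eu Ev (_ : liv = liu); last exact: eq_irrelevance.
  apply: coversC; first exact: pq_covered.
  by rewrite -val_eqE /=; nia.
Qed.

End Yes.

Section No.
Variable D : {set 'I_N}.
Hypothesis Dcov : covers_all gadj D.

(** Labels chosen in L and in R are merged, so that a game vertex has one list for both of its
    roles. *)
Definition listed x y : bool := [exists u in D,
  [&& (ty u == 8) || (ty u == 9), ix u %% X == x & (ix u %/ X) %% Y == y]].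

Lemma sum_listed : \sum_(x < X) \sum_(y < Y) listed x y <= #|D|.
Proof.
pose F (u : 'I_N) : nat * nat := (ix u %% X, (ix u %/ X) %% Y).
apply: leq_trans (_ : \sum_(x < X) \sum_(y < Y) \sum_(u in D) (F u == (x : nat, y : nat)) <= _).
  apply: leq_sum => x _; apply: leq_sum => y _.
  case: (boolP (listed x y)) => // /existsP[u /andP[uD /and3P[_ H1 H2]]].
  by rewrite (bigD1 u) //= /F (eqP H1) (eqP H2) eqxx.
rewrite pair_bigA exchange_big /= -sum1_card; apply: leq_sum => u _.
pose a : 'I_X * 'I_Y := (Ordinal (ltn_pmod (ix u) X0), Ordinal (ltn_pmod (ix u %/ X) Y0)).
rewrite (bigD1 a) //= [X in _ + X]big1 ?addn0; first by case: (_ == _).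
move=> b /negP nb; apply/eqP; rewrite eqb0; apply/negP => /eqP[E1 E2]; case: nb.
by apply/eqP; case: b E1 E2 => b1 b2 /= E1 E2; congr pair; apply: val_inj.
Qed.

Lemma pq_target i (li : i < Z) (l0 : 0 < 5) (l3 : 3 < 5) :
  target_couple gadj (vtx l0 li) (vtx l3 li).
Proof.
have [eS eI] := gadj_simple.
apply: (@target_coupleI _ _ eI _ _ (vtx (isT : 4 < 5) li)).
- by rewrite -val_eqE /=; nia.
- by apply/negP => /adj_type; rewrite !ty_vtx.
- by rewrite gadj_w.
- by rewrite eS gadj_w.
Qed.

Lemma pq_mid : all (fun a => all (fun b =>
  [&& tedge 7 a, tedge a b & tedge b 10] ==> ((a == 8) && (b == 9))) (iota 0 12)) (iota 0 12).
Proof. by vm_compute. Qed.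

Lemma pq_mid1 : all (fun a => (tedge 7 a && tedge a 10) ==> (a == 11)) (iota 0 12).
Proof. by vm_compute. Qed.

Lemma ty_class (u : 'I_N) c : ty u = 7 + c -> c < 5 ->
  exists i (lc : c < 5) (li : i < Z), u = vtx lc li.
Proof.
case: (hub_or_class u) => [[lk ->]|[c' [i [lc [li ->]]]]].
  by rewrite ty_hub; lia.
by rewrite ty_vtx => /eqP; rewrite eqn_add2l => /eqP <- _; exists i, lc, li.
Qed.

(** The [K] indices [j * (X * X) + y * X + x] encode the same pair. Either [D] contains their
    vertices in W for all [j], or for some [j] the couple in P and Q can only be covered by a path
    through L and R. *)
Lemma no_cover x y : x < X -> y < X -> K <= #|D| \/ exists y1 y2,
  [/\ y1 < Y, y2 < Y, listed x y1, listed y y2 & cons x y1 y y2].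
Proof.
have [eS eI] := gadj_simple.
move=> lx ly.
have ij j : j < K -> j * (X * X) + y * X + x < Z.
  move=> lj; apply: leq_trans ZXK; nia.
have imod j : ((j * (X * X) + y * X + x) %% X = x) *
    (((j * (X * X) + y * X + x) %/ X) %% X = y).
  rewrite mulnA -mulnDl modnMDl modn_small // divnMDl // divn_small // addn0.
  by rewrite modnMDl modn_small.
pose wv (j : 'I_K) := vtx (isT : 4 < 5) (ij j (ltn_ord j)).
have [/forallP H|] := boolP [forall j : 'I_K, wv j \in D].
  left; have inj : injective wv.
    move=> j j' /(congr1 val) /= /eqP; rewrite eqn_add2l !eqn_add2r.
    by rewrite eqn_pmul2r ?muln_gt0 ?X0 // => /eqP /val_inj.
  rewrite -[K]card_ord -cardsT -(card_imset _ inj); apply/subset_leq_card/subsetP.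
  by move=> u /imsetP[j _ ->].
rewrite negb_forall => /existsP[j wD]; right.
set i := j * (X * X) + y * X + x; have li : i < Z := ij j (ltn_ord j).
have m12 u : ty (u : 'I_N) \in iota 0 12 by rewrite mem_iota ty_lt.
have := Dcov (pq_target li (isT : 0 < 5) (isT : 3 < 5)).
case/coversE => [/adj_type|[[d dD /andP[e1 e2]]|[d1 [d2 [D1 D2 e1 e2 e3]]]]].
- by rewrite !ty_vtx.
- have /allP/(_ _ (m12 d))/implyP := pq_mid1.
  have T1 := adj_type e1; have T2 := adj_type e2; rewrite !ty_vtx in T1 T2.
  rewrite T1 T2 => /(_ isT)/eqP Td.
  have [i' [l4 [li' Ed]]] := @ty_class d 4 Td isT.
  move: e1; rewrite Ed gadj_w // => /eqP E; case/negP: wD; move: dD; rewrite Ed.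
  by congr (_ \in D); apply: val_inj; rewrite /= -E.
have T1 := adj_type e1; have T2 := adj_type e2; have T3 := adj_type e3.
rewrite !ty_vtx in T1 T3.
have /allP/(_ _ (m12 d1))/allP/(_ _ (m12 d2))/implyP := pq_mid.
rewrite T1 T2 T3 => /(_ isT)/andP[/eqP Td1 /eqP Td2].
have [i1 [l1 [li1 E1]]] := @ty_class d1 1 Td1 isT.
have [i2 [l2 [li2 E2]]] := @ty_class d2 2 Td2 isT.
rewrite E1 gadj_pl in e1; rewrite eS E2 gadj_qr in e3; rewrite E1 E2 gadj_lr in e2.
rewrite !imod in e1 e3.
exists ((i1 %/ X) %% Y), ((i2 %/ X) %% Y); split.
- by rewrite ltn_mod.
- by rewrite ltn_mod.
- by apply/existsP; exists d1; rewrite D1 Td1 E1 !ty_vtx (eqP e1) !eqxx.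
- by apply/existsP; exists d2; rewrite D2 Td2 E2 !ty_vtx (eqP e3) !eqxx.
- by rewrite (eqP e1) (eqP e3).
Qed.

End No.
End Gadget.
End HubGadget.

(** * The gap between satisfiable and unsatisfiable formulas *)

Module GameGraph.
Import EnergyBound ParallelGame ProjectionGame PcpVerifier PcpCorrectness HubGadget.
Import Order.TTheory GRing.Theory Num.Theory.

(** Bernoulli gives [(1 + 1/n)^n >= 2], and [(1 - y) (1 + y) <= 1]. *)
Lemma half_power n : (0 < n)%N -> ((1 - n%:R^-1 : rat) ^+ n <= 2^-1)%R.
Proof.
move=> n0; have nR : (0 < n%:R :> rat)%R by rewrite ltr0n.
set y := (n%:R^-1 : rat)%R; have y0 : (0 < y)%R by rewrite invr_gt0.
have y1 : (y <= 1)%R by rewrite invf_le1 // ler1n.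
have ny : (n%:R * y = 1)%R by rewrite mulfV // lt0r_neq0.
have bern k : (1 + k%:R * y <= (1 + y) ^+ k)%R.
  elim: k => [|k IH]; first by rewrite mul0r addr0 expr0.
  rewrite exprS; apply: le_trans (_ : (1 + y) * (1 + k%:R * y) <= _)%R.
    rewrite -natr1; have : (0 <= k%:R * y * y)%R by rewrite !mulr_ge0 // ltW.
    by move: (k%:R : rat)%R => r; nra.
  by rewrite ler_wpM2l //; lra.
have := bern n; rewrite ny => b2.
have le1 : ((1 - y) ^+ n * (1 + y) ^+ n <= 1)%R.
  rewrite -exprMn; apply: exprn_ile1; nra.
have a0 : (0 <= (1 - y) ^+ n)%R by rewrite exprn_ge0 // subr_ge0.
move: b2 le1 a0; move: ((1 - y) ^+ n)%R ((1 + y) ^+ n)%R => a b; nra.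
Qed.

Section GameLink.
Variables (p m w : nat) (cl : nat -> bool).
Local Notation M := (pcpM m w).
Local Notation q := (pcpq m w).
Local Notation nv := (pcpnv p m w).
Local Notation ns := (pcpns p m w).

(* The parameter of a line or segment is read modulo [p] to keep every number
   bounded for all arguments. *)
Definition pcp_consistent v b v' b' :=
  all (fun e => all (fun t => all (fun e' => all (fun t' =>
    (pcp_pos p m w v e (t %% p) == pcp_pos p m w v' e' (t' %% p)) ==>
    (pcp_ans p m w cl v b e (t %% p) == pcp_ans p m w cl v' b' e' (t' %% p) %[mod p]))
   (iota 0 p)) (iota 0 q)) (iota 0 p)) (iota 0 q).

Definition parallel_consistent k x y x' y' :=
  all (fun j => pcp_consistent (digit nv j x) (digit ns j y) (digit nv j x') (digit ns j y'))
    (iota 0 k).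

Variables (b0 kap : nat).
Hypothesis pp : prime p.
Hypothesis m0 : 0 < m.
Hypothesis w2 : 1 < w.
Hypothesis p_big : 4 * M * m.+1 <= p.
Hypothesis p_m : m.+2 < p.
Hypothesis b0_ldt : m.+2 * (2 * m.+2 * m.+1 + m.+1) <= b0.
Hypothesis b0_main : 2 * (2 + w + 2 * w * m.+2 + 2 * M) <= b0.

Definition gap := M.+2 * q * b0.
(** With [eps = 1 / gap] one round contracts by [1 - 1 / (16 gap^2)], so this many rounds contract
    by at most [2^(-2 kap - 1)], which beats lists of average size [2^kap]. *)
Definition nrounds := 16 * gap ^ 2 * (2 * kap).+1.
Local Notation k := nrounds.
Local Notation X := (nv ^ k).
Local Notation Y := (ns ^ k).

Let p0 : 0 < p. Proof. exact: prime_gt0. Qed.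
Let nv0 : 0 < nv. Proof. by rewrite /pcpnv muln_gt0 /= expn_gt0 p0. Qed.
Let ns0 : 0 < ns. Proof. by rewrite /pcpns expn_gt0 p0. Qed.
Let q0 : 0 < q. Proof. by rewrite /pcpq; lia. Qed.
Let gap0 : 0 < gap.
Proof. by rewrite /gap !muln_gt0 /= q0; apply: leq_trans b0_main. Qed.

Theorem game_yes : (exists a, satisfies m w cl a) -> exists ys : nat -> nat,
  (forall x, x < X -> ys x < Y) /\
  forall x x', x < X -> x' < X -> parallel_consistent k x (ys x) x' (ys x').
Proof.
move=> [a /(pcp_complete pp m0 w2)] H.
have [Pi [bf [bfl HP]]] : exists (Pi : nat * nat -> 'F_p) (bf : nat -> nat),
    (forall v, bf v < ns) /\ forall v e t, v < nv -> e < q -> t < p ->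
      (pcp_ans p m w cl v (bf v) e t)%:R%R = Pi (pcp_pos p m w v e t).
  by case: H => Pi [bf [h1 h2]]; exists Pi, bf.
exists (fun x => \sum_(j < k) bf (digit nv j x) * ns ^ j); split.
  by move=> x _; apply: (@sum_digits_lt _ _ (fun j => bf (digit nv j x))).
move=> x x' _ _; apply/allP => j; rewrite mem_iota add0n => /= jk.
rewrite !(@digit_sum ns k (fun j => bf (digit nv j _))) //.
have dl z : digit nv j z < nv by exact: digit_lt.
apply/allP => e; rewrite mem_iota add0n => /= eq.
apply/allP => t _; apply/allP => e'; rewrite mem_iota add0n => /= eq'.
apply/allP => t' _; apply/implyP => /eqP E.
rewrite -(natF_eq pp); by apply/eqP; rewrite !HP ?ltn_mod // E.
Qed.

Section NoSide.
Hypothesis unsat : ~ exists a, satisfies m w cl a.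

(** A crude bound on the components of all positions, which makes the positions a finite type. *)
Let B := \sum_(v < nv) \sum_(e < q) \sum_(t < p)
  ((pcp_pos p m w v e t).1 + (pcp_pos p m w v e t).2).

Let posB v e t : v < nv -> e < q -> t < p ->
  (pcp_pos p m w v e t).1 + (pcp_pos p m w v e t).2 <= B.
Proof.
move=> lv le lt; rewrite /B (bigD1 (Ordinal lv)) //= (bigD1 (Ordinal le)) //=.
rewrite (bigD1 (Ordinal lt)) //=; lia.
Qed.

Let U := ('I_B.+1 * 'I_B.+1)%type.
Let E := ('I_q * 'I_p)%type.
Let pos (v : nat) (et : E) : U :=
  (inord (pcp_pos p m w v et.1 et.2).1, inord (pcp_pos p m w v et.1 et.2).2).
Let ans (v b : nat) (et : E) : 'F_p := ((pcp_ans p m w cl v b et.1 et.2)%:R)%R.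

Let cons_consistent v b v' b' : v < nv -> v' < nv ->
  pcp_consistent v b v' b' -> consistent pos ans v b v' b'.
Proof.
move=> lv lv' /allP H; apply/forallP => -[e t]; apply/forallP => -[e' t'].
apply/implyP => /eqP [E1 E2].
have i1 (a b1 : nat) : a <= B -> b1 <= B -> inord a = inord b1 :> 'I_B.+1 -> a = b1.
  by move=> la lb /(congr1 val); rewrite /= !inordK ?ltnS.
have h1 := @posB v e t lv (ltn_ord e) (ltn_ord t).
have h2 := @posB v' e' t' lv' (ltn_ord e') (ltn_ord t').
have := H e; rewrite mem_iota add0n => /(_ (ltn_ord e)) /allP/(_ (val t)).
rewrite mem_iota add0n => /(_ (ltn_ord t)) /allP/(_ (val e')).
rewrite mem_iota add0n => /(_ (ltn_ord e')) /allP/(_ (val t')).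
rewrite mem_iota add0n => /(_ (ltn_ord t')) /implyP.
rewrite (modn_small (ltn_ord t)) (modn_small (ltn_ord t')) => K.
rewrite /ans (natF_eq pp); apply: K; apply/eqP.
rewrite (surjective_pairing (pcp_pos p m w v e t)) (surjective_pairing (pcp_pos p m w v' e' t')).
by congr pair; apply: i1 => //; lia.
Qed.

Let par_Rk n x y x' y' : (forall j, j < n ->
    pcp_consistent (digit nv j x) (digit ns j y) (digit nv j x') (digit ns j y')) ->
  Rk nv ns (consistent pos ans) n x y x' y'.
Proof.
elim: n x y x' y' => //= n IH x y x' y' H; apply/andP; split.
  by apply: cons_consistent; rewrite ?ltn_mod // -?digit0; exact: (H 0).
by apply: IH => j lj; have := H j.+1 lj; rewrite !digitS.
Qed.

Let eps : rat := (gap%:R^-1)%R.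

(** The contrapositive of the soundness of the verifier; beyond [nv] the labelling is continued by
    its value at vertex 0. *)
Let sound (Pi : U -> 'F_p) (bf : 'I_nv -> 'I_ns) :
  ((#|[set ve : 'I_nv * E | ans ve.1 (bf ve.1) ve.2 == Pi (pos ve.1 ve.2)]|)%:R
   <= (1 - eps) * (#|'I_nv|%:R * #|{: E}|%:R) :> rat)%R.
Proof.
set good := #|_|.
pose Pi' (u : nat * nat) : 'F_p := Pi (inord u.1, inord u.2).
pose bf' v : nat := bf (insubd (Ordinal nv0) v).
pose bad := \sum_(v < nv) \sum_(e < q) \sum_(t < p)
  ((pcp_ans p m w cl v (bf' v) e t)%:R%R != Pi' (pcp_pos p m w v e t)).
have many : nv * q * p <= bad * gap.
  rewrite leqNgt; apply/negP => few; apply: unsat.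
  exact: (@pcp_sound p m w cl pp m0 w2 b0 p_big p_m b0_ldt b0_main Pi' bf' few).
have tot : good + bad = nv * (q * p).
  have -> : good = \sum_(v < nv) \sum_(e < q) \sum_(t < p)
     ((pcp_ans p m w cl v (bf' v) e t)%:R%R == Pi' (pcp_pos p m w v e t)).
    under [RHS]eq_bigr => v _ do rewrite pair_bigA.
    rewrite pair_bigA /good -sum1_card big_mkcond /=.
    apply: eq_bigr => -[v [e t]] _; rewrite inE /= /bf' (_ : insubd _ _ = v); last first.
      by apply: val_inj; rewrite val_insubd ltn_ord.
    by rewrite /ans /pos /Pi' /=; case: eqP.
  rewrite -big_split /= -[nv in RHS]card_ord -sum_nat_const; apply: eq_bigr => v _.
  rewrite -big_split /= -[q in RHS]card_ord -sum_nat_const; apply: eq_bigr => e _.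
  rewrite -big_split /= -[p in RHS]card_ord -sum1_card; apply: eq_bigr => t _.
  by case: eqP.
rewrite card_prod !card_ord -natrM.
have gR : (0 < gap%:R :> rat)%R by rewrite ltr0n.
have : ((nv * (q * p))%:R <= bad%:R * gap%:R :> rat)%R.
  by rewrite -natrM ler_nat mulnA.
rewrite -tot natrD => H.
have : (eps * (good%:R + bad%:R) <= bad%:R)%R.
  by rewrite /eps mulrC ler_pdivrMr.
lra.
Qed.

(** For a smaller [D] the alternative with [K = X * 2 ^ kap] vertices in W is excluded, so the
    labels in [D] cover all pairs with lists of average size at most [2 ^ kap]. The covering bound
    would then give [1 <= 1 / 2]. *)
Lemma game_no Z (D : {set 'I_(gsize Z)}) : X * Y <= Z -> X * X * (X * 2 ^ kap) <= Z ->
  covers_all (@gadj X Y Z (parallel_consistent k)) D -> X * 2 ^ kap <= #|D|.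
Proof.
move=> ZXY ZXK Dcov; rewrite leqNgt; apply/negP => lt.
have X0 : 0 < X by rewrite expn_gt0 nv0.
have Y0 : 0 < Y by rewrite expn_gt0 ns0.
have E0 : 0 < #|{: E}| by rewrite card_prod !card_ord muln_gt0 q0.
have e01 : ((0 < eps) && (eps <= 1))%R.
  by rewrite invr_gt0 ltr0n gap0 invf_le1 ?ltr0n // ler1n.
have := @game_cover rat nv ns E U 'F_p pos ans eps nv0 ns0 E0 0%R e01 sound k
  (listed X Y D) (2 ^+ kap)%R.
move=> /(_ (exprn_gt0 _ _)) H; have {}H := H isT.
have {}H : (1 <= (2 ^+ kap) ^+ 2 * (1 - eps ^+ 2 / 16) ^+ k :> rat)%R.
  apply: H => [x x' lx lx'|].
    have [|[y [y' [l1 l2 L1 L2 C]]]] := no_cover X0 Y0 ZXY ZXK Dcov lx lx'.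
      by rewrite leqNgt lt.
    exists y, y'; split=> //; apply: par_Rk => j jk.
    by move/allP: C => /(_ j); rewrite mem_iota; apply.
  have sl := sum_listed X0 Y0 D.
  apply: le_trans (_ : (#|D|%:R <= _)%R); last first.
    by rewrite -natrX -natrM ler_nat mulnC ltnW.
  rewrite -(ler_nat rat) in sl; apply: le_trans sl.
  rewrite natr_sum; apply: ler_sum => x _; by rewrite natr_sum.
set n := 16 * gap ^ 2.
have n0 : 0 < n by rewrite muln_gt0 expn_gt0 gap0.
have en : (eps ^+ 2 / 16 = n%:R^-1 :> rat)%R.
  by rewrite /n natrM natrX invfM exprVn mulrC.
move: H; rewrite en /nrounds -/n exprM.
have := half_power n0; set h := ((1 - _) ^+ n)%R => hh.
have h0 : (0 <= h)%R.
  by rewrite exprn_ge0 // subr_ge0 invf_le1 ?ltr0n // ler1n.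
have : (h ^+ (2 * kap).+1 <= 2^-1 ^+ (2 * kap).+1)%R by apply: lerXn2r; rewrite ?nnegrE.
rewrite -exprM [(kap * 2)%N]mulnC; set r := (2 * kap)%N => le1.
have p2 : (0 < 2 ^+ r :> rat)%R by rewrite exprn_gt0.
move: le1; rewrite [(2^-1 ^+ _)%R]exprS exprVn => le1 ge1.
have : (2 ^+ r * h ^+ r.+1 <= 2^-1)%R.
  apply: le_trans (ler_wpM2l (ltW p2) le1) _.
  by rewrite mulrCA mulfV ?mulr1 // lt0r_neq0.
lra.
Qed.

End NoSide.
End GameLink.
End GameGraph.

(** * Computability of the adjacency relation *)

Module GraphComputability.
Import TuringRuns ComputableFunctions EnergyBound PcpVerifier ComputableClosure CookLevinTableau PcpCorrectness HubGadget GameGraph.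
Lemma vexp f g c : vcomp f -> vcomp g -> vcomp c -> (forall s, f s ^ g s <= c s) ->
  vcomp (fun s => f s ^ g s).
Proof.
move=> Hf Hg Hc le; apply: vcomp_ext (vexpcap Hf Hg Hc) _ => s.
by rewrite (minn_idPl _).
Qed.

Lemma vmem (l : seq (nat * nat)) a b : vcomp a -> vcomp b ->
  vcomp (fun s => (a s, b s) \in l).
Proof.
move=> Ha Hb; elim: l => [|[x y] l IH]; first exact: vconst.
apply: vcomp_ext (vor (vand (veq Ha (vconst x)) (veq Hb (vconst y))) IH) _ => s.
by rewrite in_cons xpair_eqE.
Qed.

(** A number with [n] base-[p] digits stays below [p ^ n], so the caps are inactive. *)
Lemma vsumdig p c n (a : nat -> env -> nat) : vcomp p -> vcomp c -> vcomp n ->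
  vcomp (fun s => a (s.2 0) (tl s)) -> (forall i s, a i s < p s) ->
  (forall s, p s ^ n s <= c s) -> vcomp (fun s => \sum_(i < n s) a i s * p s ^ i).
Proof.
move=> Hp Hc Hn Ha lt le.
have H := @vsumcap n (fun i s => a i s * minn (p s ^ i) (c s)) c Hn _ Hc.
apply: vcomp_ext (H _) _.
  by apply: comp_mul Ha _; apply: vexpcap (vtl Hp) (comp_var 0) (vtl Hc).
move=> s; have p0 : 0 < p s := leq_ltn_trans (leq0n _) (lt 0 s).
have -> : \sum_(i < n s) a i s * minn (p s ^ i) (c s) = \sum_(i < n s) a i s * p s ^ i.
  apply: eq_bigr => i _; rewrite (minn_idPl _) //; apply: leq_trans (le s).
  by rewrite leq_pexp2l // ltnW.
rewrite (minn_idPl _) //; apply: leq_trans (le s); apply: ltnW.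
by apply: (@sum_digits_lt _ _ (fun i => a i s)).
Qed.

Section Adjacency.
Variable N : tm.
Local Notation w := (litw N).

Let w4 : 4 < w. Proof. by have := ncell_gt0 N; rewrite /litw; lia. Qed.

(** The bounds are required in every environment, not only at the intended parameters; [c] is a
    computable bound on the two exponentials that occur. *)
Definition bounded nf Tf mf pf c : Prop :=
  [/\ vcomp nf, vcomp Tf & [/\ vcomp mf, vcomp pf, vcomp c, forall s, 0 < pf s &
     forall s, pf s ^ pcpM (mf s) w <= c s /\ 2 ^ pcpM (mf s) w <= c s]].

Definition instance (nf Tf mf : env -> nat) s := clauses N s.1 (nf s) (Tf s) (mf s).

Lemma bounded_tl nf Tf mf pf c : bounded nf Tf mf pf c ->
  bounded (nf \o tl) (Tf \o tl) (mf \o tl) (pf \o tl) (c \o tl).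
Proof.
move=> [Hn HT [Hm Hp Hc p0 le]]; split; [exact: vtl Hn | exact: vtl HT |].
by split; [exact: vtl Hm | exact: vtl Hp | exact: vtl Hc | move=> s; exact: p0 |
  move=> s; exact: le].
Qed.

Section Bounded.
Variables nf Tf mf pf c : env -> nat.
Hypothesis Hb : bounded nf Tf mf pf c.
Local Notation M := (fun s => pcpM (mf s) w).

Let Hn : vcomp nf. Proof. by case: Hb. Qed.
Let HT : vcomp Tf. Proof. by case: Hb. Qed.
Let Hm : vcomp mf. Proof. by case: Hb => _ _ []. Qed.
Let Hp : vcomp pf. Proof. by case: Hb => _ _ []. Qed.
Let Hc : vcomp c. Proof. by case: Hb => _ _ []. Qed.
Let p0 s : 0 < pf s. Proof. by case: Hb => _ _ []. Qed.
Let leM s : pf s ^ pcpM (mf s) w <= c s. Proof. by case: Hb => _ _ [_ _ _ _ /(_ s)[]]. Qed.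
Let le2 s : 2 ^ pcpM (mf s) w <= c s. Proof. by case: Hb => _ _ [_ _ _ _ /(_ s)[]]. Qed.
Let lem s : pf s ^ mf s <= c s.
Proof. by apply: leq_trans (leM s); rewrite leq_pexp2l // /pcpM; have := w4; nia. Qed.

Lemma vM : vcomp (fun s => pcpM (mf s) w).
Proof. by apply: comp_add (vconst _); apply: comp_mul (vconst _) Hm. Qed.
Lemma vpM : vcomp (fun s => pf s ^ pcpM (mf s) w). Proof. exact: vexp Hp vM Hc leM. Qed.
Lemma vpm : vcomp (fun s => pf s ^ mf s). Proof. exact: vexp Hp Hm Hc lem. Qed.

Lemma vblk j z : vcomp j -> vcomp z -> vcomp (fun s => blk (pf s) (mf s) (j s) (z s)).
Proof. by move=> Hj Hz; apply: vdigit Hz => //; exact: vpm. Qed.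

Lemma vpos1 v e t : vcomp v -> vcomp e -> vcomp t -> vcomp (fun s => (pcp_pos (pf s) (mf s) w (v s) (e s) (t s %% pf s)).1).
Proof.
move=> Hv He Ht; have Htau := vdiv Hv vpM; have Hz := vmod Hv vpM; have Htp := vmod Ht Hp.
pose tau s := v s %/ pf s ^ pcpM (mf s) w.
apply: (@vcomp_ext (fun s => if tau s == 0 then
    (if e s < w then 0 else if e s == w then 1 else (pcpM (mf s) w).+1)
  else if tau s <= pcpM (mf s) w then (if e s == 0 then tau s else (tau s).+1) else 0)).
  apply: vif; first exact: veq Htau (vconst 0).
    apply: vif; [exact: vlt He (vconst _) | exact: vconst |].
    apply: vif; [exact: veq He (vconst _) | exact: vconst |].
    by apply: comp_succ; exact: vM.
  apply: vif; [exact: vle Htau vM | | exact: vconst].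
  by apply: vif; [exact: veq He (vconst _) | exact: Htau | apply: comp_succ; exact: Htau].
by move=> s; rewrite /pcp_pos -/(tau s); do 4?[case: ifP => //].
Qed.

Lemma vpos2 v e t : vcomp v -> vcomp e -> vcomp t -> vcomp (fun s => (pcp_pos (pf s) (mf s) w (v s) (e s) (t s %% pf s)).2).
Proof.
move=> Hv He Ht; have Htau := vdiv Hv vpM; have Hz := vmod Hv vpM; have Htp := vmod Ht Hp.
pose tau s := v s %/ pf s ^ pcpM (mf s) w.
pose z s := v s %% pf s ^ pcpM (mf s) w.
apply: (@vcomp_ext (fun s => if tau s == 0 then
    (if e s < w then blk (pf s) (mf s) (e s) (z s) else z s)
  else if tau s <= pcpM (mf s) w then nup (pf s) (mf s) w (z s) (tau s).-1 (t s %% pf s)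
  else nlin (pf s) (mf s) (blk (pf s) (mf s) 0 (z s)) (blk (pf s) (mf s) 1 (z s))
         (minn (e s) (mf s).+1))).
  apply: vif; first exact: veq Htau (vconst 0).
    apply: vif; [exact: vlt He (vconst _) | by apply: vblk | exact: Hz].
  apply: vif; first exact: vle Htau vM.
    apply: (@vsumdig pf c (fun s => pcpM (mf s) w) (fun j s =>
      if j == (tau s).-1 then t s %% pf s else digit (pf s) j (z s))) => //.
    - exact: vM.
    - apply: vif; [| exact: (vtl Htp) |].
        by apply: veq (comp_var 0) _; apply: vpred; exact: (vtl Htau).
      by apply: vdigit (comp_var 0) _; [exact: vtl Hp | exact: (vtl Hz)].
    - by move=> i s; case: ifP => _; [rewrite ltn_mod | exact: digit_lt].
  apply: (@vsumdig pf c mf (fun i s =>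
      (digit (pf s) i (blk (pf s) (mf s) 0 (z s)) + minn (e s) (mf s).+1 *
       digit (pf s) i (blk (pf s) (mf s) 1 (z s))) %% pf s)) => //.
  - have Hbl j : vcomp (fun s : env => blk (pf (tl s)) (mf (tl s)) j (z (tl s))).
      by apply: (vtl (vblk (vconst j) Hz)).
    apply: vmod (vtl Hp); apply: comp_add; first by apply: vdigit (vtl Hp) (comp_var 0) (Hbl 0).
    apply: comp_mul; first by apply: vmin (vtl He) (comp_succ (vtl Hm)).
    by apply: vdigit (vtl Hp) (comp_var 0) (Hbl 1).
  - by move=> i s; rewrite ltn_mod.
by move=> s; rewrite /pcp_pos -/(tau s) -/(z s); do 4?[case: ifP => //].
Qed.

Lemma vpminus f : vcm pf f -> vcm pf (fun s => 1 + (pf s).-1 * f s).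
Proof.
move=> Hf; apply: (vcm_add Hp); first exact: vmo (vconst 1) Hp.
by apply: (vcm_mul Hp) => //; apply: (vmo _ Hp); exact: vpred.
Qed.

Lemma vnev b n x : vcomp b -> vcomp n -> vcomp x ->
  vcm pf (fun s => nev (pf s) (n s) (b s) (x s)).
Proof.
move=> Hbb Hnn Hx; apply: (@vcm_sum pf n (fun j s => digit (pf s) j (b s) * x s ^ j)) => //.
have Hp' := vtl Hp; apply: (vcm_mul Hp').
  by apply: (vmo _ Hp'); apply: vdigit Hp' (comp_var 0) (vtl Hbb).
by apply: (vcm_exp Hp') (comp_var 0); apply: (vmo _ Hp'); exact: vtl Hx.
Qed.

Lemma vdigit1 j x : vcomp j -> vcomp x -> vcm pf (fun s => digit (pf s) (j s) (x s)).
Proof. by move=> Hj Hx; apply: (vmo _ Hp); exact: vdigit. Qed.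

Lemma vnCl z : vcomp z ->
  vcm pf (fun s => nCl (pf s) (mf s) w (instance nf Tf mf s) (z s)).
Proof.
move=> Hz.
have H2 : vcomp (fun s => 2 ^ pcpM (mf s) w) := vexp (vconst 2) vM Hc le2.
have Hp' := vtl Hp.
apply: (@vcm_sum pf _ (fun bb s => instance nf Tf mf s bb *
  \prod_(i < pcpM (mf s) w) nlit (pf s) bb i (z s))) => //.
apply: (vcm_mul Hp').
  apply: (vmo _ Hp').
  exact: (@vclauses N _ _ _ _ (vtl Hn) (vtl HT) (vtl Hm) (comp_var 0)).
have Hp'' := vtl Hp'.
apply: (@vcm_prod _ (fun s => pcpM (mf (tl s)) w) (fun i s =>
   nlit (pf (tl s)) (s.2 0) i (z (tl s)))) => //; first exact: (vtl vM).
have Hd : vcm (fun s => pf (tl (tl s))) (fun s => digit (pf (tl (tl s))) (s.2 0) (z (tl (tl s)))).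
  by apply: (vmo _ Hp''); apply: vdigit Hp'' (comp_var 0) (vtl (vtl Hz)).
apply: vcm_if => //.
  by apply: veq (vconst 1); apply: vdigit (vconst 2) (comp_var 0) (comp_var 1).
apply: (vcm_add Hp''); first exact: vmo (vconst 1) Hp''.
by apply: (vcm_mul Hp'') => //; apply: (vmo _ Hp''); exact: vpred.
Qed.

(** Answers involve sums over [2 ^ M] indices of long products. Only residues are computed, and
    consistency compares nothing else. *)
Lemma vans v b e t : vcomp v -> vcomp b -> vcomp e -> vcomp t ->
  vcm pf (fun s => pcp_ans (pf s) (mf s) w (instance nf Tf mf s) (v s) (b s) (e s)
                     (t s %% pf s)).
Proof.
move=> Hv Hbb He Ht; have Htau := vdiv Hv vpM; have Hz := vmod Hv vpM.
have Htp := vmod Ht Hp.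
have V0 : vcm pf (fun=> 0) by apply: (vmo _ Hp); exact: vconst.
apply: vcm_if; first exact: veq Htau (vconst 0).
  apply: vcm_if; [exact: vlt He (vconst _) | exact: vdigit1 |].
  apply: vcm_if; [exact: veq He (vconst _) | | exact: V0].
  apply: (vcm_mul Hp); first exact: vnCl.
  apply: (@vcm_prod pf (fun=> w) (fun j s => digit (pf s) j (b s) +
    (pf s).-1 * digit (pf s) (w * mf s + j) (v s %% pf s ^ pcpM (mf s) w))) => //.
    exact: vconst.
  have Hp' := vtl Hp; apply: (vcm_add Hp').
    by apply: (vmo _ Hp'); apply: vdigit Hp' (comp_var 0) (vtl Hbb).
  apply: (vmo _ Hp'); apply: comp_mul; first exact: vpred.
  apply: vdigit Hp' _ (vtl Hz).
  by apply: comp_add (comp_var 0); apply: comp_mul (vconst _) (vtl Hm).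
apply: vcm_if; first exact: vle Htau vM.
  have H2 := comp_succ (comp_succ Hm).
  apply: vcm_if; [exact: veq He (vconst _) | exact: vnev |].
  apply: (vcm_add Hp).
    apply: (vcm_mul Hp); last exact: vdigit1 (vconst 0) Hbb.
    by apply: vpminus; exact: vmo.
  by apply: (vcm_mul Hp); [exact: vmo | exact: vnev Hbb H2 (vconst 1)].
by apply: vnev => //; [exact: comp_succ | apply: vmin => //; exact: comp_succ].
Qed.

End Bounded.

Lemma vconsistent nf Tf mf pf c v b v' b' : bounded nf Tf mf pf c ->
  vcomp v -> vcomp b -> vcomp v' -> vcomp b' ->
  vcomp (fun s => pcp_consistent (pf s) (mf s) w (instance nf Tf mf s)
                    (v s) (b s) (v' s) (b' s)).
Proof.
move=> B0 Hv Hb Hv' Hb'.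
pose body e t e' t' s :=
  (pcp_pos (pf s) (mf s) w (v s) e (t %% pf s) == pcp_pos (pf s) (mf s) w (v' s) e' (t' %% pf s)) ==>
  (pcp_ans (pf s) (mf s) w (instance nf Tf mf s) (v s) (b s) e (t %% pf s) ==
   pcp_ans (pf s) (mf s) w (instance nf Tf mf s) (v' s) (b' s) e' (t' %% pf s) %[mod pf s]).
have H4 : vcomp (fun s => body (s.2 3) (s.2 2) (s.2 1) (s.2 0) (tl (tl (tl (tl s))))).
  have B4 := bounded_tl (bounded_tl (bounded_tl (bounded_tl B0))).
  have t4 f : vcomp f -> vcomp (fun s => f (tl (tl (tl (tl s))))).
    by move=> Hf; exact: (vtl (vtl (vtl (vtl Hf)))).
  have P1 := vpos1 B4 (t4 _ Hv) (comp_var 3) (comp_var 2).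
  have P2 := vpos2 B4 (t4 _ Hv) (comp_var 3) (comp_var 2).
  have P1' := vpos1 B4 (t4 _ Hv') (comp_var 1) (comp_var 0).
  have P2' := vpos2 B4 (t4 _ Hv') (comp_var 1) (comp_var 0).
  have A1 := vans B4 (t4 _ Hv) (t4 _ Hb) (comp_var 3) (comp_var 2).
  have A2 := vans B4 (t4 _ Hv') (t4 _ Hb') (comp_var 1) (comp_var 0).
  apply: vcomp_ext (vor (vneg (vand (veq P1 P1') (veq P2 P2'))) (veq A1 A2)) _ => s.
  rewrite /body implybE /mo; case: B4 => _ _ [_ _ _ /(_ s) p0 _].
  have -> : ((pf \o tl \o tl \o tl \o tl) s == 0) = false by apply/negbTE; rewrite -lt0n.
  by congr (nat_of_bool (~~ _ || _)).
have Hp : vcomp pf by case: B0 => _ _ [].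
have Hq : vcomp (fun s => pcpq (mf s) w).
  case: B0 => _ _ [Hm _ _ _ _]; apply: comp_add (vconst 2).
  exact: comp_add (vconst _) Hm.
apply: (@vall (fun s => pcpq (mf s) w) (fun e s => all (fun t => all (fun e' =>
  all (fun t' => body e t e' t' s) (iota 0 (pf s))) (iota 0 (pcpq (mf s) w))) (iota 0 (pf s)))) => //.
apply: (@vall (fun s => pf (tl s)) (fun t s => all (fun e' =>
  all (fun t' => body (s.2 0) t e' t' (tl s)) (iota 0 (pf (tl s))))
  (iota 0 (pcpq (mf (tl s)) w)))); first exact: (vtl Hp).
apply: (@vall (fun s => pcpq (mf (tl (tl s))) w) (fun e' s => 
  all (fun t' => body (s.2 1) (s.2 0) e' t' (tl (tl s))) (iota 0 (pf (tl (tl s)))))).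
  exact: (vtl (vtl Hq)).
apply: (@vall (fun s => pf (tl (tl (tl s)))) (fun t' s =>
  body (s.2 2) (s.2 1) (s.2 0) t' (tl (tl (tl s))))); first exact: (vtl (vtl (vtl Hp))).
exact: H4.
Qed.

Section Graph.
Variables nf Tf mf pf kf X Y Z c : env -> nat.
Hypothesis Hb : bounded nf Tf mf pf c.
Hypothesis Hk : vcomp kf.
Hypothesis Hns : forall s, pcpns (pf s) (mf s) w <= c s.
Hypothesis HX : vcomp X.
Hypothesis HY : vcomp Y.
Hypothesis HZ : vcomp Z.

Definition cons_at s := parallel_consistent (pf s) (mf s) w (instance nf Tf mf s) (kf s).

Lemma vparallel x y x' y' : vcomp x -> vcomp y -> vcomp x' -> vcomp y' ->
  vcomp (fun s => cons_at s (x s) (y s) (x' s) (y' s)).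
Proof.
move=> Hx Hy Hx' Hy'.
have [_ _ [Hm Hp Hc p0 _]] := Hb.
have Hnv : vcomp (fun s => pcpnv (pf s) (mf s) w).
  apply: comp_mul (vpM Hb); do 2!apply: comp_succ; exact: (vM Hb).
have Hns' : vcomp (fun s => pcpns (pf s) (mf s) w).
  apply: (vexp Hp _ Hc Hns); apply: comp_add (vconst 2).
  exact: comp_add (vconst _) Hm.
apply: (@vall kf (fun j s => pcp_consistent (pf s) (mf s) w (instance nf Tf mf s)
  (digit (pcpnv (pf s) (mf s) w) j (x s)) (digit (pcpns (pf s) (mf s) w) j (y s))
  (digit (pcpnv (pf s) (mf s) w) j (x' s)) (digit (pcpns (pf s) (mf s) w) j (y' s)))) => //.
have dv g : vcomp g -> vcomp (fun s => digit (pcpnv (pf (tl s)) (mf (tl s)) w) (s.2 0) (g (tl s))).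
  by move=> Hg; apply: vdigit (vtl Hnv) (comp_var 0) (vtl Hg).
have ds g : vcomp g -> vcomp (fun s => digit (pcpns (pf (tl s)) (mf (tl s)) w) (s.2 0) (g (tl s))).
  by move=> Hg; apply: vdigit (vtl Hns') (comp_var 0) (vtl Hg).
exact: (vconsistent (bounded_tl Hb) (dv _ Hx) (ds _ Hy) (dv _ Hx') (ds _ Hy')).
Qed.

Lemma vadj u v : vcomp u -> vcomp v ->
  vcomp (fun s => adjn (X s) (Y s) (Z s) (cons_at s) (u s) (v s)).
Proof.
have Hty f : vcomp f -> vcomp (fun s => ty (Z s) (f s)).
  move=> Hf; apply: vif; [exact: vlt Hf (vconst 7) | exact: Hf |].
  apply: comp_add (vconst 7) _; apply: vdiv HZ; exact: comp_sub Hf (vconst 7).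
have Hix f : vcomp f -> vcomp (fun s => ix (Z s) (f s)).
  by move=> Hf; apply: vmod HZ; exact: comp_sub Hf (vconst 7).
have Harc f g : vcomp f -> vcomp g ->
    vcomp (fun s => garc (X s) (Y s) (Z s) (cons_at s) (f s) (g s)).
  move=> Hf Hg; have T1 := Hty _ Hf; have T2 := Hty _ Hg; have I1 := Hix _ Hf; have I2 := Hix _ Hg.
  have tt a b : vcomp (fun s => (ty (Z s) (f s) == a) && (ty (Z s) (g s) == b)).
    exact: vand (veq T1 (vconst a)) (veq T2 (vconst b)).
  apply: vifb (tt _ _) _ _; first exact: veq (vmod I1 HX) (vmod I2 HX).
  apply: vifb (tt _ _) _ _; first exact: veq (vmod (vdiv I1 HX) HX) (vmod I2 HX).
  apply: vifb; last apply: vifb (tt _ _) _ _.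
  - apply: vand; last exact: veq T2 (vconst 11).
    exact: vor (veq T1 (vconst 7)) (veq T1 (vconst 10)).
  - exact: veq I1 I2.
  - exact: vparallel (vmod I1 HX) (vmod (vdiv I1 HX) HY) (vmod I2 HX) (vmod (vdiv I2 HX) HY).
  - exact: vmem T1 T2.
by move=> Hu Hv; apply: vor; exact: Harc.
Qed.

End Graph.
End Adjacency.
End GraphComputability.

(** * The choice of parameters *)

Module ReductionParameters.
Import TuringRuns ComputableFunctions EnergyBound PcpVerifier ComputableClosure CookLevinTableau PcpCorrectness HubGadget GameGraph GraphComputability GraphPrograms GraphDecider.
Import Order.TTheory GRing.Theory Num.Theory.

Lemma fact_bound n : n`! <= 2 ^ (n * n).
Proof.
elim: n => // n IH; rewrite factS.
apply: leq_trans (leq_mul (ltnW (ltn_expl n.+1 (isT : 1 < 2))) IH) _.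
rewrite -expnD leq_exp2l //; nia.
Qed.

Lemma leq_exp2rW a b k : a <= b -> a ^ k <= b ^ k.
Proof. by case: k => // k; rewrite leq_exp2r. Qed.

(** Euclid's argument. It gives a prime above a bound [B] with about [B ^ 2] bits, which is
    affordable for polylogarithmic [B]. *)
Lemma pdiv_fact n : n < pdiv n`!.+1.
Proof.
rewrite ltnNge; apply/negP => le.
have pr : prime (pdiv n`!.+1) by rewrite pdiv_prime // ltnS fact_gt0.
have d2 : pdiv n`!.+1 %| n`! by apply: dvdn_fact; rewrite le prime_gt0.
have := dvdn_sub (pdiv_dvd n`!.+1) d2; rewrite subSnn dvdn1 => /eqP E.
by rewrite E in pr.
Qed.

(** [eps] is first reduced to at most 1. If [r * eps >= 2] then [(r + 2) (1 - eps) <= r], so on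
    [2^(B^(r + 2))] vertices the ratio is at most [2^(B^r)]. The exponent returned is [r + 1], whose
    additional factor [B] absorbs the 9. *)
Lemma ratio_lt (R : realType) (eps : R) : (0 < eps)%R -> exists r, forall B n : nat,
  4 < B -> 1 < n -> n <= 2 ^ (B ^ r.+1) ->
  (9%:R * approx_ratio eps n < (2 ^ (B ^ r))%N%:R)%R.
Proof.
move=> e0; pose e1 := Num.min eps 1%R.
have e10 : (0 < e1)%R by rewrite lt_min e0 ltr01.
have e11 : (e1 <= 1)%R by rewrite ge_min lexx orbT.
have ee : (e1 <= eps)%R by rewrite ge_min lexx.
have [r hr] : exists r : nat, (2 <= r%:R * e1)%R.
  exists (Num.bound (2 / e1)%R); rewrite -ler_pdivrMr //; apply/ltW/archi_boundP.
  by rewrite divr_ge0 // ltW.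
exists r.+1 => B n B4 n1 nB.
have ln2 : (0 < ln 2%:R :> R)%R by rewrite ln_gt0 // ltr1n.
have n0 : 0 < n := ltnW n1.
pose lg := log2 R n.
have lg1 : (1 <= lg)%R.
  by rewrite /lg /log2 ler_pdivlMr // mul1r ler_ln ?posrE ?ltr0n // ler_nat.
have lgE : (lg <= (B ^ r.+2)%N%:R)%R.
  rewrite /lg /log2 ler_pdivrMr // mulr_natl -lnXn ?ltr0n // ler_ln ?posrE ?ltr0n ?exprn_gt0 ?ltr0n //.
  by rewrite -natrX ler_nat.
have B1 : (1 <= B%:R :> R)%R by rewrite ler1n; lia.
have step1 : (lg `^ (1 - eps) <= lg `^ (1 - e1))%R by apply: ler_powR => //; rewrite lerB.
have step2 : (lg `^ (1 - e1) <= ((B ^ r.+2)%N%:R) `^ (1 - e1))%R.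
  apply: ge0_ler_powR => //; rewrite ?nnegrE ?subr_ge0 //.
  by apply: le_trans lg1.
have step3 : (((B ^ r.+2)%N%:R : R) `^ (1 - e1) <= (B ^ r)%N%:R)%R.
  rewrite !natrX -!powR_mulrn // -powRrM; apply: ler_powR => //.
  have : (0 <= e1 * 2)%R by rewrite mulr_ge0 // ltW.
  have -> : (r.+2%:R = r%:R + 2 :> R)%R by rewrite -addn2 natrD.
  by move: (r%:R : R)%R hr => y; nra.
have le : (approx_ratio eps n <= (2 ^ (B ^ r))%N%:R)%R.
  rewrite natrX -powR_mulrn //; apply: ler_powR; first by rewrite ler1n.
  exact: le_trans step1 (le_trans step2 step3).
apply: (@le_lt_trans _ _ (9%:R * (2 ^ (B ^ r))%N%:R)%R); first by rewrite ler_wpM2l.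
rewrite -natrM ltr_nat; apply: leq_trans (_ : 2 ^ (4 + B ^ r) <= _).
  by rewrite expnD ltn_pmul2r // expn_gt0.
have Br : 0 < B ^ r by rewrite expn_gt0; apply/orP; left; exact: leq_trans B4.
rewrite leq_exp2l // expnS; clear -B4 Br; move: (B ^ r) Br => y Br; nia.
Qed.

Lemma polybS g : polyb g -> polyb (fun l => (g l).+1).
Proof. by move=> H; apply: (polyb_le (polybD H (polybC 1))) => l _; rewrite addn1. Qed.

Lemma polyb_pow g k : polyb g -> polyb (fun l => g l ^ k).
Proof.
move=> H; elim: k => [|k IH]; first exact: (polybC 1).
by apply: (polyb_le (polybM H IH)) => l _; rewrite expnS.
Qed.

Ltac poly_l := repeat first [ by assumption | apply: polybC | apply: polyb_id
  | apply: polybS | apply: polyb_pow | apply: polybD | apply: polybM ].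

Ltac comp_l := repeat first [ by assumption | exact: vconst | apply: comp_succ
  | apply: vpoly_expn | apply: comp_add | apply: comp_mul ].

Section Params.
Variables (N : tm) (c0 k0 r : nat).
Local Notation K := (ncell N).
Local Notation w := (litw N).

(** With this factor, [pC * (log n + 1)] bits suffice to number the variables of the tableau. *)
Definition pC := 2 * k0 + (2 * c0 + 2) * (4 * c0 + 4) * K.
Definition pT n := c0 * n ^ k0 + c0 + 1.
Definition pm l := pC * l.+1.
Definition pM l := w * pm l + w.
Definition pq l := w + pm l + 2.
(** The sum of the two lower bounds that soundness imposes on [b0]. *)
Definition pb0 l := (pm l).+2 * (2 * (pm l).+2 * (pm l).+1 + (pm l).+1) +
  2 * (2 + w + 2 * w * (pm l).+2 + 2 * pM l).
Definition pgap l := (pM l).+2 * pq l * pb0 l.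
Definition pBp l := 4 * pM l * (pm l).+1 + (pm l).+3.
Definition pe l := (pBp l) ^ 2 + 1.
Definition pe1 l := (pM l).+2 + pe l * pM l.
Definition pe2 l := pe l * pq l.
(** The base of the comparison between gap and size: it dominates the bits that each unit of [kap]
    adds to the size of the graph, where [pe1] and [pe2] bound the bits of [nv] and [ns], and it
    exceeds 4. *)
Definition pB2 l := 48 * pgap l ^ 2 * (3 * pe1 l + pe2 l) + 5.
Definition pkap l := pB2 l ^ r.
Definition pE l := pB2 l ^ r.+1.
Definition pk l := 16 * pgap l ^ 2 * (2 * pkap l).+1.
Definition pprime l := pdiv (pBp l)`!.+1.

Lemma poly_pE : polyb pE.
Proof.
have H0 : polyb (fun l => l) := polyb_id.
have Hm : polyb pm by rewrite /pm; poly_l.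
have HM : polyb pM by rewrite /pM; poly_l.
have Hq : polyb pq by rewrite /pq; poly_l.
have Hb : polyb pb0 by rewrite /pb0; poly_l.
have Hg : polyb pgap by rewrite /pgap; poly_l.
have HB : polyb pBp by rewrite /pBp; poly_l.
have He : polyb pe by rewrite /pe; poly_l.
have H1 : polyb pe1 by rewrite /pe1; poly_l.
have H2 : polyb pe2 by rewrite /pe2; poly_l.
have HB2 : polyb pB2 by rewrite /pB2; poly_l.
by rewrite /pE; poly_l.
Qed.

Let K1 : 0 < K. Proof. exact: ncell_gt0. Qed.
Let w4 : 4 < w. Proof. by have := K1; rewrite /litw; lia. Qed.
Let C1 : 0 < pC. Proof. by rewrite /pC; have := K1; nia. Qed.
Let m1 l : 0 < pm l. Proof. by rewrite /pm muln_gt0 C1. Qed.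
Let M1 l : 0 < pM l. Proof. by rewrite /pM; have := w4; lia. Qed.

Lemma tableau_fits n : (pT n).+1 * (2 * pT n).+1 * K <= 2 ^ pm (trunc_log 2 n).
Proof.
set l := (trunc_log 2 n).+1; pose t := 2 ^ (l * k0).
have nl : n ^ k0 <= t by rewrite /t expnM leq_exp2rW // ltnW // trunc_log_ltn.
have t0 : 0 < t by rewrite expn_gt0.
have T1 : (pT n).+1 <= (2 * c0 + 2) * t by rewrite /pT; nia.
have T2 : (2 * pT n).+1 <= (4 * c0 + 4) * t by rewrite /pT; nia.
apply: leq_trans (leq_mul (leq_mul T1 T2) (leqnn K)) _.
have -> : pm (trunc_log 2 n) = 2 * k0 * l + (2 * c0 + 2) * (4 * c0 + 4) * K * l.
  by rewrite /pm /pC mulnDl.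
rewrite expnD.
have -> : (2 * c0 + 2) * t * ((4 * c0 + 4) * t) * K =
   (t * t) * ((2 * c0 + 2) * (4 * c0 + 4) * K) by ring.
apply: leq_mul; first by rewrite /t -expnD leq_exp2l //; lia.
apply: leq_trans (ltnW (ltn_expl _ (isT : 1 < 2))) _.
by rewrite leq_exp2l // leq_pmulr.
Qed.

Lemma pprime_bounds l : [/\ prime (pprime l), pBp l < pprime l & pprime l <= 2 ^ pe l].
Proof.
split; [by rewrite pdiv_prime // ltnS fact_gt0 | exact: pdiv_fact |].
apply: leq_trans (dvdn_leq _ (pdiv_dvd _)) _ => //.
rewrite /pe addn1 expnS; have := fact_bound (pBp l); rewrite mulnn.
have : 0 < 2 ^ (pBp l ^ 2) by rewrite expn_gt0.
lia.
Qed.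

Local Notation nv p m := (pcpnv p m w).
Local Notation ns p m := (pcpns p m w).

(** Room for [X * Y] pairs of a vertex and a label, and for [X ^ 2] pairs of vertices in
    [X * 2 ^ kap] copies each. *)
Definition gZ p m k kap := (nv p m ^ k) ^ 3 * ns p m ^ k * 2 ^ kap.

Let gap1 l : 0 < pgap l.
Proof. by rewrite /pgap !muln_gt0 /= /pq /pb0; lia. Qed.
Let B25 l : 4 < pB2 l. Proof. by rewrite /pB2; lia. Qed.
Let kap1 l : 0 < pkap l. Proof. by rewrite /pkap expn_gt0; have := B25 l; lia. Qed.
Let k1 l : 0 < pk l.
Proof.
have g0 : 0 < pgap l ^ 2 by rewrite expn_gt0 gap1.
by rewrite /pk; move: (pgap l ^ 2) (2 * pkap l) g0 => z y z0; rewrite !muln_gt0 z0.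
Qed.

(** The number of rounds is at most [48 * pgap l ^ 2 * pkap l], so the bits of the factors of [gZ]
    are linear in [pkap l], with the coefficient provided for in [pB2]. *)
Lemma gsize_bound l : gsize (gZ (pprime l) (pm l) (pk l) (pkap l)) <= 2 ^ pE l.
Proof.
have [pr _ pe_] := pprime_bounds l; have p0 := prime_gt0 pr.
have nvb : nv (pprime l) (pm l) <= 2 ^ pe1 l.
  rewrite /pcpnv /pe1 expnD; apply: leq_mul; first exact/ltnW/ltn_expl.
  by rewrite expnM leq_exp2rW.
have nsb : ns (pprime l) (pm l) <= 2 ^ pe2 l by rewrite /pcpns /pe2 expnM leq_exp2rW.
have nv0 : 0 < nv (pprime l) (pm l) by rewrite muln_gt0 /= expn_gt0 p0.
have ns0 : 0 < ns (pprime l) (pm l) by rewrite expn_gt0 p0.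
have Zb : gZ (pprime l) (pm l) (pk l) (pkap l) <=
    2 ^ (pe1 l * pk l * 3 + pe2 l * pk l + pkap l).
  rewrite /gZ !expnD; apply: leq_mul => //; apply: leq_mul.
    by rewrite expnM leq_exp2rW // expnM leq_exp2rW.
  by rewrite expnM leq_exp2rW.
apply: leq_trans (_ : 2 ^ (4 + (pe1 l * pk l * 3 + pe2 l * pk l + pkap l)) <= _).
  rewrite expnD /gsize; move: Zb; set Z := gZ _ _ _ _; set u := 2 ^ (_ + _) => Zb.
  have : 0 < u by rewrite expn_gt0.
  have -> : 2 ^ 4 = 16 by []. 
  lia.
rewrite leq_exp2l // /pE expnS -/(pkap l) /pB2.
have kb : pk l <= 48 * pgap l ^ 2 * pkap l.
  by rewrite /pk; have := kap1 l; move: (pgap l ^ 2) (pkap l) => g kk; nia.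
have := kap1 l; move: kb; move: (48 * pgap l ^ 2) (pk l) (pkap l) (pe1 l) (pe2 l) => g k kk e1 e2.
move=> kb kk0; rewrite mulnDl.
have : (e1 * 3 + e2) * k <= (e1 * 3 + e2) * (g * kk) by rewrite leq_mul2l kb orbT.
have -> : g * (3 * e1 + e2) * kk = (e1 * 3 + e2) * (g * kk) by ring.
move: (_ * (g * kk)) => z; lia.
Qed.

(* The numbers below are cut off at the bound [Q], so that they are computable
   in time polynomial in [Q] for every value of [l] and [Q]. *)
Definition cprime l Q := pdiv (minn (pBp l)`! Q).-1.+2.
Definition small l Q :=
  [&& minn (cprime l Q ^ pM l) Q.+1 <= Q, minn (2 ^ pM l) Q.+1 <= Q,
      minn (cprime l Q ^ pq l) Q.+1 <= Q,
      minn (((pM l).+2 * minn (cprime l Q ^ pM l) Q.+1) ^ pk l) Q.+1 <= Q,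
      minn ((minn (cprime l Q ^ pq l) Q.+1) ^ pk l) Q.+1 <= Q &
      minn (2 ^ pkap l) Q.+1 <= Q].
Definition gp l Q := if small l Q then cprime l Q else 1.
Definition gm l Q := if small l Q then pm l else 0.
Definition gk l Q := if small l Q then pk l else 0.
Definition gkap l Q := if small l Q then pkap l else 0.
(** Besides [Q] it covers the fallback values [p = 1] and [m = k = kap = 0], where [2 ^ M] becomes
    [2 ^ w]. *)
Definition gcap Q := Q + 2 ^ w + w.+2.

Let min_cap a Q : (minn a Q.+1 <= Q) = (a <= Q).
Proof. by apply/idP/idP; lia. Qed.

Lemma smallE l Q : small l Q = [&& cprime l Q ^ pM l <= Q, 2 ^ pM l <= Q,
  cprime l Q ^ pq l <= Q, nv (cprime l Q) (pm l) ^ pk l <= Q,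
  ns (cprime l Q) (pm l) ^ pk l <= Q & 2 ^ pkap l <= Q].
Proof.
rewrite /small !min_cap; apply/and5P/and5P => -[h1 h2 h3 h4 h5]; split=> //; move: h4 h5.
- by rewrite (minn_idPl _) // ltnW.
- by rewrite !(minn_idPl _) // ltnW.
- by rewrite (minn_idPl _) // ltnW.
- by rewrite !(minn_idPl _) // ltnW.
Qed.

Lemma cut_bounds l Q : [/\ 0 < gp l Q, gp l Q ^ pcpM (gm l Q) w <= gcap Q,
  2 ^ pcpM (gm l Q) w <= gcap Q, ns (gp l Q) (gm l Q) <= gcap Q &
  [/\ nv (gp l Q) (gm l Q) ^ gk l Q <= gcap Q, ns (gp l Q) (gm l Q) ^ gk l Q <= gcap Q &
      2 ^ gkap l Q <= gcap Q]].
Proof.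
rewrite /gp /gm /gk /gkap /gcap; case: ifP => [|_].
  rewrite smallE => /and5P[h1 h2 h3 h4 /andP[h5 h6]].
  by split; [exact: pdiv_gt0 | | | | split]; rewrite -addnA;
    apply: leq_trans (leq_addr _ Q); do ?assumption.
rewrite !expn0 /pcpM /pcpns !exp1n muln0 add0n; split; try lia; split; lia.
Qed.

(** At the intended [Q] no cut takes place: the tested powers are at most [gZ], hence at most the
    number of vertices, and the factorial is bounded through [pB2]. *)
Lemma cut_exact l : let Q := 2 ^ pE l in
  [/\ gp l Q = pprime l, gm l Q = pm l, gk l Q = pk l & gkap l Q = pkap l].
Proof.
move=> Q; have gs := gsize_bound l; rewrite -/Q in gs.
have [pr pB _] := pprime_bounds l; have p0 := prime_gt0 pr; have p2 := prime_gt1 pr.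
have BQ : (pBp l)`! <= Q.
  apply: leq_trans (fact_bound _) _; rewrite leq_exp2l // /pE.
  apply: leq_trans (_ : pB2 l <= _); last by rewrite expnS leq_pmulr // -/(pkap l).
  rewrite /pB2 /pe1 /pe mulnn; have := gap1 l; have := M1 l.
  have : 0 < pgap l ^ 2 by rewrite expn_gt0 gap1.
  move: (pgap l ^ 2) (pM l) (pBp l ^ 2) (pe2 l) => g M b e g0 M0 _.
  have h1 : b <= (b + 1) * M by nia.
  have h2 : b <= 3 * (M.+2 + (b + 1) * M) + e by lia.
  nia.
have cp : cprime l Q = pprime l.
  by rewrite /cprime (minn_idPl BQ) prednK // fact_gt0.
set X := nv (pprime l) (pm l) ^ pk l; set Y := ns (pprime l) (pm l) ^ pk l.
have nv0 : 0 < nv (pprime l) (pm l) by rewrite muln_gt0 /= expn_gt0 p0.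
have ns0 : 0 < ns (pprime l) (pm l) by rewrite expn_gt0 p0.
have X0 : 0 < X by rewrite expn_gt0 nv0.
have Y0 : 0 < Y by rewrite expn_gt0 ns0.
have k20 : 0 < 2 ^ pkap l by rewrite expn_gt0.
have ZQ : X ^ 3 * Y * 2 ^ pkap l <= Q by apply: leq_trans gs; rewrite /gsize /gZ -/X -/Y; lia.
have X3 : X <= X ^ 3 by rewrite -{1}(expn1 X) leq_pexp2l.
have X30 : 0 < X ^ 3 by rewrite expn_gt0 X0.
have XQ : X <= Q.
  by apply: leq_trans X3 (leq_trans _ ZQ); rewrite -mulnA leq_pmulr // muln_gt0 Y0.
have YQ : Y <= Q by apply: leq_trans ZQ; rewrite mulnAC leq_pmull // muln_gt0 X30.
have kQ : 2 ^ pkap l <= Q by apply: leq_trans ZQ; rewrite leq_pmull // muln_gt0 X30.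
have powk a : 0 < a -> a <= a ^ pk l by move=> a0; rewrite -{1}(expn1 a); exact: leq_pexp2l a0 (k1 l).
have pMX : pprime l ^ pM l <= Q.
  by apply: leq_trans XQ; apply: leq_trans (powk _ nv0); rewrite leq_pmull.
have pqY : pprime l ^ pq l <= Q by apply: leq_trans YQ; exact: powk.
have sm : small l Q.
  rewrite smallE cp pMX pqY XQ YQ kQ !andbT /=.
  by apply: leq_trans pMX; rewrite leq_exp2rW.
by rewrite /gp /gm /gk /gkap sm.
Qed.

Section Computable.
Variables lf Qf : env -> nat.
Hypothesis Hl : vcomp lf.
Hypothesis HQ : vcomp Qf.

Let Hm : vcomp (fun s => pm (lf s)). Proof. by rewrite /pm; comp_l. Qed.
Let HM : vcomp (fun s => pM (lf s)). Proof. by rewrite /pM; comp_l. Qed.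
Let Hq : vcomp (fun s => pq (lf s)). Proof. by rewrite /pq; comp_l. Qed.
Let Hb : vcomp (fun s => pb0 (lf s)). Proof. by rewrite /pb0; comp_l. Qed.
Let Hg : vcomp (fun s => pgap (lf s)). Proof. by rewrite /pgap; comp_l. Qed.
Let HB : vcomp (fun s => pBp (lf s)). Proof. by rewrite /pBp; comp_l. Qed.
Let He : vcomp (fun s => pe (lf s)). Proof. by rewrite /pe; comp_l. Qed.
Let H1 : vcomp (fun s => pe1 (lf s)). Proof. by rewrite /pe1; comp_l. Qed.
Let H2 : vcomp (fun s => pe2 (lf s)). Proof. by rewrite /pe2; comp_l. Qed.
Let HB2 : vcomp (fun s => pB2 (lf s)). Proof. by rewrite /pB2; comp_l. Qed.
Let Hkap : vcomp (fun s => pkap (lf s)). Proof. by rewrite /pkap; comp_l. Qed.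
Let Hk : vcomp (fun s => pk (lf s)). Proof. by rewrite /pk; comp_l. Qed.

Lemma vpE : vcomp (fun s => pE (lf s)). Proof. by rewrite /pE; comp_l. Qed.

Let Hcp : vcomp (fun s => cprime (lf s) (Qf s)).
Proof. by apply: vpdiv; apply: vpred; exact: vfactcap. Qed.

Let Hsmall : vcomp (fun s => small (lf s) (Qf s)).
Proof.
have Q1 := comp_succ HQ.
have cap f g : vcomp f -> vcomp g -> vcomp (fun s => minn (f s ^ g s) (Qf s).+1).
  by move=> Hf Hgg; exact: vexpcap.
have c1 := cap _ _ Hcp HM; have c2 := cap _ _ Hcp Hq.
apply: vand; last apply: vand; last apply: vand; last apply: vand; last apply: vand;
  apply: (vle _ HQ).
- exact: c1.
- exact: (cap _ _ (vconst 2) HM).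
- exact: c2.
- by apply: (cap (fun s => _ * _) _ _ Hk); apply: comp_mul c1; do 2!apply: comp_succ.
- exact: (cap _ _ c2 Hk).
- exact: (cap _ _ (vconst 2) Hkap).
Qed.

Lemma vgp : vcomp (fun s => gp (lf s) (Qf s)).
Proof. exact: vif Hsmall Hcp (vconst 1). Qed.
Lemma vgm : vcomp (fun s => gm (lf s) (Qf s)).
Proof. exact: vif Hsmall Hm (vconst 0). Qed.
Lemma vgk : vcomp (fun s => gk (lf s) (Qf s)).
Proof. exact: vif Hsmall Hk (vconst 0). Qed.
Lemma vgkap : vcomp (fun s => gkap (lf s) (Qf s)).
Proof. exact: vif Hsmall Hkap (vconst 0). Qed.
Lemma vgcap : vcomp (fun s => gcap (Qf s)).
Proof. by rewrite /gcap; comp_l. Qed.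

Lemma cut_bounded nf Tf : vcomp nf -> vcomp Tf ->
  bounded N nf Tf (fun s => gm (lf s) (Qf s)) (fun s => gp (lf s) (Qf s)) (fun s => gcap (Qf s)).
Proof.
move=> Hn HT; split=> //; split; [exact: vgm | exact: vgp | exact: vgcap | |] => s;
  by have [? ? ? ? _] := cut_bounds (lf s) (Qf s).
Qed.

Definition gX s := nv (gp (lf s) (Qf s)) (gm (lf s) (Qf s)) ^ gk (lf s) (Qf s).
Definition gY s := ns (gp (lf s) (Qf s)) (gm (lf s) (Qf s)) ^ gk (lf s) (Qf s).
Definition gZZ s := gZ (gp (lf s) (Qf s)) (gm (lf s) (Qf s)) (gk (lf s) (Qf s)) (gkap (lf s) (Qf s)).

Lemma vgX : vcomp gX.
Proof.
have B := cut_bounded (vconst 0) (vconst 0).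
apply: (vexp _ vgk vgcap).
  by apply: comp_mul (vpM B); do 2!apply: comp_succ; exact: (vM B).
by move=> s; have [_ _ _ _ []] := cut_bounds (lf s) (Qf s).
Qed.

Lemma vgY : vcomp gY.
Proof.
apply: (vexp _ vgk vgcap).
  apply: (vexp vgp _ vgcap).
    by apply: comp_add (vconst 2); apply: comp_add (vconst _) vgm.
  by move=> s; have [_ _ _ ? _] := cut_bounds (lf s) (Qf s).
by move=> s; have [_ _ _ _ []] := cut_bounds (lf s) (Qf s).
Qed.

Lemma v2kap : vcomp (fun s => 2 ^ gkap (lf s) (Qf s)).
Proof.
apply: (vexp (vconst 2) vgkap vgcap).
by move=> s; have [_ _ _ _ []] := cut_bounds (lf s) (Qf s).
Qed.

Lemma vgZ : vcomp gZZ.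
Proof.
by apply: comp_mul v2kap; apply: comp_mul vgY; apply: vpoly_expn; exact: vgX.
Qed.

End Computable.
End Params.
End ReductionParameters.

(** * The reduction applied to an approximation algorithm *)

Module ApproximationHardness.
Import TuringRuns ComputableFunctions EnergyBound PcpVerifier ComputableClosure CookLevinTableau PcpCorrectness HubGadget GameGraph GraphComputability GraphPrograms GraphDecider ReductionParameters.
Import Order.TTheory GRing.Theory Num.Theory.

Section Hardness.
Variables (R : realType) (eps : R).
Variable C : forall V : finType, rel V -> Prop.
Variable F : forall V : finType, rel V -> {set V} -> Prop.
Hypothesis eps0 : (0 < eps)%R.
Hypothesis C_triangle_free : forall (V : finType) (e : rel V), triangle_free e -> C e.
Hypothesis F_covers : forall (V : finType) (e : rel V) D, F e D -> covers_all e D.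
Hypothesis F_feasible : forall (V : finType) (e : rel V) D,
  dominating e D -> covers_all e D -> F e D.
Variables (M0 : tm) (cM kM : nat).
Hypothesis approxM : forall n (e : rel 'I_n),
  simple_graph e -> connected_graph e -> C e ->
  halts_within M0 (encode_graph e) (cM * size (encode_graph e) ^ kM + cM) /\
  exists D : {set 'I_n}, [/\ outputs M0 (encode_graph e) (encode_set D), F e D &
    forall Dopt, min_card (F e) Dopt -> (#|D|%:R <= approx_ratio eps n * #|Dopt|%:R)%R].

(** In the satisfiable case the optimum is at most [2 X + 7 <= 9 X], and the ratio keeps the answer
    below [X * 2 ^ kap]; otherwise every covering set is at least that large. [C] and [F] are
    abstract so that all variants of the problem share the argument. *)
Lemma approx_separates (N : tm) x T m p b0 kap Z (e : rel 'I_(gsize Z)) :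
  let w := litw N in let cl := clauses N x (size x) T m in
  let k := nrounds m w b0 kap in
  let X := pcpnv p m w ^ k in let Y := pcpns p m w ^ k in
  0 < T -> halts_within N x T.-1 -> T.+1 * (2 * T).+1 * ncell N <= 2 ^ m ->
  prime p -> 0 < m -> 4 * pcpM m w * m.+1 <= p -> m.+2 < p ->
  m.+2 * (2 * m.+2 * m.+1 + m.+1) <= b0 ->
  2 * (2 + w + 2 * w * m.+2 + 2 * pcpM m w) <= b0 ->
  Z = X ^ 3 * Y * 2 ^ kap ->
  (9%:R * approx_ratio eps (gsize Z) < (2 ^ kap)%N%:R)%R ->
  (forall u v, e u v = @gadj X Y Z (parallel_consistent p m w cl k) u v) ->
  exists D : {set 'I_(gsize Z)}, [/\ outputs M0 (encode_graph e) (encode_set D),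
    halts_within M0 (encode_graph e) (cM * size (encode_graph e) ^ kM + cM) &
    accepts N x <-> #|D| < X * 2 ^ kap].
Proof.
move=> w cl k X Y T0 hN Tm pp m0 pbig pm b01 b02 ZE ratio Ee.
have -> : e = @gadj X Y Z (parallel_consistent p m w cl k).
  by apply: funext => u; apply: funext => v.
clear e Ee; set e := gadj _ _ _.
have w2 : 1 < w by have := ncell_gt0 N; rewrite /w /litw; lia.
have p0 := prime_gt0 pp.
have X0 : 0 < X by rewrite expn_gt0 muln_gt0 /= expn_gt0 p0.
have Y0 : 0 < Y by rewrite expn_gt0 expn_gt0 p0.
have k20 : 0 < 2 ^ kap by rewrite expn_gt0.
have X3 : X <= X ^ 3 by rewrite -{1}(expn1 X) leq_pexp2l.
have ZXY : X * Y <= Z.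
  by rewrite ZE; apply: leq_trans (leq_mul X3 (leqnn Y)) _; rewrite leq_pmulr.
have ZXK : X * X * (X * 2 ^ kap) <= Z.
  have -> : X * X * (X * 2 ^ kap) = X ^ 3 * 2 ^ kap by rewrite !expnS expn0; ring.
  by rewrite ZE mulnAC leq_pmulr.
have tf := gadj_triangle_free (parallel_consistent p m w cl k) X0 Y0 ZXY ZXK.
have [ha [D [out FD opt]]] := approxM (gadj_simple _ X0 Y0 ZXY ZXK)
  (gadj_connected _ X0 Y0 ZXY ZXK) (C_triangle_free tf).
exists D; split=> //; have CLv := cook_levin T0 hN Tm.
split=> [ac|lt].
  have /(game_yes b0 kap pp m0 w2)[ys [ysY ysC]] := CLv.2 ac.
  pose S := solution X Z ys.
  have FS : F e S.
    apply: F_feasible; first exact: (solution_dominating _ X0 Y0 ZXY ZXK).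
    exact: (solution_covers X0 Y0 ZXY ZXK ysY ysC).
  (* The guarantee of [M0] refers to an optimal solution; one exists because [S] is feasible and
     there are finitely many sets. *)
  have [Dopt [FDo mino]] : exists Dopt, min_card (F e) Dopt.
    have PS : (fun D' : {set 'I_(gsize Z)} => `[< F e D' >]) S by apply/asboolP.
    case: (@arg_minnP _ S (fun D' => `[< F e D' >]) (fun D' => #|D'|) PS) => Do /asboolP FDo mino.
    by exists Do; split=> // D' FD'; apply: mino; apply/asboolP.
  have cS : #|Dopt| <= 9 * X.
    apply: leq_trans (mino S FS) _.
    by apply: leq_trans (card_solution X0 Y0 ZXY ZXK ys) _; lia.
  have r0 : (0 <= approx_ratio eps (gsize Z))%R by exact: powR_ge0.
  rewrite -(ltr_nat R); apply: le_lt_trans (opt _ (conj FDo mino)) _.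
  apply: le_lt_trans (_ : approx_ratio eps (gsize Z) * (9 * X)%:R < _)%R.
    by rewrite ler_wpM2l // ler_nat.
  by rewrite !natrM mulrA [X in (X * _ < _)%R]mulrC [ltRHS]mulrC ltr_pM2r // ltr0n.
apply: contrapT => nac; move: lt; rewrite ltnNge => /negP; apply.
apply: (game_no pp m0 w2 pbig pm b01 b02 _ ZXY ZXK (F_covers FD)).
by move=> sat; apply: nac; apply/CLv.
Qed.

(** Comparing the size of the answer with the threshold decides [L]. The time is polynomial in
    [n + 2 ^ E], and [E] is polynomial in [log n], so it is of the form [n ^ (log^d n)]. *)
Theorem approx_hardness L : deterministic M0 -> NP L -> DTIME_npolylog L.
Proof.
move=> detM [k0 [N [NL [c0 hN]]]].
have [r Hr] := ratio_lt eps0.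
pose lg n := trunc_log 2 n.
(* [i] is the place of the input length in the environment, which moves up by one for each number
   put in front. *)
pose lf i (s : env) := lg (s.2 i).
have Hl i : vcomp (lf i) := vlog (comp_var i).
pose nf i (s : env) : nat := s.2 i.
pose Tf i (s : env) := pT c0 k0 (s.2 i).
have HT i : vcomp (Tf i).
  by rewrite /Tf /pT; have := comp_var i => ?; comp_l.
pose E n := pE N c0 k0 r (lg n).
pose Q i (s : env) : nat := s.2 i.
have HQ i : vcomp (Q i) := comp_var i.
pose Ef := fun s => pE N c0 k0 r (lf 0 s).
pose Zf l q := gZZ N c0 k0 r l q.
pose Nf := fun s => gsize (Zf (lf 1) (Q 0) s).
pose adjf := fun s => adjn (gX N c0 k0 r (lf 3) (Q 2) s) (gY N c0 k0 r (lf 3) (Q 2) s)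
  (Zf (lf 3) (Q 2) s)
  (cons_at N (nf 3) (Tf 3) (fun s => gm N c0 k0 r (lf 3 s) (Q 2 s))
     (fun s => gp N c0 k0 r (lf 3 s) (Q 2 s)) (fun s => gk N c0 k0 r (lf 3 s) (Q 2 s)) s)
  (s.2 1) (s.2 0) : nat.
pose Af := fun s => (s.2 0 < gX N c0 k0 r (lf 2) (Q 1) s *
  2 ^ gkap N c0 k0 r (lf 2 s) (Q 1 s)) : nat.
have [||||||A [g [pg detA HL Hh]]] := @decider M0 Ef Nf adjf Af E L cM kM detM.
- exact: vpE (Hl 0).
- apply: comp_add (vconst 7) _; apply: comp_mul (vconst 5) _; exact: vgZ (Hl 1) (HQ 0).
- have B := cut_bounded N c0 k0 r (Hl 3) (HQ 2) (comp_var 3) (HT 3).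
  apply: (vadj B (vgk N c0 k0 r (Hl 3) (HQ 2)) _ (vgX N c0 k0 r (Hl 3) (HQ 2))
    (vgY N c0 k0 r (Hl 3) (HQ 2)) (vgZ N c0 k0 r (Hl 3) (HQ 2)) (comp_var 1) (comp_var 0)).
  by move=> s; have [_ _ _ ? _] := cut_bounds N c0 k0 r (lf 3 s) (Q 2 s).
- apply: vlt (comp_var 0) _; apply: comp_mul (v2kap N c0 k0 r (Hl 2) (HQ 1)).
  exact: vgX (Hl 2) (HQ 1).
- by [].
- move=> x s e; set l := lg (size x).
  have [Ep Em Ek Ekap] := cut_exact N c0 k0 r l; set q := 2 ^ pE N c0 k0 r l in Ep Em Ek Ekap.
  have [pr pB _] := pprime_bounds N c0 k0 l.
  have sz := gsize_bound N c0 k0 r l.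
  pose T := pT c0 k0 (size x).
  have hx : halts_within N x T.-1 by rewrite /T /pT addn1 /=; exact: hN.
  have T0 : 0 < T by rewrite /T /pT addn1.
  have fits := tableau_fits N c0 k0 (size x).
  pose m := gm N c0 k0 r l q; pose p := gp N c0 k0 r l q; pose kap := gkap N c0 k0 r l q.
  have Ekk : gk N c0 k0 r l q = nrounds m (litw N) (pb0 N c0 k0 l) kap.
    by rewrite Ek /m Em /kap Ekap.
  have ZE : Zf (lf 1) (Q 0) s = gZ N p m (nrounds m (litw N) (pb0 N c0 k0 l) kap) kap.
    by rewrite /Zf /gZZ -Ekk.
  have rt : (9%:R * approx_ratio eps (gsize (Zf (lf 1) (Q 0) s)) < (2 ^ kap)%N%:R)%R.
    rewrite /kap Ekap; apply: Hr; [by rewrite /pB2; lia | by rewrite /gsize; lia |].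
    by rewrite ZE /m Em /p Ep /kap Ekap; exact: sz.
  have m0 : 0 < m.
    rewrite /m Em /pm muln_gt0 /= andbT /pC; have := ncell_gt0 N; clear; nia.
  have [D [h1 h2 h3]] := @approx_separates N x T m p (pb0 N c0 k0 l) kap (Zf (lf 1) (Q 0) s) e
    T0 hx (ltac:(by rewrite /m Em)) (ltac:(by rewrite /p Ep)) m0
    (ltac:(by rewrite /m Em /p Ep; apply: leq_trans (ltnW pB); rewrite /pBp leq_addr))
    (ltac:(by rewrite /m Em /p Ep; apply: leq_ltn_trans pB; rewrite /pBp; lia))
    (ltac:(by rewrite /m Em /pb0 leq_addr)) (ltac:(by rewrite /m Em /pb0 leq_addl))
    ZE rt (ltac:(by move=> u v; rewrite -Ekk /gadj; exact: lt0b)).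
  exists D; split=> //; rewrite /Af lt0b; apply: iff_trans (NL x) _.
  by move: h3; rewrite -Ekk.
have [kg Hg] := pg.
have [d Hd] : polyb (fun l => (pE N c0 k0 r l + l + 3) * kg).
  by have H0 := poly_pE N c0 k0 r; have H1 : polyb (fun l => l) := polyb_id; poly_l.
(* For [n < 4] the logarithm is at most 1 and raising [d] gains nothing; these lengths are charged
   to the constant. *)
pose c := (\sum_(n < 4) g (n + 2 ^ E n + 2)).+1.
exists d, A; split=> //; split=> //; exists c => x pth Hp.
apply: leq_trans (Hh x pth Hp) _; set n := size x.
case: (ltnP n 4) => n4.
  apply: leq_trans (leq_addl _ _).
  by rewrite /c (bigD1 (Ordinal n4)) //=; apply: leqW; exact: leq_addr.
set l := trunc_log 2 n; have l2 : 1 < l by apply: trunc_log_max.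
apply: leq_trans (Hg _ _) _; first by lia.
apply: leq_trans (_ : n ^ (l ^ d) <= _); last first.
  by rewrite /c mulSn -addnA leq_addr.
apply: leq_trans (_ : 2 ^ (l ^ d) <= _); last by apply: leq_exp2rW; lia.
apply: leq_trans (_ : (2 ^ (pE N c0 k0 r l + l + 3)) ^ kg <= _); last first.
  by rewrite -expnM leq_exp2l // Hd.
apply: leq_exp2rW; have nl : n < 2 ^ l.+1 by exact: trunc_log_ltn.
have E3 (a b : nat) : a + b + 3 = a + b.+1 + 2 by clear; lia.
rewrite E3 !expnD; have : 0 < 2 ^ E n by rewrite expn_gt0.
move: nl; rewrite /E -/(lg n) -/l.
move: (2 ^ pE N c0 k0 r l) (2 ^ l.+1) => a b; clear; nia.
Qed.

End Hardness.
End ApproximationHardness.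

Import ApproximationHardness.
Import GRing.Theory Num.Theory.
Local Open Scope ring_scope.

Theorem theorem4 (R : realType)
    (hardness : ~ (forall L : language, NP L -> DTIME_npolylog L))
    (eps : R) (eps_gt0 : 0 < eps) :
  [/\ ~ (exists M,
          poly_time_approx all_graphs feasible_1DR2 (approx_ratio eps) M),
      ~ (exists M,
          poly_time_approx triangle_free feasible_1DR2 (approx_ratio eps) M)
    & ~ (exists M,
          poly_time_approx all_graphs covers_all (approx_ratio eps) M)].
Proof.
(* The gadget graphs are triangle-free and their small solutions dominating, so the same reduction
   serves all three variants. *)
have hard C F := @approx_hardness R eps C F eps_gt0.
split=> -[M [detM [c [k H]]]]; apply: hardness => L.
- by apply: (hard _ _ _ _ _ M c k) H L detM => // V e D [].
- by apply: (hard _ _ _ _ _ M c k) H L detM => // V e D [].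
- by apply: (hard _ _ _ _ _ M c k) H L detM.
Qed.
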